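(* Let $f$ be a function satisfying the standing assumptions given in the context, and suppose that its modulator $p_f$ is an even function or an odd function. Put $\kappa=0$ if $p_f$ is even and $\kappa=1$ if $p_f$ is odd. Then for all $s\in\mathbb{C}\setminus\{0\}$, $$L(1-s,f)=\frac{2i^{\kappa}\,\Gamma(s)\cos\left(\frac{\pi}{2}(s-\kappa)\right)}{(2\pi)^{s}}\,F(s,f_{(2i\pi)}).$$
   Context: Standing assumptions and notation. $f$ is a real-analytic function at $0$, $f(t)=\sum_{n\ge 0}\frac{C_{f,n}}{n!}t^n$. Its modulator is $p_f(t):=\frac{e^t-1}{t}f(t)=\sum_{n\ge 0}\frac{P_{f,n}}{n!}t^n$, which defines the numbers $P_{f,n}$. It is assumed that the power series $\sum_{n\ge0}P_{f,n}t^n$ has a non-zero (possibly infinite) radius of convergence $\rho_f$; consequently $p_f$ extends to an entire function. Put $r_f:=1/\rho_f$ (with $r_f=0$ if $\rho_f=\infty$), $n_f:=\lfloor r_f\rfloor+1$, and $\Omega_f:=\{z\in\mathbb{C} : z\notin\mathbb{R}_{\le 0},\ |z|>r_f\}$. Generalized power: for $s\in\mathbb{C}$ and $z\in\Omega_f$, $z^{(s,f)}:=\sum_{k=0}^{\infty}\binom{s}{k}P_{f,k}z^{s-k}$, where complex powers $z^{a}=e^{a\log z}$ use the principal logarithm. LC-function: for $\Re(s)>1$, $L(s,f):=\sum_{n=n_f}^{\infty}n^{(-s,f)}$. The same symbol denotes its meromorphic continuation to $\mathbb{C}$, which is known to be entire if $p_f(0)=0$ and otherwise to have only a simple pole, at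 $s=1$, with residue $p_f(0)$. For $\alpha\in\mathbb{C}\setminus\{0\}$, $f_{(\alpha)}(t):=\frac{e^{\alpha t}-1}{\alpha(e^t-1)}f(\alpha t)$. One has $p_{f_{(\alpha)}}(t)=p_f(\alpha t)$, hence $P_{f_{(\alpha)},n}=\alpha^nP_{f,n}$ and $r_{f_{(\alpha)}}=|\alpha|r_f$; all the definitions above and below apply to $f_{(\alpha)}$ in place of $f$ (its coefficients may be complex). FC-function: $F(s,f):=\frac{\Gamma(1-s)}{2i\pi}\int_{\mu_f}\frac{z^{(s-1,f)}}{e^{-z}-1}\,dz$, where $\mu_f$ is a Hankel contour contained in $\Omega_f$: it comes from $-\infty$ below the negative real axis, goes once counterclockwise around the closed disk $|z|\le r_f$ (around the origin if $r_f=0$), and returns to $-\infty$ above the negative real axis, without encircling any of the singularities $2i\pi k$ ($k\in\mathbb{Z}$, $2\pi|k|>r_f$) of $1/(e^{-z}-1)$ lying in $\Omega_f$. The integral is an entire function of $s$, so $F(s,f)$ is analytic for $s\neq1,2,3,\dots$. Convention: the right-hand side of the functional equation, as a function of $s\in\mathbb{C}\setminus\{0\}$, may have isolated singularities at non-zero integers; these are removable and the right-hand side is understood there by analytic continuation. *)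

(* Defs.v *)
From Stdlib Require Import Reals ZArith ClassicalEpsilon.
From Coquelicot Require Import Coquelicot.

Open Scope C_scope.

(** * Complex analysis missing from Coquelicot *)

Definition CSeries (a : nat -> C) : C :=
  (Series (fun n => Re (a n)), Series (fun n => Im (a n))).

Definition CLim_seq (u : nat -> C) : C :=
  (real (Lim_seq (fun n => Re (u n))), real (Lim_seq (fun n => Im (u n)))).

Definition holomorphic_at (g : C -> C) (s : C) : Prop :=
  locally (T := C_UniformSpace) s
    (fun z => ex_derive (K := C_AbsRing) (V := C_NormedModule) g z).

(** [h], defined near [s] except possibly at [s], has a removable singularity
    at [s], and its analytic continuation takes the value [v] there. *)
Definition continued_value (h : C -> C) (s v : C) : Prop :=
  exists g : C -> C,
    holomorphic_at g s /\
    locally' (T := C_UniformSpace) s (fun z => g z = h z) /\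
    g s = v.

Definition Cexp (z : C) : C :=
  RtoC (exp (Re z)) * (cos (Im z), sin (Im z)).

Definition Ccos (z : C) : C := (Cexp (Ci * z) + Cexp (- (Ci * z))) / 2.

(** Principal logarithm.  The half-angle formula for the principal argument is
    valid exactly off the cut (-oo, 0], where alone the logarithm is used. *)
Definition Carg (z : C) : R := (2 * atan (Im z / (Cmod z + Re z)))%R.
Definition Clog (z : C) : C := (ln (Cmod z), Carg z).
Definition Cpower (z a : C) : C := Cexp (a * Clog z).

Fixpoint Cbinom (s : C) (k : nat) : C :=
  match k with
  | O => 1
  | S j => Cbinom s j * (s - INR j) / INR (S j)
  end.

(** Rising product s (s+1) ... (s+n). *)
Fixpoint Crising (s : C) (n : nat) : C :=
  match n with
  | O => s
  | S m => Crising s m * (s + INR (S m))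
  end.

(** Gauss's limit n! n^s / (s (s+1) ... (s+n)), which gives the Gamma function
    on all of C minus its poles 0, -1, -2, ...; the value at a pole is
    meaningless. *)
Definition CGamma (s : C) : C :=
  CLim_seq (fun n => INR (fact n) * Cpower (INR n) s / Crising s n).

(** * Germs at 0, modulators *)

(** A germ at 0 is represented by any function C -> C defining it: the notions
    below depend only on the values near 0.  Taylor numbers are normalised as
    in h(t) = sum_n a_n t^n / n!. *)

Definition egf (a : nat -> C) (z : C) : C :=
  CSeries (fun n => a n / INR (fact n) * z ^ n).

Definition is_taylor (h : C -> C) (a : nat -> C) : Prop :=
  locally (T := C_UniformSpace) (RtoC 0)
    (fun z => is_pseries (K := C_AbsRing) (V := C_NormedModule)
                (fun n => a n / INR (fact n)) z (h z)).

Definition taylor (h : C -> C) : nat -> C :=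
  epsilon (inhabits (fun _ : nat => RtoC 0)) (is_taylor h).

Definition real_analytic_at_0 (f : R -> R) : Prop :=
  locally (T := R_UniformSpace) 0%R
    (fun t => is_pseries (K := R_AbsRing) (V := R_NormedModule)
                (fun n => (Derive_n f n 0 / INR (fact n))%R) t (f t)).

(** The holomorphic extension, near 0, of a function real-analytic at 0. *)
Definition complex_ext (f : R -> R) : C -> C :=
  egf (fun n => RtoC (Derive_n f n 0)).

(** The modulator (e^t - 1)/t h(t) as a germ, with its limit value at 0. *)
Definition modulator_germ (h : C -> C) (t : C) : C :=
  if Ceq_dec t 0 then h 0 else (Cexp t - 1) / t * h t.

Definition P_ (h : C -> C) : nat -> C := taylor (modulator_germ h).

(** The modulator as an entire function. *)
Definition modulator (h : C -> C) : C -> C := egf (P_ h).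

Definition rho (h : C -> C) : Rbar := CV_radius (fun n => Cmod (P_ h n)).

(** [Rbar_inv p_infty] is 0. *)
Definition r_ (h : C -> C) : R := real (Rbar_inv (rho h)).

Definition n_ (h : C -> C) : nat := S (Z.to_nat (Int_part (r_ h))).

Definition standing (f : R -> R) : Prop :=
  real_analytic_at_0 f /\ Rbar_lt 0 (rho (complex_ext f)).

(** The germ h_(alpha), with its limit value at 0. *)
Definition dilate (alpha : C) (h : C -> C) (t : C) : C :=
  if Ceq_dec t 0 then h 0
  else (Cexp (alpha * t) - 1) / (alpha * (Cexp t - 1)) * h (alpha * t).

(** * Generalised powers, LC- and FC-functions *)

(** z^(s,h) *)
Definition gpower (h : C -> C) (z s : C) : C :=
  CSeries (fun k => Cbinom s k * P_ h k * Cpower z (s - INR k)).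

(** [L] is the meromorphic continuation of s |-> L(s,h) to C. Its only possible
    singularity is a simple pole at 1, where the value of the total function
    [L] is then irrelevant. *)
Definition is_LC (h : C -> C) (L : C -> C) : Prop :=
  (forall s : C, (1 < Re s)%R ->
     is_series (K := C_AbsRing) (V := C_NormedModule)
       (fun j => gpower h (INR (n_ h + j)) (- s)) (L s)) /\
  (forall s : C, s <> 1 -> holomorphic_at L s) /\
  filterlim (fun s => (s - 1) * L s)
    (locally' (T := C_UniformSpace) (RtoC 1))
    (locally (T := C_UniformSpace) (modulator h 0)) /\
  (modulator h 0 = 0 -> holomorphic_at L 1).

(** The Hankel contour with parameters [c] and [d] runs along Im z = -d from -oo
    to the circle |z| = c, counterclockwise along this circle up to Im z = d,
    then back to -oo along Im z = d. *)
Definition hankel_ok (h : C -> C) (c d : R) : Prop :=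
  (r_ h < c)%R /\ (0 < d < c)%R /\
  (forall k : Z, (r_ h < 2 * PI * Rabs (IZR k) -> c < 2 * PI * Rabs (IZR k))%R).

Definition hankel_int (c d : R) (g : C -> C) : C :=
  let a := sqrt (c ^ 2 - d ^ 2)%R in
  let th := (PI - asin (d / c))%R in
  RInt_gen (V := C_R_CompleteNormedModule)
    (fun x : R => g (x, (- d)%R)) (Rbar_locally m_infty) (at_point (- a)%R)
  + RInt (V := C_R_CompleteNormedModule)
      (fun t : R => g (c * Cexp (Ci * t)) * (Ci * c * Cexp (Ci * t)))
      (- th)%R th
  - RInt_gen (V := C_R_CompleteNormedModule)
      (fun x : R => g (x, d)) (Rbar_locally m_infty) (at_point (- a)%R).

(** F(s,h), computed on the contour [c], [d]; meaningful for s <> 1, 2, 3, ... *)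
Definition FC (c d : R) (h : C -> C) (s : C) : C :=
  CGamma (1 - s) / (2 * Ci * PI)
  * hankel_int c d (fun z => gpower h z (s - 1) / (Cexp (- z) - 1)).

Definition is_integer (s : C) : Prop := exists n : Z, s = RtoC (IZR n).

(* Main.v *)
(** In the coordinate w = log z the FC-integrand becomes a function G on the
    strip |Im w| < pi, holomorphic to the right of the contour except for
    simple poles over the points z = 2 i pi k with |k| >= n_f; there its residue
    is minus the value of z^(s-1, f_(2 i pi)) at the pole.  If Re s < 0, pushing
    the Hankel contour out to the circles |z| = (2N+1) pi gives
    int = 2 i pi sum_(|k| >= n_f) (2 i pi k)^(s-1, f_(2 i pi)).
    As P_(f_(2 i pi), k) = (2 i pi)^k P_(f, k) and the modulator has parity
    kappa, this is an elementary factor times L(1-s, f).  Both sides being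
    holomorphic for s <> 0, the identity theorem extends the equality, and
    Gamma(s) Gamma(1-s) sin(pi s) = pi turns it into the functional equation.

    The continuation of L is only known to be complex differentiable, with no
    continuity of the derivative; this is why the identity theorem is derived
    from Goursat's theorem. *)

Require Import Defs.
From Stdlib Require Import Reals ZArith Lra Lia ClassicalEpsilon FunctionalExtensionality.
From Coquelicot Require Import Coquelicot.
Open Scope C_scope.

(** * Complex derivatives *)

(** The logarithmic coordinate turns principal powers into exponentials and circular arcs into
    vertical segments, so Goursat, residues and Cauchy's formula are needed on rectangles only. The
    straight legs of the contour become curves; they stay in the strips pi/2 < |Im w| < pi, where
    the integrand has no poles and therefore a primitive, which replaces any homotopy argument. The
    circles |z| = (2N+1) pi pass half-way between consecutive poles: there |exp(-z) - 1| >= 1/2, the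
    arc is O(R^(Re s)), and this vanishes in the limit because Re s < 0. Series and improper
    integrals depend holomorphically on s by a single principle, proved from a uniform second-order
    Cauchy estimate: bounded pointwise limits of holomorphic functions are holomorphic. Gamma is
    given as Gauss's limit, so the reflection formula is derived from Euler's sine product, itself
    obtained from the integrals of cos(2 s x) cos^n x over [0, pi/2]. To keep the poles of Gamma out
    of the identity theorem, the latter is applied to the equation between the Hankel integral and
    L(1-s); only s = 0 is then exceptional. *)

Lemma Cmod_le_Rabs (z : C) : (Cmod z <= Rabs (Re z) + Rabs (Im z))%R.
Proof.
  unfold Cmod. fold (Re z) (Im z).
  pose proof (Rabs_pos (Re z)). pose proof (Rabs_pos (Im z)).
  rewrite <- (sqrt_Rsqr (Rabs (Re z) + Rabs (Im z))) by lra.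
  apply sqrt_le_1_alt. unfold Rsqr.
  replace (Re z ^ 2)%R with (Rabs (Re z) * Rabs (Re z))%R
    by (rewrite <- Rabs_mult, Rabs_right; nra).
  replace (Im z ^ 2)%R with (Rabs (Im z) * Rabs (Im z))%R
    by (rewrite <- Rabs_mult, Rabs_right; nra).
  nra.
Qed.

Lemma im_le_Cmod (z : C) : (Rabs (Im z) <= Cmod z)%R.
Proof. exact (Rle_trans _ _ _ (Rmax_r _ _) (Rmax_Cmod z)). Qed.

Lemma Cmod_minus_sym (x y : C) : Cmod (x - y) = Cmod (y - x).
Proof. rewrite <- Cmod_opp. f_equal. ring. Qed.

Lemma Cmod_triangle_rev (x y : C) : (Cmod x - Cmod y <= Cmod (x - y))%R.
Proof.
  pose proof (Cmod_triangle (x - y) y). replace (x - y + y) with x in H by ring. lra.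
Qed.

Ltac C_parts := apply injective_projections; unfold Re, Im; simpl.

Lemma Cmult_reg_l (a b c : C) : a <> 0 -> a * b = a * c -> b = c.
Proof.
  intros Ha H. replace b with (/ a * (a * b)) by (field; auto). rewrite H. field; auto.
Qed.

(** The increment form avoids division and works directly with [Cmod]; [is_derive_is_cderiv] shows
    that it is the usual complex derivative. *)
Definition is_cderiv (f : C -> C) (z D : C) : Prop :=
  forall eps, (0 < eps)%R -> exists del, (0 < del)%R /\
    forall h : C, (Cmod h < del)%R ->
      (Cmod (f (z + h)%C - f z - D * h) <= eps * Cmod h)%R.

Definition cdiff (f : C -> C) (z : C) : Prop := exists D, is_cderiv f z D.

Definition is_rderiv (f : R -> C) (t : R) (D : C) : Prop :=
  forall eps, (0 < eps)%R -> exists del, (0 < del)%R /\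
    forall h : R, (Rabs h < del)%R ->
      (Cmod (f (t + h)%R - f t - D * h) <= eps * Rabs h)%R.

Definition ccont (f : C -> C) (z : C) : Prop :=
  forall eps, (0 < eps)%R -> exists del, (0 < del)%R /\
    forall h : C, (Cmod h < del)%R -> (Cmod (f (z + h)%C - f z) < eps)%R.

Lemma is_cderiv_ccont f z D : is_cderiv f z D -> ccont f z.
Proof.
  intros H eps He. destruct (H 1%R Rlt_0_1) as [d [Hd H1]].
  pose proof (Cmod_ge_0 D).
  exists (Rmin d (eps / (2 + Cmod D)))%R. split.
  { apply Rmin_pos; auto. apply Rdiv_lt_0_compat; lra. }
  intros h Hh. specialize (H1 h (Rlt_le_trans _ _ _ Hh (Rmin_l _ _))).
  pose proof (Rlt_le_trans _ _ _ Hh (Rmin_r _ _)) as H2.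
  apply (Rmult_lt_compat_r (2 + Cmod D)) in H2; [|lra].
  replace (eps / (2 + Cmod D) * (2 + Cmod D))%R with eps in H2 by (field; lra).
  replace (f (z + h) - f z) with (f (z + h) - f z - D * h + D * h) by ring.
  eapply Rle_lt_trans; [apply Cmod_triangle|]. rewrite Cmod_mult.
  pose proof (Cmod_ge_0 h). nra.
Qed.

Lemma cdiff_ccont f z : cdiff f z -> ccont f z.
Proof. intros [D H]. exact (is_cderiv_ccont _ _ _ H). Qed.

Lemma is_cderiv_const c z : is_cderiv (fun _ => c) z 0.
Proof.
  intros e He; exists 1%R; split; [lra|]; intros h _.
  replace (c - c - 0 * h) with (RtoC 0) by ring. rewrite Cmod_0.
  pose proof (Cmod_ge_0 h); nra.
Qed.

Lemma is_cderiv_id z : is_cderiv (fun w => w) z 1.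
Proof.
  intros e He; exists 1%R; split; [lra|]; intros h _.
  replace (z + h - z - 1 * h) with (RtoC 0) by ring. rewrite Cmod_0.
  pose proof (Cmod_ge_0 h); nra.
Qed.

Lemma is_cderiv_plus f g z a b : is_cderiv f z a -> is_cderiv g z b ->
  is_cderiv (fun w => f w + g w) z (a + b).
Proof.
  intros Hf Hg e He.
  destruct (Hf (e/2)%R ltac:(lra)) as [d1 [Hd1 H1]].
  destruct (Hg (e/2)%R ltac:(lra)) as [d2 [Hd2 H2]].
  exists (Rmin d1 d2); split; [apply Rmin_pos; auto|]. intros h Hh.
  specialize (H1 h (Rlt_le_trans _ _ _ Hh (Rmin_l _ _))).
  specialize (H2 h (Rlt_le_trans _ _ _ Hh (Rmin_r _ _))).
  replace (f (z + h) + g (z + h) - (f z + g z) - (a + b) * h)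
    with ((f (z + h) - f z - a * h) + (g (z + h) - g z - b * h)) by ring.
  eapply Rle_trans; [apply Cmod_triangle|]. lra.
Qed.

Lemma is_cderiv_mult f g z a b : is_cderiv f z a -> is_cderiv g z b ->
  is_cderiv (fun w => f w * g w) z (a * g z + f z * b).
Proof.
  intros Hf Hg e He.
  pose proof (Cmod_ge_0 (f z)) as Pf. pose proof (Cmod_ge_0 (g z)) as Pg.
  pose proof (Cmod_ge_0 a) as Pa.
  (* The remainder of a product has four terms, with weights 1, |f z|, |g z| and |a|. K is the sum
     of the weights, so a tolerance e/(3K) for each leaves e/3 in total. *)
  set (K := (1 + Cmod (f z) + Cmod (g z) + Cmod a)%R).
  assert (HK : (0 < K)%R) by (unfold K; lra).
  assert (Hq : (0 < e / (3 * K))%R) by (apply Rdiv_lt_0_compat; lra).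
  destruct (Hf _ Hq) as [d1 [Hd1 H1]].
  destruct (Hg _ Hq) as [d2 [Hd2 H2]].
  destruct (is_cderiv_ccont _ _ _ Hg (Rmin 1 (e / (3 * K)))%R (Rmin_pos _ _ Rlt_0_1 Hq))
    as [d3 [Hd3 H3]].
  exists (Rmin d1 (Rmin d2 d3)); split; [repeat apply Rmin_pos; auto|]. intros h Hh.
  assert (L1 : (Cmod h < d1)%R) by (eapply Rlt_le_trans; [exact Hh|apply Rmin_l]).
  assert (L2 : (Cmod h < d2)%R)
    by (eapply Rlt_le_trans; [exact Hh|eapply Rle_trans; [apply Rmin_r|apply Rmin_l]]).
  assert (L3 : (Cmod h < d3)%R)
    by (eapply Rlt_le_trans; [exact Hh|eapply Rle_trans; [apply Rmin_r|apply Rmin_r]]).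
  specialize (H1 h L1). specialize (H2 h L2). specialize (H3 h L3).
  assert (H3a := Rlt_le_trans _ _ _ H3 (Rmin_l _ _)).
  assert (H3b := Rlt_le_trans _ _ _ H3 (Rmin_r _ _)).
  replace (f (z + h) * g (z + h) - f z * g z - (a * g z + f z * b) * h)
    with ((f (z + h) - f z - a * h) * (g (z + h) - g z)
          + (f (z + h) - f z - a * h) * g z
          + (f z * (g (z + h) - g z - b * h) + a * h * (g (z + h) - g z))) by ring.
  eapply Rle_trans; [apply Cmod_triangle|].
  eapply Rle_trans; [apply Rplus_le_compat; apply Cmod_triangle|].
  rewrite !Cmod_mult.
  set (q := (e / (3 * K))%R) in *. set (t := Cmod h) in *.
  assert (Ht : (0 <= t)%R) by apply Cmod_ge_0.
  set (A := Cmod (f (z + h) - f z - a * h)) in *.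
  set (B := Cmod (g (z + h) - g z - b * h)) in *.
  set (G := Cmod (g (z + h) - g z)) in *.
  assert (HA : (0 <= A)%R) by apply Cmod_ge_0.
  assert (HB : (0 <= B)%R) by apply Cmod_ge_0.
  assert (HG : (0 <= G)%R) by apply Cmod_ge_0.
  assert (Hqt : (0 <= q * t)%R) by nra.
  assert (E1 : (A * G <= q * t)%R) by nra.
  assert (E2 : (A * Cmod (g z) <= q * t * Cmod (g z))%R) by nra.
  assert (E3 : (Cmod (f z) * B <= q * t * Cmod (f z))%R) by nra.
  assert (E4 : (Cmod a * t * G <= q * t * Cmod a)%R).
  { replace (q * t * Cmod a)%R with (Cmod a * t * q)%R by ring.
    apply Rmult_le_compat_l; [nra|lra]. }
  assert (E5 : (q * t * K = e * t / 3)%R) by (unfold q; field; lra).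
  assert (E6 : (q * t + q * t * Cmod (g z) + (q * t * Cmod (f z) + q * t * Cmod a)
           = q * t * K)%R) by (unfold K; ring).
  nra.
Qed.

Lemma is_cderiv_comp f g z a b : is_cderiv g z b -> is_cderiv f (g z) a ->
  is_cderiv (fun w => f (g w)) z (a * b).
Proof.
  intros Hg Hf e He.
  pose proof (Cmod_ge_0 a) as Pa. pose proof (Cmod_ge_0 b) as Pb.
  assert (Hq : (0 < e / (2 * (1 + Cmod b)))%R) by (apply Rdiv_lt_0_compat; lra).
  assert (Hq2 : (0 < Rmin 1 (e / (2 * (1 + Cmod a))))%R)
    by (apply Rmin_pos; [lra|apply Rdiv_lt_0_compat; lra]).
  destruct (Hf _ Hq) as [d1 [Hd1 H1]].
  destruct (Hg _ Hq2) as [d2 [Hd2 H2]].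
  destruct (is_cderiv_ccont _ _ _ Hg _ Hd1) as [d3 [Hd3 H3]].
  exists (Rmin d2 d3); split; [apply Rmin_pos; auto|]. intros h Hh.
  specialize (H2 h (Rlt_le_trans _ _ _ Hh (Rmin_l _ _))).
  specialize (H3 h (Rlt_le_trans _ _ _ Hh (Rmin_r _ _))).
  specialize (H1 _ H3).
  replace (g z + (g (z + h) - g z)) with (g (z + h)) in H1 by ring.
  replace (f (g (z + h)) - f (g z) - a * b * h)
    with ((f (g (z + h)) - f (g z) - a * (g (z + h) - g z)) + a * (g (z + h) - g z - b * h))
    by ring.
  eapply Rle_trans; [apply Cmod_triangle|]. rewrite Cmod_mult.
  set (t := Cmod h) in *. assert (Ht : (0 <= t)%R) by apply Cmod_ge_0.
  assert (HG : (Cmod (g (z + h)%C - g z) <= (1 + Cmod b) * t)%R).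
  { replace (g (z + h) - g z) with ((g (z + h) - g z - b * h) + b * h) by ring.
    eapply Rle_trans; [apply Cmod_triangle|]. rewrite Cmod_mult. fold t.
    pose proof (Rmin_l 1 (e / (2 * (1 + Cmod a)))). nra. }
  assert (H2' : (Cmod (g (z + h)%C - g z - b * h) <= e / (2 * (1 + Cmod a)) * t)%R).
  { eapply Rle_trans; [exact H2|]. apply Rmult_le_compat_r; auto. apply Rmin_r. }
  assert (X1 : (e / (2 * (1 + Cmod b)) * Cmod (g (z + h)%C - g z) <= e / 2 * t)%R).
  { replace (e / 2 * t)%R with (e / (2 * (1 + Cmod b)) * ((1 + Cmod b) * t))%R by (field; lra).
    apply Rmult_le_compat_l; lra. }
  assert (X2 : (Cmod a * Cmod (g (z + h)%C - g z - b * h) <= e / 2 * t)%R).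
  { apply Rle_trans with ((1 + Cmod a) * (e / (2 * (1 + Cmod a)) * t))%R.
    - apply Rmult_le_compat; try lra; try apply Cmod_ge_0.
    - right. field. lra. }
  lra.
Qed.

Lemma is_cderiv_ext_loc f g z D : (exists del, (0 < del)%R /\
   forall h, (Cmod h < del)%R -> f (z + h) = g (z + h)) ->
  is_cderiv f z D -> is_cderiv g z D.
Proof.
  intros [d0 [Hd0 E]] H e He. destruct (H e He) as [d [Hd H1]].
  exists (Rmin d0 d); split; [apply Rmin_pos; auto|]. intros h Hh.
  rewrite <- (E h) by (eapply Rlt_le_trans; [exact Hh|apply Rmin_l]).
  assert (E0 : f z = g z).
  { specialize (E 0). rewrite Cmod_0, Cplus_0_r in E. auto. }
  rewrite <- E0. apply H1. eapply Rlt_le_trans; [exact Hh|apply Rmin_r].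
Qed.

Lemma is_cderiv_ext f g z D : (forall w, f w = g w) -> is_cderiv f z D -> is_cderiv g z D.
Proof. intros E. apply is_cderiv_ext_loc. exists 1%R. split; [lra|auto]. Qed.

(** The remainder is exactly h^2 / (z^2 (z + h)), and |h| < |z|/2 keeps |z + h| above |z|/2. *)
Lemma is_cderiv_inv0 (z : C) : z <> 0 -> is_cderiv Cinv z (- / (z * z)).
Proof.
  intros Hz e He. assert (Pz := proj1 (Cmod_gt_0 z) Hz). set (m := Cmod z) in *.
  exists (Rmin (m / 2) (e * (m * m * m) / 2)). split.
  { apply Rmin_pos; [lra|]. repeat apply Rmult_lt_0_compat; lra. }
  intros h Hh.
  assert (L1 := Rlt_le_trans _ _ _ Hh (Rmin_l _ _)).
  assert (L2 := Rlt_le_trans _ _ _ Hh (Rmin_r _ _)).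
  assert (M : (m / 2 <= Cmod (z + h)%C)%R).
  { pose proof (Cmod_triangle_rev z (- h)). rewrite Cmod_opp in H.
    replace (z - - h) with (z + h) in H by ring. fold m in H. lra. }
  assert (Hzh : z + h <> 0) by (apply Cmod_gt_0; lra).
  replace (/ (z + h) - / z - - / (z * z) * h) with (h * h * / (z * z * (z + h)))
    by (field; auto).
  rewrite !Cmod_mult, Cmod_inv, !Cmod_mult by (repeat apply Cmult_neq_0; auto). fold m.
  set (t := Cmod h) in *. assert (Ht : (0 <= t)%R) by apply Cmod_ge_0.
  assert (Hm3 : (0 < m * m * m)%R) by (repeat apply Rmult_lt_0_compat; lra).
  assert (I : (/ (m * m * Cmod (z + h)%C) <= 2 / (m * m * m))%R).
  { replace (2 / (m * m * m))%R with (/ (m * m * (m / 2)))%R by (field; lra).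
    apply Rinv_le_contravar; [nra|]. apply Rmult_le_compat_l; nra. }
  apply Rle_trans with (t * t * (2 / (m * m * m)))%R.
  { apply Rmult_le_compat_l; nra. }
  assert (J : (t * (2 / (m * m * m)) <= e)%R).
  { apply Rle_trans with ((e * (m * m * m) / 2) * (2 / (m * m * m)))%R.
    - apply Rmult_le_compat_r; [|lra]. apply Rlt_le, Rdiv_lt_0_compat; lra.
    - right; field; lra. }
  nra.
Qed.

Lemma cdiff_const c z : cdiff (fun _ => c) z.
Proof. eexists; apply is_cderiv_const. Qed.
Lemma cdiff_id z : cdiff (fun w => w) z.
Proof. eexists; apply is_cderiv_id. Qed.
Lemma cdiff_plus f g z : cdiff f z -> cdiff g z -> cdiff (fun w => f w + g w) z.
Proof. intros [a A] [b B]; eexists; apply is_cderiv_plus; eauto. Qed.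
Lemma cdiff_mult f g z : cdiff f z -> cdiff g z -> cdiff (fun w => f w * g w) z.
Proof. intros [a A] [b B]; eexists; apply is_cderiv_mult; eauto. Qed.
Lemma cdiff_comp f g z : cdiff g z -> cdiff f (g z) -> cdiff (fun w => f (g w)) z.
Proof. intros [a A] [b B]; eexists; apply (is_cderiv_comp f g); eauto. Qed.
Lemma cdiff_opp f z : cdiff f z -> cdiff (fun w => - f w) z.
Proof.
  intros H. destruct (cdiff_mult (fun _ => - (1)) f z (cdiff_const _ z) H) as [D HD].
  exists D. eapply is_cderiv_ext; [|exact HD]. intros w; simpl; ring.
Qed.
Lemma cdiff_minus f g z : cdiff f z -> cdiff g z -> cdiff (fun w => f w - g w) z.
Proof. intros; apply (cdiff_plus f (fun w => - g w)); auto. now apply cdiff_opp. Qed.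
Lemma cdiff_inv (f : C -> C) z : f z <> 0 -> cdiff f z -> cdiff (fun w => / f w) z.
Proof.
  intros Hz H. apply (cdiff_comp Cinv f); auto.
  exact (ex_intro _ _ (is_cderiv_inv0 _ Hz)).
Qed.
Lemma cdiff_div (f g : C -> C) z : g z <> 0 -> cdiff f z -> cdiff g z -> cdiff (fun w => f w / g w) z.
Proof. intros; apply (cdiff_mult f (fun w => / g w)); auto. now apply cdiff_inv. Qed.
Lemma cdiff_pow f n z : cdiff f z -> cdiff (fun w => f w ^ n) z.
Proof.
  intros H; induction n; [exact (cdiff_const 1 z)|].
  apply (cdiff_mult f (fun w => f w ^ n)); auto.
Qed.
Lemma cdiff_ext f g z : (forall w, f w = g w) -> cdiff f z -> cdiff g z.
Proof. intros E [D H]; exists D; eapply is_cderiv_ext; eauto. Qed.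
Lemma cdiff_ext_loc f g z : (exists del, (0 < del)%R /\
   forall h, (Cmod h < del)%R -> f (z + h) = g (z + h)) -> cdiff f z -> cdiff g z.
Proof. intros E [D H]; exists D; eapply is_cderiv_ext_loc; eauto. Qed.

Lemma is_derive_is_cderiv (f : C -> C) (z D : C) :
  is_derive (K := C_AbsRing) (V := C_NormedModule) f z D <-> is_cderiv f z D.
Proof.
  split.
  - intros [_ H] e He. specialize (H z (fun P h => h) (mkposreal e He)).
    destruct H as [d Hd].
    exists (pos d); split; [apply cond_pos|]. intros h Hh.
    specialize (Hd (z + h)).
    assert (B : ball (M := AbsRing_UniformSpace C_AbsRing) z d (z + h)).
    { change (Cmod (z + h - z) < d)%R. replace (z + h - z) with h by ring. auto. }
    specialize (Hd B). simpl in Hd.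
    change (Cmod (f (z + h)%C - f z - (z + h - z) * D) <= e * Cmod (z + h - z))%R in Hd.
    replace (z + h - z) with h in Hd by ring.
    now rewrite (Cmult_comm D h).
  - intros H. split; [apply is_linear_scal_l|].
    intros x Hx e. pose proof (is_filter_lim_locally_unique _ _ Hx) as Ex.
    change (z = x :> C) in Ex. subst x.
    destruct (H e (cond_pos e)) as [d [Hd H1]].
    exists (mkposreal d Hd). intros y0 Hy. set (y := y0 : C).
    change (Cmod (y - z) < d)%R in Hy. change y0 with y. clearbody y. clear y0.
    specialize (H1 (y - z) Hy). replace (z + (y - z)) with y in H1 by ring.
    change (Cmod (f y - f z - (y - z) * D) <= e * Cmod (y - z))%R.
    now rewrite (Cmult_comm _ D).
Qed.

Lemma ex_derive_cdiff (f : C -> C) (z : C) :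
  ex_derive (K := C_AbsRing) (V := C_NormedModule) f z <-> cdiff f z.
Proof. split; intros [D H]; exists D; now apply is_derive_is_cderiv. Qed.

(** * The complex exponential *)

Lemma Cexp_plus z w : Cexp (z + w) = Cexp z * Cexp w.
Proof.
  unfold Cexp. C_parts; rewrite exp_plus, ?cos_plus, ?sin_plus; ring.
Qed.

Lemma Cexp_0 : Cexp 0 = 1.
Proof. unfold Cexp; C_parts; rewrite exp_0, ?cos_0, ?sin_0; ring. Qed.

Lemma Cmod_Cexp z : Cmod (Cexp z) = exp (Re z).
Proof.
  unfold Cexp. rewrite Cmod_mult, Cmod_R, Rabs_right by (apply Rle_ge, Rlt_le, exp_pos).
  unfold Cmod; simpl. pose proof (sin2_cos2 (Im z)) as H. unfold Rsqr in H.
  replace (_ + _)%R with 1%R by lra. rewrite sqrt_1. ring.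
Qed.

Lemma Cexp_neq_0 z : Cexp z <> 0.
Proof. apply Cmod_gt_0. rewrite Cmod_Cexp. apply exp_pos. Qed.

Lemma Cexp_opp z : Cexp (- z) = / Cexp z.
Proof.
  apply (Cmult_reg_l (Cexp z)); [apply Cexp_neq_0|].
  rewrite <- Cexp_plus, Cinv_r by apply Cexp_neq_0.
  replace (z + - z) with (RtoC 0) by ring. apply Cexp_0.
Qed.

(** * Curves and integrals of complex-valued functions *)

Lemma Rabs_sin_le (y : R) : (Rabs (sin y) <= Rabs y)%R.
Proof.
  destruct (Rtotal_order y 0) as [H|[->|H]].
  - rewrite (Rabs_left y) by auto. pose proof (sin_lt_x (- y) ltac:(lra)).
    pose proof (SIN_bound y).
    rewrite sin_neg in H0. apply Rabs_le; split; [lra|].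
    destruct (Rle_dec (-1) y) as [L|L]; [|lra].
    pose proof (sin_gt_0 (- y) ltac:(lra) ltac:(pose proof PI2_1; lra)).
    rewrite sin_neg in H2. lra.
  - rewrite sin_0. lra.
  - rewrite (Rabs_right y) by lra. pose proof (sin_lt_x y H).
    pose proof (SIN_bound y). apply Rabs_le; split; [|lra].
    destruct (Rle_dec y 1) as [L|L]; [|lra].
    pose proof (sin_gt_0 y ltac:(lra) ltac:(pose proof PI2_1; lra)). lra.
Qed.

(** The half-angle formula 1 - cos y = 2 sin^2 (y/2) reduces this to |sin u| <= |u|. *)
Lemma one_minus_cos_bound (y : R) : (0 <= 1 - cos y <= y * y / 2)%R.
Proof.
  replace y with (2 * (y / 2))%R at 1 2 by field. rewrite cos_2a_sin.
  pose proof (Rabs_sin_le (y / 2)) as H.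
  assert (sin (y/2) * sin (y/2) <= (y/2) * (y/2))%R.
  { apply Rsqr_le_abs_1 in H. exact H. }
  pose proof (Rle_0_sqr (sin (y / 2))). unfold Rsqr in H1. lra.
Qed.

Lemma sin_ge_cubic (y : R) : (0 <= y <= PI)%R -> (y - y * y * y / 6 <= sin y)%R.
Proof.
  intros [H1 H2].
  destruct (sin_bound y 0 H1 H2) as [H _].
  unfold sin_approx, sin_term in H. simpl in H. lra.
Qed.

Lemma sin_minus_id_bound (y : R) : (Rabs y <= 1)%R -> (Rabs (sin y - y) <= y * y)%R.
Proof.
  intros Hy. pose proof PI2_1.
  assert (K : forall u, (0 <= u <= 1)%R -> (Rabs (sin u - u) <= u * u)%R).
  { intros u Hu. pose proof (sin_ge_cubic u ltac:(lra)).
    assert (sin u <= u)%R by (destruct (Req_dec u 0) as [->|];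
      [rewrite sin_0; lra|apply Rlt_le, sin_lt_x; lra]).
    apply Rabs_le. nra. }
  destruct (Rle_dec 0 y).
  - apply K. rewrite Rabs_right in Hy; lra.
  - specialize (K (- y)%R). rewrite sin_neg in K.
    rewrite <- Rabs_Ropp. replace (- (sin y - y))%R with (- sin y - - y)%R by ring.
    replace (y * y)%R with (- y * - y)%R by ring. apply K.
    rewrite Rabs_left in Hy; lra.
Qed.

(** The upper bound comes from exp(-x) >= 1 - x, that is exp x <= 1/(1 - x), with |x| <= 1/2. *)
Lemma exp_quadratic_bound (x : R) : (Rabs x <= 1/2)%R -> (0 <= exp x - 1 - x <= 2 * (x * x))%R.
Proof.
  intros Hx. apply Rabs_le_between in Hx.
  pose proof (exp_ineq1_le x). split; [lra|].
  pose proof (exp_ineq1_le (- x)). rewrite exp_Ropp in H0.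
  pose proof (exp_pos x).
  apply (Rmult_le_compat_r (exp x)) in H0; [|lra].
  rewrite Rinv_l in H0 by lra. nra.
Qed.

(** Splitting off the separate errors of exp, cos and sin bounds each of the real and imaginary
    parts by 3 |h|^2. Together with the addition formula this yields the derivative of [Cexp]; it
    serves again for cosines and for Gauss's product. *)
Lemma Cexp_quadratic_bound (h : C) : (Cmod h <= 1/2)%R ->
  (Cmod (Cexp h - 1 - h) <= 8 * (Cmod h * Cmod h))%R.
Proof.
  intros Hh. eapply Rle_trans; [apply Cmod_le_Rabs|].
  pose proof (re_le_Cmod h) as Hx. pose proof (im_le_Cmod h) as Hy.
  set (m := Cmod h) in *.
  replace (Re (Cexp h - 1 - h)) with ((exp (Re h) - 1 - Re h) * cos (Im h)
     + (1 + Re h) * (cos (Im h) - 1))%R by (unfold Cexp, Re, Im; simpl; ring).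
  replace (Im (Cexp h - 1 - h)) with ((exp (Re h) - 1) * sin (Im h)
     + (sin (Im h) - Im h))%R by (unfold Cexp, Re, Im; simpl; ring).
  set (x := Re h) in *. set (y := Im h) in *.
  destruct (exp_quadratic_bound x ltac:(lra)) as [E1 E2].
  destruct (one_minus_cos_bound y) as [C1 C2].
  pose proof (sin_minus_id_bound y ltac:(lra)) as S1.
  pose proof (Rabs_sin_le y) as S2. pose proof (COS_bound y) as [B1 B2].
  apply Rabs_le_between in Hx. 
  assert (Xx : (x * x <= m * m)%R) by nra.
  assert (Yy : (y * y <= m * m)%R).
  { apply Rabs_le_between in Hy. nra. }
  assert (T1 : (Rabs ((exp x - 1 - x) * cos y + (1 + x) * (cos y - 1)) <= 3 * (m * m))%R).
  { apply Rabs_le. split; nra. }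
  assert (T2 : (Rabs ((exp x - 1) * sin y + (sin y - y)) <= 3 * (m * m))%R).
  { eapply Rle_trans; [apply Rabs_triang|]. rewrite Rabs_mult.
    assert (Rabs (exp x - 1) <= 2 * m)%R by (apply Rabs_le; nra).
    pose proof (Rabs_pos (exp x - 1)). pose proof (Rabs_pos (sin y)).
    assert (Rabs (exp x - 1) * Rabs (sin y) <= 2 * m * m)%R
      by (apply Rmult_le_compat; lra).
    lra. }
  nra.
Qed.

Lemma is_cderiv_exp (z : C) : is_cderiv Cexp z (Cexp z).
Proof.
  intros e He. pose proof (exp_pos (Re z)) as P.
  exists (Rmin (1/2) (e / (8 * exp (Re z)))). split.
  { apply Rmin_pos; [lra|apply Rdiv_lt_0_compat; lra]. }
  intros h Hh. rewrite Cexp_plus.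
  replace (Cexp z * Cexp h - Cexp z - Cexp z * h) with (Cexp z * (Cexp h - 1 - h)) by ring.
  rewrite Cmod_mult, Cmod_Cexp.
  assert (L1 := Rlt_le_trans _ _ _ Hh (Rmin_l _ _)).
  assert (L2 := Rlt_le_trans _ _ _ Hh (Rmin_r _ _)).
  pose proof (Cexp_quadratic_bound h ltac:(lra)). pose proof (Cmod_ge_0 h).
  apply (Rmult_lt_compat_l (8 * exp (Re z))) in L2; [|lra].
  replace (8 * exp (Re z) * (e / (8 * exp (Re z))))%R with e in L2 by (field; lra).
  apply Rle_trans with (exp (Re z) * (8 * (Cmod h * Cmod h)))%R.
  - apply Rmult_le_compat_l; lra.
  - nra.
Qed.

Lemma cdiff_exp f z : cdiff f z -> cdiff (fun w => Cexp (f w)) z.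
Proof. intros H. apply (cdiff_comp Cexp); auto. eexists; apply is_cderiv_exp. Qed.

(** * Differentiable and continuous curves in the plane *)

Lemma is_rderiv_re f t D : is_rderiv f t D -> is_derive (fun u => Re (f u)) t (Re D).
Proof.
  intros H. split; [apply is_linear_scal_l|].
  intros x Hx e. pose proof (is_filter_lim_locally_unique _ _ Hx) as Ex.
  change (t = x :> R) in Ex. subst x.
  destruct (H e (cond_pos e)) as [d [Hd H1]].
  exists (mkposreal d Hd). intros y0 Hy. set (y := y0 : R).
  change (Rabs (y - t) < d)%R in Hy. change y0 with y. clearbody y. clear y0. specialize (H1 _ Hy).
  replace (t + (y - t))%R with y in H1 by ring.
  change (Rabs ((Re (f y) - Re (f t)) - (y - t) * Re D) <= e * Rabs (y - t))%R.
  eapply Rle_trans; [|exact H1]. eapply Rle_trans; [|apply re_le_Cmod].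
  right. f_equal. unfold Re. simpl. ring.
Qed.

Lemma is_rderiv_im f t D : is_rderiv f t D -> is_derive (fun u => Im (f u)) t (Im D).
Proof.
  intros H. split; [apply is_linear_scal_l|].
  intros x Hx e. pose proof (is_filter_lim_locally_unique _ _ Hx) as Ex.
  change (t = x :> R) in Ex. subst x.
  destruct (H e (cond_pos e)) as [d [Hd H1]].
  exists (mkposreal d Hd). intros y0 Hy. set (y := y0 : R).
  change (Rabs (y - t) < d)%R in Hy. change y0 with y. clearbody y. clear y0. specialize (H1 _ Hy).
  replace (t + (y - t))%R with y in H1 by ring.
  change (Rabs ((Im (f y) - Im (f t)) - (y - t) * Im D) <= e * Rabs (y - t))%R.
  eapply Rle_trans; [|exact H1]. eapply Rle_trans; [|apply im_le_Cmod].
  right. f_equal. unfold Im. simpl. ring.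
Qed.

Lemma is_derive_eps (f : R -> R) t D : is_derive f t D -> forall eps, (0 < eps)%R ->
  exists del, (0 < del)%R /\ forall h, (Rabs h < del)%R ->
   (Rabs (f (t + h) - f t - D * h) <= eps * Rabs h)%R.
Proof.
  intros [_ H] e He. specialize (H t (fun P h => h) (mkposreal e He)).
  destruct H as [d Hd]. exists (pos d); split; [apply cond_pos|]. intros h Hh.
  specialize (Hd (t + h)%R).
  assert (B : ball t d (t + h)%R).
  { change (Rabs (t + h - t) < d)%R. replace (t + h - t)%R with h by ring. auto. }
  specialize (Hd B).
  change (Rabs ((f (t + h) - f t) - (t + h - t) * D) <= e * Rabs (t + h - t))%R in Hd.
  replace (t + h - t)%R with h in Hd by ring. now rewrite (Rmult_comm D h).
Qed.

Lemma is_rderiv_pair (a b : R -> R) t da db : is_derive a t da -> is_derive b t db ->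
  is_rderiv (fun u => (a u, b u) : C) t (da, db).
Proof.
  intros Ha Hb e He.
  destruct (is_derive_eps _ _ _ Ha (e/2)%R ltac:(lra)) as [d1 [Hd1 H1]].
  destruct (is_derive_eps _ _ _ Hb (e/2)%R ltac:(lra)) as [d2 [Hd2 H2]].
  exists (Rmin d1 d2); split; [apply Rmin_pos; auto|]. intros h Hh.
  specialize (H1 h (Rlt_le_trans _ _ _ Hh (Rmin_l _ _))).
  specialize (H2 h (Rlt_le_trans _ _ _ Hh (Rmin_r _ _))).
  eapply Rle_trans; [apply Cmod_le_Rabs|].
  replace (Re _) with (a (t + h) - a t - da * h)%R by (unfold Re; simpl; ring).
  replace (Im _) with (b (t + h) - b t - db * h)%R by (unfold Im; simpl; ring).
  lra.
Qed.

Lemma is_rderiv_comp (F : C -> C) (g : R -> C) t a b : is_rderiv g t b -> is_cderiv F (g t) a ->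
  is_rderiv (fun u => F (g u)) t (a * b).
Proof.
  intros Hg Hf e He.
  pose proof (Cmod_ge_0 a) as Pa. pose proof (Cmod_ge_0 b) as Pb.
  assert (Hq : (0 < e / (2 * (1 + Cmod b)))%R) by (apply Rdiv_lt_0_compat; lra).
  assert (Hq2 : (0 < Rmin 1 (e / (2 * (1 + Cmod a))))%R)
    by (apply Rmin_pos; [lra|apply Rdiv_lt_0_compat; lra]).
  destruct (Hf _ Hq) as [d1 [Hd1 H1]].
  destruct (Hg _ Hq2) as [d2 [Hd2 H2]].
  exists (Rmin d2 (d1 / (1 + Cmod b)))%R; split.
  { apply Rmin_pos; auto. apply Rdiv_lt_0_compat; lra. }
  intros h Hh.
  specialize (H2 h (Rlt_le_trans _ _ _ Hh (Rmin_l _ _))).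
  assert (L := Rlt_le_trans _ _ _ Hh (Rmin_r _ _)).
  set (t0 := Rabs h) in *. assert (Ht : (0 <= t0)%R) by apply Rabs_pos.
  assert (HG : (Cmod (g (t + h)%R - g t) <= (1 + Cmod b) * t0)%R).
  { replace (g (t + h)%R - g t) with ((g (t + h)%R - g t - b * h) + b * h) by ring.
    eapply Rle_trans; [apply Cmod_triangle|]. rewrite Cmod_mult, Cmod_R. fold t0.
    pose proof (Rmin_l 1 (e / (2 * (1 + Cmod a)))). nra. }
  assert (H3 : (Cmod (g (t + h)%R - g t) < d1)%R).
  { eapply Rle_lt_trans; [exact HG|].
    apply (Rmult_lt_compat_l (1 + Cmod b)) in L; [|lra].
    replace ((1 + Cmod b) * (d1 / (1 + Cmod b)))%R with d1 in L by (field; lra). auto. }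
  specialize (H1 _ H3).
  replace (g t + (g (t + h)%R - g t)) with (g (t + h)%R) in H1 by ring.
  replace (F (g (t + h)%R) - F (g t) - a * b * h)
    with ((F (g (t + h)%R) - F (g t) - a * (g (t + h)%R - g t))
          + a * (g (t + h)%R - g t - b * h)) by ring.
  eapply Rle_trans; [apply Cmod_triangle|]. rewrite Cmod_mult.
  assert (H2' : (Cmod (g (t + h)%R - g t - b * h) <= e / (2 * (1 + Cmod a)) * t0)%R).
  { eapply Rle_trans; [exact H2|]. apply Rmult_le_compat_r; auto. apply Rmin_r. }
  assert (X1 : (e / (2 * (1 + Cmod b)) * Cmod (g (t + h)%R - g t) <= e / 2 * t0)%R).
  { replace (e / 2 * t0)%R with (e / (2 * (1 + Cmod b)) * ((1 + Cmod b) * t0))%R by (field; lra).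
    apply Rmult_le_compat_l; lra. }
  assert (X2 : (Cmod a * Cmod (g (t + h)%R - g t - b * h) <= e / 2 * t0)%R).
  { apply Rle_trans with ((1 + Cmod a) * (e / (2 * (1 + Cmod a)) * t0))%R.
    - apply Rmult_le_compat; try lra; try apply Cmod_ge_0.
    - right. field. lra. }
  lra.
Qed.

Notation Ccontinuous := (continuous (T := R_UniformSpace) (U := C_UniformSpace)).

(** Balls of [C_UniformSpace] are products of intervals, not discs; the passage between the two
    costs the factor 2 in e/2. *)
Lemma Ccontinuous_eps (g : R -> C) t : Ccontinuous g t <->
  forall eps, (0 < eps)%R -> exists del, (0 < del)%R /\
    forall u, (Rabs (u - t) < del)%R -> (Cmod (g u - g t) < eps)%R.
Proof.
  split.
  - intros H e He.
    assert (He2 : (0 < e / 2)%R) by lra.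
    destruct (H (fun z => ball (M := C_UniformSpace) (g t) (e/2) z)
        (locally_ball (T := C_UniformSpace) _ (mkposreal _ He2))) as [d Hd].
    exists (pos d). split; [apply cond_pos|]. intros u Hu.
    destruct (Hd u Hu) as [B1 B2].
    change (Rabs (Re (g u) - Re (g t)) < e / 2)%R in B1.
    change (Rabs (Im (g u) - Im (g t)) < e / 2)%R in B2.
    eapply Rle_lt_trans; [apply Cmod_le_Rabs|].
    replace (Re (g u - g t)) with (Re (g u) - Re (g t))%R by (unfold Re; simpl; ring).
    replace (Im (g u - g t)) with (Im (g u) - Im (g t))%R by (unfold Im; simpl; ring).
    lra.
  - intros H P [e He]. destruct (H e (cond_pos e)) as [d [Hd H1]].
    exists (mkposreal d Hd). intros u Hu. specialize (H1 u Hu). apply He.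
    split.
    + change (Rabs (Re (g u) - Re (g t)) < e)%R.
      replace (Re (g u) - Re (g t))%R with (Re (g u - g t)) by (unfold Re; simpl; ring).
      eapply Rle_lt_trans; [apply re_le_Cmod|auto].
    + change (Rabs (Im (g u) - Im (g t)) < e)%R.
      replace (Im (g u) - Im (g t))%R with (Im (g u - g t)) by (unfold Im; simpl; ring).
      eapply Rle_lt_trans; [apply im_le_Cmod|auto].
Qed.

Lemma Ccontinuous_comp (f : C -> C) (g : R -> C) t : ccont f (g t) -> Ccontinuous g t ->
  Ccontinuous (fun u => f (g u)) t.
Proof.
  rewrite !Ccontinuous_eps. intros Hf Hg e He.
  destruct (Hf e He) as [d1 [Hd1 H1]]. destruct (Hg d1 Hd1) as [d [Hd H2]].
  exists d; split; auto. intros u Hu. specialize (H1 _ (H2 u Hu)).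
  replace (g t + (g u - g t)) with (g u) in H1 by ring. exact H1.
Qed.

Lemma is_rderiv_continuous g t D : is_rderiv g t D -> Ccontinuous g t.
Proof.
  intros H. apply Ccontinuous_eps. intros eps He.
  destruct (H 1%R Rlt_0_1) as [d [Hd H1]]. pose proof (Cmod_ge_0 D).
  exists (Rmin d (eps / (2 + Cmod D)))%R. split.
  { apply Rmin_pos; auto. apply Rdiv_lt_0_compat; lra. }
  intros u Hu. specialize (H1 (u - t)%R (Rlt_le_trans _ _ _ Hu (Rmin_l _ _))).
  pose proof (Rlt_le_trans _ _ _ Hu (Rmin_r _ _)) as H2.
  apply (Rmult_lt_compat_r (2 + Cmod D)) in H2; [|lra].
  replace (eps / (2 + Cmod D) * (2 + Cmod D))%R with eps in H2 by (field; lra).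
  replace (t + (u - t))%R with u in H1 by ring.
  replace (g u - g t) with (g u - g t - D * (u - t)%R + D * (u - t)%R) by ring.
  eapply Rle_lt_trans; [apply Cmod_triangle|]. rewrite Cmod_mult, Cmod_R.
  pose proof (Rabs_pos (u - t)). nra.
Qed.

Lemma Ccontinuous_re g t : Ccontinuous g t -> continuous (fun u => Re (g u)) t.
Proof. intros H. apply (continuous_comp g (fst (A:=R)(B:=R))); auto. destruct (g t); apply (continuous_fst (U:=R_UniformSpace)(V:=R_UniformSpace)). Qed.
Lemma Ccontinuous_im g t : Ccontinuous g t -> continuous (fun u => Im (g u)) t.
Proof. intros H. apply (continuous_comp g (snd (A:=R)(B:=R))); auto. destruct (g t); apply (continuous_snd (U:=R_UniformSpace)(V:=R_UniformSpace)). Qed.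

Lemma Ccontinuous_const c t : Ccontinuous (fun _ => c) t.
Proof. apply continuous_const. Qed.

Lemma Ccontinuous_mult f g t : Ccontinuous f t -> Ccontinuous g t -> Ccontinuous (fun u => f u * g u) t.
Proof.
  rewrite !Ccontinuous_eps. intros Hf Hg e He.
  pose proof (Cmod_ge_0 (f t)) as Pf. pose proof (Cmod_ge_0 (g t)) as Pg.
  set (K := (1 + Cmod (f t) + Cmod (g t))%R).
  assert (HK : (0 < K)%R) by (unfold K; lra).
  assert (Hq : (0 < e / (2 * K))%R) by (apply Rdiv_lt_0_compat; lra).
  destruct (Hf (Rmin 1 (e / (2 * K))) (Rmin_pos _ _ Rlt_0_1 Hq)) as [d1 [Hd1 H1]].
  destruct (Hg _ Hq) as [d2 [Hd2 H2]].
  exists (Rmin d1 d2); split; [apply Rmin_pos; auto|]. intros u Hu.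
  specialize (H1 u (Rlt_le_trans _ _ _ Hu (Rmin_l _ _))).
  specialize (H2 u (Rlt_le_trans _ _ _ Hu (Rmin_r _ _))).
  assert (H1a := Rlt_le_trans _ _ _ H1 (Rmin_l _ _)).
  assert (H1b := Rlt_le_trans _ _ _ H1 (Rmin_r _ _)).
  replace (f u * g u - f t * g t)
    with ((f u - f t) * (g u - g t) + (f u - f t) * g t + f t * (g u - g t)) by ring.
  eapply Rle_lt_trans; [apply Cmod_triangle|].
  eapply Rle_lt_trans; [apply Rplus_le_compat_r, Cmod_triangle|]. rewrite !Cmod_mult.
  set (q := (e / (2 * K))%R) in *.
  assert (E : (q * K = e / 2)%R) by (unfold q; field; lra). unfold K in E.
  pose proof (Cmod_ge_0 (f u - f t)). pose proof (Cmod_ge_0 (g u - g t)). nra.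
Qed.

(** * Integrals of complex-valued functions over an interval *)

Definition CInt (f : R -> C) (a b : R) : C := RInt (V := C_R_CompleteNormedModule) f a b.
Definition is_CInt (f : R -> C) (a b : R) (l : C) : Prop :=
  is_RInt (V := C_R_NormedModule) f a b l.
Definition ccont_on (f : R -> C) (a b : R) : Prop :=
  forall t, (Rmin a b <= t <= Rmax a b)%R -> Ccontinuous f t.

Lemma is_CInt_unique f a b l : is_CInt f a b l -> CInt f a b = l.
Proof. apply (is_RInt_unique (V := C_R_CompleteNormedModule)). Qed.

Lemma is_CInt_cont f a b : ccont_on f a b -> is_CInt f a b (CInt f a b).
Proof.
  intros H. apply (RInt_correct (V := C_R_CompleteNormedModule)).
  apply (ex_RInt_continuous (V := C_R_CompleteNormedModule)), H.
Qed.

Lemma is_CInt_pair f a b l : is_RInt (fun t => Re (f t)) a b (Re l) ->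
  is_RInt (fun t => Im (f t)) a b (Im l) -> is_CInt f a b l.
Proof. destruct l as [x y]. apply (is_RInt_fct_extend_pair (U := R_NormedModule) (V := R_NormedModule)). Qed.

Lemma is_CInt_re f a b l : is_CInt f a b l -> is_RInt (fun t => Re (f t)) a b (Re l).
Proof. apply (is_RInt_fct_extend_fst (U := R_NormedModule) (V := R_NormedModule)). Qed.
Lemma is_CInt_im f a b l : is_CInt f a b l -> is_RInt (fun t => Im (f t)) a b (Im l).
Proof. apply (is_RInt_fct_extend_snd (U := R_NormedModule) (V := R_NormedModule)). Qed.

Lemma is_CInt_plus f g a b u v : is_CInt f a b u -> is_CInt g a b v ->
  is_CInt (fun t => f t + g t) a b (u + v).
Proof. apply (is_RInt_plus (V := C_R_NormedModule)). Qed.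

(** The integral takes its values in C as a real vector space, hence multiplication by a complex
    constant is checked on real and imaginary parts. *)
Lemma is_CInt_scal c f a b l : is_CInt f a b l -> is_CInt (fun t => c * f t) a b (c * l).
Proof.
  intros H. pose proof (is_CInt_re _ _ _ _ H) as Hr. pose proof (is_CInt_im _ _ _ _ H) as Hi.
  apply is_CInt_pair.
  - replace (Re (c * l)) with (Re c * Re l - Im c * Im l)%R by (unfold Re, Im; simpl; ring).
    apply (is_RInt_ext (fun t => Re c * Re (f t) - Im c * Im (f t))%R).
    { intros; unfold Re, Im; simpl; ring. }
    apply (is_RInt_minus (V := R_NormedModule)); apply (is_RInt_scal (V := R_NormedModule)); auto.
  - replace (Im (c * l)) with (Re c * Im l + Im c * Re l)%R by (unfold Re, Im; simpl; ring).
    apply (is_RInt_ext (fun t => Re c * Im (f t) + Im c * Re (f t))%R).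
    { intros; unfold Re, Im; simpl; ring. }
    apply (is_RInt_plus (V := R_NormedModule)); apply (is_RInt_scal (V := R_NormedModule)); auto.
Qed.

Lemma CInt_ext f g a b : (forall t, (Rmin a b <= t <= Rmax a b)%R -> f t = g t) ->
  CInt f a b = CInt g a b.
Proof. intros E. apply (RInt_ext (V := C_R_CompleteNormedModule)). intros; apply E; lra. Qed.

Lemma CInt_plus f g a b : ccont_on f a b -> ccont_on g a b ->
  CInt (fun t => f t + g t) a b = CInt f a b + CInt g a b.
Proof. intros; apply is_CInt_unique, is_CInt_plus; apply is_CInt_cont; auto. Qed.

Lemma CInt_scal c f a b : ccont_on f a b -> CInt (fun t => c * f t) a b = c * CInt f a b.
Proof. intros; apply is_CInt_unique, is_CInt_scal, is_CInt_cont; auto. Qed.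

Lemma CInt_Chasles f a b c : ccont_on f a b -> ccont_on f b c ->
  CInt f a b + CInt f b c = CInt f a c.
Proof.
  intros. apply (RInt_Chasles (V := C_R_CompleteNormedModule));
  apply (ex_RInt_continuous (V := C_R_CompleteNormedModule)); auto.
Qed.

Lemma CInt_swap f a b : ccont_on f a b -> CInt f b a = - CInt f a b.
Proof.
  intros H. apply is_CInt_unique.
  apply (is_RInt_swap (V := C_R_NormedModule)). now apply is_CInt_cont.
Qed.

Lemma norm_C_R (z : C) : norm (V := C_R_NormedModule) z = Cmod z.
Proof.
  unfold norm; simpl. unfold prod_norm, Cmod. simpl. f_equal.
  unfold norm; simpl. unfold abs; simpl.
  rewrite !Rmult_1_r, <- !Rabs_mult, !(Rabs_right (_ * _)); auto; nra.
Qed.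

Lemma is_CInt_bound f a b l (M : R) : (a <= b)%R ->
  (forall t, (a <= t <= b)%R -> (Cmod (f t) <= M)%R) -> is_CInt f a b l ->
  (Cmod l <= M * (b - a))%R.
Proof.
  intros Hab HM H. rewrite Rmult_comm.
  rewrite <- norm_C_R. apply (norm_RInt_le_const (V := C_R_NormedModule) f); auto.
  intros t Ht. rewrite norm_C_R. now apply HM.
Qed.

Lemma CInt_bound f a b (M : R) : (a <= b)%R -> ccont_on f a b ->
  (forall t, (a <= t <= b)%R -> (Cmod (f t) <= M)%R) ->
  (Cmod (CInt f a b) <= M * (b - a))%R.
Proof. intros Hab Hc HM. apply (is_CInt_bound f); auto. now apply is_CInt_cont. Qed.

Lemma is_CInt_deriv F f a b : (forall t, (Rmin a b <= t <= Rmax a b)%R -> is_rderiv F t (f t)) ->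
  ccont_on f a b -> is_CInt f a b (F b - F a).
Proof.
  intros HF Hf. apply is_CInt_pair.
  - replace (Re (F b - F a)) with (minus (Re (F b)) (Re (F a))) by (unfold Re; simpl; reflexivity).
    apply (is_RInt_derive (V := R_CompleteNormedModule) (fun t => Re (F t)) (fun t => Re (f t))).
    + intros; now apply is_rderiv_re, HF.
    + intros; now apply Ccontinuous_re, Hf.
  - replace (Im (F b - F a)) with (minus (Im (F b)) (Im (F a))) by (unfold Im; simpl; reflexivity).
    apply (is_RInt_derive (V := R_CompleteNormedModule) (fun t => Im (F t)) (fun t => Im (f t))).
    + intros; now apply is_rderiv_im, HF.
    + intros; now apply Ccontinuous_im, Hf.
Qed.

(** * Goursat's theorem on rectangles *)

(** The integral of f(z) dz once counterclockwise around the rectangle; [Ci] is dz/dy on the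
    vertical sides. *)
Definition bdry (f : C -> C) (x1 x2 y1 y2 : R) : C :=
  CInt (fun x => f (x, y1)) x1 x2 + Ci * CInt (fun y => f (x2, y)) y1 y2
  - CInt (fun x => f (x, y2)) x1 x2 - Ci * CInt (fun y => f (x1, y)) y1 y2.

Definition on_rect (P : C -> Prop) (x1 x2 y1 y2 : R) : Prop :=
  forall x y, (x1 <= x <= x2)%R -> (y1 <= y <= y2)%R -> P (x, y).

Lemma is_rderiv_hline y t : is_rderiv (fun x => (x, y) : C) t 1.
Proof.
  apply (is_rderiv_pair (fun x => x) (fun _ => y)); [exact (is_derive_id (K:=R_AbsRing) t)|exact (is_derive_const (K:=R_AbsRing) (V:=R_NormedModule) y t)].
Qed.

Lemma is_rderiv_vline x t : is_rderiv (fun y => (x, y) : C) t Ci.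
Proof.
  apply (is_rderiv_pair (fun _ => x) (fun y => y)); [exact (is_derive_const (K:=R_AbsRing) (V:=R_NormedModule) x t)|exact (is_derive_id (K:=R_AbsRing) t)].
Qed.

Lemma Ccontinuous_hline f x y : ccont f (x, y) -> Ccontinuous (fun t => f (t, y)) x.
Proof.
  intros H. apply (Ccontinuous_comp f (fun t => (t, y) : C)); auto.
  eapply is_rderiv_continuous, is_rderiv_hline.
Qed.

Lemma Ccontinuous_vline f x y : ccont f (x, y) -> Ccontinuous (fun t => f (x, t)) y.
Proof.
  intros H. apply (Ccontinuous_comp f (fun t => (x, t) : C)); auto.
  eapply is_rderiv_continuous, is_rderiv_vline.
Qed.

Lemma ccont_on_hline f y a b : (a <= b)%R ->
  (forall x, (a <= x <= b)%R -> ccont f (x, y)) -> ccont_on (fun t => f (t, y)) a b.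
Proof.
  intros Hab H t Ht. rewrite Rmin_left, Rmax_right in Ht by auto.
  now apply Ccontinuous_hline, H.
Qed.

Lemma ccont_on_vline f x a b : (a <= b)%R ->
  (forall y, (a <= y <= b)%R -> ccont f (x, y)) -> ccont_on (fun t => f (x, t)) a b.
Proof.
  intros Hab H t Ht. rewrite Rmin_left, Rmax_right in Ht by auto.
  now apply Ccontinuous_vline, H.
Qed.

Lemma bdry_split_x f x1 m x2 y1 y2 : (x1 <= m <= x2)%R ->
  (forall x, (x1 <= x <= x2)%R -> ccont f (x, y1)) ->
  (forall x, (x1 <= x <= x2)%R -> ccont f (x, y2)) ->
  bdry f x1 x2 y1 y2 = bdry f x1 m y1 y2 + bdry f m x2 y1 y2.
Proof.
  intros Hm H1 H2. unfold bdry.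
  rewrite <- (CInt_Chasles (fun x => f (x, y1)) x1 m x2), <- (CInt_Chasles (fun x => f (x, y2)) x1 m x2);
  try (apply ccont_on_hline; intros; first [lra | apply H1; lra | apply H2; lra]).
  ring.
Qed.

Lemma bdry_split_y f x1 x2 y1 m y2 : (y1 <= m <= y2)%R ->
  (forall y, (y1 <= y <= y2)%R -> ccont f (x1, y)) ->
  (forall y, (y1 <= y <= y2)%R -> ccont f (x2, y)) ->
  bdry f x1 x2 y1 y2 = bdry f x1 x2 y1 m + bdry f x1 x2 m y2.
Proof.
  intros Hm H1 H2. unfold bdry.
  rewrite <- (CInt_Chasles (fun y => f (x1, y)) y1 m y2), <- (CInt_Chasles (fun y => f (x2, y)) y1 m y2);
  try (apply ccont_on_vline; intros; first [lra | apply H1; lra | apply H2; lra]).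
  ring.
Qed.

Lemma bdry_ext f g x1 x2 y1 y2 : (x1 <= x2)%R -> (y1 <= y2)%R ->
  on_rect (fun z => f z = g z) x1 x2 y1 y2 -> bdry f x1 x2 y1 y2 = bdry g x1 x2 y1 y2.
Proof.
  intros Hx Hy H. unfold bdry.
  rewrite (CInt_ext (fun x => f (x, y1)) (fun x => g (x, y1))),
    (CInt_ext (fun x => f (x, y2)) (fun x => g (x, y2))),
    (CInt_ext (fun y => f (x1, y)) (fun y => g (x1, y))),
    (CInt_ext (fun y => f (x2, y)) (fun y => g (x2, y)));
    [reflexivity|intros t Ht; rewrite Rmin_left, Rmax_right in Ht by auto; apply H; lra ..].
Qed.

Definition ccont_edges (f : C -> C) (x1 x2 y1 y2 : R) : Prop :=
  (forall x, (x1 <= x <= x2)%R -> ccont f (x, y1) /\ ccont f (x, y2)) /\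
  (forall y, (y1 <= y <= y2)%R -> ccont f (x1, y) /\ ccont f (x2, y)).

Lemma on_rect_edges f x1 x2 y1 y2 : (x1 <= x2)%R -> (y1 <= y2)%R ->
  on_rect (ccont f) x1 x2 y1 y2 -> ccont_edges f x1 x2 y1 y2.
Proof. intros Hx Hy H; split; intros t Ht; split; apply H; lra. Qed.

Lemma bdry_plus f g x1 x2 y1 y2 : (x1 <= x2)%R -> (y1 <= y2)%R ->
  ccont_edges f x1 x2 y1 y2 -> ccont_edges g x1 x2 y1 y2 ->
  bdry (fun z => f z + g z) x1 x2 y1 y2 = bdry f x1 x2 y1 y2 + bdry g x1 x2 y1 y2.
Proof.
  intros Hx Hy [F1 F2] [G1 G2]. unfold bdry.
  rewrite (CInt_plus (fun x => f (x, y1))), (CInt_plus (fun x => f (x, y2))),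
    (CInt_plus (fun y => f (x1, y))), (CInt_plus (fun y => f (x2, y)));
  try (apply (ccont_on_hline f); auto; intros; now apply F1);
  try (apply (ccont_on_hline g); auto; intros; now apply G1);
  try (apply (ccont_on_vline f); auto; intros; now apply F2);
  try (apply (ccont_on_vline g); auto; intros; now apply G2).
  ring.
Qed.

Lemma bdry_scal c f x1 x2 y1 y2 : (x1 <= x2)%R -> (y1 <= y2)%R ->
  ccont_edges f x1 x2 y1 y2 ->
  bdry (fun z => c * f z) x1 x2 y1 y2 = c * bdry f x1 x2 y1 y2.
Proof.
  intros Hx Hy [F1 F2]. unfold bdry.
  rewrite (CInt_scal c (fun x => f (x, y1))), (CInt_scal c (fun x => f (x, y2))),
    (CInt_scal c (fun y => f (x1, y))), (CInt_scal c (fun y => f (x2, y)));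
  try (apply (ccont_on_hline f); auto; intros; now apply F1);
  try (apply (ccont_on_vline f); auto; intros; now apply F2).
  ring.
Qed.

Lemma bdry_bound f x1 x2 y1 y2 (M : R) : (x1 <= x2)%R -> (y1 <= y2)%R ->
  ccont_edges f x1 x2 y1 y2 ->
  (forall x, (x1 <= x <= x2)%R -> (Cmod (f (x, y1)) <= M)%R /\ (Cmod (f (x, y2)) <= M)%R) ->
  (forall y, (y1 <= y <= y2)%R -> (Cmod (f (x1, y)) <= M)%R /\ (Cmod (f (x2, y)) <= M)%R) ->
  (Cmod (bdry f x1 x2 y1 y2) <= M * (2 * (x2 - x1) + 2 * (y2 - y1)))%R.
Proof.
  intros Hx Hy [F1 F2] B1 B2. unfold bdry.
  assert (C1 := CInt_bound (fun x => f (x, y1)) x1 x2 M Hx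
    ltac:(apply ccont_on_hline; auto; intros; now apply F1) ltac:(intros; now apply B1)).
  assert (C2 := CInt_bound (fun x => f (x, y2)) x1 x2 M Hx
    ltac:(apply ccont_on_hline; auto; intros; now apply F1) ltac:(intros; now apply B1)).
  assert (C3 := CInt_bound (fun y => f (x1, y)) y1 y2 M Hy
    ltac:(apply ccont_on_vline; auto; intros; now apply F2) ltac:(intros; now apply B2)).
  assert (C4 := CInt_bound (fun y => f (x2, y)) y1 y2 M Hy
    ltac:(apply ccont_on_vline; auto; intros; now apply F2) ltac:(intros; now apply B2)).
  eapply Rle_trans; [apply Cmod_triangle|]. rewrite Cmod_opp.
  eapply Rle_trans; [apply Rplus_le_compat_r, Cmod_triangle|]. rewrite Cmod_opp.
  eapply Rle_trans; [apply Rplus_le_compat_r, Rplus_le_compat_r, Cmod_triangle|].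
  rewrite !Cmod_mult, Cmod_Ci. lra.
Qed.

Lemma is_CInt_hline F f y a b : (a <= b)%R ->
  (forall x, (a <= x <= b)%R -> is_cderiv F (x, y) (f (x, y)) /\ ccont f (x, y)) ->
  CInt (fun x => f (x, y)) a b = F (b, y) - F (a, y).
Proof.
  intros Hab H. apply is_CInt_unique.
  apply (is_CInt_deriv (fun x => F (x, y))).
  - intros t Ht. rewrite Rmin_left, Rmax_right in Ht by auto.
    replace (f (t, y)) with (f (t, y) * 1) by ring.
    apply (is_rderiv_comp F (fun x => (x, y) : C)); [apply is_rderiv_hline|now apply H].
  - apply ccont_on_hline; auto. intros; now apply H.
Qed.

Lemma is_CInt_vline F f x a b : (a <= b)%R ->
  (forall y, (a <= y <= b)%R -> is_cderiv F (x, y) (f (x, y)) /\ ccont f (x, y)) ->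
  Ci * CInt (fun y => f (x, y)) a b = F (x, b) - F (x, a).
Proof.
  intros Hab H.
  assert (Hc : ccont_on (fun y => f (x, y)) a b)
    by (apply ccont_on_vline; auto; intros; now apply H).
  rewrite <- CInt_scal by auto. apply is_CInt_unique.
  apply (is_CInt_deriv (fun y => F (x, y))).
  - intros t Ht. rewrite Rmin_left, Rmax_right in Ht by auto.
    rewrite Cmult_comm.
    apply (is_rderiv_comp F (fun y => (x, y) : C)); [apply is_rderiv_vline|now apply H].
  - intros t Ht. apply Ccontinuous_mult; [apply Ccontinuous_const|now apply Hc].
Qed.

Lemma bdry_primitive F f x1 x2 y1 y2 : (x1 <= x2)%R -> (y1 <= y2)%R ->
  on_rect (fun z => is_cderiv F z (f z) /\ ccont f z) x1 x2 y1 y2 ->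
  bdry f x1 x2 y1 y2 = 0.
Proof.
  intros Hx Hy H. unfold bdry.
  rewrite (is_CInt_hline F f y1), (is_CInt_hline F f y2), (is_CInt_vline F f x1),
    (is_CInt_vline F f x2); auto; try (intros; apply H; lra).
  ring.
Qed.

(** An affine function has a quadratic primitive. In Goursat's argument this removes the first-order
    part of f at the limit point. *)
Lemma bdry_affine a b z0 x1 x2 y1 y2 : (x1 <= x2)%R -> (y1 <= y2)%R ->
  bdry (fun z => a + b * (z - z0)) x1 x2 y1 y2 = 0.
Proof.
  intros Hx Hy.
  apply (bdry_primitive (fun z => a * z + b / 2 * ((z - z0) * (z - z0)))); auto.
  intros x y _ _. split.
  - eapply is_cderiv_ext; [intros; reflexivity|].
    replace (a + b * ((x, y) - z0)) with ((0 * (x, y) + a * 1) + (0 * (((x, y) - z0) * ((x, y) - z0)) +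
      b / 2 * ((1 + 0) * ((x, y) - z0) + ((x, y) - z0) * (1 + 0)))) by field.
    assert (K : is_cderiv (fun z => z - z0) (x, y) (1 + 0)).
    { apply (is_cderiv_plus (fun z => z) (fun _ => - z0)); [apply is_cderiv_id|].
      apply is_cderiv_const. }
    apply (is_cderiv_plus (fun z => a * z) (fun z => b / 2 * ((z - z0) * (z - z0)))).
    + apply (is_cderiv_mult (fun _ => a) (fun z => z)); [apply is_cderiv_const|apply is_cderiv_id].
    + apply (is_cderiv_mult (fun _ => b / 2) (fun z => (z - z0) * (z - z0)));
      [apply is_cderiv_const|].
      apply (is_cderiv_mult (fun z => z - z0) (fun z => z - z0)); auto.
  - apply cdiff_ccont. apply cdiff_plus; [apply cdiff_const|].
    apply (cdiff_mult (fun _ => b)); [apply cdiff_const|].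
    apply cdiff_minus; [apply cdiff_id|apply cdiff_const].
Qed.

Lemma nested_intervals (a b : nat -> R) : (forall n, a n <= a (S n))%R ->
  (forall n, b (S n) <= b n)%R -> (forall n, a n <= b n)%R ->
  exists x, forall n, (a n <= x <= b n)%R.
Proof.
  intros Ha Hb Hab.
  assert (Ma : forall n k, (a n <= a (n + k)%nat)%R).
  { intros n k; induction k; [rewrite Nat.add_0_r; lra|].
    rewrite Nat.add_succ_r. specialize (Ha (n + k)%nat). lra. }
  assert (Mb : forall n k, (b (n + k)%nat <= b n)%R).
  { intros n k; induction k; [rewrite Nat.add_0_r; lra|].
    rewrite Nat.add_succ_r. specialize (Hb (n + k)%nat). lra. }
  assert (U : forall n m, (a n <= b m)%R).
  { intros n m. specialize (Ma n m). specialize (Mb m n). specialize (Hab (n + m)%nat).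
    rewrite Nat.add_comm in Mb. lra. }
  destruct (completeness (fun r => exists n, r = a n)) as [x [Hx1 Hx2]].
  - exists (b 0%nat). intros r [n ->]. apply U.
  - exists (a 0%nat), 0%nat; auto.
  - exists x. intros n; split; [apply Hx1; eauto|]. apply Hx2. intros r [m ->]. apply U.
Qed.

(* A rectangle is encoded as ((x1, x2), (y1, y2)). *)
Definition rect_bdry (f : C -> C) (r : (R * R) * (R * R)) : C :=
  bdry f (fst (fst r)) (snd (fst r)) (fst (snd r)) (snd (snd r)).

(** The last quadrant is taken without a test: if the first three integrals fall below a quarter of
    the whole, the triangle inequality leaves at least a quarter for the fourth. *)
Definition worst_quadrant (f : C -> C) (r : (R * R) * (R * R)) : (R * R) * (R * R) :=
  let '((x1, x2), (y1, y2)) := r in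
  let m := ((x1 + x2) / 2)%R in let n := ((y1 + y2) / 2)%R in
  if Rle_dec (Cmod (rect_bdry f r)) (4 * Cmod (rect_bdry f ((x1, m), (y1, n)))) then ((x1, m), (y1, n))
  else if Rle_dec (Cmod (rect_bdry f r)) (4 * Cmod (rect_bdry f ((m, x2), (y1, n)))) then ((m, x2), (y1, n))
  else if Rle_dec (Cmod (rect_bdry f r)) (4 * Cmod (rect_bdry f ((x1, m), (n, y2)))) then ((x1, m), (n, y2))
  else ((m, x2), (n, y2)).

Lemma worst_quadrant_spec f x1 x2 y1 y2 : (x1 <= x2)%R -> (y1 <= y2)%R ->
  on_rect (ccont f) x1 x2 y1 y2 ->
  exists a b c d, worst_quadrant f ((x1, x2), (y1, y2)) = ((a, b), (c, d)) /\
   (x1 <= a)%R /\ (b <= x2)%R /\ (y1 <= c)%R /\ (d <= y2)%R /\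
   (b - a = (x2 - x1) / 2)%R /\ (d - c = (y2 - y1) / 2)%R /\
   (Cmod (bdry f x1 x2 y1 y2) <= 4 * Cmod (bdry f a b c d))%R.
Proof.
  intros Hx Hy Hc. unfold worst_quadrant, rect_bdry. cbn [fst snd].
  set (m := ((x1 + x2) / 2)%R). set (n := ((y1 + y2) / 2)%R).
  assert (Hm : (x1 <= m <= x2 /\ m - x1 = (x2 - x1) / 2 /\ x2 - m = (x2 - x1) / 2)%R)
    by (unfold m; lra).
  assert (Hn : (y1 <= n <= y2 /\ n - y1 = (y2 - y1) / 2 /\ y2 - n = (y2 - y1) / 2)%R)
    by (unfold n; lra).
  clearbody m n. destruct Hm as [Hm [Hm1 Hm2]]. destruct Hn as [Hn [Hn1 Hn2]].
  destruct (Rle_dec _ _) as [L1|L1]; [exists x1, m, y1, n; repeat split; auto; lra|].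
  destruct (Rle_dec _ _) as [L2|L2]; [exists m, x2, y1, n; repeat split; auto; lra|].
  destruct (Rle_dec _ _) as [L3|L3]; [exists x1, m, n, y2; repeat split; auto; lra|].
  exists m, x2, n, y2; repeat split; auto; try lra.
  assert (E : bdry f x1 x2 y1 y2 = (bdry f x1 m y1 n + bdry f m x2 y1 n)
    + (bdry f x1 m n y2 + bdry f m x2 n y2)).
  { rewrite (bdry_split_y f x1 x2 y1 n y2) by (try (intros; apply Hc); lra).
    rewrite (bdry_split_x f x1 m x2 y1 n) by (try (intros; apply Hc); lra).
    rewrite (bdry_split_x f x1 m x2 n y2) by (try (intros; apply Hc); lra). reflexivity. }
  assert (T : (Cmod (bdry f x1 x2 y1 y2) <= (Cmod (bdry f x1 m y1 n) + Cmod (bdry f m x2 y1 n))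
     + (Cmod (bdry f x1 m n y2) + Cmod (bdry f m x2 n y2)))%R).
  { rewrite E. eapply Rle_trans; [apply Cmod_triangle|].
    apply Rplus_le_compat; apply Cmod_triangle. }
  lra.
Qed.

(** Bisection keeps a quarter of the boundary integral at each stage, while N halvings divide the
    perimeter by 2^N. On the last rectangle f is within q w of an affine function, whose boundary
    integral is 0, so the factors 4^N and 2^(-2N) cancel and q remains. *)
Theorem goursat f x1 x2 y1 y2 : (x1 <= x2)%R -> (y1 <= y2)%R ->
  on_rect (cdiff f) x1 x2 y1 y2 -> bdry f x1 x2 y1 y2 = 0.
Proof.
  intros Hx Hy Hf.
  assert (Hc : on_rect (ccont f) x1 x2 y1 y2).
  { intros x y X Y. now apply cdiff_ccont, Hf. }
  set (r := fun n => Nat.iter n (worst_quadrant f) ((x1, x2), (y1, y2))).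
  set (a := fun n => fst (fst (r n))). set (b := fun n => snd (fst (r n))).
  set (c := fun n => fst (snd (r n))). set (d := fun n => snd (snd (r n))).
  assert (Er : forall n, r n = ((a n, b n), (c n, d n))).
  { intros n; unfold a, b, c, d. now destruct (r n) as [[? ?] [? ?]]. }
  assert (In : forall n, (x1 <= a n /\ b n <= x2 /\ y1 <= c n /\ d n <= y2 /\
     b n - a n = (x2 - x1) / 2 ^ n /\ d n - c n = (y2 - y1) / 2 ^ n /\
     Cmod (bdry f x1 x2 y1 y2) <= 4 ^ n * Cmod (bdry f (a n) (b n) (c n) (d n)))%R).
  { induction n.
    - unfold a, b, c, d; simpl. repeat split; lra.
    - destruct IHn as [I1 [I2 [I3 [I4 [I5 [I6 I7]]]]]].
      assert (P2 : (0 < 2 ^ n)%R) by (apply pow_lt; lra).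
      assert (P4 : (0 < 4 ^ n)%R) by (apply pow_lt; lra).
      assert (Wx : (0 <= (x2 - x1) / 2 ^ n)%R) by (apply Rdiv_le_0_compat; lra).
      assert (Wy : (0 <= (y2 - y1) / 2 ^ n)%R) by (apply Rdiv_le_0_compat; lra).
      destruct (worst_quadrant_spec f (a n) (b n) (c n) (d n)) as
        [a' [b' [c' [d' [E [J1 [J2 [J3 [J4 [J5 [J6 J7]]]]]]]]]]]; try lra.
      { intros x y X Y; apply Hc; lra. }
      rewrite <- Er in E. change (worst_quadrant f (r n)) with (r (S n)) in E.
      rewrite Er in E. injection E as -> -> -> ->.
      repeat split; try lra.
      + rewrite J5, I5. simpl. field. lra.
      + rewrite J6, I6. simpl. field. lra.
      + simpl. nra. }
  assert (St : forall n, (a n <= a (S n) /\ b (S n) <= b n /\ c n <= c (S n) /\ d (S n) <= d n)%R).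
  { intros n. destruct (In n) as [I1 [I2 [I3 [I4 [I5 [I6 I7]]]]]].
    assert (P2 : (0 < 2 ^ n)%R) by (apply pow_lt; lra).
    assert (Wx : (0 <= (x2 - x1) / 2 ^ n)%R) by (apply Rdiv_le_0_compat; lra).
    assert (Wy : (0 <= (y2 - y1) / 2 ^ n)%R) by (apply Rdiv_le_0_compat; lra).
    destruct (worst_quadrant_spec f (a n) (b n) (c n) (d n)) as
        [a' [b' [c' [d' [E [J1 [J2 [J3 [J4 [J5 [J6 J7]]]]]]]]]]]; try lra.
    { intros x y X Y; apply Hc; lra. }
    rewrite <- Er in E. change (worst_quadrant f (r n)) with (r (S n)) in E.
    rewrite Er in E. injection E as -> -> -> ->. repeat split; lra. }
  assert (Pos : forall n, (a n <= b n /\ c n <= d n)%R).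
  { intros n. destruct (In n) as [I1 [I2 [I3 [I4 [I5 [I6 I7]]]]]].
    assert (P2 : (0 < 2 ^ n)%R) by (apply pow_lt; lra).
    assert (Wx : (0 <= (x2 - x1) / 2 ^ n)%R) by (apply Rdiv_le_0_compat; lra).
    assert (Wy : (0 <= (y2 - y1) / 2 ^ n)%R) by (apply Rdiv_le_0_compat; lra). lra. }
  destruct (nested_intervals a b) as [x0 X0]; try (intros n; first [apply (St n)|apply (Pos n)]).
  destruct (nested_intervals c d) as [y0 Y0]; try (intros n; first [apply (St n)|apply (Pos n)]).
  destruct (Hf x0 y0) as [D HD].
  { specialize (X0 0%nat). apply X0. } { specialize (Y0 0%nat). apply Y0. }
  set (W := ((x2 - x1) + (y2 - y1))%R).
  assert (HW : (0 <= W)%R) by (unfold W; lra).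
  apply Cmod_eq_0, Rle_antisym; [|apply Cmod_ge_0].
  apply le_epsilon. intros e He. rewrite Rplus_0_l.
  (* The argument ends with the bound 2 q W^2, where W is half the perimeter; the + 1 covers W =
     0. *)
  assert (Hq : (0 < e / (4 * W * W + 1))%R) by (apply Rdiv_lt_0_compat; nra).
  destruct (HD _ Hq) as [del [Hdel H1]]. set (q := (e / (4 * W * W + 1))%R) in *.
  destruct (pow_lt_1_zero (1/2) ltac:(rewrite Rabs_right; lra) (del / (W + 1))) as [N HN].
  { apply Rdiv_lt_0_compat; lra. }
  specialize (HN N (le_n _)). rewrite Rabs_right in HN by (apply Rle_ge, pow_le; lra).
  assert (E2 : ((1 / 2) ^ N = / 2 ^ N)%R).
  { unfold Rdiv. rewrite Rmult_1_l, pow_inv by lra. auto. }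
  rewrite E2 in HN.
  assert (P2 : (0 < 2 ^ N)%R) by (apply pow_lt; lra).
  assert (Pi : (0 < / 2 ^ N)%R) by (apply Rinv_0_lt_compat; lra).
  set (w := (W / 2 ^ N)%R).
  assert (Hw : (0 <= w)%R) by (apply Rdiv_le_0_compat; lra).
  assert (Hwd : (w < del)%R).
  { unfold w, Rdiv. apply (Rmult_lt_compat_r (W + 1)) in HN; [|lra].
    replace (del / (W + 1) * (W + 1))%R with del in HN by (field; lra). nra. }
  destruct (In N) as [I1 [I2 [I3 [I4 [I5 [I6 I7]]]]]].
  destruct (Pos N) as [Px Py]. specialize (X0 N). specialize (Y0 N).
  assert (EW : (w = (b N - a N) + (d N - c N))%R) by (rewrite I5, I6; unfold w, W; field; lra).
  set (A := fun z : C => f (x0, y0) + D * (z - (x0, y0))).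
  set (g := fun z : C => f z + - (1) * A z).
  assert (cA : forall z, ccont A z).
  { intros z. apply cdiff_ccont. apply cdiff_plus; [apply cdiff_const|].
    apply (cdiff_mult (fun _ => D)); [apply cdiff_const|].
    apply cdiff_minus; [apply cdiff_id|apply cdiff_const]. }
  assert (cg : on_rect (ccont g) (a N) (b N) (c N) (d N)).
  { intros x y X Y. apply cdiff_ccont. apply cdiff_plus; [apply Hf; lra|].
    apply (cdiff_mult (fun _ => - (1))); [apply cdiff_const|].
    apply cdiff_plus; [apply cdiff_const|].
    apply (cdiff_mult (fun _ => D)); [apply cdiff_const|].
    apply cdiff_minus; [apply cdiff_id|apply cdiff_const]. }
  assert (Bd : on_rect (fun z => (Cmod (g z) <= q * w)%R) (a N) (b N) (c N) (d N)).
  { intros x y X Y. unfold g, A.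
    assert (Hh : (Cmod ((x, y) - (x0, y0)) <= w)%R).
    { eapply Rle_trans; [apply Cmod_le_Rabs|]. rewrite EW.
      unfold Re, Im; simpl. apply Rplus_le_compat; apply Rabs_le; lra. }
    specialize (H1 ((x, y) - (x0, y0)) (Rle_lt_trans _ _ _ Hh Hwd)).
    replace ((x0, y0) + ((x, y) - (x0, y0))) with ((x, y) : C) in H1 by (C_parts; ring).
    replace (f (x, y) + - (1) * (f (x0, y0) + D * ((x, y) - (x0, y0))))
      with (f (x, y) - f (x0, y0) - D * ((x, y) - (x0, y0))) by ring.
    eapply Rle_trans; [exact H1|]. apply Rmult_le_compat_l; lra. }
  assert (Eb : bdry f (a N) (b N) (c N) (d N) = bdry g (a N) (b N) (c N) (d N)).
  { rewrite (bdry_ext f (fun z => g z + A z)); auto; [|intros x y _ _; unfold g; ring].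
    rewrite (bdry_plus g A); auto.
    - unfold A. rewrite bdry_affine by auto. ring.
    - now apply on_rect_edges.
    - apply on_rect_edges; auto. intros ? ? _ _; apply cA. }
  assert (B : (Cmod (bdry f (a N) (b N) (c N) (d N)) <= q * w * (2 * w))%R).
  { rewrite Eb. replace (2 * w)%R with (2 * (b N - a N) + 2 * (d N - c N))%R by lra.
    apply bdry_bound; auto.
    - now apply on_rect_edges.
    - intros; split; apply Bd; lra.
    - intros; split; apply Bd; lra. }
  assert (E4 : (4 ^ N * (w * w) = W * W)%R).
  { unfold w. replace 4%R with (2 * 2)%R by ring. rewrite Rpow_mult_distr. field. lra. }
  assert (P4 : (0 < 4 ^ N)%R) by (apply pow_lt; lra).
  apply Rle_trans with (q * (2 * (W * W)))%R.
  - eapply Rle_trans; [exact I7|].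
    apply Rle_trans with (4 ^ N * (q * w * (2 * w)))%R; [apply Rmult_le_compat_l; lra|].
    right. rewrite <- E4. ring.
  - assert (q * (4 * W * W + 1) = e)%R by (unfold q; field; nra). nra.
Qed.

(** * Residues and Cauchy's formula *)

Lemma bdry_ext_edges f g x1 x2 y1 y2 : (x1 <= x2)%R -> (y1 <= y2)%R ->
  (forall x, (x1 <= x <= x2)%R -> f (x, y1) = g (x, y1) /\ f (x, y2) = g (x, y2)) ->
  (forall y, (y1 <= y <= y2)%R -> f (x1, y) = g (x1, y) /\ f (x2, y) = g (x2, y)) ->
  bdry f x1 x2 y1 y2 = bdry g x1 x2 y1 y2.
Proof.
  intros Hx Hy H1 H2. unfold bdry.
  rewrite (CInt_ext (fun x => f (x, y1)) (fun x => g (x, y1))),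
    (CInt_ext (fun x => f (x, y2)) (fun x => g (x, y2))),
    (CInt_ext (fun y => f (x1, y)) (fun y => g (x1, y))),
    (CInt_ext (fun y => f (x2, y)) (fun y => g (x2, y)));
    [reflexivity|intros t Ht; rewrite Rmin_left, Rmax_right in Ht by auto;
       first [now apply H1|now apply H2] ..].
Qed.

Lemma pair_eq_minus (x y x0 y0 : R) : ((x, y) : C) - (x0, y0) = ((x - x0)%R, (y - y0)%R).
Proof. C_parts; ring. Qed.

(** Rectangles to the left, to the right, below and above the small square are cut off; none
    contains the exceptional point, so Goursat makes each contribution vanish. *)
Lemma bdry_shrink f x0 y0 (r x1 x2 y1 y2 : R) : (0 < r)%R ->
  (x1 <= x0 - r)%R -> (x0 + r <= x2)%R -> (y1 <= y0 - r)%R -> (y0 + r <= y2)%R ->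
  on_rect (fun z => z <> (x0, y0) -> cdiff f z) x1 x2 y1 y2 ->
  bdry f x1 x2 y1 y2 = bdry f (x0 - r) (x0 + r) (y0 - r) (y0 + r).
Proof.
  intros Hr X1 X2 Y1 Y2 Hf.
  assert (Hd : forall x y, (x1 <= x <= x2)%R -> (y1 <= y <= y2)%R ->
     (x <> x0 \/ y <> y0) -> cdiff f (x, y)).
  { intros x y X Y N. apply Hf; auto. intros E; injection E; intros; subst; tauto. }
  assert (Hc : forall x y, (x1 <= x <= x2)%R -> (y1 <= y <= y2)%R ->
     (x <> x0 \/ y <> y0) -> ccont f (x, y)).
  { intros; now apply cdiff_ccont, Hd. }
  rewrite (bdry_split_x f x1 (x0 - r) x2 y1 y2) by (try (intros; apply Hc); lra).
  rewrite (goursat f x1 (x0 - r) y1 y2) by (try (intros ? ? ? ?; apply Hd); lra).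
  rewrite (bdry_split_x f (x0 - r) (x0 + r) x2 y1 y2) by (try (intros; apply Hc); lra).
  rewrite (goursat f (x0 + r) x2 y1 y2) by (try (intros ? ? ? ?; apply Hd); lra).
  rewrite (bdry_split_y f (x0 - r) (x0 + r) y1 (y0 - r) y2) by (try (intros; apply Hc); lra).
  rewrite (goursat f (x0 - r) (x0 + r) y1 (y0 - r)) by (try (intros ? ? ? ?; apply Hd); lra).
  rewrite (bdry_split_y f (x0 - r) (x0 + r) (y0 - r) (y0 + r) y2) by (try (intros; apply Hc); lra).
  rewrite (goursat f (x0 - r) (x0 + r) (y0 + r) y2) by (try (intros ? ? ? ?; apply Hd); lra).
  ring.
Qed.

Lemma sqr_plus_sqr_pos (u r : R) : (r <> 0)%R -> (0 < u * u + r * r)%R.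
Proof. intros Hr. pose proof (Rsqr_pos_lt r Hr). unfold Rsqr in H. nra. Qed.

Lemma half_ln_deriv (r t0 t : R) : (r <> 0)%R ->
  is_derive (fun t => (/ 2 * ln ((t - t0) * (t - t0) + r * r))%R) t
    ((t - t0) / ((t - t0) * (t - t0) + r * r))%R.
Proof.
  intros Hr. pose proof (sqr_plus_sqr_pos (t - t0) r Hr).
  auto_derive; [lra|]. field. lra.
Qed.

Lemma atan_ratio_deriv (r t0 t : R) : (r <> 0)%R ->
  is_derive (fun t => (atan ((t - t0) / r))%R) t
    (r / ((t - t0) * (t - t0) + r * r))%R.
Proof.
  intros Hr. pose proof (sqr_plus_sqr_pos (t - t0) r Hr).
  auto_derive; [auto|]. field. repeat split; auto; nra.
Qed.

Lemma cdiff_shift_inv (s z : C) : z <> s -> cdiff (fun z => / (z - s)) z.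
Proof.
  intros N. apply cdiff_inv; [now apply Cminus_eq_contra|].
  apply cdiff_minus; [apply cdiff_id|apply cdiff_const].
Qed.

(** A primitive is 1/2 ln(u^2 + q^2) + i atan(u/q) with u = t - t0, a branch of the logarithm that
    is smooth along the whole line. The interval is symmetric, so the real part cancels. Both signs
    of q are needed, for opposite sides of a square. *)
Lemma CInt_inv_line (t0 q r : R) : q <> 0%R ->
  CInt (fun t => / (((t - t0)%R, (- q)%R) : C)) (t0 - r) (t0 + r) = (0%R, (2 * atan (r / q))%R).
Proof.
  intros Hq. apply is_CInt_unique.
  replace ((0%R, (2 * atan (r / q))%R) : C) with
    (((/ 2 * ln ((t0 + r - t0) * (t0 + r - t0) + q * q))%R, atan ((t0 + r - t0) / q)) -
     ((/ 2 * ln ((t0 - r - t0) * (t0 - r - t0) + q * q))%R, atan ((t0 - r - t0) / q)) : C).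
  2:{ rewrite pair_eq_minus. replace (t0 + r - t0)%R with r by ring.
      replace (t0 - r - t0)%R with (- r)%R by ring. rewrite Rmult_opp_opp.
      replace (- r / q)%R with (- (r / q))%R by (field; auto). rewrite atan_opp. f_equal; ring. }
  assert (D : forall t, is_rderiv
    (fun t => ((/ 2 * ln ((t - t0) * (t - t0) + q * q))%R, atan ((t - t0) / q)) : C) t
    (/ (((t - t0)%R, (- q)%R) : C))).
  { intros t. replace (/ _) with ((((t - t0) / ((t - t0) * (t - t0) + q * q))%R,
        (q / ((t - t0) * (t - t0) + q * q))%R) : C).
    - apply is_rderiv_pair; [now apply half_ln_deriv|now apply atan_ratio_deriv].
    - pose proof (sqr_plus_sqr_pos (t - t0) q Hq). C_parts; field; nra. }
  apply (is_CInt_deriv _ _ _ _ (fun t _ => D t)). intros t _.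
  apply (Ccontinuous_comp Cinv (fun t => ((t - t0)%R, (- q)%R) : C)).
  - apply cdiff_ccont, (cdiff_inv (fun z => z)); [|apply cdiff_id].
    intros E. injection E. intros. lra.
  - apply (is_rderiv_continuous _ _ (1%R, 0%R)).
    apply (is_rderiv_pair (fun t => (t - t0)%R) (fun _ => (- q)%R)); auto_derive; auto; ring.
Qed.

(** Each side is seen from the centre under a right angle and contributes i pi/2. Vertical sides
    reduce to horizontal ones by a rotation through i. *)
Lemma bdry_inv_square (x0 y0 r : R) : (0 < r)%R ->
  bdry (fun z => / (z - (x0, y0))) (x0 - r) (x0 + r) (y0 - r) (y0 + r) = 2 * PI * Ci.
Proof.
  intros Hr.
  assert (V : forall q, q <> 0%R ->
    Ci * CInt (fun y => / ((((x0 + q)%R, y) : C) - (x0, y0))) (y0 - r) (y0 + r) = (0%R, (2 * atan (r / q))%R)).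
  { intros q Hq. rewrite <- (CInt_inv_line y0 q r Hq), <- CInt_scal.
    - apply CInt_ext. intros t _. rewrite pair_eq_minus. replace (x0 + q - x0)%R with q by ring.
      replace (((t - y0)%R, (- q)%R) : C) with (- Ci * (q, (t - y0)%R)) by (C_parts; ring).
      assert (N : ((q, (t - y0)%R) : C) <> 0) by (intros E; injection E; intros; lra).
      replace (/ (- Ci * (q, (t - y0)%R))) with (- / Ci * / (q, (t - y0)%R)) by (field; split; auto; apply Ci_nz).
      rewrite Ci_inv. ring.
    - apply (ccont_on_vline (fun z => / (z - (x0, y0)))); [lra|]. intros y _.
      apply cdiff_ccont, cdiff_shift_inv. intros E. injection E. intros. lra. }
  assert (H : forall q, q <> 0%R ->
    CInt (fun x => / (((x, (y0 - q)%R) : C) - (x0, y0))) (x0 - r) (x0 + r) = (0%R, (2 * atan (r / q))%R)).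
  { intros q Hq. rewrite <- (CInt_inv_line x0 q r Hq). apply CInt_ext. intros t _. rewrite pair_eq_minus.
    replace (y0 - q - y0)%R with (- q)%R by ring. reflexivity. }
  assert (Ht := H (- r)%R ltac:(lra)). replace (y0 - - r)%R with (y0 + r)%R in Ht by ring.
  assert (Vl := V (- r)%R ltac:(lra)). replace (x0 + - r)%R with (x0 - r)%R in Vl by ring.
  unfold bdry. rewrite (H r), (V r), Ht, Vl by lra.
  replace (r / r)%R with 1%R by (field; lra). replace (r / - r)%R with (- (1))%R by (field; lra).
  rewrite atan_opp, atan_1. C_parts; field.
Qed.

Lemma Cmod_pair_ge (x y r : R) : (r <= Rabs x)%R \/ (r <= Rabs y)%R -> (r <= Cmod (x, y))%R.
Proof.
  intros [H|H]; (eapply Rle_trans; [exact H|]); [apply (re_le_Cmod (x, y))|apply (im_le_Cmod (x, y))].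
Qed.

Lemma Cmod_pair_le (x y r : R) : (Rabs x <= r)%R -> (Rabs y <= r)%R -> (Cmod (x, y) <= 2 * r)%R.
Proof.
  intros H1 H2. eapply Rle_trans; [apply Cmod_le_Rabs|]. unfold Re, Im; simpl. lra.
Qed.

(** After subtraction of rho/(z - z0) the function is o(1/r) on the square of half-side r, whose
    perimeter is 8 r. The residue enters only as the limit of h f(z0 + h), so no Laurent expansion
    is required. *)
Theorem residue_simple_pole (f : C -> C) (x0 y0 : R) (rho : C) x1 x2 y1 y2 :
  (x1 < x0 < x2)%R -> (y1 < y0 < y2)%R ->
  on_rect (fun z => z <> (x0, y0) -> cdiff f z) x1 x2 y1 y2 ->
  (forall eps, (0 < eps)%R -> exists del, (0 < del)%R /\ forall h : C, h <> 0 -> (Cmod h < del)%R ->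
     (Cmod (h * f ((x0, y0) + h)%C - rho) <= eps)%R) ->
  bdry f x1 x2 y1 y2 = 2 * PI * Ci * rho.
Proof.
  intros X Y Hf Hlim.
  apply Ceq_minus, Cmod_eq_0, Rle_antisym; [|apply Cmod_ge_0].
  apply le_epsilon. intros e He. rewrite Rplus_0_l.
  (* On the edges |z - z0| >= r, so the difference is at most e/(8 r), and the perimeter 8 r turns
     this into e. Corners lie within 2 r of z0, hence r <= del/4 below. *)
  destruct (Hlim (e / 8)%R ltac:(lra)) as [del [Hdel H1]].
  set (r := Rmin (del / 4) (Rmin (Rmin (x0 - x1) (x2 - x0)) (Rmin (y0 - y1) (y2 - y0)))).
  assert (Hr : (0 < r)%R) by (unfold r; repeat apply Rmin_pos; lra).
  assert (r1 : (r <= del / 4)%R) by apply Rmin_l.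
  assert (r0 : (r <= Rmin (Rmin (x0 - x1) (x2 - x0)) (Rmin (y0 - y1) (y2 - y0)))%R) by apply Rmin_r.
  assert (rx : (r <= Rmin (x0 - x1) (x2 - x0))%R) by (eapply Rle_trans; [exact r0|apply Rmin_l]).
  assert (ry : (r <= Rmin (y0 - y1) (y2 - y0))%R) by (eapply Rle_trans; [exact r0|apply Rmin_r]).
  pose proof (Rmin_l (x0 - x1) (x2 - x0)). pose proof (Rmin_r (x0 - x1) (x2 - x0)).
  pose proof (Rmin_l (y0 - y1) (y2 - y0)). pose proof (Rmin_r (y0 - y1) (y2 - y0)).
  clearbody r.
  rewrite (bdry_shrink f x0 y0 r) by (auto; lra).
  set (k := fun z : C => / (z - (x0, y0))).
  set (g := fun z => f z + - rho * k z).
  assert (Nz : forall x y, (r <= Rabs (x - x0))%R \/ (r <= Rabs (y - y0))%R ->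
     ((x, y) : C) <> (x0, y0)).
  { intros x y O E. injection E; intros; subst. rewrite !Rminus_eq_0, Rabs_R0 in O. lra. }
  assert (ck : forall x y, (r <= Rabs (x - x0))%R \/ (r <= Rabs (y - y0))%R -> ccont k (x, y)).
  { intros; apply cdiff_ccont, cdiff_shift_inv; auto. }
  assert (ckr : forall x y, (r <= Rabs (x - x0))%R \/ (r <= Rabs (y - y0))%R ->
     ccont (fun z => - rho * k z) (x, y)).
  { intros; apply cdiff_ccont. apply (cdiff_mult (fun _ => - rho)); [apply cdiff_const|].
    apply cdiff_shift_inv; auto. }
  assert (Df : forall x y, (x0 - r <= x <= x0 + r)%R -> (y0 - r <= y <= y0 + r)%R ->
     (r <= Rabs (x - x0))%R \/ (r <= Rabs (y - y0))%R -> cdiff f (x, y)).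
  { intros; apply Hf; auto; lra. }
  (* Transfers a property of the points at distance at least r from the centre in one coordinate to
     the four edges. *)
  assert (Fold : forall P : C -> Prop, (forall x y, (x0 - r <= x <= x0 + r)%R -> (y0 - r <= y <= y0 + r)%R ->
     (r <= Rabs (x - x0))%R \/ (r <= Rabs (y - y0))%R -> P (x, y)) ->
     (forall x, (x0 - r <= x <= x0 + r)%R -> P (x, (y0 - r)%R) /\ P (x, (y0 + r)%R)) /\
     (forall y, (y0 - r <= y <= y0 + r)%R -> P ((x0 - r)%R, y) /\ P ((x0 + r)%R, y))).
  { intros P HP. assert (a1 : (r <= Rabs (- r))%R) by (rewrite Rabs_Ropp, Rabs_right; lra).
    assert (a2 : (r <= Rabs r)%R) by (rewrite Rabs_right; lra).
    split; intros t Ht; split; apply HP; auto; try lra;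
    [right; replace (y0 - r - y0)%R with (- r)%R by ring
    |right; replace (y0 + r - y0)%R with r by ring
    |left; replace (x0 - r - x0)%R with (- r)%R by ring
    |left; replace (x0 + r - x0)%R with r by ring]; auto. }
  assert (E : bdry f (x0 - r) (x0 + r) (y0 - r) (y0 + r) =
     bdry g (x0 - r) (x0 + r) (y0 - r) (y0 + r) + rho * (2 * PI * Ci)).
  { rewrite <- (bdry_inv_square x0 y0 r Hr). fold k. unfold g.
    rewrite bdry_plus, bdry_scal; try lra.
    - ring.
    - apply (Fold (ccont k)); auto.
    - apply (Fold (ccont f)). intros; apply cdiff_ccont; auto.
    - apply (Fold (ccont (fun z => - rho * k z))); auto. }
  rewrite E. replace (_ + _ - _) with (bdry g (x0 - r) (x0 + r) (y0 - r) (y0 + r)) by ring.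
  apply Rle_trans with (e / 8 / r * (2 * (x0 + r - (x0 - r)) + 2 * (y0 + r - (y0 - r))))%R;
    [|right; field; lra].
  assert (Bg : forall x y, (x0 - r <= x <= x0 + r)%R -> (y0 - r <= y <= y0 + r)%R ->
     (r <= Rabs (x - x0))%R \/ (r <= Rabs (y - y0))%R -> (Cmod (g (x, y)) <= e / 8 / r)%R).
  { intros x y Hx Hy O. unfold g, k.
    assert (N := Nz x y O). set (h := ((x, y) : C) - (x0, y0)).
    assert (Hh : h <> 0) by now apply Cminus_eq_contra.
    assert (Lo : (r <= Cmod h)%R) by (unfold h; rewrite pair_eq_minus; now apply Cmod_pair_ge).
    assert (Up : (Cmod h <= 2 * r)%R)
      by (unfold h; rewrite pair_eq_minus; apply Cmod_pair_le; apply Rabs_le; lra).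
    specialize (H1 h Hh ltac:(lra)).
    assert (Eh : ((x0, y0) : C) + h = (x, y)) by (unfold h; C_parts; ring). rewrite Eh in H1.
    replace (f (x, y) + - rho * / h) with ((h * f (x, y) - rho) / h) by (field; auto).
    rewrite Cmod_div by auto. unfold Rdiv. apply Rmult_le_compat; try lra.
    - apply Cmod_ge_0.
    - apply Rlt_le, Rinv_0_lt_compat; lra.
    - apply Rinv_le_contravar; lra. }
  apply bdry_bound; try lra.
  - apply (Fold (ccont g)). intros; apply cdiff_ccont.
    apply cdiff_plus; [now apply Df|].
    apply (cdiff_mult (fun _ => - rho)); [apply cdiff_const|apply cdiff_shift_inv; auto].
  - apply (proj1 (Fold (fun z => (Cmod (g z) <= e / 8 / r)%R) Bg)).
  - apply (proj2 (Fold (fun z => (Cmod (g z) <= e / 8 / r)%R) Bg)).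
Qed.

Theorem cauchy_formula (f : C -> C) (x0 y0 : R) x1 x2 y1 y2 :
  (x1 < x0 < x2)%R -> (y1 < y0 < y2)%R -> on_rect (cdiff f) x1 x2 y1 y2 ->
  bdry (fun z => f z / (z - (x0, y0))) x1 x2 y1 y2 = 2 * PI * Ci * f (x0, y0).
Proof.
  intros X Y Hf. apply (residue_simple_pole _ x0 y0); auto.
  - intros x y Hx Hy N. apply (cdiff_mult f); [now apply Hf|]. now apply cdiff_shift_inv.
  - intros e He. destruct (cdiff_ccont f (x0, y0) (Hf x0 y0 ltac:(lra) ltac:(lra)) e He) as [d [Hd H]].
    exists d; split; auto. intros h Hh Hh2.
    replace (h * (f ((x0, y0) + h) / ((x0, y0) + h - (x0, y0))) - f (x0, y0))
      with (f ((x0, y0) + h) - f (x0, y0)).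
    + now apply Rlt_le, H.
    + replace ((x0, y0) + h - (x0, y0)) with h by ring. field. auto.
Qed.

(** * Limits of holomorphic functions and the identity theorem *)

(** Squares play the role of discs because Cauchy's formula is available on rectangles. *)
Definition on_square (P : C -> Prop) (s : C) (r : R) : Prop :=
  on_rect P (Re s - r) (Re s + r) (Im s - r) (Im s + r).

(** The edges are reached through the single condition |z - s| >= r, which is the one that estimates
    on the boundary use. *)
Lemma square_edges (P : C -> Prop) (s : C) (r : R) : (0 < r)%R ->
  on_square (fun z => (r <= Cmod (z - s))%R -> P z) s r ->
  (forall x, (Re s - r <= x <= Re s + r)%R -> P (x, (Im s - r)%R) /\ P (x, (Im s + r)%R)) /\
  (forall y, (Im s - r <= y <= Im s + r)%R -> P ((Re s - r)%R, y) /\ P ((Re s + r)%R, y)).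
Proof.
  intros Hr H.
  assert (a1 : (r <= Rabs (- r))%R) by (rewrite Rabs_Ropp, Rabs_right; lra).
  assert (a2 : (r <= Rabs r)%R) by (rewrite Rabs_right; lra).
  destruct s as [sx sy]; unfold Re, Im in *; cbn [fst snd] in *.
  split; intros t Ht; split; apply H; unfold Re, Im; simpl; try lra; rewrite pair_eq_minus; apply Cmod_pair_ge;
  [right; replace (sy - r - sy)%R with (- r)%R by ring
  |right; replace (sy + r - sy)%R with r by ring
  |left; replace (sx - r - sx)%R with (- r)%R by ring
  |left; replace (sx + r - sx)%R with r by ring]; auto.
Qed.

Lemma two_PI_Ci_neq_0 : 2 * PI * Ci <> 0.
Proof.
  intros E. apply (f_equal Im) in E. unfold Im in E; simpl in E. pose proof PI_RGT_0. lra.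
Qed.

Lemma PI_neq_C0 : RtoC PI <> 0.
Proof. intros E. injection E. apply PI_neq0. Qed.

Lemma Cmod_two_PI_Ci : Cmod (2 * PI * Ci) = (2 * PI)%R.
Proof.
  rewrite !Cmod_mult, Cmod_Ci, !Cmod_R, !Rabs_right; try ring; pose proof PI_RGT_0; lra.
Qed.

Lemma in_square (s h : C) (r : R) : (Cmod h < r)%R ->
  (Re s - r < Re (s + h)%C < Re s + r)%R /\ (Im s - r < Im (s + h)%C < Im s + r)%R.
Proof.
  intros Hh. pose proof (re_le_Cmod h). pose proof (im_le_Cmod h).
  apply Rabs_le_between in H, H0. unfold Re, Im in *; simpl. lra.
Qed.

(** Cauchy's formula at s and at s + h is combined with 1/(z-s-h) = 1/(z-s) + h/(z-s)^2 +
    h^2/((z-s-h)(z-s)^2). On the edges the last kernel is at most 2/r^3, the perimeter is 8 r, and 2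
    pi >= 2, which gives 8 M/r^2. The constant depends on f only through M, so it is uniform over
    families. *)
Lemma cauchy_remainder (f : C -> C) (s : C) (r M : R) : (0 < r)%R ->
  on_square (cdiff f) s r -> on_square (fun z => (Cmod (f z) <= M)%R) s r ->
  exists D, forall h : C, (Cmod h <= r / 2)%R ->
    (Cmod (f (s + h)%C - f s - h * D) <= 8 * M / (r * r) * (Cmod h * Cmod h))%R.
Proof.
  intros Hr Hf HM. pose proof PI_RGT_0 as HPI. pose proof PI2_1 as HPI2.
  set (x1 := (Re s - r)%R). set (x2 := (Re s + r)%R).
  set (y1 := (Im s - r)%R). set (y2 := (Im s + r)%R).
  exists (bdry (fun z => f z * (/ (z - s) * / (z - s))) x1 x2 y1 y2 / (2 * PI * Ci)).
  intros h Hh.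
  assert (Hs : (x1 < Re s < x2)%R /\ (y1 < Im s < y2)%R) by (unfold x1, x2, y1, y2; lra).
  assert (Hsh := in_square s h r ltac:(lra)). fold x1 x2 y1 y2 in Hsh.
  assert (Es : s = (Re s, Im s)) by (destruct s; reflexivity).
  assert (Esh : s + h = (Re (s + h), Im (s + h))) by (destruct (s + h); reflexivity).
  assert (C0 := cauchy_formula f (Re s) (Im s) x1 x2 y1 y2 (proj1 Hs) (proj2 Hs) Hf).
  assert (C1 := cauchy_formula f (Re (s + h)) (Im (s + h)) x1 x2 y1 y2 (proj1 Hsh) (proj2 Hsh) Hf).
  rewrite <- Es in C0. rewrite <- Esh in C1.
  set (k := fun z => f z * (/ (z - (s + h)) * (/ (z - s) * / (z - s)))).
  assert (Nz : forall z, (r <= Cmod (z - s))%R -> z <> s /\ z <> s + h /\ (r / 2 <= Cmod (z - (s + h)))%R).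
  { intros z Hz.
    assert (L : (r / 2 <= Cmod (z - (s + h)))%R).
    { pose proof (Cmod_triangle_rev (z - s) h). replace (z - s - h) with (z - (s + h)) in H by ring. lra. }
    repeat split; auto.
    - intros ->. replace (s - s) with (RtoC 0) in Hz by ring. rewrite Cmod_0 in Hz. lra.
    - intros ->. replace (s + h - (s + h)) with (RtoC 0) in L by ring. rewrite Cmod_0 in L. lra. }
  assert (D0 : forall z, z <> s -> cdiff f z -> cdiff (fun z => f z / (z - s)) z).
  { intros z N Hz. apply (cdiff_mult f); auto. now apply cdiff_shift_inv. }
  assert (D2 : forall z, z <> s -> cdiff f z -> cdiff (fun z => f z * (/ (z - s) * / (z - s))) z).
  { intros z N Hz. apply (cdiff_mult f); auto. apply (cdiff_mult (fun z => / (z - s))); now apply cdiff_shift_inv. }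
  assert (D3 : forall z, z <> s -> z <> s + h -> cdiff f z -> cdiff k z).
  { intros z N N' Hz. apply (cdiff_mult f); auto.
    apply (cdiff_mult (fun z => / (z - (s + h)))); [now apply cdiff_shift_inv|].
    apply (cdiff_mult (fun z => / (z - s))); now apply cdiff_shift_inv. }
  assert (Ed : forall g : C -> C, (forall z, z <> s -> z <> s + h -> cdiff f z -> cdiff g z) ->
     ccont_edges g x1 x2 y1 y2).
  { intros g Hg. apply (square_edges (ccont g) s r Hr). intros x y X Y L.
    apply cdiff_ccont, Hg; try apply (Nz _ L). now apply Hf. }
  assert (E : f (s + h) - f s - h * (bdry (fun z => f z * (/ (z - s) * / (z - s))) x1 x2 y1 y2 / (2 * PI * Ci))
     = h * h * bdry k x1 x2 y1 y2 / (2 * PI * Ci)).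
  { pose proof two_PI_Ci_neq_0 as N2.
    assert (X : bdry (fun z => f z / (z - (s + h))) x1 x2 y1 y2 =
       bdry (fun z => f z / (z - s)) x1 x2 y1 y2 +
       (h * bdry (fun z => f z * (/ (z - s) * / (z - s))) x1 x2 y1 y2 + h * h * bdry k x1 x2 y1 y2)).
    { rewrite <- bdry_scal by (try lra; apply Ed; intros; apply D2; auto).
      rewrite <- bdry_scal by (try lra; apply Ed; intros; apply D3; auto).
      rewrite <- bdry_plus; try lra;
        [|apply Ed; intros; apply (cdiff_mult (fun _ => h)); [apply cdiff_const|now apply D2]
         |apply Ed; intros; apply (cdiff_mult (fun _ => h * h)); [apply cdiff_const|now apply D3]].
      rewrite <- bdry_plus; try lra;
        [|apply Ed; intros; now apply D0
         |apply Ed; intros; apply (cdiff_plus (fun z => h * (f z * (/ (z - s) * / (z - s)))));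
          [apply (cdiff_mult (fun _ => h)); [apply cdiff_const|now apply D2]
          |apply (cdiff_mult (fun _ => h * h)); [apply cdiff_const|now apply D3]]].
      apply bdry_ext_edges; try lra;
      apply (square_edges (fun z => f z / (z - (s + h)) = f z / (z - s) +
        (h * (f z * (/ (z - s) * / (z - s))) + h * h * k z)) s r Hr);
      intros x y _ _ L; destruct (Nz _ L) as [N0 [N1 _]]; unfold k; field;
      split; apply Cminus_eq_contra; auto. }
    rewrite C0, C1 in X.
    apply (Cmult_reg_l (2 * PI * Ci)); auto.
    transitivity (2 * PI * Ci * f (s + h) - 2 * PI * Ci * f s -
      h * bdry (fun z => f z * (/ (z - s) * / (z - s))) x1 x2 y1 y2); [field; auto using PI_neq_C0, Ci_nz|].
    rewrite X. field; auto using PI_neq_C0, Ci_nz. }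
  rewrite E, Cmod_div, !Cmod_mult by apply two_PI_Ci_neq_0.
  rewrite <- !Cmod_mult, Cmod_two_PI_Ci, !Cmod_mult.
  assert (M0 : (0 <= M)%R).
  { apply Rle_trans with (Cmod (f (Re s, Im s))); [apply Cmod_ge_0|apply HM; lra]. }
  assert (r3 : (0 < r * r * r)%R) by (repeat apply Rmult_lt_0_compat; auto).
  assert (B : (Cmod (bdry k x1 x2 y1 y2) <= M * (2 / (r * r * r)) * (2 * (x2 - x1) + 2 * (y2 - y1)))%R).
  { assert (Bk : on_square (fun z => (r <= Cmod (z - s))%R -> (Cmod (k z) <= M * (2 / (r * r * r)))%R) s r).
    { intros x y X Y L. destruct (Nz _ L) as [N0 [N1 L2]]. unfold k. rewrite !Cmod_mult.
      apply Rmult_le_compat; try apply Cmod_ge_0.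
      { rewrite <- !Cmod_mult. apply Cmod_ge_0. }
      { now apply HM. }
      rewrite !Cmod_inv by (apply Cminus_eq_contra; auto).
      replace (2 / (r * r * r))%R with (/ (r / 2) * (/ r * / r))%R by (field; lra).
      assert (0 < / r)%R by (now apply Rinv_0_lt_compat).
      assert (/ Cmod ((x, y) - s) <= / r)%R by (apply Rinv_le_contravar; lra).
      assert (0 < / Cmod ((x, y) - s))%R by (apply Rinv_0_lt_compat; lra).
      apply Rmult_le_compat.
      - apply Rlt_le, Rinv_0_lt_compat; lra.
      - nra.
      - apply Rinv_le_contravar; lra.
      - apply Rmult_le_compat; lra. }
    apply square_edges in Bk; auto. destruct Bk as [B1 B2].
    apply bdry_bound; auto; unfold x1, x2, y1, y2; lra. }
  replace (2 * (x2 - x1) + 2 * (y2 - y1))%R with (8 * r)%R in B by (unfold x1, x2, y1, y2; ring).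
  replace (M * (2 / (r * r * r)) * (8 * r))%R with (16 * M / (r * r))%R in B by (field; lra).
  pose proof (Cmod_ge_0 h) as Ph. set (t := Cmod h) in *.
  set (b := Cmod (bdry k x1 x2 y1 y2)) in *.
  assert (0 <= b)%R by apply Cmod_ge_0.
  assert (Q : (0 <= 16 * M / (r * r))%R) by lra.
  apply Rle_trans with (t * t * (16 * M / (r * r)) / 2)%R.
  - set (Y := (16 * M / (r * r))%R) in *. clearbody Y.
    unfold Rdiv. rewrite !(Rmult_assoc (t * t)). apply Rmult_le_compat_l; [nra|].
    apply Rmult_le_compat; auto.
    + apply Rlt_le, Rinv_0_lt_compat; lra.
    + apply Rinv_le_contravar; lra.
  - right. field. lra.
Qed.

(** * Limits of complex sequences, and of sequences of holomorphic functions *)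

Definition is_Clim (u : nat -> C) (l : C) : Prop :=
  forall eps, (0 < eps)%R -> exists N : nat, forall n, (N <= n)%nat -> (Cmod (u n - l) < eps)%R.

Lemma is_Clim_le u l (M : R) : is_Clim u l -> (forall n, (Cmod (u n) <= M)%R) -> (Cmod l <= M)%R.
Proof.
  intros H B. apply le_epsilon. intros e He. destruct (H e He) as [N HN].
  specialize (HN N (le_n _)). specialize (B N).
  pose proof (Cmod_triangle_rev l (u N)). rewrite Cmod_minus_sym in H0. lra.
Qed.

Lemma is_Clim_unique u l l' : is_Clim u l -> is_Clim u l' -> l = l'.
Proof.
  intros H H'. apply Ceq_minus, Cmod_eq_0, Rle_antisym; [|apply Cmod_ge_0].
  apply le_epsilon. intros e He. rewrite Rplus_0_l.
  destruct (H (e/2)%R ltac:(lra)) as [N HN]. destruct (H' (e/2)%R ltac:(lra)) as [N' HN'].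
  specialize (HN (N + N')%nat ltac:(lia)). specialize (HN' (N + N')%nat ltac:(lia)).
  replace (l - l') with ((u (N + N')%nat - l') - (u (N + N')%nat - l)) by ring.
  eapply Rle_trans; [apply Cmod_triangle|]. rewrite Cmod_opp. lra.
Qed.

Lemma is_Clim_ext u v l : (forall n, u n = v n) -> is_Clim u l -> is_Clim v l.
Proof. intros E H e He. destruct (H e He) as [N HN]. exists N. intros n Hn. rewrite <- E. auto. Qed.

Lemma is_Clim_re u l : is_Clim u l -> is_lim_seq (fun n => Re (u n)) (Re l).
Proof.
  intros H. apply is_lim_seq_spec. intros e. destruct (H e (cond_pos e)) as [N HN].
  exists N. intros n Hn. eapply Rle_lt_trans; [|apply (HN n Hn)].
  replace (Re (u n) - Re l)%R with (Re (u n - l)) by (unfold Re; simpl; ring). apply re_le_Cmod.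
Qed.

Lemma is_Clim_im u l : is_Clim u l -> is_lim_seq (fun n => Im (u n)) (Im l).
Proof.
  intros H. apply is_lim_seq_spec. intros e. destruct (H e (cond_pos e)) as [N HN].
  exists N. intros n Hn. eapply Rle_lt_trans; [|apply (HN n Hn)].
  replace (Im (u n) - Im l)%R with (Im (u n - l)) by (unfold Im; simpl; ring). apply im_le_Cmod.
Qed.

Lemma is_Clim_pair u l : is_lim_seq (fun n => Re (u n)) (Re l) ->
  is_lim_seq (fun n => Im (u n)) (Im l) -> is_Clim u l.
Proof.
  intros Hr Hi e He. apply is_lim_seq_spec in Hr, Hi.
  assert (He2 : (0 < e / 2)%R) by lra.
  destruct (Hr (mkposreal _ He2)) as [N HN]. destruct (Hi (mkposreal _ He2)) as [N' HN'].
  exists (N + N')%nat. intros n Hn. specialize (HN n ltac:(lia)). specialize (HN' n ltac:(lia)).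
  simpl in HN, HN'. eapply Rle_lt_trans; [apply Cmod_le_Rabs|].
  replace (Re (u n - l)) with (Re (u n) - Re l)%R by (unfold Re; simpl; ring).
  replace (Im (u n - l)) with (Im (u n) - Im l)%R by (unfold Im; simpl; ring). lra.
Qed.

Lemma is_Clim_cauchy u : (forall eps, (0 < eps)%R -> exists N, forall n m, (N <= n)%nat -> (N <= m)%nat ->
    (Cmod (u n - u m) < eps)%R) -> exists l, is_Clim u l.
Proof.
  intros H.
  assert (Hr : ex_finite_lim_seq (fun n => Re (u n))).
  { apply ex_lim_seq_cauchy_corr. intros e. destruct (H e (cond_pos e)) as [N HN].
    exists N. intros n m Hn Hm. eapply Rle_lt_trans; [|apply (HN n m Hn Hm)].
    replace (Re (u n) - Re (u m))%R with (Re (u n - u m)) by (unfold Re; simpl; ring). apply re_le_Cmod. }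
  assert (Hi : ex_finite_lim_seq (fun n => Im (u n))).
  { apply ex_lim_seq_cauchy_corr. intros e. destruct (H e (cond_pos e)) as [N HN].
    exists N. intros n m Hn Hm. eapply Rle_lt_trans; [|apply (HN n m Hn Hm)].
    replace (Im (u n) - Im (u m))%R with (Im (u n - u m)) by (unfold Im; simpl; ring). apply im_le_Cmod. }
  destruct Hr as [x Hx]. destruct Hi as [y Hy]. exists (x, y). now apply is_Clim_pair.
Qed.

(* The Cauchy estimate of the second-order remainder is uniform in [n], so that
   boundedness and pointwise convergence already make the derivatives converge. *)
Theorem cdiff_bounded_limit (f : nat -> C -> C) (g : C -> C) (s : C) (r M : R) : (0 < r)%R ->
  (forall n, on_square (cdiff (f n)) s r) ->
  (forall n, on_square (fun z => (Cmod (f n z) <= M)%R) s r) ->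
  on_square (fun z => is_Clim (fun n => f n z) (g z)) s r -> cdiff g s.
Proof.
  intros Hr Hd HM Hl.
  set (K := (8 * M / (r * r))%R).
  assert (M0 : (0 <= M)%R).
  { apply Rle_trans with (Cmod (f 0%nat (Re s, Im s))); [apply Cmod_ge_0|apply (HM 0%nat); lra]. }
  assert (HK : (0 <= K)%R) by (apply Rdiv_le_0_compat; nra).
  assert (HD : forall n, exists D, forall h : C, (Cmod h <= r / 2)%R ->
    (Cmod (f n (s + h)%C - f n s - h * D) <= K * (Cmod h * Cmod h))%R).
  { intros n. now apply cauchy_remainder. }
  set (D := fun n => epsilon (inhabits (RtoC 0)) (fun D => forall h : C, (Cmod h <= r / 2)%R ->
    (Cmod (f n (s + h)%C - f n s - h * D) <= K * (Cmod h * Cmod h))%R)).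
  assert (HD' : forall n (h : C), (Cmod h <= r / 2)%R ->
    (Cmod (f n (s + h)%C - f n s - h * D n) <= K * (Cmod h * Cmod h))%R).
  { intros n. exact (epsilon_spec _ _ (HD n)). }
  clearbody D. clear HD.
  assert (Hl' : forall h : C, (Cmod h <= r / 2)%R -> is_Clim (fun n => f n (s + h)) (g (s + h))).
  { intros h Hh. pose proof (in_square s h r ltac:(lra)).
    specialize (Hl (Re (s + h)) (Im (s + h)) ltac:(lra) ltac:(lra)).
    replace ((Re (s + h), Im (s + h)) : C) with (s + h) in Hl by (destruct (s + h); reflexivity).
    exact Hl. }
  assert (Hls : is_Clim (fun n => f n s) (g s)).
  { specialize (Hl' 0). rewrite Cplus_0_r, Cmod_0 in Hl'. apply Hl'. lra. }
  destruct (is_Clim_cauchy D) as [D0 HD0].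
  { intros e He.
    (* Comparing the expansions at s and s + t shows that t (D n - D m) is at most 2 K t^2 plus four
       small differences of values; with this t the first part is at most e t / 2. *)
    set (t := Rmin (r / 2) (e / (4 * (K + 1)))).
    assert (Ht : (0 < t)%R) by (apply Rmin_pos; [lra|apply Rdiv_lt_0_compat; lra]).
    assert (t1 : (t <= r / 2)%R) by apply Rmin_l.
    assert (t2 : (t * (K + 1) <= e / 4)%R).
    { apply Rle_trans with (e / (4 * (K + 1)) * (K + 1))%R.
      - apply Rmult_le_compat_r; [lra|apply Rmin_r].
      - right; field; lra. }
    clearbody t.
    assert (Et : Cmod (RtoC t) = t) by (rewrite Cmod_R, Rabs_right; lra).
    destruct (Hl' t ltac:(lra) (e * t / 16)%R ltac:(nra)) as [N1 HN1].
    destruct (Hls (e * t / 16)%R ltac:(nra)) as [N2 HN2].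
    exists (N1 + N2)%nat. intros n m Hn Hm.
    assert (a1 := HN1 n ltac:(lia)). assert (a2 := HN1 m ltac:(lia)).
    assert (a3 := HN2 n ltac:(lia)). assert (a4 := HN2 m ltac:(lia)).
    assert (b1 := HD' n t ltac:(lra)). assert (b2 := HD' m t ltac:(lra)). rewrite Et in b1, b2.
    assert (X : (Cmod (t * (D n - D m)) < e * t)%R).
    { replace (t * (D n - D m)) with
       ((f m (s + t) - f m s - t * D m) + - (f n (s + t) - f n s - t * D n)
        + ((f n (s + t) - g (s + t)) + - (f m (s + t) - g (s + t)) + (- (f n s - g s) + (f m s - g s)))) by ring.
      eapply Rle_lt_trans; [apply Cmod_triangle|].
      eapply Rle_lt_trans; [apply Rplus_le_compat; apply Cmod_triangle|].
      eapply Rle_lt_trans; [apply Rplus_le_compat_l, Rplus_le_compat; apply Cmod_triangle|].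
      rewrite !Cmod_opp. nra. }
    rewrite Cmod_mult, Et in X. nra. }
  exists D0. intros e He.
  exists (Rmin (r / 2) (e / (K + 1)))%R. split.
  { apply Rmin_pos; [lra|apply Rdiv_lt_0_compat; lra]. }
  intros h Hh.
  assert (L1 := Rlt_le_trans _ _ _ Hh (Rmin_l _ _)).
  assert (L2 := Rlt_le_trans _ _ _ Hh (Rmin_r _ _)).
  apply (Rmult_lt_compat_r (K + 1)) in L2; [|lra].
  replace (e / (K + 1) * (K + 1))%R with e in L2 by (field; lra).
  apply Rle_trans with (K * (Cmod h * Cmod h))%R; [|pose proof (Cmod_ge_0 h); nra].
  apply (is_Clim_le (fun n => f n (s + h) - f n s - D n * h)).
  - intros e' He'. pose proof (Cmod_ge_0 h).
    destruct (Hl' h ltac:(lra) (e' / 3)%R ltac:(lra)) as [N1 HN1].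
    destruct (Hls (e' / 3)%R ltac:(lra)) as [N2 HN2].
    destruct (HD0 (e' / (3 * (1 + Cmod h)))%R ltac:(apply Rdiv_lt_0_compat; lra)) as [N3 HN3].
    exists (N1 + N2 + N3)%nat. intros n Hn.
    specialize (HN1 n ltac:(lia)). specialize (HN2 n ltac:(lia)). specialize (HN3 n ltac:(lia)).
    apply (Rmult_lt_compat_r (1 + Cmod h)) in HN3; [|lra].
    replace (e' / (3 * (1 + Cmod h)) * (1 + Cmod h))%R with (e' / 3)%R in HN3 by (field; lra).
    replace (_ - _) with ((f n (s + h) - g (s + h)) + - (f n s - g s) + - (h * (D n - D0))) by ring.
    eapply Rle_lt_trans; [apply Cmod_triangle|].
    eapply Rle_lt_trans; [apply Rplus_le_compat_r, Cmod_triangle|].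
    rewrite !Cmod_opp, Cmod_mult. pose proof (Cmod_ge_0 (D n - D0)). nra.
  - intros n. rewrite (Cmult_comm (D n)). apply HD'. lra.
Qed.

Lemma ccont_on_bounded g a b : (a <= b)%R -> ccont_on g a b ->
  exists M, forall t, (a <= t <= b)%R -> (Cmod (g t) <= M)%R.
Proof.
  intros Hab Hc.
  assert (B : forall k : R -> R, (forall t, (a <= t <= b)%R -> continuous k t) ->
     exists M, forall t, (a <= t <= b)%R -> (Rabs (k t) <= M)%R).
  { intros k Hk. destruct (continuity_ab_maj (fun t => Rabs (k t)) a b Hab) as [m [Hm _]].
    - intros t Ht. apply (continuity_pt_comp k Rabs).
      + apply continuity_pt_filterlim. now apply Hk.
      + apply Rcontinuity_abs.
    - exists (Rabs (k m)). exact Hm. }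
  destruct (B (fun t => Re (g t))) as [M1 H1].
  { intros t Ht. apply Ccontinuous_re, Hc. rewrite Rmin_left, Rmax_right; auto. }
  destruct (B (fun t => Im (g t))) as [M2 H2].
  { intros t Ht. apply Ccontinuous_im, Hc. rewrite Rmin_left, Rmax_right; auto. }
  exists (M1 + M2)%R. intros t Ht. eapply Rle_trans; [apply Cmod_le_Rabs|].
  specialize (H1 t Ht). specialize (H2 t Ht). lra.
Qed.

Lemma square_edges_bounded (f : C -> C) (s : C) (r : R) : (0 < r)%R ->
  ccont_edges f (Re s - r) (Re s + r) (Im s - r) (Im s + r) -> exists M,
  (forall x, (Re s - r <= x <= Re s + r)%R ->
     (Cmod (f (x, (Im s - r)%R)) <= M)%R /\ (Cmod (f (x, (Im s + r)%R)) <= M)%R) /\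
  (forall y, (Im s - r <= y <= Im s + r)%R ->
     (Cmod (f ((Re s - r)%R, y)) <= M)%R /\ (Cmod (f ((Re s + r)%R, y)) <= M)%R).
Proof.
  intros Hr [H1 H2].
  destruct (ccont_on_bounded (fun x => f (x, (Im s - r)%R)) (Re s - r) (Re s + r)) as [M1 B1];
    [lra|apply ccont_on_hline; [lra|intros; now apply H1]|].
  destruct (ccont_on_bounded (fun x => f (x, (Im s + r)%R)) (Re s - r) (Re s + r)) as [M2 B2];
    [lra|apply ccont_on_hline; [lra|intros; now apply H1]|].
  destruct (ccont_on_bounded (fun y => f ((Re s - r)%R, y)) (Im s - r) (Im s + r)) as [M3 B3];
    [lra|apply ccont_on_vline; [lra|intros; now apply H2]|].
  destruct (ccont_on_bounded (fun y => f ((Re s + r)%R, y)) (Im s - r) (Im s + r)) as [M4 B4];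
    [lra|apply ccont_on_vline; [lra|intros; now apply H2]|].
  exists (Rmax (Rmax M1 M2) (Rmax M3 M4)).
  split; intros t Ht; split.
  - eapply Rle_trans; [now apply B1|]. eapply Rle_trans; [apply Rmax_l|apply Rmax_l].
  - eapply Rle_trans; [now apply B2|]. eapply Rle_trans; [apply Rmax_r|apply Rmax_l].
  - eapply Rle_trans; [now apply B3|]. eapply Rle_trans; [apply Rmax_l|apply Rmax_r].
  - eapply Rle_trans; [now apply B4|]. eapply Rle_trans; [apply Rmax_r|apply Rmax_r].
Qed.

(* Cauchy's formula for E(z) / (z - a)^n at z0 gives |E(z0)| <= K (|z0 - a| / r)^n for all n. *)
Theorem identity_square (E : C -> C) (a : C) (r d : R) (z0 : C) : (0 < r)%R -> (0 < d)%R ->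
  on_square (cdiff E) a r -> (forall z, (Cmod (z - a) < d)%R -> E z = 0) ->
  (Cmod (z0 - a) < r)%R -> E z0 = 0.
Proof.
  intros Hr Hd HE H0 Hz0.
  destruct (Rlt_dec (Cmod (z0 - a)) d) as [L|L]; [now apply H0|].
  pose proof PI_RGT_0 as HPI.
  assert (P0 : (0 < Cmod (z0 - a))%R) by lra.
  assert (Nz : z0 - a <> 0) by now apply Cmod_gt_0.
  set (h := z0 - a) in *.
  assert (Ez0 : z0 = a + h) by (unfold h; ring).
  pose proof (in_square a h r Hz0) as Hin. rewrite <- Ez0 in Hin.
  set (x1 := (Re a - r)%R) in *. set (x2 := (Re a + r)%R) in *.
  set (y1 := (Im a - r)%R) in *. set (y2 := (Im a + r)%R) in *.
  assert (Ep : z0 = (Re z0, Im z0)) by (destruct z0; reflexivity).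
  assert (Na : forall z, (r <= Cmod (z - a))%R -> z <> a /\ z <> z0).
  { intros z Hz; split; intros ->.
    - replace (a - a) with (RtoC 0) in Hz by ring. rewrite Cmod_0 in Hz. lra.
    - fold h in Hz. lra. }
  set (k := fun z => E z / (z - z0)).
  assert (Ek : ccont_edges k x1 x2 y1 y2).
  { apply (square_edges (ccont k) a r Hr). intros x y X Y Z. apply cdiff_ccont.
    apply (cdiff_mult E); [now apply HE|]. apply cdiff_shift_inv. now apply Na. }
  destruct (square_edges_bounded k a r Hr Ek) as [M [B1 B2]]. fold x1 x2 y1 y2 in B1, B2.
  assert (M0 : (0 <= M)%R).
  { eapply Rle_trans; [apply Cmod_ge_0|apply (B1 (Re a)); unfold x1, x2; lra]. }
  set (q := (Cmod h / r)%R).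
  assert (Hq : (0 <= q < 1)%R).
  { unfold q. split; [apply Rdiv_le_0_compat; lra|].
    apply (Rmult_lt_reg_r r); auto. unfold Rdiv. rewrite Rmult_assoc, Rinv_l; lra. }
  assert (K : forall n : nat, (Cmod (E z0) <= M * (8 * r) / (2 * PI) * q ^ n)%R).
  { intros n.
    set (g := fun z => E z * / (z - a) ^ n).
    assert (Dg : on_rect (cdiff g) x1 x2 y1 y2).
    { intros x y X Y. destruct (Ceq_dec (x, y) a) as [Ea|Ea].
      - apply (cdiff_ext_loc (fun _ => 0)); [|apply cdiff_const].
        exists d; split; auto. intros w Hw. unfold g. rewrite H0; [ring|].
        rewrite Ea. replace (a + w - a) with w by ring. auto.
      - apply (cdiff_mult E); [now apply HE|]. apply (cdiff_inv (fun z => (z - a) ^ n)).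
        + apply Cpow_nz. now apply Cminus_eq_contra.
        + apply (cdiff_pow (fun z => z - a)). apply cdiff_minus; [apply cdiff_id|apply cdiff_const]. }
    assert (Cf := cauchy_formula g (Re z0) (Im z0) x1 x2 y1 y2 (proj1 Hin) (proj2 Hin) Dg).
    rewrite <- Ep in Cf.
    assert (Bg : (Cmod (bdry (fun z => g z / (z - z0))%C x1 x2 y1 y2) <=
        M * / r ^ n * (2 * (x2 - x1) + 2 * (y2 - y1)))%R).
    { assert (rn : (0 < r ^ n)%R) by now apply pow_lt.
      assert (Bz : forall z, (r <= Cmod (z - a))%R -> (Cmod (k z) <= M)%R ->
         (Cmod (g z / (z - z0)) <= M * / r ^ n)%R).
      { intros z Hz Hk. destruct (Na z Hz) as [N1 N2].
        replace (g z / (z - z0)) with (k z * / (z - a) ^ n).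
        2:{ unfold g, k. field. split; [apply Cpow_nz|]; now apply Cminus_eq_contra. }
        rewrite Cmod_mult, Cmod_inv, Cmod_pow by (apply Cpow_nz; now apply Cminus_eq_contra).
        apply Rmult_le_compat; auto; try apply Cmod_ge_0.
        - apply Rlt_le, Rinv_0_lt_compat, pow_lt. lra.
        - apply Rinv_le_contravar; auto. apply pow_incr. lra. }
      assert (Hedge := square_edges (fun z => (r <= Cmod (z - a))%R) a r Hr ltac:(intros ? ? ? ? ?; auto)).
      destruct Hedge as [e1 e2].
      apply bdry_bound; try (unfold x1, x2, y1, y2; lra).
      - apply (square_edges (ccont (fun z => g z / (z - z0))) a r Hr). intros x y X Y Z.
        apply cdiff_ccont. apply (cdiff_mult g); [now apply Dg|]. apply cdiff_shift_inv. now apply Na.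
      - intros x X. split; apply Bz; first [now apply e1|now apply B1].
      - intros y Y. split; apply Bz; first [now apply e2|now apply B2]. }
    rewrite Cf, Cmod_mult, Cmod_two_PI_Ci in Bg. unfold g in Bg. fold h in Bg.
    rewrite Cmod_mult, Cmod_inv, Cmod_pow in Bg by now apply Cpow_nz.
    replace (2 * (x2 - x1) + 2 * (y2 - y1))%R with (8 * r)%R in Bg by (unfold x1, x2, y1, y2; ring).
    assert (hn : (0 < Cmod h ^ n)%R) by now apply pow_lt.
    assert (rn : (0 < r ^ n)%R) by now apply pow_lt.
    replace (M * (8 * r) / (2 * PI) * q ^ n)%R with (M * / r ^ n * (8 * r) * (Cmod h ^ n / (2 * PI)))%R.
    2:{ unfold q, Rdiv. rewrite Rpow_mult_distr, pow_inv. field. split; lra. }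
    apply (Rmult_le_compat_r (Cmod h ^ n / (2 * PI))) in Bg.
    - replace (2 * PI * (Cmod (E z0) * / Cmod h ^ n) * (Cmod h ^ n / (2 * PI)))%R with (Cmod (E z0)) in Bg
        by (field; lra). exact Bg.
    - apply Rdiv_le_0_compat; lra. }
  apply Cmod_eq_0, Rle_antisym; [|apply Cmod_ge_0].
  assert (Lq : is_lim_seq (fun n => M * (8 * r) / (2 * PI) * q ^ n)%R (M * (8 * r) / (2 * PI) * 0)%R).
  { apply (is_lim_seq_scal_l _ _ 0). apply is_lim_seq_geom. rewrite Rabs_right; lra. }
  rewrite Rmult_0_r in Lq.
  exact (is_lim_seq_le _ _ (Cmod (E z0)) 0 K (is_lim_seq_const _) Lq).
Qed.

(** * Primitives and integrals depending on a complex variable *)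

Lemma ccont_on_swap g a b : ccont_on g a b -> ccont_on g b a.
Proof. intros H t Ht. apply H. now rewrite Rmin_comm, Rmax_comm. Qed.

Lemma CInt_bound_fun f (g : R -> R) a b lg : (a <= b)%R -> ccont_on f a b ->
  (forall t, (a <= t <= b)%R -> (Cmod (f t) <= g t)%R) -> is_RInt g a b lg ->
  (Cmod (CInt f a b) <= lg)%R.
Proof.
  intros Hab Hc HM Hg.
  rewrite <- norm_C_R. apply (norm_RInt_le (V := C_R_NormedModule) f g a b); auto.
  - intros t Ht. rewrite norm_C_R. now apply HM.
  - now apply is_CInt_cont.
Qed.

Lemma CInt_bound_abs f a b (M : R) : ccont_on f a b ->
  (forall t, (Rmin a b <= t <= Rmax a b)%R -> (Cmod (f t) <= M)%R) ->
  (Cmod (CInt f a b) <= M * Rabs (b - a))%R.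
Proof.
  intros Hc HM. destruct (Rle_dec a b) as [L|L].
  - rewrite Rabs_right by lra. apply CInt_bound; auto. intros t Ht. apply HM.
    rewrite Rmin_left, Rmax_right; auto.
  - rewrite CInt_swap by (now apply ccont_on_swap). rewrite Cmod_opp, Rabs_left by lra.
    replace (- (b - a))%R with (a - b)%R by ring. apply CInt_bound; [lra|now apply ccont_on_swap|].
    intros t Ht. apply HM. rewrite Rmin_right, Rmax_left; lra.
Qed.

Lemma CInt_const c a b : CInt (fun _ => c) a b = (b - a)%R * c.
Proof.
  apply is_CInt_unique. unfold is_CInt.
  replace ((b - a)%R * c) with (scal (V := C_R_NormedModule) (b - a)%R c).
  - apply (is_RInt_const (V := C_R_NormedModule)).
  - rewrite scal_R_Cmult. reflexivity.
Qed.

(** Reversing an interval changes only the sign. All orders of the end points are wanted because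
    [strip_primitive] integrates towards arbitrary points. *)
Lemma goursat_oriented f x1 x2 y1 y2 :
  on_rect (cdiff f) (Rmin x1 x2) (Rmax x1 x2) (Rmin y1 y2) (Rmax y1 y2) ->
  bdry f x1 x2 y1 y2 = 0.
Proof.
  intros Hf.
  assert (Hh : forall y, (Rmin y1 y2 <= y <= Rmax y1 y2)%R -> ccont_on (fun x => f (x, y)) x1 x2).
  { intros y Hy t Ht. now apply Ccontinuous_hline, cdiff_ccont, Hf. }
  assert (Hv : forall x, (Rmin x1 x2 <= x <= Rmax x1 x2)%R -> ccont_on (fun y => f (x, y)) y1 y2).
  { intros x Hx t Ht. now apply Ccontinuous_vline, cdiff_ccont, Hf. }
  pose proof (Rmin_l x1 x2). pose proof (Rmin_r x1 x2). pose proof (Rmax_l x1 x2). pose proof (Rmax_r x1 x2).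
  pose proof (Rmin_l y1 y2). pose proof (Rmin_r y1 y2). pose proof (Rmax_l y1 y2). pose proof (Rmax_r y1 y2).
  assert (Ex : bdry f x2 x1 y1 y2 = - bdry f x1 x2 y1 y2).
  { unfold bdry. rewrite (CInt_swap (fun x => f (x, y1)) x1 x2), (CInt_swap (fun x => f (x, y2)) x1 x2)
      by (apply Hh; lra). ring. }
  assert (Ey : bdry f x1 x2 y2 y1 = - bdry f x1 x2 y1 y2).
  { unfold bdry. rewrite (CInt_swap (fun y => f (x1, y)) y1 y2), (CInt_swap (fun y => f (x2, y)) y1 y2)
      by (apply Hv; lra). ring. }
  assert (Exy : bdry f x2 x1 y2 y1 = bdry f x1 x2 y1 y2).
  { unfold bdry. rewrite (CInt_swap (fun y => f (x1, y)) y1 y2), (CInt_swap (fun y => f (x2, y)) y1 y2)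
      by (apply Hv; lra).
    rewrite (CInt_swap (fun x => f (x, y1)) x1 x2), (CInt_swap (fun x => f (x, y2)) x1 x2)
      by (apply Hh; lra). ring. }
  destruct (Rle_dec x1 x2) as [X|X]; destruct (Rle_dec y1 y2) as [Y|Y].
  - rewrite Rmin_left, Rmax_right, Rmin_left, Rmax_right in Hf by lra. now apply goursat.
  - rewrite (Rmin_left x1), (Rmax_right x1), (Rmin_right y1), (Rmax_left y1) in Hf by lra.
    rewrite goursat in Ey by (auto; lra). replace (bdry f x1 x2 y1 y2) with (- - bdry f x1 x2 y1 y2) by ring.
    rewrite <- Ey. ring.
  - rewrite (Rmin_right x1), (Rmax_left x1), (Rmin_left y1), (Rmax_right y1) in Hf by lra.
    rewrite goursat in Ex by (auto; lra). replace (bdry f x1 x2 y1 y2) with (- - bdry f x1 x2 y1 y2) by ring.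
    rewrite <- Ex. ring.
  - rewrite (Rmin_right x1), (Rmax_left x1), (Rmin_right y1), (Rmax_left y1) in Hf by lra.
    rewrite goursat in Exy by (auto; lra). now rewrite <- Exy.
Qed.

(** The primitive integrates from a base point first horizontally, then vertically. A half-strip
    contains the rectangle spanned by any two of its points, so Goursat applies to every comparison
    of paths. *)
Lemma strip_primitive (f : C -> C) (a c d : R) : (c < d)%R ->
  (forall w, (a < Re w)%R -> (c < Im w < d)%R -> cdiff f w) ->
  exists Q, forall w, (a < Re w)%R -> (c < Im w < d)%R -> is_cderiv Q w (f w).
Proof.
  intros Hcd Hf.
  set (x0 := (a + 1)%R). set (y0 := ((c + d) / 2)%R).
  assert (Hx0 : (a < x0)%R) by (unfold x0; lra).
  assert (Hy0 : (c < y0 < d)%R) by (unfold y0; lra).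
  clearbody x0 y0.
  assert (Hh : forall y u v, (c < y < d)%R -> (a < u)%R -> (a < v)%R -> ccont_on (fun x => f (x, y)) u v).
  { intros y u v Hy Hu Hv t Ht. apply Ccontinuous_hline, cdiff_ccont, Hf; unfold Re, Im; simpl; auto.
    pose proof (Rmin_Rgt_r u v a (conj Hu Hv)). lra. }
  assert (Hv : forall x u v, (a < x)%R -> (c < u < d)%R -> (c < v < d)%R -> ccont_on (fun y => f (x, y)) u v).
  { intros x u v Hx Hu Hv t Ht. apply Ccontinuous_vline, cdiff_ccont, Hf; unfold Re, Im; simpl; auto.
    pose proof (Rmin_Rgt_r u v c (conj (proj1 Hu) (proj1 Hv))).
    pose proof (Rmax_Rlt u v d). lra. }
  exists (fun w => CInt (fun u => f (u, y0)) x0 (Re w) + Ci * CInt (fun v => f (Re w, v)) y0 (Im w)).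
  intros [x y] Hx Hy. unfold Re, Im in Hx, Hy; simpl in Hx, Hy.
  intros e He.
  destruct (cdiff_ccont f (x, y) (Hf (x, y) Hx Hy) (e / 2)%R ltac:(lra)) as [d1 [Hd1 H1]].
  exists (Rmin (d1 / 2) (Rmin (x - a) (Rmin (y - c) (d - y)))). split.
  { repeat apply Rmin_pos; lra. }
  intros [h1 h2] Hh12.
  assert (L1 := Rlt_le_trans _ _ _ Hh12 (Rmin_l _ _)).
  assert (L2 := Rlt_le_trans _ _ _ Hh12 (Rmin_r _ _)).
  assert (L3 := Rlt_le_trans _ _ _ L2 (Rmin_l _ _)).
  assert (L4 := Rlt_le_trans _ _ _ L2 (Rmin_r _ _)).
  assert (L5 := Rlt_le_trans _ _ _ L4 (Rmin_l _ _)).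
  assert (L6 := Rlt_le_trans _ _ _ L4 (Rmin_r _ _)).
  assert (R1 := re_le_Cmod (h1, h2)). assert (R2 := im_le_Cmod (h1, h2)).
  unfold Re, Im in R1, R2; cbn [fst snd] in R1, R2.
  set (m := Cmod (h1, h2)) in *. clear Hh12 L2 L4.
  assert (B1 := R1). assert (B2 := R2). apply Rabs_le_between in B1, B2.
  replace (((x, y) : C) + (h1, h2)) with ((((x + h1)%R, (y + h2)%R)) : C) by (C_parts; ring).
  unfold Re, Im; cbn [fst snd].
  set (x' := (x + h1)%R) in *. set (y' := (y + h2)%R) in *.
  assert (Hx' : (a < x')%R) by (unfold x'; lra).
  assert (Hy' : (c < y' < d)%R) by (unfold y'; lra).
  assert (G := goursat_oriented f x x' y0 y).
  assert (G0 : bdry f x x' y0 y = 0).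
  { apply G. intros u v U V. apply Hf; unfold Re, Im; simpl.
    - pose proof (Rmin_Rgt_r x x' a (conj Hx Hx')). lra.
    - pose proof (Rmin_Rgt_r y0 y c (conj (proj1 Hy0) (proj1 Hy))). pose proof (Rmax_Rlt y0 y d). lra. }
  unfold bdry in G0.
  (* Goursat between the heights y0 and y replaces the increment by the integral of f along the
     short path from (x, y) to (x', y) to (x', y'). *)
  assert (E : CInt (fun u => f (u, y0)) x0 x' + Ci * CInt (fun v => f (x', v)) y0 y' -
     (CInt (fun u => f (u, y0)) x0 x + Ci * CInt (fun v => f (x, v)) y0 y) =
     CInt (fun u => f (u, y)) x x' + Ci * CInt (fun v => f (x', v)) y y').
  { rewrite <- (CInt_Chasles (fun u => f (u, y0)) x0 x x') by (apply Hh; auto).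
    rewrite <- (CInt_Chasles (fun v => f (x', v)) y0 y y') by (apply Hv; auto).
    transitivity (CInt (fun x1 : R => f (x1, y0)) x x' + Ci * CInt (fun y1 : R => f (x', y1)) y0 y -
       CInt (fun x1 : R => f (x1, y)) x x' - Ci * CInt (fun y1 : R => f (x, y1)) y0 y +
       (CInt (fun u => f (u, y)) x x' + Ci * CInt (fun v => f (x', v)) y y')); [ring|].
    rewrite G0. ring. }
  rewrite E.
  assert (D1 : CInt (fun u => f (u, y)) x x' = CInt (fun u => f (u, y) + - f (x, y)) x x' + h1 * f (x, y)).
  { rewrite CInt_plus; [|apply Hh; auto|intros t _; apply Ccontinuous_const].
    rewrite CInt_const. replace (x' - x)%R with h1 by (unfold x'; ring). ring. }
  assert (D2 : CInt (fun v => f (x', v)) y y' = CInt (fun v => f (x', v) + - f (x, y)) y y' + h2 * f (x, y)).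
  { rewrite CInt_plus; [|apply Hv; auto|intros t _; apply Ccontinuous_const].
    rewrite CInt_const. replace (y' - y)%R with h2 by (unfold y'; ring). ring. }
  rewrite D1, D2.
  replace (CInt (fun u => f (u, y) + - f (x, y)) x x' + h1 * f (x, y) +
    Ci * (CInt (fun v => f (x', v) + - f (x, y)) y y' + h2 * f (x, y)) - f (x, y) * (h1, h2))
   with (CInt (fun u => f (u, y) + - f (x, y)) x x' + Ci * CInt (fun v => f (x', v) + - f (x, y)) y y').
  2:{ replace ((h1, h2) : C) with (h1 + Ci * h2) by (C_parts; ring). ring. }
  eapply Rle_trans; [apply Cmod_triangle|]. rewrite Cmod_mult, Cmod_Ci, Rmult_1_l.
  assert (near : forall u v, (Rabs (u - x) <= m)%R -> (Rabs (v - y) <= m)%R ->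
     (Cmod (f (u, v) + - f (x, y)) <= e / 2)%R).
  { intros u v Hu Hv'. assert (N : (Cmod ((u, v) - (x, y)) < d1)%R).
    { rewrite pair_eq_minus. pose proof (Cmod_pair_le (u - x) (v - y) m Hu Hv'). lra. }
    specialize (H1 _ N). replace (((x, y) : C) + ((u, v) - (x, y))) with ((u, v) : C) in H1 by (C_parts; ring).
    apply Rlt_le. exact H1. }
  assert (I1 : (Cmod (CInt (fun u => f (u, y) + - f (x, y))%C x x') <= e / 2 * Rabs h1)%R).
  { replace h1 with (x' - x)%R by (unfold x'; ring). apply CInt_bound_abs.
    - intros t Ht. apply (Ccontinuous_hline (fun z => f z + - f (x, y))), cdiff_ccont.
      apply cdiff_plus; [|apply cdiff_const]. apply Hf; unfold Re, Im; simpl; auto.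
      pose proof (Rmin_Rgt_r x x' a (conj Hx Hx')). lra.
    - intros t Ht. apply near.
      + apply Rabs_le. unfold Rmin, Rmax in Ht. destruct (Rle_dec x x'); unfold x' in *; lra.
      + rewrite Rminus_eq_0, Rabs_R0. unfold m. apply Cmod_ge_0. }
  assert (I2 : (Cmod (CInt (fun v => f (x', v) + - f (x, y))%C y y') <= e / 2 * Rabs h2)%R).
  { replace h2 with (y' - y)%R by (unfold y'; ring). apply CInt_bound_abs.
    - intros t Ht. apply (Ccontinuous_vline (fun z => f z + - f (x, y))), cdiff_ccont.
      apply cdiff_plus; [|apply cdiff_const]. apply Hf; unfold Re, Im; simpl; auto.
      pose proof (Rmin_Rgt_r y y' c (conj (proj1 Hy) (proj1 Hy'))). pose proof (Rmax_Rlt y y' d). lra.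
    - intros t Ht. apply near.
      + apply Rabs_le. unfold x'. lra.
      + apply Rabs_le. unfold Rmin, Rmax in Ht. destruct (Rle_dec y y'); unfold y' in *; lra. }
  fold m. pose proof (Rabs_pos h1). pose proof (Rabs_pos h2). nra.
Qed.

(** The Cauchy remainder is uniform in t, so D t is a uniform limit of difference quotients
    continuous in t; it is therefore integrable, and the second-order bound can be integrated. *)
Lemma cdiff_CInt (F : C -> R -> C) (a b : R) (s : C) (r M : R) : (a <= b)%R -> (0 < r)%R ->
  (forall t, (a <= t <= b)%R -> on_square (cdiff (fun z => F z t)) s r) ->
  on_square (fun z => ccont_on (F z) a b) s r ->
  (forall t, (a <= t <= b)%R -> on_square (fun z => (Cmod (F z t) <= M)%R) s r) ->
  cdiff (fun z => CInt (F z) a b) s.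
Proof.
  intros Hab Hr Hd Hc HM.
  set (K := (8 * M / (r * r))%R).
  assert (sq : forall P : C -> Prop, on_square P s r -> forall h : C, (Cmod h <= r / 2)%R -> P (s + h)).
  { intros P HP h Hh. pose proof (in_square s h r ltac:(lra)).
    specialize (HP (Re (s + h)) (Im (s + h)) ltac:(lra) ltac:(lra)).
    now replace ((Re (s + h), Im (s + h)) : C) with (s + h) in HP by (destruct (s + h); reflexivity). }
  assert (sq0 : forall P : C -> Prop, on_square P s r -> P s).
  { intros P HP. replace s with (s + 0) by ring. apply sq; auto. rewrite Cmod_0. lra. }
  assert (M0 : (0 <= M)%R).
  { eapply Rle_trans; [apply Cmod_ge_0|apply (sq0 _ (HM a ltac:(lra)))]. }
  assert (HK : (0 <= K)%R) by (apply Rdiv_le_0_compat; nra).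
  set (D := fun t => epsilon (inhabits (RtoC 0)) (fun D => forall h : C, (Cmod h <= r / 2)%R ->
    (Cmod (F (s + h)%C t - F s t - h * D) <= K * (Cmod h * Cmod h))%R)).
  assert (HD : forall t, (a <= t <= b)%R -> forall h : C, (Cmod h <= r / 2)%R ->
    (Cmod (F (s + h)%C t - F s t - h * D t) <= K * (Cmod h * Cmod h))%R).
  { intros t Ht. apply (epsilon_spec _ _ (cauchy_remainder (fun z => F z t) s r M Hr (Hd t Ht) (HM t Ht))). }
  clearbody D.
  (* p clamps t to [a, b]: continuity at the end points is two-sided, whereas D is controlled only
     on the interval. *)
  set (p := fun t => Rmax a (Rmin b t)).
  assert (Hp : forall t, (a <= p t <= b)%R).
  { intros t. unfold p. split; [apply Rmax_l|]. apply Rmax_lub; auto. apply Rmin_l. }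
  assert (Hpid : forall t, (a <= t <= b)%R -> p t = t).
  { intros t Ht. unfold p. rewrite Rmin_right, Rmax_right; lra. }
  assert (Hpc : forall t u, (Rabs (p u - p t) <= Rabs (u - t))%R).
  { intros t u. unfold p, Rmax, Rmin. repeat destruct Rle_dec; unfold Rabs; repeat destruct Rcase_abs; lra. }
  assert (cF : forall z t, (ccont_on (F z) a b) -> Ccontinuous (fun u => F z (p u)) t).
  { intros z t Hz. specialize (Hz (p t)). rewrite Rmin_left, Rmax_right in Hz by auto. specialize (Hz (Hp t)).
    rewrite Ccontinuous_eps in Hz |- *. intros e He. destruct (Hz e He) as [d [Hd0 H0]].
    exists d; split; auto. intros u Hu. apply H0. eapply Rle_lt_trans; [apply Hpc|auto]. }
  assert (cD : forall t, Ccontinuous (fun u => D (p u)) t).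
  { intros t. apply Ccontinuous_eps. intros e He.
    set (q := Rmin (r / 2) (e / (4 * (K + 1)))).
    assert (Hq : (0 < q)%R) by (apply Rmin_pos; [lra|apply Rdiv_lt_0_compat; lra]).
    assert (q1 : (q <= r / 2)%R) by apply Rmin_l.
    assert (q2 : (q * (K + 1) <= e / 4)%R).
    { apply Rle_trans with (e / (4 * (K + 1)) * (K + 1))%R.
      - apply Rmult_le_compat_r; [lra|apply Rmin_r].
      - right; field; lra. }
    clearbody q.
    assert (Eq : Cmod (RtoC q) = q) by (rewrite Cmod_R, Rabs_right; lra).
    assert (c1 := cF (s + q) t (sq _ Hc q ltac:(lra))). assert (c2 := cF s t (sq0 _ Hc)).
    rewrite Ccontinuous_eps in c1, c2.
    destruct (c1 (e * q / 8)%R ltac:(nra)) as [d1 [Hd1 e1]].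
    destruct (c2 (e * q / 8)%R ltac:(nra)) as [d2 [Hd2 e2]].
    exists (Rmin d1 d2); split; [apply Rmin_pos; auto|]. intros u Hu.
    specialize (e1 u (Rlt_le_trans _ _ _ Hu (Rmin_l _ _))).
    specialize (e2 u (Rlt_le_trans _ _ _ Hu (Rmin_r _ _))).
    assert (b1 := HD (p u) (Hp u) q ltac:(lra)). assert (b2 := HD (p t) (Hp t) q ltac:(lra)).
    rewrite Eq in b1, b2.
    assert (X : (Cmod (q * (D (p u) - D (p t))) < e * q)%R).
    { replace (q * (D (p u) - D (p t))) with
       (- (F (s + q) (p u) - F s (p u) - q * D (p u)) + (F (s + q) (p t) - F s (p t) - q * D (p t))
        + ((F (s + q) (p u) - F (s + q) (p t)) + - (F s (p u) - F s (p t)))) by ring.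
      eapply Rle_lt_trans; [apply Cmod_triangle|].
      eapply Rle_lt_trans; [apply Rplus_le_compat; apply Cmod_triangle|].
      rewrite !Cmod_opp. nra. }
    rewrite Cmod_mult, Eq in X. nra. }
  exists (CInt (fun u => D (p u)) a b).
  intros e He.
  exists (Rmin (r / 2) (e / ((K + 1) * (b - a + 1))))%R. split.
  { apply Rmin_pos; [lra|apply Rdiv_lt_0_compat; nra]. }
  intros h Hh.
  assert (L1 := Rlt_le_trans _ _ _ Hh (Rmin_l _ _)).
  assert (L2 := Rlt_le_trans _ _ _ Hh (Rmin_r _ _)).
  apply (Rmult_lt_compat_r ((K + 1) * (b - a + 1))) in L2; [|nra].
  replace (e / ((K + 1) * (b - a + 1)) * ((K + 1) * (b - a + 1)))%R with e in L2 by (field; lra).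
  assert (cs := sq0 _ Hc). assert (csh := sq _ Hc h ltac:(lra)).
  assert (E : CInt (F (s + h)) a b - CInt (F s) a b - CInt (fun u => D (p u)) a b * h =
    CInt (fun t => F (s + h) t + (- (1) * F s t + - h * D (p t))) a b).
  { assert (k1 : ccont_on (fun t => - (1) * F s t) a b).
    { intros t Ht. apply Ccontinuous_mult; [apply Ccontinuous_const|now apply cs]. }
    assert (k2 : ccont_on (fun t => - h * D (p t)) a b).
    { intros t Ht. apply Ccontinuous_mult; [apply Ccontinuous_const|apply cD]. }
    rewrite CInt_plus; auto.
    - rewrite CInt_plus, !CInt_scal; auto; [ring|intros t _; apply cD].
    - intros t Ht. apply (continuous_plus (V := C_R_NormedModule)); [now apply k1|now apply k2]. }
  rewrite E.
  apply Rle_trans with (K * (Cmod h * Cmod h) * (b - a))%R.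
  - apply CInt_bound; auto.
    + intros t Ht. apply (continuous_plus (V := C_R_NormedModule)); [now apply csh|].
      apply (continuous_plus (V := C_R_NormedModule)).
      * apply Ccontinuous_mult; [apply Ccontinuous_const|now apply cs].
      * apply Ccontinuous_mult; [apply Ccontinuous_const|apply cD].
    + intros t Ht. rewrite Hpid by auto.
      replace (F (s + h) t + (- (1) * F s t + - h * D t)) with (F (s + h) t - F s t - h * D t) by ring.
      apply HD; auto. lra.
  - pose proof (Cmod_ge_0 h).
    assert (K * (b - a) <= (K + 1) * (b - a + 1))%R by nra.
    assert (Cmod h * (K * (b - a)) <= e)%R by nra. nra.
Qed.

(** * Complex series and improper integrals *)

Definition Csum (a : nat -> C) (n : nat) : C := sum_n (G := C_AbelianMonoid) a n.

Lemma Csum_S a n : Csum a (S n) = Csum a n + a (S n).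
Proof. unfold Csum. now rewrite sum_Sn. Qed.
Lemma Csum_0 a : Csum a 0 = a 0%nat.
Proof. unfold Csum. now rewrite sum_O. Qed.

Lemma Csum_re a n : Re (Csum a n) = sum_n (fun k => Re (a k)) n.
Proof.
  induction n; [now rewrite Csum_0, sum_O|].
  rewrite Csum_S, sum_Sn, <- IHn. reflexivity.
Qed.
Lemma Csum_im a n : Im (Csum a n) = sum_n (fun k => Im (a k)) n.
Proof.
  induction n; [now rewrite Csum_0, sum_O|].
  rewrite Csum_S, sum_Sn, <- IHn. reflexivity.
Qed.

Lemma sum_n_incr_le_Series (b : nat -> R) n : (forall k, (0 <= b k)%R) -> ex_series b ->
  (sum_n b n <= Series b)%R.
Proof.
  intros Hb H.
  assert (L : is_lim_seq (sum_n b) (Series b)) by exact (Series_correct _ H).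
  apply (is_lim_seq_incr_compare _ _ L).
  intros k. rewrite sum_Sn. unfold plus; simpl. specialize (Hb (S k)). lra.
Qed.

Lemma Csum_bound a (b : nat -> R) n : (forall k, (Cmod (a k) <= b k)%R) -> ex_series b ->
  (Cmod (Csum a n) <= Series b)%R.
Proof.
  intros Hb H. apply Rle_trans with (sum_n b n).
  - clear H. induction n.
    + rewrite Csum_0, sum_O. apply Hb.
    + rewrite Csum_S, sum_Sn. unfold plus; simpl.
      eapply Rle_trans; [apply Cmod_triangle|]. specialize (Hb (S n)). lra.
  - apply sum_n_incr_le_Series; auto. intros k. eapply Rle_trans; [apply Cmod_ge_0|apply Hb].
Qed.

Lemma ex_series_re_dom a (b : nat -> R) : (forall k, (Cmod (a k) <= b k)%R) -> ex_series b ->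
  ex_series (fun k => Re (a k)).
Proof.
  intros Hb H. apply (ex_series_le (V := R_CompleteNormedModule) _ b); auto.
  intros k. eapply Rle_trans; [apply re_le_Cmod|apply Hb].
Qed.
Lemma ex_series_im_dom a (b : nat -> R) : (forall k, (Cmod (a k) <= b k)%R) -> ex_series b ->
  ex_series (fun k => Im (a k)).
Proof.
  intros Hb H. apply (ex_series_le (V := R_CompleteNormedModule) _ b); auto.
  intros k. eapply Rle_trans; [apply im_le_Cmod|apply Hb].
Qed.

(** [CSeries] is a total function; domination by a convergent real series is what ties its value to
    the partial sums. *)
Lemma CSeries_Clim a (b : nat -> R) : (forall k, (Cmod (a k) <= b k)%R) -> ex_series b ->
  is_Clim (Csum a) (CSeries a).
Proof.
  intros Hb H. apply is_Clim_pair.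
  - apply (is_lim_seq_ext (sum_n (fun k => Re (a k)))).
    { intros n; now rewrite Csum_re. }
    exact (Series_correct _ (ex_series_re_dom a b Hb H)).
  - apply (is_lim_seq_ext (sum_n (fun k => Im (a k)))).
    { intros n; now rewrite Csum_im. }
    exact (Series_correct _ (ex_series_im_dom a b Hb H)).
Qed.

Lemma CSeries_bound a (b : nat -> R) : (forall k, (Cmod (a k) <= b k)%R) -> ex_series b ->
  (Cmod (CSeries a) <= Series b)%R.
Proof.
  intros Hb H. apply (is_Clim_le (Csum a)); [eapply CSeries_Clim; eauto|].
  intros n. now apply Csum_bound.
Qed.

Lemma CSeries_ext a b : (forall n, a n = b n) -> CSeries a = CSeries b.
Proof.
  intros H. unfold CSeries.
  rewrite (Series_ext _ (fun n => Re (b n))), (Series_ext (fun n => Im (a n)) (fun n => Im (b n)));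
  auto; intros n; now rewrite H.
Qed.

Lemma is_Clim_scal c u l : is_Clim u l -> is_Clim (fun n => c * u n) (c * l).
Proof.
  intros H e He. pose proof (Cmod_ge_0 c).
  destruct (H (e / (1 + Cmod c))%R ltac:(apply Rdiv_lt_0_compat; lra)) as [N HN].
  exists N. intros n Hn. specialize (HN n Hn).
  replace (c * u n - c * l) with (c * (u n - l)) by ring. rewrite Cmod_mult.
  apply (Rmult_lt_compat_r (1 + Cmod c)) in HN; [|lra].
  replace (e / (1 + Cmod c) * (1 + Cmod c))%R with e in HN by (field; lra).
  pose proof (Cmod_ge_0 (u n - l)). nra.
Qed.

Lemma is_Clim_plus u v l m : is_Clim u l -> is_Clim v m -> is_Clim (fun n => u n + v n) (l + m).
Proof.
  intros H H' e He.
  destruct (H (e/2)%R ltac:(lra)) as [N HN]. destruct (H' (e/2)%R ltac:(lra)) as [N' HN'].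
  exists (N + N')%nat. intros n Hn. specialize (HN n ltac:(lia)). specialize (HN' n ltac:(lia)).
  replace (u n + v n - (l + m)) with ((u n - l) + (v n - m)) by ring.
  eapply Rle_lt_trans; [apply Cmod_triangle|]. lra.
Qed.

Lemma is_Clim_const c : is_Clim (fun _ => c) c.
Proof.
  intros e He. exists 0%nat. intros n _. replace (c - c) with (RtoC 0) by ring. now rewrite Cmod_0.
Qed.

Lemma is_Clim_shift u l k : is_Clim (fun n => u (n + k)%nat) l -> is_Clim u l.
Proof.
  intros H e He. destruct (H e He) as [N HN]. exists (N + k)%nat. intros n Hn.
  specialize (HN (n - k)%nat ltac:(lia)). now replace (n - k + k)%nat with n in HN by lia.
Qed.

Lemma is_Clim_shift_inv u l k : is_Clim u l -> is_Clim (fun n => u (n + k)%nat) l.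
Proof. intros H e He. destruct (H e He) as [N HN]. exists N. intros n Hn. apply HN. lia. Qed.

Lemma is_Clim_mult u v l m : is_Clim u l -> is_Clim v m -> is_Clim (fun n => u n * v n) (l * m).
Proof.
  intros H H'.
  apply is_Clim_pair.
  - apply is_Clim_re in H as Hr, H' as Hr'. apply is_Clim_im in H, H'.
    apply (is_lim_seq_ext (fun n => Re (u n) * Re (v n) - Im (u n) * Im (v n))%R).
    { intros; unfold Re, Im; simpl; ring. }
    apply (is_lim_seq_minus' _ _ (Re l * Re m) (Im l * Im m)); apply (is_lim_seq_mult' _ _ _ _); auto.
  - apply is_Clim_re in H as Hr, H' as Hr'. apply is_Clim_im in H, H'.
    apply (is_lim_seq_ext (fun n => Re (u n) * Im (v n) + Im (u n) * Re (v n))%R).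
    { intros; unfold Re, Im; simpl; ring. }
    apply (is_lim_seq_plus' _ _ (Re l * Im m) (Im l * Re m)); apply (is_lim_seq_mult' _ _ _ _); auto.
Qed.

Lemma Csum_scal c a n : Csum (fun k => c * a k) n = c * Csum a n.
Proof. induction n; rewrite ?Csum_0, ?Csum_S, ?IHn; ring. Qed.

Lemma Csum_ext a b n : (forall k, a k = b k) -> Csum a n = Csum b n.
Proof. intros H; induction n; rewrite ?Csum_0, ?Csum_S, ?IHn, H; auto. Qed.

Lemma CSeries_scal c a (b : nat -> R) : (forall k, (Cmod (a k) <= b k)%R) -> ex_series b ->
  CSeries (fun k => c * a k) = c * CSeries a.
Proof.
  intros Hb H. apply (is_Clim_unique (Csum (fun k => c * a k))).
  - apply (CSeries_Clim _ (fun k => Cmod c * b k)%R).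
    + intros k. rewrite Cmod_mult. apply Rmult_le_compat_l; auto. apply Cmod_ge_0.
    + now apply (ex_series_scal (V := R_NormedModule)).
  - apply (is_Clim_ext (fun n => c * Csum a n)); [intros; now rewrite Csum_scal|].
    apply is_Clim_scal. eapply CSeries_Clim; eauto.
Qed.

Lemma is_series_Clim a l : is_series (K := C_AbsRing) (V := C_NormedModule) a l -> is_Clim (Csum a) l.
Proof.
  intros H e He.
  assert (He2 : (0 < e / 2)%R) by lra.
  destruct (H (fun z => ball (M := C_UniformSpace) l (e/2) z)
        (locally_ball (T := C_UniformSpace) _ (mkposreal _ He2))) as [N HN].
  exists N. intros n Hn. destruct (HN n Hn) as [B1 B2].
  change (Rabs (Re (Csum a n) - Re l) < e / 2)%R in B1.
  change (Rabs (Im (Csum a n) - Im l) < e / 2)%R in B2.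
  eapply Rle_lt_trans; [apply Cmod_le_Rabs|].
  replace (Re (Csum a n - l)) with (Re (Csum a n) - Re l)%R by (unfold Re; simpl; ring).
  replace (Im (Csum a n - l)) with (Im (Csum a n) - Im l)%R by (unfold Im; simpl; ring).
  lra.
Qed.

Lemma Clim_is_series a l : is_Clim (Csum a) l -> is_series (K := C_AbsRing) (V := C_NormedModule) a l.
Proof.
  intros H P [e He]. destruct (H e (cond_pos e)) as [N HN].
  exists N. intros n Hn. apply He. specialize (HN n Hn). split.
  - change (Rabs (Re (Csum a n) - Re l) < e)%R.
    replace (Re (Csum a n) - Re l)%R with (Re (Csum a n - l)) by (unfold Re; simpl; ring).
    eapply Rle_lt_trans; [apply re_le_Cmod|auto].
  - change (Rabs (Im (Csum a n) - Im l) < e)%R.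
    replace (Im (Csum a n) - Im l)%R with (Im (Csum a n - l)) by (unfold Im; simpl; ring).
    eapply Rle_lt_trans; [apply im_le_Cmod|auto].
Qed.

Lemma cdiff_Csum (F : nat -> C -> C) n z : (forall k, cdiff (F k) z) ->
  cdiff (fun w => Csum (fun k => F k w) n) z.
Proof.
  intros H. induction n.
  - apply (cdiff_ext (F 0%nat)); auto. intros; now rewrite Csum_0.
  - apply (cdiff_ext (fun w => Csum (fun k => F k w) n + F (S n) w)).
    + intros; now rewrite Csum_S.
    + now apply cdiff_plus.
Qed.

(** The dominating series bounds all partial sums on the square, and that is all
    [cdiff_bounded_limit] asks in place of uniform convergence. *)
Lemma cdiff_CSeries (F : nat -> C -> C) (b : nat -> R) (s : C) (r : R) : (0 < r)%R ->
  (forall n, on_square (cdiff (F n)) s r) ->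
  (forall n, on_square (fun z => (Cmod (F n z) <= b n)%R) s r) ->
  ex_series b -> cdiff (fun z => CSeries (fun n => F n z)) s.
Proof.
  intros Hr Hd HM Hb.
  apply (cdiff_bounded_limit (fun n z => Csum (fun k => F k z) n) _ s r (Series b)); auto.
  - intros n x y X Y. apply (cdiff_Csum F). intros k. now apply Hd.
  - intros n x y X Y. apply Csum_bound; auto. intros k. now apply HM.
  - intros x y X Y. apply (CSeries_Clim (fun n => F n (x, y)) b); auto. intros k. now apply HM.
Qed.

Lemma is_RInt_exp_half (K a b : R) :
  is_RInt (fun t => K * exp (t / 2))%R a b (2 * K * exp (b / 2) - 2 * K * exp (a / 2))%R.
Proof.
  apply (is_RInt_derive (V := R_CompleteNormedModule) (fun t => 2 * K * exp (t / 2))%R).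
  - intros t _. auto_derive; auto. unfold Rdiv. rewrite Rmult_1_l. field.
  - intros t _. apply (ex_derive_continuous (K := R_AbsRing) (V := R_NormedModule)). auto_derive; auto.
Qed.

Lemma CInt_exp_bound (g : R -> C) (K b x y : R) : (x <= y <= b)%R ->
  (forall t, (t <= b)%R -> Ccontinuous g t) ->
  (forall t, (t <= b)%R -> (Cmod (g t) <= K * exp (t / 2))%R) ->
  (Cmod (CInt g x y) <= 2 * K * exp (y / 2))%R.
Proof.
  intros Hxy Hc HM.
  assert (K0 : (0 <= K)%R).
  { specialize (HM b (Rle_refl _)). pose proof (Cmod_ge_0 (g b)). pose proof (exp_pos (b / 2)).
    destruct (Rle_dec 0 K); auto. nra. }
  eapply Rle_trans.
  - apply (CInt_bound_fun g (fun t => K * exp (t / 2))%R x y _); [lra| | |apply is_RInt_exp_half].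
    + intros t Ht. rewrite Rmin_left, Rmax_right in Ht by lra. apply Hc. lra.
    + intros t Ht. apply HM. lra.
  - pose proof (exp_pos (x / 2)). nra.
Qed.

(** The explicit tail 2 K exp(x/2) is kept along with the limit, because convergence has to be
    controlled uniformly in a parameter later. *)
Lemma improper_CInt (g : R -> C) (K b : R) :
  (forall t, (t <= b)%R -> Ccontinuous g t) ->
  (forall t, (t <= b)%R -> (Cmod (g t) <= K * exp (t / 2))%R) ->
  exists l, RInt_gen (V := C_R_CompleteNormedModule) g (Rbar_locally m_infty) (at_point b) = l /\
    forall x, (x <= b)%R -> (Cmod (CInt g x b - l) <= 2 * K * exp (x / 2))%R.
Proof.
  intros Hc HM.
  assert (K0 : (0 <= K)%R).
  { specialize (HM b (Rle_refl _)). pose proof (Cmod_ge_0 (g b)). pose proof (exp_pos (b / 2)).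
    destruct (Rle_dec 0 K); auto. nra. }
  assert (Con : forall x y, (x <= y <= b)%R -> ccont_on g x y).
  { intros x y H t Ht. rewrite Rmin_left, Rmax_right in Ht by lra. apply Hc. lra. }
  assert (Diff : forall x y, (x <= y <= b)%R -> (Cmod (CInt g x b - CInt g y b) <= 2 * K * exp (y / 2))%R).
  { intros x y H. rewrite <- (CInt_Chasles g x y b) by (apply Con; lra).
    replace (CInt g x y + CInt g y b - CInt g y b) with (CInt g x y) by ring.
    now apply (CInt_exp_bound g K b). }
  assert (Small : forall e, (0 < e)%R -> exists B, (B <= b)%R /\ forall y, (y <= B)%R -> (2 * K * exp (y / 2) < e)%R).
  { intros e He. exists (Rmin b (2 * ln (e / (2 * K + 1)))). split; [apply Rmin_l|].
    intros y Hy. assert (y <= 2 * ln (e / (2 * K + 1)))%R by (eapply Rle_trans; [exact Hy|apply Rmin_r]).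
    assert (P : (0 < e / (2 * K + 1))%R) by (apply Rdiv_lt_0_compat; lra).
    assert (X : (exp (y / 2) <= e / (2 * K + 1))%R).
    { rewrite <- (exp_ln (e / (2 * K + 1))) by auto. destruct (Req_dec (y / 2) (ln (e / (2 * K + 1)))) as [->|N].
      - lra.
      - apply Rlt_le, exp_increasing. lra. }
    pose proof (exp_pos (y / 2)).
    apply (Rmult_le_compat_r (2 * K + 1)) in X; [|lra].
    replace (e / (2 * K + 1) * (2 * K + 1))%R with e in X by (field; lra). nra. }
  (* The limit is taken along integer steps and then extended to every x by the tail estimate
     [Diff]. *)
  destruct (is_Clim_cauchy (fun n => CInt g (b - INR n) b)) as [l Hl].
  { intros e He. destruct (Small e He) as [B [HB HS]].
    destruct (nfloor_ex (b - B)) as [N HN]; [lra|].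
    exists (S N). intros n m Hn Hm.
    assert (Hn' : (INR (S N) <= INR n)%R) by now apply le_INR.
    assert (Hm' : (INR (S N) <= INR m)%R) by now apply le_INR.
    rewrite S_INR in Hn', Hm'.
    destruct (Rle_dec (b - INR n) (b - INR m)).
    - eapply Rle_lt_trans; [apply Diff; pose proof (pos_INR m); lra|apply HS; lra].
    - rewrite Cmod_minus_sym.
      eapply Rle_lt_trans; [apply Diff; pose proof (pos_INR n); lra|apply HS; lra]. }
  assert (Lim : forall x, (x <= b)%R -> (Cmod (CInt g x b - l) <= 2 * K * exp (x / 2))%R).
  { intros x Hx. apply le_epsilon. intros e He. destruct (Hl e He) as [N HN].
    destruct (nfloor_ex (b - x)) as [N' HN']; [lra|].
    specialize (HN (N + S N')%nat ltac:(lia)).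
    assert (Hn' : (INR (S N') <= INR (N + S N'))%R) by (apply le_INR; lia). rewrite S_INR in Hn'.
    assert (D := Diff (b - INR (N + S N'))%R x ltac:(lra)). rewrite Cmod_minus_sym in D.
    replace (CInt g x b - l) with ((CInt g x b - CInt g (b - INR (N + S N')) b) +
       (CInt g (b - INR (N + S N')) b - l)) by ring.
    eapply Rle_trans; [apply Cmod_triangle|]. lra. }
  exists l. split; auto.
  apply (is_RInt_gen_unique (V := C_R_CompleteNormedModule)).
  intros P [e He]. destruct (Small e (cond_pos e)) as [B [HB HS]].
  exists (fun x => (x < B)%R) (fun y => y = b).
  - exists B. auto.
  - reflexivity.
  - intros x y Hx ->. exists (CInt g x b). split.
    + apply is_CInt_cont, Con. simpl. lra.
    + apply He. assert (L := Lim x ltac:(simpl; lra)). specialize (HS x ltac:(lra)).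
      split.
      * change (Rabs (Re (CInt g x b) - Re l) < e)%R.
        replace (Re (CInt g x b) - Re l)%R with (Re (CInt g x b - l)) by (unfold Re; simpl; ring).
        eapply Rle_lt_trans; [apply re_le_Cmod|lra].
      * change (Rabs (Im (CInt g x b) - Im l) < e)%R.
        replace (Im (CInt g x b) - Im l)%R with (Im (CInt g x b - l)) by (unfold Im; simpl; ring).
        eapply Rle_lt_trans; [apply im_le_Cmod|lra].
Qed.

Lemma INR_large (B : R) : exists N, forall n, (N <= n)%nat -> (B <= INR n)%R.
Proof.
  destruct (nfloor_ex (Rmax 0 B)) as [N HN]; [apply Rmax_l|].
  exists (S N). intros n Hn. apply le_INR in Hn. rewrite S_INR in Hn. pose proof (Rmax_r 0 B). lra.
Qed.

(** * Logarithmic coordinates *)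

(** tan(y/2) = sin y / (1 + cos y), and cos(y/2) > 0 on the open strip, so the half-angle formula in
    [Carg] returns y itself. *)
Lemma Clog_exp (w : C) : (- PI < Im w < PI)%R -> Clog (Cexp w) = w.
Proof.
  intros Hw. unfold Clog, Carg. rewrite Cmod_Cexp, ln_exp.
  destruct w as [x y]. unfold Re, Im in *; simpl in *.
  f_equal.
  assert (Hc : (0 < cos (y / 2))%R) by (apply cos_gt_0; lra).
  assert (Hx := exp_pos x).
  assert (Ec : (cos y = 2 * (cos (y / 2) * cos (y / 2)) - 1)%R).
  { replace y with (2 * (y / 2))%R at 1 by field. rewrite cos_2a_cos. ring. }
  assert (Es : (sin y = 2 * sin (y / 2) * cos (y / 2))%R).
  { replace y with (2 * (y / 2))%R at 1 by field. apply sin_2a. }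
  replace (_ / _)%R with (tan (y / 2)).
  - rewrite atan_tan by lra. field.
  - rewrite Ec, Es. unfold tan. field. split; [|lra].
    replace (_ + _)%R with (exp x * (2 * (cos (y / 2) * cos (y / 2))))%R by ring.
    apply Rgt_not_eq. repeat apply Rmult_lt_0_compat; lra.
Qed.

Lemma Cpower_exp (w a : C) : (- PI < Im w < PI)%R -> Cpower (Cexp w) a = Cexp (a * w).
Proof. intros H. unfold Cpower. now rewrite Clog_exp. Qed.

Lemma Cexp_polar (c t : R) : (0 < c)%R -> c * Cexp (Ci * t) = Cexp ((ln c, t)).
Proof.
  intros Hc. unfold Cexp. C_parts; rewrite exp_ln by auto;
  replace (0 * t - 1 * 0)%R with 0%R by ring; replace (0 * 0 + 1 * t)%R with t by ring;
  rewrite exp_0; ring.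
Qed.

Lemma Cexp_real (x : R) : Cexp x = exp x.
Proof. unfold Cexp. C_parts; rewrite cos_0, sin_0; ring. Qed.

Lemma RtoC_Cexp_ln (x : R) : (0 < x)%R -> RtoC x = Cexp (ln x).
Proof. intros H. now rewrite Cexp_real, exp_ln. Qed.

Lemma Cpower_pos (x : R) (a : C) : (0 < x)%R -> Cpower x a = Cexp (a * ln x).
Proof.
  intros H. rewrite RtoC_Cexp_ln by auto. apply Cpower_exp.
  unfold Im; simpl. pose proof PI_RGT_0; lra.
Qed.

Lemma Cexp_eq_1 (z : C) : Cexp z = 1 -> exists k : Z, z = (0%R, (2 * PI * IZR k)%R).
Proof.
  intros H.
  assert (Hm : exp (Re z) = 1%R) by (rewrite <- Cmod_Cexp, H; apply Cmod_1).
  assert (Hx : Re z = 0%R) by (apply exp_inv; now rewrite exp_0).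
  assert (Hc : cos (Im z) = 1%R).
  { apply (f_equal Re) in H. unfold Cexp in H. rewrite Hx, exp_0 in H. unfold Re in H; simpl in H. lra. }
  assert (Hs : sin (Im z / 2) = 0%R).
  { replace (Im z) with (2 * (Im z / 2))%R in Hc by field. rewrite cos_2a_sin in Hc.
    apply Rsqr_0_uniq. unfold Rsqr. lra. }
  destruct (sin_eq_0_0 _ Hs) as [k Hk]. exists k.
  destruct z as [x y]. unfold Re, Im in *; simpl in *. f_equal; lra.
Qed.

(* The logarithm of z = x + i d, for d > 0, and its conjugate. *)
Definition log_line (d x : R) : C := ((/ 2 * ln (x * x + d * d))%R, (PI / 2 - atan (x / d))%R).
Definition log_line_conj (d x : R) : C := ((/ 2 * ln (x * x + d * d))%R, (- (PI / 2 - atan (x / d)))%R).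

(** pi/2 - atan(x/d) is the argument of x + i d for d > 0 whatever the sign of x, so one smooth
    formula covers the whole line. *)
Lemma log_line_parts (d x : R) : (0 < d)%R ->
  (exp (/ 2 * ln (x * x + d * d)) * cos (PI / 2 - atan (x / d)) = x)%R /\
  (exp (/ 2 * ln (x * x + d * d)) * sin (PI / 2 - atan (x / d)) = d)%R.
Proof.
  intros Hd. assert (S : (0 < x * x + d * d)%R) by (apply sqr_plus_sqr_pos; lra).
  rewrite cos_shift, sin_shift, sin_atan, cos_atan.
  replace (/ 2 * ln (x * x + d * d))%R with (ln (sqrt (x * x + d * d))).
  2:{ rewrite <- Rpower_sqrt by auto. unfold Rpower. rewrite ln_exp. auto. }
  rewrite exp_ln by now apply sqrt_lt_R0.
  assert (E : (sqrt (x * x + d * d) = d * sqrt (1 + Rsqr (x / d)))%R).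
  { replace (x * x + d * d)%R with (Rsqr d * (1 + Rsqr (x / d)))%R by (unfold Rsqr; field; lra).
    rewrite sqrt_mult_alt by (apply Rle_0_sqr). rewrite sqrt_Rsqr; lra. }
  assert (P : (0 < sqrt (1 + Rsqr (x / d)))%R).
  { apply sqrt_lt_R0. pose proof (Rle_0_sqr (x / d)). lra. }
  rewrite E. unfold Rsqr in *. split; field; lra.
Qed.

Lemma Cexp_log_line (d x : R) : (0 < d)%R -> Cexp (log_line d x) = (x, d).
Proof.
  intros Hd. destruct (log_line_parts d x Hd) as [H1 H2].
  unfold log_line, Cexp. unfold Re, Im; cbn [fst snd]. C_parts.
  - rewrite Rmult_0_l, Rminus_0_r. exact H1.
  - rewrite Rmult_0_l, Rplus_0_r. exact H2.
Qed.

Lemma Cexp_log_line_conj (d x : R) : (0 < d)%R -> Cexp (log_line_conj d x) = (x, (- d)%R).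
Proof.
  intros Hd. destruct (log_line_parts d x Hd) as [H1 H2].
  unfold log_line_conj, Cexp. unfold Re, Im; cbn [fst snd]. rewrite cos_neg, sin_neg. C_parts.
  - rewrite Rmult_0_l, Rminus_0_r. exact H1.
  - rewrite Rmult_0_l, Rplus_0_r, <- Ropp_mult_distr_r. now rewrite H2.
Qed.

Lemma log_line_deriv (d x : R) : (0 < d)%R -> is_rderiv (log_line d) x (/ Cexp (log_line d x)).
Proof.
  intros Hd. rewrite Cexp_log_line by auto.
  assert (S : (0 < x * x + d * d)%R) by (apply sqr_plus_sqr_pos; lra).
  replace (/ ((x, d) : C)) with ((x / (x * x + d * d))%R, (- (d / (x * x + d * d)))%R).
  - apply is_rderiv_pair.
    + auto_derive; auto. field. lra.
    + auto_derive; auto. field. repeat split; try lra; nra.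
  - C_parts; field; nra.
Qed.

Lemma log_line_conj_deriv (d x : R) : (0 < d)%R ->
  is_rderiv (log_line_conj d) x (/ Cexp (log_line_conj d x)).
Proof.
  intros Hd. rewrite Cexp_log_line_conj by auto.
  assert (S : (0 < x * x + d * d)%R) by (apply sqr_plus_sqr_pos; lra).
  replace (/ ((x, (- d)%R) : C)) with ((x / (x * x + d * d))%R, (d / (x * x + d * d))%R).
  - apply is_rderiv_pair.
    + auto_derive; auto. field. lra.
    + auto_derive; auto. field. repeat split; try lra; nra.
  - C_parts; field; nra.
Qed.

Lemma log_line_range (d x : R) : (0 < d)%R -> (0 < Im (log_line d x) < PI)%R /\
  (- PI < Im (log_line_conj d x) < 0)%R.
Proof.
  intros Hd. unfold log_line, log_line_conj, Im; simpl. pose proof (atan_bound (x / d)). lra.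
Qed.

Lemma log_line_re_ge (d x c : R) : (0 < c)%R -> (c * c <= x * x + d * d)%R ->
  (ln c <= / 2 * ln (x * x + d * d))%R.
Proof.
  intros Hc H. apply Rle_trans with (/ 2 * ln (c * c))%R.
  - rewrite ln_mult by auto. right; field.
  - apply Rmult_le_compat_l; [lra|]. apply ln_le; auto. nra.
Qed.

Lemma ratio_negative (d x : R) : (0 < d)%R -> (x < 0)%R -> (atan (x / d) < 0)%R.
Proof.
  intros Hd Hx. rewrite <- atan_0. apply atan_increasing.
  unfold Rdiv. assert (0 < / d)%R by now apply Rinv_0_lt_compat. nra.
Qed.

(** The leg Im z = d meets the circle |z| = R at argument pi - asin(d/R), so leg and arc share their
    end point in logarithmic coordinates. This serves for the contour's own circle and for the outer
    ones. *)
Lemma log_line_end (d R : R) : (0 < d < R)%R ->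
  log_line d (- sqrt (R ^ 2 - d ^ 2)) = (ln R, (PI - asin (d / R))%R) /\
  log_line_conj d (- sqrt (R ^ 2 - d ^ 2)) = (ln R, (- (PI - asin (d / R)))%R).
Proof.
  intros H. unfold log_line, log_line_conj.
  assert (P : (0 < R ^ 2 - d ^ 2)%R) by nra.
  set (q := sqrt (R ^ 2 - d ^ 2)).
  assert (Hq : (0 < q)%R) by now apply sqrt_lt_R0.
  assert (Eq : (q * q = R ^ 2 - d ^ 2)%R) by (apply sqrt_sqrt; lra).
  assert (E1 : (/ 2 * ln (- q * - q + d * d) = ln R)%R).
  { replace (- q * - q + d * d)%R with (R * R)%R by (rewrite Rmult_opp_opp, Eq; ring).
    rewrite ln_mult by lra. field. }
  assert (E2 : (PI / 2 - atan (- q / d) = PI - asin (d / R))%R).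
  { replace (- q / d)%R with (- (q / d))%R by (field; lra).
    rewrite atan_opp. replace (q / d)%R with (/ (d / q))%R by (field; lra).
    rewrite atan_inv by (apply Rdiv_lt_0_compat; lra).
    assert (E3 : asin (d / R) = atan (d / q)).
    { assert (B : (-1 < d / R < 1)%R).
      { split; [pose proof (Rdiv_lt_0_compat d R ltac:(lra) ltac:(lra)); lra|].
        apply (Rmult_lt_reg_r R); [lra|]. unfold Rdiv. rewrite Rmult_assoc, Rinv_l; lra. }
      rewrite asin_atan by auto. f_equal.
      replace (1 - Rsqr (d / R))%R with (Rsqr (q / R)).
      - rewrite sqrt_Rsqr by (apply Rlt_le, Rdiv_lt_0_compat; lra). field. lra.
      - unfold Rsqr. replace (q / R * (q / R))%R with (q * q / (R * R))%R by (field; lra).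
        rewrite Eq. field. lra. }
    rewrite E3. field. }
  rewrite E1, E2. auto.
Qed.

(** * Generalised powers *)

(** M (M+1) ... (M+k-1) / k!, a majorant of |binom(s, k)| on the disc |s| <= M. *)
Fixpoint binom_bound (M : R) (k : nat) : R :=
  match k with
  | O => 1
  | S j => binom_bound M j * ((M + INR j) / INR (S j))
  end%R.

Lemma RtoC_neq_0 (x : R) : x <> 0%R -> RtoC x <> 0.
Proof. intros Hx E. apply Hx. now apply (f_equal Re) in E. Qed.

Lemma INR_S_pos n : (0 < INR (S n))%R.
Proof. apply lt_0_INR. lia. Qed.

Lemma binom_bound_pos M k : (0 <= M)%R -> (0 <= binom_bound M k)%R.
Proof.
  intros HM. induction k; cbn [binom_bound]; [lra|]. apply Rmult_le_pos; auto.
  apply Rdiv_le_0_compat; [pose proof (pos_INR k); lra|apply INR_S_pos].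
Qed.

Lemma Cmod_Cbinom_le (s : C) (M : R) k : (Cmod s <= M)%R -> (Cmod (Cbinom s k) <= binom_bound M k)%R.
Proof.
  intros HM. induction k; cbn [Cbinom binom_bound]; [rewrite Cmod_1; lra|].
  assert (P := INR_S_pos k).
  rewrite Cmod_div by (apply RtoC_neq_0; lra). rewrite Cmod_mult, Cmod_R, (Rabs_right (INR (S k))) by lra.
  unfold Rdiv. rewrite Rmult_assoc. apply Rmult_le_compat; auto; try apply Cmod_ge_0.
  - apply Rmult_le_pos; [apply Cmod_ge_0|apply Rlt_le, Rinv_0_lt_compat; lra].
  - apply Rmult_le_compat_r; [apply Rlt_le, Rinv_0_lt_compat; lra|].
    unfold Cminus. eapply Rle_trans; [apply Cmod_triangle|]. rewrite Cmod_opp, Cmod_R, Rabs_right; [lra|].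
    apply Rle_ge, pos_INR.
Qed.

(** The factor (M + k)/(k + 1) is at most 1 + eps once k >= M/eps, and at most 1 + M before; the
    [min] in the induction counts the early factors. *)
Lemma binom_bound_subexp (M eps : R) : (0 <= M)%R -> (0 < eps)%R ->
  exists A, forall k, (binom_bound M k <= A * (1 + eps) ^ k)%R.
Proof.
  intros HM He.
  destruct (nfloor_ex (M / eps)) as [j0 Hj0]; [apply Rdiv_le_0_compat; auto|].
  exists ((1 + M) ^ (S j0))%R.
  assert (K : forall k, (binom_bound M k <= (1 + M) ^ (min k (S j0)) * (1 + eps) ^ k)%R).
  { induction k; [simpl; lra|]. cbn [binom_bound].
    assert (P := INR_S_pos k). pose proof (pos_INR k). pose proof (binom_bound_pos M k HM).
    assert (P1 : (0 < (1 + M) ^ (min k (S j0)))%R) by (apply pow_lt; lra).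
    assert (P2 : (0 < (1 + eps) ^ k)%R) by (apply pow_lt; lra).
    rewrite S_INR in *. 
    assert (Q : (0 <= (M + INR k) / (INR k + 1))%R) by (apply Rdiv_le_0_compat; lra).
    destruct (le_lt_dec (S j0) k) as [L|L].
    - rewrite (Nat.min_r k) in IHk by auto. rewrite Nat.min_r by lia.
      assert (F : ((M + INR k) / (INR k + 1) <= 1 + eps)%R).
      { apply (Rmult_le_reg_r (INR k + 1)); [lra|]. unfold Rdiv. rewrite Rmult_assoc, Rinv_l, Rmult_1_r by lra.
        apply le_INR in L. rewrite S_INR in L.
        assert (M <= INR k * eps)%R.
        { apply Rle_trans with (M / eps * eps)%R; [right; field; lra|]. apply Rmult_le_compat_r; lra. }
        nra. }
      replace ((1 + M) ^ S j0 * (1 + eps) ^ S k)%R with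
        ((1 + M) ^ S j0 * (1 + eps) ^ k * (1 + eps))%R by (simpl; ring).
      apply Rmult_le_compat; auto.
    - rewrite (Nat.min_l k) in * by lia. rewrite Nat.min_l by lia.
      assert (F : ((M + INR k) / (INR k + 1) <= 1 + M)%R).
      { apply (Rmult_le_reg_r (INR k + 1)); [lra|]. unfold Rdiv. rewrite Rmult_assoc, Rinv_l, Rmult_1_r by lra.
        nra. }
      apply Rle_trans with ((1 + M) ^ k * (1 + eps) ^ k * (1 + M))%R.
      + apply Rmult_le_compat; auto.
      + assert (0 < (1 + M) ^ k * (1 + eps) ^ k * (1 + M))%R by (repeat apply Rmult_lt_0_compat; lra).
        replace ((1 + M) ^ S k * (1 + eps) ^ S k)%R with
          ((1 + M) ^ k * (1 + eps) ^ k * (1 + M) * (1 + eps))%R by (simpl; ring). nra. }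
  intros k. eapply Rle_trans; [apply K|]. apply Rmult_le_compat_r.
  - apply pow_le; lra.
  - apply Rle_pow; [lra|lia].
Qed.

(** Absolute convergence of the series of generalised powers on |z| = c, uniform over exponents in
    any disc. *)
Definition summable_at (p : nat -> C) (c : R) : Prop :=
  (0 < c)%R /\ forall M, (0 <= M)%R -> ex_series (fun k => binom_bound M k * (Cmod (p k) * (/ c) ^ k))%R.

(** Some x strictly between 1/c and the radius of convergence is chosen; the gap, eps = x c - 1,
    absorbs the binomial coefficients, which grow more slowly than (1 + eps)^k. *)
Lemma summable_at_CV_radius (p : nat -> C) (c : R) : (0 < c)%R ->
  Rbar_lt (/ c)%R (CV_radius (fun n => Cmod (p n))) -> summable_at p c.
Proof.
  intros Hc H. split; auto. intros M HM.
  assert (Hi : (0 < / c)%R) by now apply Rinv_0_lt_compat.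
  assert (X : exists x : R, (/ c < x)%R /\ Rbar_lt x (CV_radius (fun n => Cmod (p n)))).
  { destruct (CV_radius (fun n => Cmod (p n))) as [r| |]; simpl in *; try easy.
    - exists ((/ c + r) / 2)%R. lra.
    - exists (/ c + 1)%R. split; [lra|auto]. }
  destruct X as [x [Hx1 Hx2]].
  assert (Sx : ex_series (fun n => Rabs (Cmod (p n) * x ^ n))%R).
  { apply CV_disk_inside. rewrite Rabs_right by lra. auto. }
  set (eps := (x * c - 1)%R).
  assert (He : (0 < eps)%R).
  { unfold eps. apply (Rmult_lt_compat_r c) in Hx1; auto. rewrite Rinv_l in Hx1; lra. }
  destruct (binom_bound_subexp M eps HM He) as [A HA].
  apply (ex_series_le (V := R_CompleteNormedModule) _ (fun n => A * Rabs (Cmod (p n) * x ^ n))%R).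
  - intros k. change (Rabs (binom_bound M k * (Cmod (p k) * (/ c) ^ k)) <= A * Rabs (Cmod (p k) * x ^ k))%R.
    pose proof (binom_bound_pos M k HM). pose proof (Cmod_ge_0 (p k)).
    assert (0 < (/ c) ^ k)%R by now apply pow_lt. assert (0 < x ^ k)%R by (apply pow_lt; lra).
    rewrite !Rabs_right by (apply Rle_ge; repeat apply Rmult_le_pos; lra).
    apply Rle_trans with (A * (1 + eps) ^ k * (Cmod (p k) * (/ c) ^ k))%R.
    + apply Rmult_le_compat_r; [apply Rmult_le_pos; lra|auto].
    + right. replace x with ((1 + eps) * / c)%R by (unfold eps; field; lra).
      rewrite Rpow_mult_distr. ring.
  - now apply (ex_series_scal (V := R_NormedModule)).
Qed.

(* [gen_power p a w] is the generalised power z^(a, h) at z = exp w when P_h = p. *)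
Definition gen_power_term (p : nat -> C) (a w : C) (k : nat) : C :=
  Cbinom a k * p k * Cexp ((a - INR k) * w).
Definition gen_power (p : nat -> C) (a w : C) : C := CSeries (gen_power_term p a w).

Definition dom_term (p : nat -> C) (c M : R) (k : nat) : R :=
  (binom_bound M k * (Cmod (p k) * (/ c) ^ k))%R.

(** The common factor |exp(a w)| comes out of every term, and what is left of the power, exp(-k Re
    w), is at most c^(-k). *)
Lemma gen_power_term_bound p c M a w k : (0 < c)%R -> (Cmod a <= M)%R -> (ln c <= Re w)%R ->
  (Cmod (gen_power_term p a w k) <= exp (Re (a * w)) * dom_term p c M k)%R.
Proof.
  intros Hc Ha Hw. unfold gen_power_term, dom_term.
  assert (HM : (0 <= M)%R) by (pose proof (Cmod_ge_0 a); lra).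
  rewrite !Cmod_mult, Cmod_Cexp.
  replace (Re ((a - INR k) * w)) with (Re (a * w)%C + - (INR k * Re w))%R by (unfold Re, Im; simpl; ring).
  rewrite exp_plus.
  pose proof (Cmod_ge_0 (p k)). pose proof (Cmod_Cbinom_le a M k Ha). pose proof (Cmod_ge_0 (Cbinom a k)).
  assert (X : (exp (- (INR k * Re w)) <= (/ c) ^ k)%R).
  { replace ((/ c) ^ k)%R with (exp (- (INR k * ln c))).
    - destruct (Req_dec (INR k * ln c) (INR k * Re w)) as [->|N]; [lra|].
      apply Rlt_le, exp_increasing. pose proof (pos_INR k). nra.
    - rewrite <- Rpower_pow by (now apply Rinv_0_lt_compat). unfold Rpower. rewrite ln_Rinv by auto.
      f_equal. ring. }
  pose proof (exp_pos (Re (a * w))). pose proof (exp_pos (- (INR k * Re w))).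
  pose proof (binom_bound_pos M k HM).
  apply Rle_trans with (binom_bound M k * Cmod (p k) * (exp (Re (a * w)) * (/ c) ^ k))%R; [|right; ring].
  apply Rmult_le_compat.
  - apply Rmult_le_pos; auto.
  - apply Rmult_le_pos; lra.
  - apply Rmult_le_compat_r; auto.
  - apply Rmult_le_compat_l; lra.
Qed.

Lemma gen_power_summable p c a w : summable_at p c -> (ln c <= Re w)%R ->
  (forall k, (Cmod (gen_power_term p a w k) <= exp (Re (a * w)) * dom_term p c (Cmod a) k)%R) /\
  ex_series (fun k => exp (Re (a * w)) * dom_term p c (Cmod a) k)%R.
Proof.
  intros [Hc Hs] Hw. split.
  - intros k. apply gen_power_term_bound; auto; lra.
  - apply (ex_series_scal (V := R_NormedModule)). apply Hs, Cmod_ge_0.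
Qed.

Lemma gen_power_bound p c M a w : summable_at p c -> (Cmod a <= M)%R -> (ln c <= Re w)%R ->
  (Cmod (gen_power p a w) <= exp (Re (a * w)) * Series (dom_term p c M))%R.
Proof.
  intros [Hc Hs] Ha Hw. rewrite <- Series_scal_l. apply CSeries_bound.
  - intros k. apply gen_power_term_bound; auto.
  - apply (ex_series_scal (V := R_NormedModule)). apply Hs. pose proof (Cmod_ge_0 a); lra.
Qed.

Lemma dom_series_nonneg p c M : summable_at p c -> (0 <= M)%R -> (0 <= Series (dom_term p c M))%R.
Proof.
  intros [Hc Hs] HM. 
  assert (P : forall k, (0 <= dom_term p c M k)%R).
  { intros k. unfold dom_term. repeat apply Rmult_le_pos; [now apply binom_bound_pos|apply Cmod_ge_0|].
    apply pow_le, Rlt_le, Rinv_0_lt_compat; auto. }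
  eapply Rle_trans; [|apply (sum_n_incr_le_Series (dom_term p c M) 0); auto].
  - rewrite sum_O. apply P.
  - now apply Hs.
Qed.

Lemma Re_mult_le (a w : C) : (Re (a * w) <= Cmod a * Cmod w)%R.
Proof. rewrite <- Cmod_mult. eapply Rle_trans; [apply Rle_abs|apply re_le_Cmod]. Qed.

Lemma square_Cmod (s : C) (r : R) x y : (0 <= r)%R -> (Re s - r <= x <= Re s + r)%R ->
  (Im s - r <= y <= Im s + r)%R -> (Cmod (x, y) <= Cmod s + 2 * r)%R.
Proof.
  intros Hr X Y. replace ((x, y) : C) with (s + ((x, y) - s)) by (C_parts; ring).
  eapply Rle_trans; [apply Cmod_triangle|]. apply Rplus_le_compat_l.
  destruct s as [u v]. rewrite pair_eq_minus. unfold Re, Im in *; simpl in *.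
  apply Cmod_pair_le; apply Rabs_le; lra.
Qed.

Lemma exp_le_le (x y : R) : (x <= y)%R -> (exp x <= exp y)%R.
Proof. intros [H| ->]; [apply Rlt_le, exp_increasing; auto|lra]. Qed.

Lemma cdiff_gen_power_w p c a w : summable_at p c -> (ln c < Re w)%R -> cdiff (gen_power p a) w.
Proof.
  intros Hp Hw. set (r := (Re w - ln c)%R).
  apply (cdiff_CSeries (fun k z => gen_power_term p a z k)
    (fun k => exp (Cmod a * (Cmod w + 2 * r)) * dom_term p c (Cmod a) k)%R w r).
  - unfold r; lra.
  - intros k x y _ _. unfold gen_power_term. apply (cdiff_mult (fun _ => Cbinom a k * p k)); [apply cdiff_const|].
    apply cdiff_exp. apply (cdiff_mult (fun _ => a - INR k)); [apply cdiff_const|apply cdiff_id].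
  - intros k x y X Y. eapply Rle_trans.
    + apply (gen_power_term_bound p c (Cmod a)); [apply Hp|lra|unfold r in *; unfold Re at 1; simpl; lra].
    + apply Rmult_le_compat_r.
      * unfold dom_term. destruct Hp as [Hc _]. repeat apply Rmult_le_pos; [apply binom_bound_pos, Cmod_ge_0|apply Cmod_ge_0|].
        apply pow_le, Rlt_le, Rinv_0_lt_compat; auto.
      * apply exp_le_le. eapply Rle_trans; [apply Re_mult_le|]. apply Rmult_le_compat_l; [apply Cmod_ge_0|].
        apply square_Cmod; auto. unfold r; lra.
  - apply (ex_series_scal (V := R_NormedModule)). apply Hp, Cmod_ge_0.
Qed.

Lemma cdiff_Cbinom k a : cdiff (fun s => Cbinom s k) a.
Proof.
  induction k; [apply (cdiff_const 1)|]. cbn [Cbinom].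
  apply (cdiff_mult (fun s => Cbinom s k * (s - INR k))); [|apply cdiff_const].
  apply (cdiff_mult (fun s => Cbinom s k)); auto. apply cdiff_minus; [apply cdiff_id|apply cdiff_const].
Qed.

Lemma cdiff_gen_power_a p c a w : summable_at p c -> (ln c <= Re w)%R -> cdiff (fun s => gen_power p s w) a.
Proof.
  intros Hp Hw. pose proof (Cmod_ge_0 a) as Pa.
  apply (cdiff_CSeries (fun k s => gen_power_term p s w k)
    (fun k => exp ((Cmod a + 2 * 1) * Cmod w) * dom_term p c (Cmod a + 2 * 1) k)%R a 1).
  - lra.
  - intros k x y _ _. unfold gen_power_term.
    apply (cdiff_mult (fun s => Cbinom s k * p k)).
    + apply (cdiff_mult (fun s => Cbinom s k)); [apply cdiff_Cbinom|apply cdiff_const].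
    + apply cdiff_exp. apply (cdiff_mult (fun s => s - INR k)); [|apply cdiff_const].
      apply cdiff_minus; [apply cdiff_id|apply cdiff_const].
  - intros k x y X Y. assert (Q := square_Cmod a 1 x y ltac:(lra) X Y). eapply Rle_trans.
    + apply (gen_power_term_bound p c (Cmod a + 2 * 1)); [apply Hp|auto|auto].
    + apply Rmult_le_compat_r.
      * unfold dom_term. destruct Hp as [Hc _]. repeat apply Rmult_le_pos; [apply binom_bound_pos; lra|apply Cmod_ge_0|].
        apply pow_le, Rlt_le, Rinv_0_lt_compat; auto.
      * apply exp_le_le. eapply Rle_trans; [apply Re_mult_le|]. apply Rmult_le_compat_r; [apply Cmod_ge_0|auto].
  - apply (ex_series_scal (V := R_NormedModule)). apply Hp; lra.
Qed.

(** The condition on Im w is where the principal branch enters; the contour analysis is then carried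
    out with [gen_power], which has no cut. *)
Lemma gpower_exp (h : C -> C) (w s : C) : (- PI < Im w < PI)%R ->
  gpower h (Cexp w) s = gen_power (P_ h) s w.
Proof.
  intros Hw. unfold gpower, gen_power. apply CSeries_ext. intros k.
  unfold gen_power_term. now rewrite Cpower_exp.
Qed.

(** * The poles of the FC-integrand *)

Definition hankel_denom (w : C) : C := Cexp (- Cexp w) - 1.

(* The FC-integrand in the coordinate w = log z, including the factor dz/dw. *)
Definition log_integrand (p : nat -> C) (a w : C) : C :=
  gen_power p a w * Cexp w / hankel_denom w.

Lemma is_cderiv_hankel_denom w : is_cderiv hankel_denom w (Cexp (- Cexp w) * (- Cexp w)).
Proof.
  replace (Cexp (- Cexp w) * (- Cexp w)) with (Cexp (- Cexp w) * (- Cexp w) + 0) by ring.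
  apply (is_cderiv_plus (fun w => Cexp (- Cexp w)) (fun _ => - (1))); [|apply is_cderiv_const].
  apply (is_cderiv_comp Cexp (fun w => - Cexp w)); [|apply is_cderiv_exp].
  replace (- Cexp w) with (0 * Cexp w + - (1) * Cexp w) by ring.
  apply (is_cderiv_ext (fun w => - (1) * Cexp w)); [intros; ring|].
  apply (is_cderiv_mult (fun _ => - (1)) Cexp); [apply is_cderiv_const|apply is_cderiv_exp].
Qed.

Lemma cdiff_log_integrand p c a w : summable_at p c -> (ln c < Re w)%R -> hankel_denom w <> 0 ->
  cdiff (log_integrand p a) w.
Proof.
  intros Hp Hw Hd. apply (cdiff_div (fun w => gen_power p a w * Cexp w) hankel_denom); auto.
  - apply (cdiff_mult (gen_power p a) Cexp); [now apply (cdiff_gen_power_w p c)|].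
    eexists; apply is_cderiv_exp.
  - eexists; apply is_cderiv_hankel_denom.
Qed.

(** exp(-exp w) = 1 means exp w = -2 pi i k. Here k = 0 is impossible since exp does not vanish, and
    in the strip a purely imaginary value forces Im w = pi/2 or -pi/2. *)
Lemma hankel_denom_zero w : (- PI < Im w < PI)%R -> hankel_denom w = 0 ->
  (Im w = PI / 2 \/ Im w = - (PI / 2))%R /\ exists n, (1 <= n)%nat /\ Re w = ln (2 * PI * INR n).
Proof.
  intros Hw H. pose proof PI_RGT_0 as HPI.
  assert (E : Cexp (- Cexp w) = 1) by (replace (Cexp (- Cexp w)) with (hankel_denom w + 1) by
    (unfold hankel_denom; ring); rewrite H; ring).
  destruct (Cexp_eq_1 _ E) as [k Hk].
  assert (E2 : Cexp w = (0%R, (- (2 * PI * IZR k))%R)).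
  { replace (Cexp w) with (- - Cexp w) by ring. rewrite Hk. C_parts; ring. }
  assert (Hre : (exp (Re w) * cos (Im w) = 0)%R).
  { apply (f_equal Re) in E2. unfold Cexp in E2. unfold Re at 1 3 in E2; simpl in E2. lra. }
  assert (Hc : cos (Im w) = 0%R).
  { pose proof (exp_pos (Re w)). apply Rmult_integral in Hre. destruct Hre; lra. }
  split.
  - destruct (Rlt_dec (Im w) (- (PI / 2))).
    { assert (cos (Im w) < 0)%R by (rewrite <- cos_neg; apply cos_lt_0; lra). lra. }
    destruct (Req_dec (Im w) (- (PI / 2))); [right; auto|].
    destruct (Rlt_dec (Im w) (PI / 2)).
    { assert (0 < cos (Im w))%R by (apply cos_gt_0; lra). lra. }
    destruct (Req_dec (Im w) (PI / 2)); [left; auto|].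
    assert (cos (Im w) < 0)%R by (apply cos_lt_0; lra). lra.
  - assert (Hm : exp (Re w) = (2 * PI * INR (Z.abs_nat k))%R).
    { rewrite <- Cmod_Cexp, E2. rewrite INR_IZR_INZ, Zabs2Nat.id_abs, abs_IZR.
      replace ((0%R, (- (2 * PI * IZR k))%R) : C) with (- (Ci * (2 * PI * IZR k)%R)) by (C_parts; ring).
      rewrite Cmod_opp, Cmod_mult, Cmod_Ci, Cmod_R, !Rabs_mult, (Rabs_right 2), (Rabs_right PI) by lra. ring. }
    exists (Z.abs_nat k). split.
    + destruct (Z.abs_nat k) as [|m]; [|lia]. simpl in Hm. pose proof (exp_pos (Re w)). lra.
    + rewrite <- Hm, ln_exp. auto.
Qed.

Definition pole_up (n : nat) : C := (ln (2 * PI * INR n), (PI / 2)%R).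
Definition pole_down (n : nat) : C := (ln (2 * PI * INR n), (- (PI / 2))%R).

Lemma two_PI_INR_pos n : (1 <= n)%nat -> (0 < 2 * PI * INR n)%R.
Proof.
  intros H. pose proof PI_RGT_0. assert (0 < INR n)%R by (apply lt_0_INR; lia).
  apply Rmult_lt_0_compat; lra.
Qed.

Lemma Cexp_pole_up n : (1 <= n)%nat -> Cexp (pole_up n) = 2 * PI * Ci * INR n.
Proof.
  intros H. unfold pole_up, Cexp. unfold Re, Im; cbn [fst snd].
  rewrite exp_ln, cos_PI2, sin_PI2 by now apply two_PI_INR_pos. C_parts; ring.
Qed.

Lemma Cexp_pole_down n : (1 <= n)%nat -> Cexp (pole_down n) = - (2 * PI * Ci * INR n).
Proof.
  intros H. unfold pole_down, Cexp. unfold Re, Im; cbn [fst snd].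
  rewrite exp_ln, cos_neg, sin_neg, cos_PI2, sin_PI2 by now apply two_PI_INR_pos. C_parts; ring.
Qed.

Lemma Cexp_two_PI_Ci_INR n : Cexp (2 * PI * Ci * INR n) = 1 /\ Cexp (- (2 * PI * Ci * INR n)) = 1.
Proof.
  assert (E : Cexp (2 * PI * Ci * INR n) = 1).
  { unfold Cexp. replace (Re (2 * PI * Ci * INR n)) with 0%R by (unfold Re; simpl; ring).
    replace (Im (2 * PI * Ci * INR n)) with (0 + 2 * INR n * PI)%R by (unfold Im; simpl; ring).
    rewrite exp_0, cos_period, sin_period, cos_0, sin_0. C_parts; ring. }
  split; auto. rewrite Cexp_opp, E. field.
Qed.

(** For small h one has |D(w0 + h)| >= |d| |h| / 2, which controls the quotient. The conclusion is
    the description of a simple pole of residue N(w0)/D'(w0) that [residue_simple_pole] takes. *)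
Lemma simple_zero_limit (N D : C -> C) (w0 d : C) : ccont N w0 -> is_cderiv D w0 d -> D w0 = 0 -> d <> 0 ->
  forall eps, (0 < eps)%R -> exists del, (0 < del)%R /\ forall h : C, h <> 0 -> (Cmod h < del)%R ->
     (Cmod (h * (N (w0 + h)%C / D (w0 + h)%C) - N w0 / d) <= eps)%R.
Proof.
  intros HN HD H0 Hd e He.
  assert (Pd := proj1 (Cmod_gt_0 d) Hd). set (m := Cmod d) in *.
  set (B := (1 + Cmod (N w0))%R). pose proof (Cmod_ge_0 (N w0)) as PN.
  assert (HB : (0 < B)%R) by (unfold B; lra).
  assert (Qem : (0 < e * m)%R) by (apply Rmult_lt_0_compat; auto).
  assert (Qemm : (0 < e * (m * m))%R) by (apply Rmult_lt_0_compat; [|apply Rmult_lt_0_compat]; auto).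
  assert (Qm1 : (0 < Rmin 1 (e * m / 4))%R) by (apply Rmin_pos; lra).
  assert (Qm2 : (0 < Rmin (m / 2) (e * (m * m) / (4 * B)))%R)
    by (apply Rmin_pos; [lra|apply Rdiv_lt_0_compat; lra]).
  destruct (HN (Rmin 1 (e * m / 4)) Qm1) as [d1 [Hd1 H1]].
  destruct (HD (Rmin (m / 2) (e * (m * m) / (4 * B))) Qm2)
    as [d2 [Hd2 H2]].
  exists (Rmin d1 d2); split; [apply Rmin_pos; auto|]. intros h Hh Hlt.
  specialize (H1 h (Rlt_le_trans _ _ _ Hlt (Rmin_l _ _))).
  specialize (H2 h (Rlt_le_trans _ _ _ Hlt (Rmin_r _ _))).
  rewrite H0 in H2. replace (D (w0 + h) - 0 - d * h) with (D (w0 + h) - d * h) in H2 by ring.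
  assert (Ph := proj1 (Cmod_gt_0 h) Hh). set (t := Cmod h) in *.
  assert (LD : (m * t / 2 <= Cmod (D (w0 + h)%C))%R).
  { pose proof (Cmod_triangle_rev (d * h) (d * h - D (w0 + h))).
    replace (d * h - (d * h - D (w0 + h))) with (D (w0 + h)) in H by ring.
    rewrite (Cmod_minus_sym (d * h)), Cmod_mult in H. fold m t in H.
    pose proof (Rmin_l (m / 2) (e * (m * m) / (4 * B))). nra. }
  assert (ND : D (w0 + h) <> 0) by (apply Cmod_gt_0; nra).
  assert (N1 : (Cmod (N (w0 + h)%C) <= B)%R).
  { replace (N (w0 + h)) with (N w0 + (N (w0 + h) - N w0)) by ring.
    eapply Rle_trans; [apply Cmod_triangle|]. pose proof (Rmin_l 1 (e * m / 4)). unfold B. lra. }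
  replace (h * (N (w0 + h) / D (w0 + h)) - N w0 / d) with
    (N (w0 + h) * - (D (w0 + h) - d * h) / (d * D (w0 + h)) + (N (w0 + h) - N w0) / d) by (field; auto).
  eapply Rle_trans; [apply Cmod_triangle|].
  rewrite !Cmod_div by (auto; now apply Cmult_neq_0). rewrite !Cmod_mult, Cmod_opp. fold m.
  assert (T2 : (Cmod (N (w0 + h)%C - N w0) / m <= e / 4)%R).
  { apply (Rmult_le_reg_r m); auto. unfold Rdiv at 1. rewrite Rmult_assoc, Rinv_l, Rmult_1_r by lra.
    pose proof (Rmin_r 1 (e * m / 4)). lra. }
  assert (T1 : (Cmod (N (w0 + h)%C) * Cmod (D (w0 + h)%C - d * h) / (m * Cmod (D (w0 + h)%C)) <= e / 2)%R).
  { apply (Rmult_le_reg_r (m * Cmod (D (w0 + h)%C))); [nra|].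
    unfold Rdiv at 1. rewrite Rmult_assoc, Rinv_l, Rmult_1_r by nra.
    apply Rle_trans with (B * (e * (m * m) / (4 * B) * t))%R.
    - apply Rmult_le_compat; try apply Cmod_ge_0; auto. eapply Rle_trans; [exact H2|].
      apply Rmult_le_compat_r; [lra|apply Rmin_r].
    - replace (B * (e * (m * m) / (4 * B) * t))%R with (e / 2 * (m * (m * t / 2)))%R by (field; lra).
      apply Rmult_le_compat_l; [lra|]. apply Rmult_le_compat_l; lra. }
  lra.
Qed.

(** At a pole exp(-z) = 1, so the denominator has derivative -z in w, which cancels against the
    factor z = dz/dw of the numerator and leaves the sign. *)
Lemma residue_log_integrand p c a (w0 : C) x1 x2 y1 y2 : summable_at p c ->
  (ln c < x1)%R -> (x1 < Re w0 < x2)%R -> (y1 < Im w0 < y2)%R ->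
  Cexp (- Cexp w0) = 1 ->
  on_rect (fun w => w <> w0 -> hankel_denom w <> 0) x1 x2 y1 y2 ->
  bdry (log_integrand p a) x1 x2 y1 y2 = - (2 * PI * Ci * gen_power p a w0).
Proof.
  intros Hp Hc X Y E Hr.
  assert (Es : w0 = (Re w0, Im w0)) by (destruct w0; reflexivity).
  rewrite (residue_simple_pole (log_integrand p a) (Re w0) (Im w0) (gen_power p a w0 * Cexp w0 / (- Cexp w0)));
    auto; rewrite <- ?Es.
  - field. apply Cexp_neq_0.
  - intros x y Hx Hy N. apply (cdiff_log_integrand p c); auto; unfold Re; simpl; lra.
  - apply (simple_zero_limit (fun w => gen_power p a w * Cexp w) hankel_denom).
    + apply cdiff_ccont. apply (cdiff_mult (gen_power p a) Cexp).
      * apply (cdiff_gen_power_w p c); auto; lra.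
      * eexists; apply is_cderiv_exp.
    + replace (- Cexp w0) with (Cexp (- Cexp w0) * (- Cexp w0)) by (rewrite E; ring).
      apply is_cderiv_hankel_denom.
    + unfold hankel_denom. rewrite E. ring.
    + intros Z. apply (Cexp_neq_0 w0). replace (Cexp w0) with (- - Cexp w0) by ring. rewrite Z. ring.
Qed.

(** The rectangle is a slit annulus holding exactly the poles over 2 pi i n and -2 pi i n; cutting
    it along Im w = 0 leaves one pole in each half. *)
Lemma bdry_annulus p c a (n : nat) (u1 u2 th : R) : summable_at p c -> (1 <= n)%nat ->
  (ln c < u1)%R -> (PI / 2 < th < PI)%R -> (u1 < ln (2 * PI * INR n) < u2)%R ->
  (forall m, (1 <= m)%nat -> (u1 <= ln (2 * PI * INR m) <= u2)%R -> m = n) ->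
  bdry (log_integrand p a) u1 u2 (- th) th =
  - (2 * PI * Ci * (gen_power p a (pole_up n) + gen_power p a (pole_down n))).
Proof.
  intros Hp Hn Hu Hth Hln Huniq. pose proof PI_RGT_0 as HPI.
  assert (Z : forall w, (u1 <= Re w <= u2)%R -> (- th <= Im w <= th)%R -> hankel_denom w = 0 ->
     w = pole_up n \/ w = pole_down n).
  { intros w Hx Hy H0. destruct (hankel_denom_zero w ltac:(lra) H0) as [Hi [m [Hm Hre]]].
    rewrite Hre in Hx. rewrite (Huniq m Hm Hx) in Hre.
    destruct w as [x y]; unfold pole_up, pole_down, Re, Im in *; simpl in *; subst x.
    destruct Hi as [-> | ->]; auto. }
  assert (D : forall w, (u1 <= Re w <= u2)%R -> (- th <= Im w <= th)%R -> w <> pole_up n ->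
    w <> pole_down n -> cdiff (log_integrand p a) w).
  { intros w Hx Hy N1 N2. apply (cdiff_log_integrand p c); auto; [lra|].
    intros H0. destruct (Z w Hx Hy H0); auto. }
  assert (Ds : forall x y, (x = u1 \/ x = u2) -> (- th <= y <= th)%R -> ccont (log_integrand p a) (x, y)).
  { intros x y Hx Hy. apply cdiff_ccont, D; unfold Re, Im; simpl; try lra;
    intros E; injection E; intros; lra. }
  rewrite (bdry_split_y _ u1 u2 (- th) 0 th) by (try (intros; apply Ds; auto); lra).
  rewrite (residue_log_integrand p c a (pole_down n)), (residue_log_integrand p c a (pole_up n)); auto;
    unfold pole_up, pole_down; unfold Re, Im; simpl; try lra.
  - ring.
  - fold (pole_up n). rewrite Cexp_pole_up by auto. apply Cexp_two_PI_Ci_INR.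
  - intros x y Hx Hy N H0. destruct (Z (x, y)) as [E|E]; unfold Re, Im; simpl; auto; try lra.
    injection E; intros; lra.
  - fold (pole_down n). rewrite Cexp_pole_down by auto.
    replace (- - (2 * PI * Ci * INR n)) with (2 * PI * Ci * INR n) by ring. apply Cexp_two_PI_Ci_INR.
  - intros x y Hx Hy N H0. destruct (Z (x, y)) as [E|E]; unfold Re, Im; simpl; auto; try lra.
    injection E; intros; lra.
Qed.

(** Half-way between the moduli 2 pi (n0 + N - 1) and 2 pi (n0 + N). Thus the circle for [S N]
    encloses the poles up to index n0 + N, which is also the last index in [Csum _ N]. *)
Definition outer_radius (n0 N : nat) : R := (2 * PI * INR (n0 + N) - PI)%R.

Lemma outer_radius_pos n0 N : (1 <= n0)%nat -> (PI <= outer_radius n0 N)%R.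
Proof.
  intros H. unfold outer_radius. pose proof PI_RGT_0.
  assert (1 <= INR (n0 + N))%R by (apply (le_INR 1); lia). nra.
Qed.

(** Each step of the induction adds the annulus between two consecutive outer circles, with one pair
    of poles. The condition pi/2 < th < pi keeps the horizontal sides away from all poles. *)
Lemma bdry_poles p c1 c a n0 th N : summable_at p c1 -> (1 <= n0)%nat -> (0 < c1 < c)%R ->
  (PI / 2 < th < PI)%R ->
  (forall m, (1 <= m)%nat -> (m < n0)%nat -> (2 * PI * INR m < c)%R) -> (c < 2 * PI * INR n0)%R ->
  bdry (log_integrand p a) (ln c) (ln (outer_radius n0 (S N))) (- th) th =
  - (2 * PI * Ci * Csum (fun j => gen_power p a (pole_up (n0 + j)) + gen_power p a (pole_down (n0 + j))) N).
Proof.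
  intros Hp Hn0 Hc Hth Hin Hout. pose proof PI_RGT_0 as HPI.
  assert (Hlc : (ln c1 < ln c)%R) by (apply ln_increasing; lra).
  assert (R0 : forall m, (1 <= m)%nat -> (0 < 2 * PI * INR m)%R) by apply two_PI_INR_pos.
  assert (Ro : forall m, (0 < outer_radius n0 m)%R).
  { intros m. pose proof (outer_radius_pos n0 m Hn0). lra. }
  induction N.
  - rewrite Csum_0, Nat.add_0_r. apply (bdry_annulus p c1); auto.
    + split; apply ln_increasing; auto; try lra. unfold outer_radius.
      rewrite plus_INR. simpl. lra.
    + intros m Hm [L1 L2]. 
      assert (M1 : ~ (m < n0)%nat).
      { intros L. specialize (Hin m Hm L). assert (ln (2 * PI * INR m) < ln c)%R by (apply ln_increasing; auto). lra. }
      assert (M2 : ~ (n0 < m)%nat).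
      { intros L. apply lt_INR in L as L'. assert (INR n0 + 1 <= INR m)%R by (rewrite <- S_INR; apply le_INR; lia).
        assert (ln (outer_radius n0 1) < ln (2 * PI * INR m))%R; [|lra].
        apply ln_increasing; auto. unfold outer_radius. rewrite plus_INR. simpl. nra. }
      lia.
  - rewrite Csum_S.
    assert (Hmono : (ln (outer_radius n0 (S N)) < ln (outer_radius n0 (S (S N))))%R).
    { apply ln_increasing; auto. unfold outer_radius. rewrite !plus_INR, !S_INR. nra. }
    assert (Hlo : (ln c < ln (outer_radius n0 (S N)))%R).
    { apply ln_increasing; [lra|]. unfold outer_radius. rewrite !plus_INR, !S_INR. pose proof (pos_INR N). nra. }
    assert (Dl : forall x y, (y = th \/ y = - th)%R -> (ln c <= x)%R -> ccont (log_integrand p a) (x, y)).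
    { intros x y Hy Hx. apply cdiff_ccont, (cdiff_log_integrand p c1); auto; unfold Re, Im; simpl; [lra|].
      intros H0. apply hankel_denom_zero in H0; unfold Im in *; simpl in *; lra. }
    rewrite (bdry_split_x _ (ln c) (ln (outer_radius n0 (S N)))) by
      (try (intros; apply Dl; auto); lra).
    rewrite IHN. rewrite (bdry_annulus p c1 a (n0 + S N)); auto; try lia; try lra.
    + ring.
    + assert (Q : (1 <= n0 + S N)%nat) by lia. split; apply ln_increasing; auto.
      * unfold outer_radius. lra.
      * unfold outer_radius. rewrite !plus_INR, !S_INR. nra.
    + intros m Hm [L1 L2].
      assert (M1 : ~ (m < n0 + S N)%nat).
      { intros L. assert (INR m + 1 <= INR (n0 + S N))%R by (rewrite <- S_INR; apply le_INR; lia).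
        assert (ln (2 * PI * INR m) < ln (outer_radius n0 (S N)))%R; [|lra].
        apply ln_increasing; auto. unfold outer_radius. nra. }
      assert (M2 : ~ (n0 + S N < m)%nat).
      { intros L. assert (INR (n0 + S N) + 1 <= INR m)%R by (rewrite <- S_INR; apply le_INR; lia).
        assert (ln (outer_radius n0 (S (S N))) < ln (2 * PI * INR m))%R; [|lra].
        apply ln_increasing; auto. unfold outer_radius.
        replace (n0 + S (S N))%nat with (S (n0 + S N)) by lia. rewrite S_INR. nra. }
      lia.
Qed.

(** The variant without dz/dw: on the legs the variable of integration is x = Re z itself, with dz =
    dx. *)
Definition integrand (p : nat -> C) (a w : C) : C := gen_power p a w / hankel_denom w.

Lemma log_integrand_eq p a w : log_integrand p a w = integrand p a w * Cexp w.
Proof. unfold log_integrand, integrand, Cdiv. ring. Qed.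

Lemma cdiff_integrand p c a w : summable_at p c -> (ln c < Re w)%R -> hankel_denom w <> 0 ->
  cdiff (integrand p a) w.
Proof.
  intros Hp Hw Hd. apply (cdiff_div (gen_power p a) hankel_denom); auto.
  - now apply (cdiff_gen_power_w p c).
  - eexists; apply is_cderiv_hankel_denom.
Qed.

Lemma hankel_denom_neq_0 w : (- PI < Im w < PI)%R -> (PI / 2 < Im w \/ Im w < - (PI / 2))%R ->
  hankel_denom w <> 0.
Proof. intros H1 H2 H0. pose proof PI_RGT_0. apply hankel_denom_zero in H0; lra. Qed.

Lemma log_line_left (d x : R) : (0 < d)%R -> (x < 0)%R ->
  (PI / 2 < Im (log_line d x) < PI)%R /\ (- PI < Im (log_line_conj d x) < - (PI / 2))%R.
Proof.
  intros Hd Hx. pose proof (ratio_negative d x Hd Hx). pose proof (atan_bound (x / d)).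
  unfold log_line, log_line_conj, Im; simpl. lra.
Qed.


(** The curve l satisfies l' = 1/exp(l), so (Q o l)' is the integrand without the factor dz/dw; the
    value depends only on the ends, although l is no straight line in the w-plane. *)
Lemma line_integral_primitive p c1 a (Q : C -> C) (l : R -> C) (x1 x2 lo hi : R) : summable_at p c1 -> (x1 <= x2)%R ->
  (forall w, (ln c1 < Re w)%R -> (lo < Im w < hi)%R -> is_cderiv Q w (log_integrand p a w)) ->
  (forall x, is_rderiv l x (/ Cexp (l x))) ->
  (forall x, (x1 <= x <= x2)%R -> (ln c1 < Re (l x))%R /\ (lo < Im (l x) < hi)%R /\ hankel_denom (l x) <> 0) ->
  CInt (fun x => integrand p a (l x)) x1 x2 = Q (l x2) - Q (l x1).
Proof.
  intros Hp Hx HQ Hl H. apply is_CInt_unique.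
  apply (is_CInt_deriv (fun x => Q (l x))).
  - intros t Ht. rewrite Rmin_left, Rmax_right in Ht by auto. destruct (H t Ht) as [H1 [H2 H3]].
    replace (integrand p a (l t)) with (log_integrand p a (l t) * / Cexp (l t)).
    + apply is_rderiv_comp; auto.
    + rewrite log_integrand_eq. field. apply Cexp_neq_0.
  - intros t Ht. rewrite Rmin_left, Rmax_right in Ht by auto. destruct (H t Ht) as [H1 [H2 H3]].
    apply Ccontinuous_comp.
    + apply cdiff_ccont. now apply (cdiff_integrand p c1).
    + eapply is_rderiv_continuous, Hl.
Qed.

Lemma sqrt_minus_sqr (R d : R) : (0 < d < R)%R -> (0 < sqrt (R ^ 2 - d ^ 2))%R /\
  (sqrt (R ^ 2 - d ^ 2) * sqrt (R ^ 2 - d ^ 2) = R * R - d * d)%R.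
Proof.
  intros H. split; [apply sqrt_lt_R0; nra|]. rewrite sqrt_sqrt by nra. ring.
Qed.

(** The legs are cut where they meet the circle of radius R. Primitives [Qu] and [Qd] in the two
    pole-free strips evaluate both the legs and the horizontal sides of the rectangle, so all their
    values cancel against each other and the residues counted by [bdry_poles] remain. *)
Lemma hankel_truncated p c1 c d a n0 N : summable_at p c1 -> (1 <= n0)%nat -> (0 < c1 < c)%R ->
  (0 < d < c)%R ->
  (forall m, (1 <= m)%nat -> (m < n0)%nat -> (2 * PI * INR m < c)%R) -> (c < 2 * PI * INR n0)%R ->
  let R := outer_radius n0 (S N) in
  let X := (- sqrt (R ^ 2 - d ^ 2))%R in let A := (- sqrt (c ^ 2 - d ^ 2))%R in
  let th := (PI - asin (d / c))%R in let thR := (PI - asin (d / R))%R in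
  CInt (fun x => integrand p a (log_line_conj d x)) X A
  + Ci * CInt (fun t => log_integrand p a (ln c, t)) (- th) th
  - CInt (fun x => integrand p a (log_line d x)) X A =
  Ci * CInt (fun t => log_integrand p a (ln R, t)) (- thR) thR +
  2 * PI * Ci * Csum (fun j => gen_power p a (pole_up (n0 + j)) + gen_power p a (pole_down (n0 + j))) N.
Proof.
  intros Hp Hn0 Hc Hd Hin Hout R X A th thR. pose proof PI_RGT_0 as HPI.
  assert (HcR : (c < R)%R).
  { unfold R, outer_radius. rewrite plus_INR, S_INR. pose proof (pos_INR N). nra. }
  destruct (sqrt_minus_sqr c d Hd) as [A0 A1]. destruct (sqrt_minus_sqr R d ltac:(lra)) as [X0 X1].
  set (qc := sqrt (c ^ 2 - d ^ 2)) in *. set (qR := sqrt (R ^ 2 - d ^ 2)) in *.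
  assert (HXA : (X < A)%R) by (unfold X, A; nra).
  assert (HA : (A < 0)%R) by (unfold A; lra).
  destruct (log_line_end d c Hd) as [E1 E2]. destruct (log_line_end d R ltac:(lra)) as [E3 E4].
  fold qc A th in E1, E2. fold qR X thR in E3, E4.
  destruct (log_line_left d A ltac:(lra) HA) as [T1 _]. rewrite E1 in T1. unfold Im in T1; cbn [snd] in T1.
  destruct (log_line_left d X ltac:(lra) ltac:(lra)) as [T2 _]. rewrite E3 in T2. unfold Im in T2; cbn [snd] in T2.
  (* The legs meet the outer circle nearer to the negative axis in argument, so the outer arc is
     longer than the side of the rectangle; the excess at each end lies in a pole-free strip and is
     evaluated with [Qu] or [Qd]. *)
  assert (T3 : (th < thR)%R).
  { apply (f_equal Im) in E1, E3. unfold log_line, Im in E1, E3; cbn [snd] in E1, E3.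
    assert (atan (X / d) < atan (A / d))%R.
    { apply atan_increasing. unfold Rdiv. apply Rmult_lt_compat_r; auto. apply Rinv_0_lt_compat; lra. }
    lra. }
  assert (Hlc : (ln c1 < ln c)%R) by (apply ln_increasing; lra).
  assert (HlR : (ln c < ln R)%R) by (apply ln_increasing; lra).
  assert (Hre : forall x, (X <= x <= A)%R -> (ln c1 < / 2 * ln (x * x + d * d))%R).
  { intros x Hx. assert ((ln c <= / 2 * ln (x * x + d * d))%R); [|lra].
    apply log_line_re_ge; [lra|]. unfold A in Hx. nra. }
  destruct (strip_primitive (log_integrand p a) (ln c1) (PI / 2) PI ltac:(lra)) as [Qu HQu].
  { intros w W1 W2. apply (cdiff_log_integrand p c1); auto. apply hankel_denom_neq_0; lra. }
  destruct (strip_primitive (log_integrand p a) (ln c1) (- PI) (- (PI / 2)) ltac:(lra)) as [Qd HQd].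
  { intros w W1 W2. apply (cdiff_log_integrand p c1); auto. apply hankel_denom_neq_0; lra. }
  rewrite (line_integral_primitive p c1 a Qu (log_line d) X A (PI / 2) PI); auto; try lra.
  2:{ intros; apply log_line_deriv; lra. }
  2:{ intros x Hx. destruct (log_line_left d x ltac:(lra) ltac:(lra)) as [I1 I2]. split; [|split]; auto.
      - now apply Hre.
      - apply hankel_denom_neq_0; lra. }
  rewrite (line_integral_primitive p c1 a Qd (log_line_conj d) X A (- PI) (- (PI / 2))); auto; try lra.
  2:{ intros; apply log_line_conj_deriv; lra. }
  2:{ intros x Hx. destruct (log_line_left d x ltac:(lra) ltac:(lra)) as [I1 I2]. split; [|split]; auto.
      - now apply Hre.
      - apply hankel_denom_neq_0; lra. }
  rewrite E1, E2, E3, E4.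
  assert (B := bdry_poles p c1 c a n0 th N Hp Hn0 Hc T1 Hin Hout). fold R in B. unfold bdry in B.
  assert (Cr : forall t x, (ln c1 < x)%R -> (PI / 2 < t < PI \/ - PI < t < - (PI / 2))%R ->
    ccont (log_integrand p a) (x, t)).
  { intros t x H1 H2. apply cdiff_ccont, (cdiff_log_integrand p c1); auto.
    apply hankel_denom_neq_0; unfold Im; simpl; lra. }
  rewrite (is_CInt_hline Qu (log_integrand p a) th) in B; [|lra|].
  2:{ intros x Hx. split; [apply HQu; unfold Re, Im; simpl; lra|apply Cr; lra]. }
  rewrite (is_CInt_hline Qd (log_integrand p a) (- th)) in B; [|lra|].
  2:{ intros x Hx. split; [apply HQd; unfold Re, Im; simpl; lra|apply Cr; lra]. }
  assert (V1 := is_CInt_vline Qu (log_integrand p a) (ln R) th thR ltac:(lra)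
     ltac:(intros y Hy; split; [apply HQu; unfold Re, Im; simpl; lra|apply Cr; lra])).
  assert (V2 := is_CInt_vline Qd (log_integrand p a) (ln R) (- thR) (- th) ltac:(lra)
     ltac:(intros y Hy; split; [apply HQd; unfold Re, Im; simpl; lra|apply Cr; lra])).
  assert (CR : forall u v, (- PI < u <= v)%R -> (v < PI)%R -> ccont_on (fun t => log_integrand p a (ln R, t)) u v).
  { intros u v Huv Hv t Ht. rewrite Rmin_left, Rmax_right in Ht by lra.
    apply Ccontinuous_vline, cdiff_ccont, (cdiff_log_integrand p c1); auto; [unfold Re; simpl; lra|].
    intros H0. destruct (hankel_denom_zero (ln R, t) ltac:(unfold Im; simpl; lra) H0) as [_ [m [Hm Em]]].
    unfold Re in Em; cbn [fst] in Em.
    assert (ER : R = (2 * PI * INR m)%R).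
    { apply ln_inv; auto; [lra|]. now apply two_PI_INR_pos. }
    unfold R, outer_radius in ER.
    (* R is an odd multiple of pi, whereas poles have modulus an even multiple. *)
    assert (Ei : (2 * INR (n0 + S N) - 1 = 2 * INR m)%R) by (apply (Rmult_eq_reg_l PI); lra).
    rewrite !INR_IZR_INZ in Ei. rewrite <- !mult_IZR, <- minus_IZR in Ei. apply eq_IZR in Ei. lia. }
  rewrite <- (CInt_Chasles (fun t => log_integrand p a (ln R, t)) (- thR) th thR) by (apply CR; lra).
  rewrite <- (CInt_Chasles (fun t => log_integrand p a (ln R, t)) (- thR) (- th) th) by (apply CR; lra).
  rewrite !Cmult_plus_distr_l, V1, V2.
  set (S := 2 * PI * Ci * Csum _ N) in *.
  replace S with (- (- S)) by ring. rewrite <- B. ring.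
Qed.

(** For |Re z| >= 1 the modulus exp(-Re z) is far from 1. Otherwise |Im z| is within 1 of |z| = (2n
    - 1) pi, so cos(Im z) <= 0 and the real part of exp(-z) - 1 is at most -1. *)
Lemma hankel_denom_circle (w : C) n : (1 <= n)%nat -> exp (Re w) = (2 * PI * INR n - PI)%R ->
  (/ 2 <= Cmod (hankel_denom w))%R.
Proof.
  intros Hn H. pose proof PI_RGT_0 as HPI. pose proof PI2_1 as HPI2.
  unfold hankel_denom. set (z := Cexp w).
  assert (Hz : Cmod z = (2 * PI * INR n - PI)%R) by (unfold z; rewrite Cmod_Cexp; auto).
  assert (E2 : (2 <= exp 1)%R) by (pose proof (exp_ineq1_le 1); lra).
  assert (Hm : Cmod (Cexp (- z)) = exp (- Re z)) by (rewrite Cmod_Cexp; reflexivity).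
  destruct (Rle_dec 1 (Re z)) as [L1|L1].
  { pose proof (Cmod_triangle_rev 1 (Cexp (- z))). rewrite Cmod_1, Cmod_minus_sym, Hm in H0.
    assert (exp (- Re z) <= / 2)%R; [|lra].
    apply Rle_trans with (exp (- (1))); [apply exp_le_le; lra|].
    rewrite exp_Ropp. apply Rinv_le_contravar; lra. }
  destruct (Rle_dec (Re z) (-1)) as [L2|L2].
  { pose proof (Cmod_triangle_rev (Cexp (- z)) 1). rewrite Cmod_1, Hm in H0.
    assert (exp 1 <= exp (- Re z))%R by (apply exp_le_le; lra). lra. }
  assert (Y1 : (Rabs (Im z) <= Cmod z)%R) by apply im_le_Cmod.
  assert (Y2 : (Cmod z - 1 <= Rabs (Im z))%R).
  { pose proof (Cmod_le_Rabs z). assert (Rabs (Re z) <= 1)%R by (apply Rabs_le; lra). lra. }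
  assert (Cy : (cos (Im z) <= 0)%R).
  { replace (cos (Im z)) with (cos (Rabs (Im z))).
    2:{ unfold Rabs. destruct (Rcase_abs (Im z)); auto. apply cos_neg. }
    set (t := (Cmod z - Rabs (Im z))%R).
    replace (Rabs (Im z)) with (- (t + PI) + 2 * INR n * PI)%R by (unfold t; lra).
    rewrite cos_period, cos_neg, neg_cos. assert (0 < cos t)%R by (apply cos_gt_0; unfold t; lra). lra. }
  pose proof (re_le_Cmod (Cexp (- z) - 1)).
  replace (Re (Cexp (- z) - 1)) with (exp (- Re z) * cos (Im z) - 1)%R in H0.
  2:{ unfold Cexp, Re, Im; simpl. rewrite cos_neg. ring. }
  pose proof (exp_pos (- Re z)). rewrite Rabs_left in H0 by nra. nra.
Qed.

(** On the arc |z^a| <= R^(Re a) exp(|a| pi) and 1/|exp(-z) - 1| <= 2; dz contributes R, and the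
    angle is at most 2 pi, whence the constant 4 pi. *)
Lemma outer_arc_bound p c1 a n0 N thR : summable_at p c1 -> (1 <= n0)%nat ->
  (c1 < outer_radius n0 N)%R -> (0 < thR < PI)%R ->
  (Cmod (Ci * CInt (fun t => log_integrand p a (ln (outer_radius n0 N), t)) (- thR) thR) <=
   4 * PI * exp (Cmod a * PI) * Series (dom_term p c1 (Cmod a)) * exp ((Re a + 1) * ln (outer_radius n0 N)))%R.
Proof.
  intros Hp Hn0 Hc Hth. pose proof PI_RGT_0 as HPI.
  set (R := outer_radius n0 N) in *.
  assert (HR : (0 < R)%R) by (pose proof (outer_radius_pos n0 N Hn0); unfold R; lra).
  assert (Hc1 : (0 < c1)%R) by apply Hp.
  assert (Hl : (ln c1 < ln R)%R) by (apply ln_increasing; auto).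
  set (S := Series (dom_term p c1 (Cmod a))).
  assert (HS : (0 <= S)%R) by (apply dom_series_nonneg; auto; apply Cmod_ge_0).
  set (M := (exp (Re a * ln R + Cmod a * PI) * S * R * 2)%R).
  assert (HM0 : (0 <= M)%R).
  { unfold M. repeat apply Rmult_le_pos; try lra. apply Rlt_le, exp_pos. }
  assert (Hdn : forall t, (/ 2 <= Cmod (hankel_denom (ln R, t)))%R).
  { intros t. apply (hankel_denom_circle _ (n0 + N)); [lia|].
    unfold Re; cbn [fst]. rewrite exp_ln by auto. reflexivity. }
  rewrite Cmod_mult, Cmod_Ci, Rmult_1_l.
  apply Rle_trans with (M * (thR - - thR))%R.
  - apply CInt_bound; [lra| |].
    + intros t _. apply Ccontinuous_vline, cdiff_ccont, (cdiff_log_integrand p c1); auto.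
      apply Cmod_gt_0. specialize (Hdn t). lra.
    + intros t Ht. unfold log_integrand. specialize (Hdn t).
      rewrite Cmod_div by (apply Cmod_gt_0; lra). rewrite Cmod_mult, Cmod_Cexp.
      unfold Re at 1; cbn [fst]. rewrite exp_ln by auto.
      assert (B := gen_power_bound p c1 (Cmod a) a (ln R, t) Hp (Rle_refl _) (Rlt_le _ _ Hl)). fold S in B.
      unfold M, Rdiv. apply Rmult_le_compat.
      * apply Rmult_le_pos; [apply Cmod_ge_0|lra].
      * apply Rlt_le, Rinv_0_lt_compat; lra.
      * apply Rmult_le_compat_r; [lra|]. eapply Rle_trans; [exact B|].
        apply Rmult_le_compat_r; auto. apply exp_le_le.
        replace (Re (a * (ln R, t))) with (Re a * ln R - Im a * t)%R by (unfold Re, Im; simpl; ring).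
        pose proof (im_le_Cmod a). 
        assert (Rabs (- (Im a * t)) <= Cmod a * PI)%R.
        { rewrite Rabs_Ropp, Rabs_mult. apply Rmult_le_compat; try apply Rabs_pos; auto. apply Rabs_le; lra. }
        pose proof (Rle_abs (- (Im a * t))). lra.
      * replace 2%R with (/ / 2)%R by field. apply Rinv_le_contravar; lra.
  - apply Rle_trans with (M * (2 * PI))%R; [apply Rmult_le_compat_l; lra|].
    right. unfold M. rewrite Rmult_plus_distr_r, !exp_plus, Rmult_1_l, exp_ln by auto. ring.
Qed.

(** * The Hankel integral *)

Lemma ln_le_minus_1 (t : R) : (0 < t)%R -> (ln t <= t - 1)%R.
Proof. intros Ht. pose proof (exp_ineq1_le (ln t)). rewrite exp_ln in H; lra. Qed.

(** This is ln v <= v - 1 at v = u/(2(M+1)). The coefficient 1/2 of u lets a power of |z| consume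
    only half of the exponential decay on the legs. *)
Lemma ln_linear_bound (M u : R) : (0 <= M)%R -> (0 < u)%R ->
  (M * ln u <= u / 2 + M * Rabs (ln (2 * (M + 1))))%R.
Proof.
  intros HM Hu.
  pose proof (ln_le_minus_1 (u / (2 * (M + 1))) ltac:(apply Rdiv_lt_0_compat; lra)).
  rewrite ln_div in H by lra. pose proof (Rle_abs (ln (2 * (M + 1)))).
  assert (M * (u / (2 * (M + 1))) <= u / 2)%R.
  { apply (Rmult_le_reg_r (2 * (M + 1))); [lra|].
    replace (M * (u / (2 * (M + 1))) * (2 * (M + 1)))%R with (M * u)%R by (field; lra). nra. }
  nra.
Qed.

(** The denominator is at least exp(-x) (1 - exp A), while the generalised power is at most a
    constant times exp(M |w|), with M |w| <= -x/2 + K0; the quotient is O(exp(x/2)), uniformly for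
    |a| <= M. *)
Lemma integrand_line_bound p c1 c d A M : summable_at p c1 -> (0 < c1 < c)%R -> (0 < d)%R ->
  (A < 0)%R -> (c * c <= A * A + d * d)%R -> (0 <= M)%R ->
  exists K, (0 <= K)%R /\ forall a, (Cmod a <= M)%R -> forall x, (x <= A)%R ->
   (Cmod (integrand p a (log_line d x)) <= K * exp (x / 2))%R /\
   (Cmod (integrand p a (log_line_conj d x)) <= K * exp (x / 2))%R.
Proof.
  intros Hp Hc Hd HA HcA HM. pose proof PI_RGT_0 as HPI.
  set (S := Series (dom_term p c1 M)).
  assert (HS : (0 <= S)%R) by (apply dom_series_nonneg; auto).
  assert (HeA : (exp A < 1)%R) by (rewrite <- exp_0; apply exp_increasing; auto).
  (* The bounded part of M |w|: the offset d in |z| <= -x + d, the constant of [ln_linear_bound],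
     the bound ln c when Re w is negative, and |Im w| <= pi. *)
  set (K0 := (d / 2 + M * (Rabs (ln (2 * (M + 1))) + Rabs (ln c) + PI))%R).
  exists (exp K0 * S * / (1 - exp A))%R.
  split.
  { repeat apply Rmult_le_pos; auto; [apply Rlt_le, exp_pos|apply Rlt_le, Rinv_0_lt_compat; lra]. }
  assert (Main : forall a w x y, (Cmod a <= M)%R -> (x <= A)%R ->
    Re w = (/ 2 * ln (x * x + d * d))%R -> (Rabs (Im w) <= PI)%R -> Cexp w = (x, y) ->
    (Cmod (integrand p a w) <= exp K0 * S * / (1 - exp A) * exp (x / 2))%R).
  { intros a w x y Ha Hx Hre Him Hw.
    assert (Hcx : (c * c <= x * x + d * d)%R) by nra.
    assert (L1 : (ln c <= Re w)%R) by (rewrite Hre; apply log_line_re_ge; lra).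
    assert (Hlc : (ln c1 < ln c)%R) by (apply ln_increasing; lra).
    assert (B := gen_power_bound p c1 M a w Hp Ha ltac:(lra)). fold S in B.
    assert (L2 : (Re w <= ln (- x + d))%R).
    { rewrite Hre. apply Rle_trans with (/ 2 * ln ((- x + d) * (- x + d)))%R.
      - apply Rmult_le_compat_l; [lra|]. apply ln_le; nra.
      - rewrite ln_mult by lra. right; field. }
    assert (W : (M * Cmod w <= - x / 2 + K0)%R).
    { assert (M * Rabs (Re w) <= (- x + d) / 2 + M * (Rabs (ln (2 * (M + 1))) + Rabs (ln c)))%R.
      { pose proof (Rabs_pos (ln (2 * (M + 1)))). pose proof (Rabs_pos (ln c)).
        unfold Rabs at 1. destruct (Rcase_abs (Re w)).
        - pose proof (Rle_abs (- ln c)). rewrite Rabs_Ropp in H1. nra.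
        - pose proof (ln_linear_bound M (- x + d) HM ltac:(lra)). nra. }
      pose proof (Cmod_le_Rabs w). unfold K0. nra. }
    assert (D : (exp (- x) * (1 - exp A) <= Cmod (hankel_denom w))%R).
    { unfold hankel_denom. pose proof (Cmod_triangle_rev (Cexp (- Cexp w)) 1).
      rewrite Cmod_1, Cmod_Cexp in H. replace (Re (- Cexp w)) with (- x)%R in H by (rewrite Hw; reflexivity).
      assert (exp (- x) * exp A >= 1)%R.
      { rewrite <- exp_plus, <- exp_0. apply Rle_ge, exp_le_le. lra. }
      lra. }
    assert (Pd : (0 < exp (- x) * (1 - exp A))%R) by (apply Rmult_lt_0_compat; [apply exp_pos|lra]).
    unfold integrand. rewrite Cmod_div by (apply Cmod_gt_0; lra).
    apply Rle_trans with (exp (- x / 2 + K0) * S * / (exp (- x) * (1 - exp A)))%R.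
    - unfold Rdiv. apply Rmult_le_compat.
      + apply Cmod_ge_0.
      + apply Rlt_le, Rinv_0_lt_compat; lra.
      + eapply Rle_trans; [exact B|]. apply Rmult_le_compat_r; auto. apply exp_le_le.
        eapply Rle_trans; [apply Re_mult_le|]. pose proof (Cmod_ge_0 w). 
        apply Rle_trans with (M * Cmod w)%R; [apply Rmult_le_compat_r; auto|exact W].
      + apply Rinv_le_contravar; auto.
    - right. rewrite exp_plus. rewrite Rinv_mult, exp_Ropp, Rinv_inv.
      replace (exp (- x / 2) * exp K0 * S * (exp x * / (1 - exp A)))%R with
        (exp K0 * S * / (1 - exp A) * (exp (- x / 2) * exp x))%R by ring.
      rewrite <- exp_plus. f_equal. f_equal. field. }
  intros a Ha x Hx. destruct (log_line_range d x Hd) as [I1 I2].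
  split; eapply Main; eauto; try reflexivity.
  - apply Rabs_le; lra.
  - now apply Cexp_log_line.
  - apply Rabs_le; lra.
  - now apply Cexp_log_line_conj.
Qed.

(** c1 is a radius below c at which the generalised powers still converge, so the contour lies in
    the interior of their domain; n0 is the index of the first pole outside the circle |z| = c. *)
Record contour_data (p : nat -> C) (c1 c d : R) (n0 : nat) : Prop := {
  cd_summable : summable_at p c1;
  cd_n0 : (1 <= n0)%nat;
  cd_c1 : (0 < c1 < c)%R;
  cd_d : (0 < d < c)%R;
  cd_in : forall m, (1 <= m)%nat -> (m < n0)%nat -> (2 * PI * INR m < c)%R;
  cd_out : (c < 2 * PI * INR n0)%R }.

Definition left_end (c d : R) : R := (- sqrt (c ^ 2 - d ^ 2))%R.

Lemma left_end_spec c d : (0 < d < c)%R -> (left_end c d < 0)%R /\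
  (c * c <= left_end c d * left_end c d + d * d)%R.
Proof.
  intros H. destruct (sqrt_minus_sqr c d H). unfold left_end. rewrite Rmult_opp_opp. lra.
Qed.

Lemma integrand_line_cdiff p c1 c d n0 a x : contour_data p c1 c d n0 -> (x <= left_end c d)%R ->
  cdiff (integrand p a) (log_line d x) /\ cdiff (integrand p a) (log_line_conj d x).
Proof.
  intros [Hp Hn0 Hc Hd Hin Hout] Hx. destruct (left_end_spec c d Hd) as [L1 L2].
  destruct (log_line_left d x ltac:(lra) ltac:(lra)) as [I1 I2].
  assert (Hlc : (ln c1 < ln c)%R) by (apply ln_increasing; lra).
  assert (Hre : (ln c <= / 2 * ln (x * x + d * d))%R) by (apply log_line_re_ge; nra).
  split; (apply (cdiff_integrand p c1); auto; [unfold Re; cbn; lra|apply hankel_denom_neq_0; lra]).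
Qed.

Lemma integrand_line_cont p c1 c d n0 a x : contour_data p c1 c d n0 -> (x <= left_end c d)%R ->
  Ccontinuous (fun x => integrand p a (log_line d x)) x /\
  Ccontinuous (fun x => integrand p a (log_line_conj d x)) x.
Proof.
  intros H Hx. destruct (integrand_line_cdiff p c1 c d n0 a x H Hx) as [D1 D2].
  assert (Hd : (0 < d)%R) by apply H.
  split; apply Ccontinuous_comp; try (now apply cdiff_ccont); eapply is_rderiv_continuous.
  - now apply log_line_deriv.
  - now apply log_line_conj_deriv.
Qed.

Definition arc_integral (p : nat -> C) (c d : R) (a : C) : C :=
  Ci * CInt (fun t => log_integrand p a (ln c, t)) (- (PI - asin (d / c))) (PI - asin (d / c)).

Lemma arc_denom p c1 c d n0 t : contour_data p c1 c d n0 -> (- PI < t < PI)%R ->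
  hankel_denom (ln c, t) <> 0.
Proof.
  intros [Hp Hn0 Hc Hd Hin Hout] Ht H0.
  destruct (hankel_denom_zero (ln c, t) Ht H0) as [_ [m [Hm Em]]].
  unfold Re in Em; cbn [fst] in Em. apply ln_inv in Em; [|lra|now apply two_PI_INR_pos].
  destruct (le_lt_dec n0 m) as [L|L].
  - apply le_INR in L. pose proof PI_RGT_0. nra.
  - specialize (Hin m Hm L). lra.
Qed.

Lemma arc_cdiff p c1 c d n0 a t : contour_data p c1 c d n0 -> (- PI < t < PI)%R ->
  cdiff (log_integrand p a) (ln c, t).
Proof.
  intros H Ht. apply (cdiff_log_integrand p c1); [apply H| |now apply (arc_denom p c1 c d n0)].
  destruct (cd_c1 _ _ _ _ _ H). apply ln_increasing; auto.
Qed.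

Definition hankel_log (p : nat -> C) (c d : R) (a : C) : C :=
  RInt_gen (V := C_R_CompleteNormedModule) (fun x => integrand p a (log_line_conj d x))
     (Rbar_locally m_infty) (at_point (left_end c d))
  + arc_integral p c d a
  - RInt_gen (V := C_R_CompleteNormedModule) (fun x => integrand p a (log_line d x))
     (Rbar_locally m_infty) (at_point (left_end c d)).

(** The arc and both legs avoid the cut, so along them the principal logarithm inverts [Cexp] and
    the integrands agree pointwise. *)
Lemma hankel_int_log (h : C -> C) (c1 c d : R) (n0 : nat) (a : C) : contour_data (P_ h) c1 c d n0 ->
  hankel_int c d (fun z => gpower h z a / (Cexp (- z) - 1)) = hankel_log (P_ h) c d a.
Proof.
  intros H. assert (Hd := cd_d _ _ _ _ _ H). pose proof PI_RGT_0 as HPI.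
  assert (E : forall w, (- PI < Im w < PI)%R -> gpower h (Cexp w) a / (Cexp (- Cexp w) - 1) = integrand (P_ h) a w).
  { intros w Hw. unfold integrand, hankel_denom. now rewrite gpower_exp. }
  unfold hankel_int, hankel_log. fold (left_end c d).
  assert (E1 : forall x, gpower h (x, (- d)%R) a / (Cexp (- ((x, (- d)%R) : C)) - 1) =
     integrand (P_ h) a (log_line_conj d x)).
  { intros x. rewrite <- E by (pose proof (log_line_range d x ltac:(lra)); lra).
    now rewrite Cexp_log_line_conj by lra. }
  assert (E2 : forall x, gpower h (x, d) a / (Cexp (- ((x, d) : C)) - 1) =
     integrand (P_ h) a (log_line d x)).
  { intros x. rewrite <- E by (pose proof (log_line_range d x ltac:(lra)); lra).
    now rewrite Cexp_log_line by lra. }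
  destruct (log_line_end d c Hd) as [L _]. destruct (left_end_spec c d Hd) as [A0 _].
  destruct (log_line_left d (left_end c d) ltac:(lra) A0) as [T _].
  unfold left_end in T. rewrite L in T. unfold Im in T; cbn [snd] in T.
  f_equal; [f_equal|f_equal].
  - apply (f_equal (fun g => RInt_gen (V := C_R_CompleteNormedModule) g _ _)). apply functional_extensionality, E1.
  - unfold arc_integral. set (th := (PI - asin (d / c))%R) in *.
    transitivity (CInt (fun t => Ci * log_integrand (P_ h) a (ln c, t)) (- th) th).
    + apply CInt_ext. intros t Ht. rewrite Rmin_left, Rmax_right in Ht by lra.
      rewrite <- (Cmult_assoc Ci), Cexp_polar by lra.
      rewrite E by (unfold Im; cbn [snd]; lra). rewrite log_integrand_eq. ring.
    + apply CInt_scal. intros t Ht. rewrite Rmin_left, Rmax_right in Ht by lra.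
      apply Ccontinuous_vline, cdiff_ccont, (arc_cdiff _ c1 c d n0); auto. lra.
  - apply functional_extensionality, E2.
Qed.

Lemma exp_small (e : R) : (0 < e)%R -> exists B, forall y, (y <= B)%R -> (exp y < e)%R.
Proof.
  intros He. exists (ln (e / 2)). intros y Hy. apply Rle_lt_trans with (e / 2)%R; [|lra].
  rewrite <- (exp_ln (e / 2)) by lra. now apply exp_le_le.
Qed.

(** The tail estimates give convergence of the truncated legs, and the two plain bounds by K give
    the uniform boundedness under which holomorphy passes to the limit. *)
Lemma line_improper p c1 c d n0 M : contour_data p c1 c d n0 -> (0 <= M)%R ->
  exists K, (0 <= K)%R /\ forall a, (Cmod a <= M)%R -> forall x, (x <= left_end c d)%R ->
   (Cmod (CInt (fun x => integrand p a (log_line d x)) x (left_end c d) -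
      RInt_gen (V := C_R_CompleteNormedModule) (fun x => integrand p a (log_line d x))
     (Rbar_locally m_infty) (at_point (left_end c d))) <= K * exp (x / 2))%R /\
   (Cmod (CInt (fun x => integrand p a (log_line_conj d x)) x (left_end c d) -
      RInt_gen (V := C_R_CompleteNormedModule) (fun x => integrand p a (log_line_conj d x))
     (Rbar_locally m_infty) (at_point (left_end c d))) <= K * exp (x / 2))%R /\
   (Cmod (CInt (fun x => integrand p a (log_line d x)) x (left_end c d)) <= K)%R /\
   (Cmod (CInt (fun x => integrand p a (log_line_conj d x)) x (left_end c d)) <= K)%R.
Proof.
  intros H HM. destruct (left_end_spec c d (cd_d _ _ _ _ _ H)) as [A0 A1].
  destruct (integrand_line_bound p c1 c d (left_end c d) M (cd_summable _ _ _ _ _ H)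
    (cd_c1 _ _ _ _ _ H) (proj1 (cd_d _ _ _ _ _ H)) A0 A1 HM) as [K [HK HB]].
  exists (2 * K)%R. split; [lra|]. intros a Ha.
  assert (C1 : forall t, (t <= left_end c d)%R -> Ccontinuous (fun x => integrand p a (log_line d x)) t).
  { intros t Ht. exact (proj1 (integrand_line_cont p c1 c d n0 a t H Ht)). }
  assert (C2 : forall t, (t <= left_end c d)%R -> Ccontinuous (fun x => integrand p a (log_line_conj d x)) t).
  { intros t Ht. exact (proj2 (integrand_line_cont p c1 c d n0 a t H Ht)). }
  destruct (improper_CInt (fun x => integrand p a (log_line d x)) K (left_end c d) C1
    (fun t Ht => proj1 (HB a Ha t Ht))) as [l1 [E1 B1]].
  destruct (improper_CInt (fun x => integrand p a (log_line_conj d x)) K (left_end c d) C2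
    (fun t Ht => proj2 (HB a Ha t Ht))) as [l2 [E2 B2]].
  intros x Hx. rewrite E1, E2. split; [now apply B1|]. split; [now apply B2|].
  assert (Q : (2 * K * exp (left_end c d / 2) <= 2 * K)%R).
  { assert (exp (left_end c d / 2) <= 1)%R by (rewrite <- exp_0; apply exp_le_le; lra). nra. }
  split; (eapply Rle_trans; [|exact Q]).
  - apply (CInt_exp_bound _ K (left_end c d)); auto; [lra|]. intros t Ht; exact (proj1 (HB a Ha t Ht)).
  - apply (CInt_exp_bound _ K (left_end c d)); auto; [lra|]. intros t Ht; exact (proj2 (HB a Ha t Ht)).
Qed.

(** Let R tend to infinity in [hankel_truncated]: the legs converge, and the outer arc is O(R^(Re a
    + 1)), which tends to 0 since Re a < -1. *)
Theorem hankel_residues p c1 c d n0 a : contour_data p c1 c d n0 -> (Re a < -1)%R ->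
  is_Clim (fun N => 2 * PI * Ci *
     Csum (fun j => gen_power p a (pole_up (n0 + j)) + gen_power p a (pole_down (n0 + j))) N)
   (hankel_log p c d a).
Proof.
  intros H Ha. assert (Hd := cd_d _ _ _ _ _ H). assert (Hc := cd_c1 _ _ _ _ _ H).
  assert (Hn0 := cd_n0 _ _ _ _ _ H). assert (Ho := cd_out _ _ _ _ _ H).
  pose proof PI_RGT_0 as HPI. pose proof PI2_1 as HPI2.
  destruct (line_improper p c1 c d n0 (Cmod a) H (Cmod_ge_0 a)) as [K [HK HB]].
  specialize (HB a (Rle_refl _)).
  set (K2 := (4 * PI * exp (Cmod a * PI) * Series (dom_term p c1 (Cmod a)))%R).
  assert (HK2 : (0 <= K2)%R).
  { unfold K2. apply Rmult_le_pos.
    - apply Rmult_le_pos; [lra|apply Rlt_le, exp_pos].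
    - apply dom_series_nonneg; [apply H|apply Cmod_ge_0]. }
  intros e He.
  destruct (exp_small (e / (4 * (K + 1)))) as [B1 HB1]; [apply Rdiv_lt_0_compat; lra|].
  destruct (exp_small (e / (4 * (K2 + 1)))) as [B2 HB2]; [apply Rdiv_lt_0_compat; lra|].
  (* The leg starts at a point not exceeding d - R <= d - N, so N >= d - 2 B1 puts half of it below
     B1. *)
  destruct (INR_large (d - 2 * B1)) as [N1 HN1].
  (* As Re a + 1 is negative, R >= exp(B2/(Re a + 1)) forces (Re a + 1) ln R <= B2. *)
  destruct (INR_large (exp (B2 / (Re a + 1)))) as [N2 HN2].
  exists (N1 + N2)%nat. intros N HN. specialize (HN1 N ltac:(lia)). specialize (HN2 N ltac:(lia)).
  assert (T := hankel_truncated p c1 c d a n0 N (cd_summable _ _ _ _ _ H) Hn0 Hc Hd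
     (cd_in _ _ _ _ _ H) Ho). cbv zeta in T.
  set (R := outer_radius n0 (S N)) in *.
  assert (HcR : (c < R)%R).
  { unfold R, outer_radius. rewrite plus_INR, S_INR. pose proof (pos_INR N). nra. }
  assert (HRN : (INR N <= R)%R).
  { unfold R, outer_radius. rewrite plus_INR, S_INR. pose proof (pos_INR N). pose proof (pos_INR n0). nra. }
  fold (left_end c d) in T. fold (left_end R d) in T.
  destruct (sqrt_minus_sqr R d ltac:(lra)) as [X0 X1].
  assert (HX : (left_end R d <= d - R)%R) by (unfold left_end; nra).
  assert (HXA : (left_end R d <= left_end c d)%R).
  { destruct (sqrt_minus_sqr c d Hd) as [Y0 Y1]. unfold left_end. nra. }
  destruct (HB _ HXA) as [U1 [U2 _]].
  assert (S1 : (K * exp (left_end R d / 2) <= e / 4)%R).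
  { assert (exp (left_end R d / 2) < e / (4 * (K + 1)))%R by (apply HB1; lra).
    pose proof (exp_pos (left_end R d / 2)).
    apply (Rmult_lt_compat_r (K + 1)) in H0; [|lra].
    replace (e / (4 * (K + 1)) * (K + 1))%R with (e / 4)%R in H0 by (field; lra). nra. }
  destruct (log_line_end d R ltac:(lra)) as [L _]. fold (left_end R d) in L.
  destruct (left_end_spec R d ltac:(lra)) as [XN _].
  destruct (log_line_left d (left_end R d) ltac:(lra) XN) as [TT _]. rewrite L in TT.
  unfold Im in TT; cbn [snd] in TT.
  assert (O := outer_arc_bound p c1 a n0 (S N) (PI - asin (d / R)) (cd_summable _ _ _ _ _ H) Hn0
    ltac:(fold R; lra) ltac:(lra)). fold R K2 in O.
  assert (S2 : (K2 * exp ((Re a + 1) * ln R) <= e / 4)%R).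
  { assert (exp ((Re a + 1) * ln R) < e / (4 * (K2 + 1)))%R.
    { apply HB2. assert (B2 / (Re a + 1) <= ln R)%R.
      { rewrite <- (ln_exp (B2 / (Re a + 1))). apply ln_le; [apply exp_pos|lra]. }
      assert (Eq : ((Re a + 1) * (B2 / (Re a + 1)) = B2)%R) by (field; lra). nra. }
    pose proof (exp_pos ((Re a + 1) * ln R)).
    apply (Rmult_lt_compat_r (K2 + 1)) in H0; [|lra].
    replace (e / (4 * (K2 + 1)) * (K2 + 1))%R with (e / 4)%R in H0 by (field; lra). nra. }
  unfold hankel_log, arc_integral.
  set (I1 := RInt_gen (V := C_R_CompleteNormedModule) (fun x => integrand p a (log_line_conj d x)) _ _) in *.
  set (I2 := RInt_gen (V := C_R_CompleteNormedModule) (fun x => integrand p a (log_line d x)) _ _) in *.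
  set (J := CInt (fun t => log_integrand p a (ln c, t)) _ _) in *.
  set (J2 := Ci * CInt (fun t => log_integrand p a (ln R, t)) _ _) in *.
  set (Sm := 2 * PI * Ci * Csum _ N) in *.
  replace Sm with (CInt (fun x => integrand p a (log_line_conj d x)) (left_end R d) (left_end c d) +
     Ci * J - CInt (fun x => integrand p a (log_line d x)) (left_end R d) (left_end c d) - J2)
    by (rewrite T; ring).
  set (V1 := CInt (fun x => integrand p a (log_line_conj d x)) (left_end R d) (left_end c d)) in *.
  set (V2 := CInt (fun x => integrand p a (log_line d x)) (left_end R d) (left_end c d)) in *.
  replace (V1 + Ci * J - V2 - J2 - (I1 + Ci * J - I2)) with ((V1 - I1) + - (V2 - I2) + - J2) by ring.
  eapply Rle_lt_trans; [apply Cmod_triangle|].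
  eapply Rle_lt_trans; [apply Rplus_le_compat_r, Cmod_triangle|]. rewrite !Cmod_opp. lra.
Qed.

(** The arc is a proper integral. Each leg is the limit of its truncations, which are holomorphic in
    a and bounded by one K on a square, so [cdiff_bounded_limit] applies and no improper integral is
    differentiated. *)
Theorem cdiff_hankel_log p c1 c d n0 a : contour_data p c1 c d n0 -> cdiff (hankel_log p c d) a.
Proof.
  intros H. assert (Hd := cd_d _ _ _ _ _ H). assert (Hc := cd_c1 _ _ _ _ _ H).
  pose proof PI_RGT_0 as HPI. pose proof (Cmod_ge_0 a) as Pa.
  assert (Hlc : (ln c1 < ln c)%R) by (apply ln_increasing; lra).
  set (M := (Cmod a + 2 * 1)%R).
  assert (HM : (0 <= M)%R) by (unfold M; lra).
  destruct (left_end_spec c d Hd) as [A0 A1].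
  destruct (line_improper p c1 c d n0 M H HM) as [K [HK HB]].
  destruct (integrand_line_bound p c1 c d (left_end c d) M (cd_summable _ _ _ _ _ H)
    Hc (proj1 Hd) A0 A1 HM) as [K' [HK' HB']].
  assert (Diff : forall w b, (ln c1 < Re w)%R -> hankel_denom w <> 0 -> cdiff (fun b => integrand p b w) b).
  { intros w b Hw Hn. apply (cdiff_mult (fun b => gen_power p b w)); [|apply cdiff_const].
    apply (cdiff_gen_power_a p c1); [apply H|lra]. }
  assert (LN : forall x, (x <= left_end c d)%R ->
     ((ln c1 < Re (log_line d x))%R /\ hankel_denom (log_line d x) <> 0) /\
     ((ln c1 < Re (log_line_conj d x))%R /\ hankel_denom (log_line_conj d x) <> 0)).
  { intros x Hx. destruct (log_line_left d x ltac:(lra) ltac:(lra)) as [I1 I2].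
    assert (Hre : (ln c <= / 2 * ln (x * x + d * d))%R) by (apply log_line_re_ge; nra).
    repeat split; try (unfold Re; cbn; lra); apply hankel_denom_neq_0; lra. }
  assert (Line : forall l : R -> C,
    (forall x, (x <= left_end c d)%R -> (ln c1 < Re (l x))%R /\ hankel_denom (l x) <> 0) ->
    (forall b x, (x <= left_end c d)%R -> Ccontinuous (fun x => integrand p b (l x)) x) ->
    (forall b, (Cmod b <= M)%R -> forall x, (x <= left_end c d)%R ->
      (Cmod (CInt (fun x => integrand p b (l x)) x (left_end c d) -
      RInt_gen (V := C_R_CompleteNormedModule) (fun x => integrand p b (l x))
     (Rbar_locally m_infty) (at_point (left_end c d))) <= K * exp (x / 2))%R /\
      (Cmod (CInt (fun x => integrand p b (l x)) x (left_end c d)) <= K)%R /\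
      (Cmod (integrand p b (l x)) <= K' * exp (x / 2))%R) ->
    cdiff (fun b => RInt_gen (V := C_R_CompleteNormedModule) (fun x => integrand p b (l x))
     (Rbar_locally m_infty) (at_point (left_end c d))) a).
  { intros l L1 L2 L3.
    (* The square of half-side 1/2 about a, and those of half-side 1/4 about its points, stay in |b|
       <= M = |a| + 2. *)
    apply (cdiff_bounded_limit (fun n b => CInt (fun x => integrand p b (l x)) (left_end c d - INR n) (left_end c d))
      _ a (1/2) K); [lra| | |].
    - intros n x y X Y. pose proof (pos_INR n).
      apply (cdiff_CInt (fun b t => integrand p b (l t)) _ _ (x, y) (1/4) K'); try lra.
      + intros t Ht u v U V. destruct (L1 t ltac:(lra)). now apply Diff.
      + intros u v U V t Ht. rewrite Rmin_left, Rmax_right in Ht by lra. apply (L2 (u, v) t); lra.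
      + intros t Ht u v U V.
        assert (Q : (Cmod (u, v) <= M)%R).
        { unfold M. apply square_Cmod; unfold Re, Im in *; simpl in *; lra. }
        destruct (L3 _ Q t ltac:(lra)) as [_ [_ Q2]]. eapply Rle_trans; [exact Q2|].
        assert (exp (t / 2) <= 1)%R by (rewrite <- exp_0; apply exp_le_le; lra). nra.
    - intros n x y X Y. pose proof (pos_INR n).
      assert (Q : (Cmod (x, y) <= M)%R) by (unfold M; apply square_Cmod; lra).
      destruct (L3 _ Q (left_end c d - INR n)%R ltac:(lra)) as [_ [Q2 _]]. exact Q2.
    - intros x y X Y e He.
      assert (Hb : (Cmod (x, y) <= M)%R) by (unfold M; apply square_Cmod; lra).
      destruct (exp_small (e / (K + 1))) as [B HBB]; [apply Rdiv_lt_0_compat; lra|].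
      destruct (INR_large (- 2 * B)) as [N HN]. exists N. intros n Hn. specialize (HN n Hn).
      pose proof (pos_INR n). 
      destruct (L3 _ Hb (left_end c d - INR n)%R ltac:(lra)) as [Q2 _].
      eapply Rle_lt_trans; [exact Q2|].
      assert (exp ((left_end c d - INR n) / 2) < e / (K + 1))%R by (apply HBB; lra).
      pose proof (exp_pos ((left_end c d - INR n) / 2)).
      apply (Rmult_lt_compat_r (K + 1)) in H1; [|lra].
      replace (e / (K + 1) * (K + 1))%R with e in H1 by (field; lra). nra. }
  unfold hankel_log. apply cdiff_minus; [apply cdiff_plus|].
  - apply Line.
    + intros x Hx. exact (proj2 (LN x Hx)).
    + intros b x Hx. exact (proj2 (integrand_line_cont p c1 c d n0 b x H Hx)).
    + intros b Hb x Hx. destruct (HB b Hb x Hx) as [_ [Q1 [_ Q2]]]. split; [exact Q1|]. split; [exact Q2|].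
      exact (proj2 (HB' b Hb x Hx)).
  - unfold arc_integral. apply (cdiff_mult (fun _ => Ci)); [apply cdiff_const|].
    set (th := (PI - asin (d / c))%R).
    destruct (log_line_end d c Hd) as [L _].
    destruct (log_line_left d (left_end c d) ltac:(lra) A0) as [T _].
    unfold left_end in T. rewrite L in T. unfold Im in T; cbn [snd] in T. fold th in T.
    destruct (ccont_on_bounded (fun t => Cexp (ln c, t) * / hankel_denom (ln c, t)) (- th) th) as [B HBd]; [lra| |].
    { intros t Ht. rewrite Rmin_left, Rmax_right in Ht by lra.
      apply (Ccontinuous_vline (fun w => Cexp w * / hankel_denom w)), cdiff_ccont.
      apply (cdiff_div Cexp hankel_denom); [|eexists; apply is_cderiv_exp|eexists; apply is_cderiv_hankel_denom].
      apply (arc_denom p c1 c d n0); auto; lra. }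
    apply (cdiff_CInt (fun b t => log_integrand p b (ln c, t)) _ _ a 1
      (exp (M * (Rabs (ln c) + PI)) * Series (dom_term p c1 M) * B)); try lra.
    + intros t Ht u v U V. unfold log_integrand.
      apply (cdiff_mult (fun b => gen_power p b (ln c, t) * Cexp (ln c, t))); [|apply cdiff_const].
      apply (cdiff_mult (fun b => gen_power p b (ln c, t))); [|apply cdiff_const].
      apply (cdiff_gen_power_a p c1); [apply H|unfold Re; cbn; lra].
    + intros u v U V t Ht. rewrite Rmin_left, Rmax_right in Ht by lra.
      apply Ccontinuous_vline, cdiff_ccont, (arc_cdiff _ c1 c d n0); auto. lra.
    + intros t Ht u v U V. assert (Q := square_Cmod a 1 u v ltac:(lra) U V). fold M in Q.
      unfold log_integrand, Cdiv. rewrite <- Cmult_assoc, Cmod_mult.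
      apply Rmult_le_compat; try apply Cmod_ge_0; [|now apply HBd].
      eapply Rle_trans; [apply (gen_power_bound p c1 M); [apply H|auto|unfold Re; cbn; lra]|].
      apply Rmult_le_compat_r; [apply dom_series_nonneg; auto; apply H|].
      apply exp_le_le. eapply Rle_trans; [apply Re_mult_le|].
      apply Rmult_le_compat; try apply Cmod_ge_0; auto.
      eapply Rle_trans; [apply Cmod_le_Rabs|]. unfold Re, Im; cbn [fst snd].
      apply Rplus_le_compat_l, Rabs_le. lra.
  - apply Line.
    + intros x Hx. exact (proj1 (LN x Hx)).
    + intros b x Hx. exact (proj1 (integrand_line_cont p c1 c d n0 b x H Hx)).
    + intros b Hb x Hx. destruct (HB b Hb x Hx) as [Q1 [_ [Q2 _]]]. split; [exact Q1|]. split; [exact Q2|].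
      exact (proj1 (HB' b Hb x Hx)).
Qed.

(** * The sine product *)

Definition Csin (z : C) : C := (Cexp (Ci * z) - Cexp (- (Ci * z))) / (2 * Ci).

Lemma Ci_sqr : Ci * Ci = - (1).
Proof. C_parts; ring. Qed.

Lemma is_cderiv_scal c f z D : is_cderiv f z D -> is_cderiv (fun w => c * f w) z (c * D).
Proof.
  intros H. replace (c * D) with (0 * f z + c * D) by ring.
  apply (is_cderiv_mult (fun _ => c)); auto. apply is_cderiv_const.
Qed.

Lemma is_cderiv_exp_lin c z : is_cderiv (fun w => Cexp (c * w)) z (c * Cexp (c * z)).
Proof.
  rewrite Cmult_comm. apply (is_cderiv_comp Cexp (fun w => c * w)); [|apply is_cderiv_exp].
  pose proof (is_cderiv_scal c (fun w => w) z 1 (is_cderiv_id z)) as H.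
  now rewrite Cmult_1_r in H.
Qed.

Lemma C2_neq_0 : RtoC 2 <> 0.
Proof. intros E. apply (f_equal Re) in E. unfold Re in E; simpl in E. lra. Qed.

Lemma is_cderiv_cos_lin c z : is_cderiv (fun w => Ccos (c * w)) z (- c * Csin (c * z)).
Proof.
  apply (is_cderiv_ext (fun w => / 2 * (Cexp (Ci * c * w) + Cexp (- (Ci * c) * w)))).
  { intros w. unfold Ccos. replace (Ci * (c * w)) with (Ci * c * w) by ring.
    replace (- (Ci * c * w)) with (- (Ci * c) * w) by ring. unfold Cdiv. ring. }
  replace (- c * Csin (c * z)) with (/ 2 * (Ci * c * Cexp (Ci * c * z) + - (Ci * c) * Cexp (- (Ci * c) * z))).
  - apply is_cderiv_scal, is_cderiv_plus; apply is_cderiv_exp_lin.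
  - unfold Csin. replace (Ci * (c * z)) with (Ci * c * z) by ring.
    replace (- (Ci * c * z)) with (- (Ci * c) * z) by ring.
    transitivity (- (Ci * Ci) * - c * ((Cexp (Ci * c * z) - Cexp (- (Ci * c) * z)) / (2 * Ci))).
    + field. apply Ci_nz.
    + rewrite Ci_sqr. ring.
Qed.

Lemma is_cderiv_sin_lin c z : is_cderiv (fun w => Csin (c * w)) z (c * Ccos (c * z)).
Proof.
  apply (is_cderiv_ext (fun w => / (2 * Ci) * (Cexp (Ci * c * w) + - (1) * Cexp (- (Ci * c) * w)))).
  { intros w. unfold Csin. replace (Ci * (c * w)) with (Ci * c * w) by ring.
    replace (- (Ci * c * w)) with (- (Ci * c) * w) by ring. unfold Cdiv. ring. }
  replace (c * Ccos (c * z)) with (/ (2 * Ci) * (Ci * c * Cexp (Ci * c * z) +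
    - (1) * (- (Ci * c) * Cexp (- (Ci * c) * z)))).
  - apply is_cderiv_scal, is_cderiv_plus; [|apply is_cderiv_scal]; apply is_cderiv_exp_lin.
  - unfold Ccos. replace (Ci * (c * z)) with (Ci * c * z) by ring.
    replace (- (Ci * c * z)) with (- (Ci * c) * z) by ring. field. apply Ci_nz.
Qed.

Lemma Ccos_RtoC (x : R) : Ccos x = cos x.
Proof.
  unfold Ccos, Cexp. replace (Re (Ci * x)) with 0%R by (unfold Re; simpl; ring).
  replace (Im (Ci * x)) with x by (unfold Im; simpl; ring).
  replace (Re (- (Ci * x))) with 0%R by (unfold Re; simpl; ring).
  replace (Im (- (Ci * x))) with (- x)%R by (unfold Im; simpl; ring).
  rewrite exp_0, cos_neg, sin_neg. C_parts; field.
Qed.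

Lemma Csin_RtoC (x : R) : Csin x = sin x.
Proof.
  unfold Csin, Cexp. replace (Re (Ci * x)) with 0%R by (unfold Re; simpl; ring).
  replace (Im (Ci * x)) with x by (unfold Im; simpl; ring).
  replace (Re (- (Ci * x))) with 0%R by (unfold Re; simpl; ring).
  replace (Im (- (Ci * x))) with (- x)%R by (unfold Im; simpl; ring).
  rewrite exp_0, cos_neg, sin_neg. C_parts; field.
Qed.

Lemma Ccos_0 : Ccos 0 = 1.
Proof. rewrite Ccos_RtoC, cos_0. auto. Qed.
Lemma Csin_0 : Csin 0 = 0.
Proof. rewrite Csin_RtoC, sin_0. auto. Qed.

Lemma is_cderiv_pow f z D n : is_cderiv f z D ->
  is_cderiv (fun w => f w ^ S n) z (INR (S n) * f z ^ n * D).
Proof.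
  intros H. induction n.
  - apply (is_cderiv_ext f); [intros; simpl; ring|]. replace (INR 1 * f z ^ 0 * D) with D; auto.
    simpl. ring.
  - replace (INR (S (S n)) * f z ^ S n * D) with (D * f z ^ S n + f z * (INR (S n) * f z ^ n * D)).
    + apply (is_cderiv_mult f (fun w => f w ^ S n)); auto.
    + rewrite (S_INR (S n)), RtoC_plus, Cpow_S. ring.
Qed.

Lemma is_cderiv_cos z : is_cderiv Ccos z (- Csin z).
Proof.
  replace (- Csin z) with (- (1) * Csin (1 * z)).
  - apply (is_cderiv_ext (fun w => Ccos (1 * w))); [intros; f_equal; ring|]. apply is_cderiv_cos_lin.
  - replace (1 * z) with z by ring. ring.
Qed.

Lemma is_cderiv_sin z : is_cderiv Csin z (Ccos z).
Proof.
  replace (Ccos z) with (1 * Ccos (1 * z)).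
  - apply (is_cderiv_ext (fun w => Csin (1 * w))); [intros; f_equal; ring|]. apply is_cderiv_sin_lin.
  - replace (1 * z) with z by ring. ring.
Qed.

Lemma Csin2_Ccos2 z : Csin z * Csin z = 1 - Ccos z * Ccos z.
Proof.
  unfold Csin, Ccos. rewrite Cexp_opp. pose proof (Cexp_neq_0 (Ci * z)). set (e := Cexp (Ci * z)) in *.
  transitivity (((e - / e) * (e - / e)) / (4 * (Ci * Ci))).
  - field. split; auto. apply Ci_nz.
  - rewrite Ci_sqr. field. auto.
Qed.

(** The integrals of cos(2 s x) cos^n x over [0, pi/2] link sin(pi s), their value at n = 0 up to 2
    s, to the sine product: each step of their recurrence in n yields one factor 1 - s^2/m^2. *)
Definition cos_kernel (s : C) (n : nat) (z : C) : C := Ccos (2 * s * z) * Ccos z ^ n.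
Definition cos_int (s : C) (n : nat) : C := CInt (fun x => cos_kernel s n (x, 0%R)) 0 (PI / 2).

Lemma cdiff_cos_kernel s n z : cdiff (cos_kernel s n) z.
Proof.
  apply (cdiff_mult (fun z => Ccos (2 * s * z))); [eexists; apply is_cderiv_cos_lin|].
  apply cdiff_pow. eexists; apply is_cderiv_cos.
Qed.

Lemma cos_kernel_cont s n a b : (a <= b)%R -> ccont_on (fun x => cos_kernel s n (x, 0%R)) a b.
Proof. intros H. apply ccont_on_hline; auto. intros. apply cdiff_ccont, cdiff_cos_kernel. Qed.

(** T collects the boundary terms of two integrations by parts: it vanishes at 0 because of the
    sines and at pi/2 because of the powers of cos, and its derivative is the wanted combination of
    kernels. *)
Lemma cos_int_rec s n :
  (INR (S (S n)) * INR (S (S n)) - 4 * s * s) * cos_int s (S (S n)) =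
  INR (S (S n)) * INR (S n) * cos_int s n.
Proof.
  pose proof PI_RGT_0 as HPI.
  set (N := RtoC (INR (S (S n)))). set (N1 := RtoC (INR (S n))).
  set (T := fun z => - (2 * s) * (Csin (2 * s * z) * Ccos z ^ S (S n)) +
     N * (Ccos (2 * s * z) * (Ccos z ^ S n * Csin z))).
  assert (H : CInt (fun x => (N * N - 4 * s * s) * cos_kernel s (S (S n)) (x, 0%R) +
      - (N * N1) * cos_kernel s n (x, 0%R)) 0 (PI / 2) = T ((PI / 2)%R, 0%R) - T (0%R, 0%R)).
  { apply (is_CInt_hline T (fun z => (N * N - 4 * s * s) * cos_kernel s (S (S n)) z + - (N * N1) * cos_kernel s n z)).
    - lra.
    - intros x _. set (z := (x, 0%R) : C). split.
      + assert (D1 : is_cderiv T z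
          (- (2 * s) * ((2 * s * Ccos (2 * s * z)) * Ccos z ^ S (S n) +
             Csin (2 * s * z) * (N * Ccos z ^ S n * - Csin z)) +
           N * ((- (2 * s) * Csin (2 * s * z)) * (Ccos z ^ S n * Csin z) +
             Ccos (2 * s * z) * ((N1 * Ccos z ^ n * - Csin z) * Csin z + Ccos z ^ S n * Ccos z)))).
        { apply is_cderiv_plus.
          - apply is_cderiv_scal. apply (is_cderiv_mult (fun z => Csin (2 * s * z)) (fun z => Ccos z ^ S (S n))).
            + apply is_cderiv_sin_lin.
            + apply is_cderiv_pow, is_cderiv_cos.
          - apply is_cderiv_scal. apply (is_cderiv_mult (fun z => Ccos (2 * s * z)) (fun z => Ccos z ^ S n * Csin z)).
            + apply is_cderiv_cos_lin.
            + apply (is_cderiv_mult (fun z => Ccos z ^ S n) Csin).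
              * apply is_cderiv_pow, is_cderiv_cos.
              * apply is_cderiv_sin. }
        match type of D1 with is_cderiv _ _ ?X => replace ((N * N - 4 * s * s) * cos_kernel s (S (S n)) z + - (N * N1) * cos_kernel s n z) with X; auto end.
        unfold cos_kernel. rewrite !Cpow_S.
        assert (EN : N = N1 + 1) by (unfold N, N1; rewrite (S_INR (S n)), RtoC_plus; auto).
        pose proof (Csin2_Ccos2 z) as E.
        set (u := Ccos (2 * s * z)) in *. set (us := Csin (2 * s * z)) in *.
        set (v := Ccos z) in *. set (vs := Csin z) in *. set (vn := v ^ n). rewrite EN.
        transitivity (- (2 * s) * (2 * s * u * (v * (v * vn))) +
          (N1 + 1) * (u * (- (N1 * vn) * (vs * vs) + v * vn * v))); [ring|].
        rewrite E. ring.
      + apply cdiff_ccont, cdiff_plus.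
        * apply (cdiff_mult (fun _ => N * N - 4 * s * s)); [apply cdiff_const|apply cdiff_cos_kernel].
        * apply (cdiff_mult (fun _ => - (N * N1))); [apply cdiff_const|apply cdiff_cos_kernel]. }
  assert (T0 : T (0%R, 0%R) = 0).
  { unfold T. change ((0%R, 0%R) : C) with (RtoC 0). rewrite Csin_0.
    replace (2 * s * 0) with (RtoC 0) by ring. rewrite Csin_0. ring. }
  assert (T1 : T ((PI / 2)%R, 0%R) = 0).
  { unfold T. change (((PI / 2)%R, 0%R) : C) with (RtoC (PI / 2)). rewrite Ccos_RtoC, cos_PI2, !Cpow_S. ring. }
  rewrite T0, T1, CInt_plus, !CInt_scal in H.
  - unfold cos_int. apply Ceq_minus. etransitivity; [|etransitivity; [exact H|ring]]. ring.
  - apply cos_kernel_cont; lra.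
  - apply cos_kernel_cont; lra.
  - intros t Ht. apply Ccontinuous_mult; [apply Ccontinuous_const|]. apply (cos_kernel_cont s (S (S n)) 0 (PI / 2)); [lra|auto].
  - intros t Ht. apply Ccontinuous_mult; [apply Ccontinuous_const|]. apply (cos_kernel_cont s n 0 (PI / 2)); [lra|auto].
Qed.

Lemma cos_int_0 (s : C) : s <> 0 -> 2 * s * cos_int s 0 = Csin (PI * s).
Proof.
  intros Hs. pose proof PI_RGT_0.
  unfold cos_int. rewrite (is_CInt_hline (fun z => / (2 * s) * Csin (2 * s * z)) (cos_kernel s 0)).
  - change ((0%R, 0%R) : C) with (RtoC 0). change (((PI / 2)%R, 0%R) : C) with (RtoC (PI / 2)).
    replace (2 * s * 0) with (RtoC 0) by ring. rewrite Csin_0.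
    replace (2 * s * (PI / 2)%R) with (PI * s) by (rewrite RtoC_div by lra; field).
    field. auto.
  - lra.
  - intros x _. split; [|apply cdiff_ccont, cdiff_cos_kernel].
    replace (cos_kernel s 0 (x, 0%R)) with (/ (2 * s) * (2 * s * Ccos (2 * s * (x, 0%R)))).
    + apply is_cderiv_scal, is_cderiv_sin_lin.
    + unfold cos_kernel. cbn [Cpow]. field. auto.
Qed.

(* Wallis integrals int_0^(pi/2) cos^(2m). *)
Fixpoint wallis (m : nat) : R :=
  match m with
  | O => PI / 2
  | S k => wallis k * (INR (2 * k + 1) / INR (2 * k + 2))
  end%R.

Lemma wallis_pos m : (0 < wallis m)%R.
Proof.
  induction m; cbn [wallis]; [pose proof PI_RGT_0; lra|].
  apply Rmult_lt_0_compat; auto. apply Rdiv_lt_0_compat; apply lt_0_INR; lia.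
Qed.

Lemma cos_int_wallis m : cos_int 0 (2 * m) = wallis m.
Proof.
  induction m.
  - cbn [Nat.mul wallis]. unfold cos_int.
    rewrite (CInt_ext _ (fun _ => 1)).
    + rewrite CInt_const. rewrite Rminus_0_r. ring.
    + intros t _. unfold cos_kernel. replace (2 * 0 * (t, 0%R)) with (RtoC 0) by ring.
      rewrite Ccos_0. simpl. ring.
  - assert (R1 := cos_int_rec 0 (2 * m)).
    replace (S (S (2 * m))) with (2 * S m)%nat in R1 by lia.
    rewrite IHm in R1. cbn [wallis].
    replace (2 * m + 1)%nat with (S (2 * m)) by lia. replace (2 * m + 2)%nat with (2 * S m)%nat by lia.
    assert (P : RtoC (INR (2 * S m)) <> 0) by (intros E; apply (f_equal Re) in E; revert E; apply not_0_INR; lia).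
    apply (Cmult_reg_l (INR (2 * S m) * INR (2 * S m))); [now apply Cmult_neq_0|].
    replace (INR (2 * S m) * INR (2 * S m) * cos_int 0 (2 * S m)) with
      ((INR (2 * S m) * INR (2 * S m) - 4 * 0 * 0) * cos_int 0 (2 * S m)) by ring.
    rewrite R1, RtoC_mult, RtoC_div by (apply not_0_INR; lia). field. auto.
Qed.

(** For |w| <= 1/2 the linear terms of exp(i w) and exp(-i w) cancel and the quadratic errors
    remain; for larger w the crude bound exp B + 1 suffices, because then 1 <= 4 |w|^2. *)
Lemma Ccos_quadratic_bound (w : C) (B : R) : (Cmod w <= B)%R ->
  (Cmod (Ccos w - 1) <= (8 + 4 * (exp B + 1)) * (Cmod w * Cmod w))%R.
Proof.
  intros Hw. pose proof (Cmod_ge_0 w). pose proof (exp_pos B).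
  assert (Ei : Cmod (Ci * w) = Cmod w) by (rewrite Cmod_mult, Cmod_Ci; ring).
  destruct (Rle_dec (Cmod w) (1/2)) as [L|L].
  - replace (Ccos w - 1) with (/ 2 * ((Cexp (Ci * w) - 1 - Ci * w) + (Cexp (- (Ci * w)) - 1 - - (Ci * w))))
      by (unfold Ccos; field).
    pose proof (Cexp_quadratic_bound (Ci * w) ltac:(lra)) as Q1.
    pose proof (Cexp_quadratic_bound (- (Ci * w)) ltac:(rewrite Cmod_opp; lra)) as Q2.
    rewrite Cmod_opp in Q2. rewrite Ei in Q1, Q2.
    rewrite Cmod_mult, Cmod_inv, Cmod_R, Rabs_right by (try lra; apply C2_neq_0).
    pose proof (Cmod_triangle (Cexp (Ci * w) - 1 - Ci * w) (Cexp (- (Ci * w)) - 1 - - (Ci * w))).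
    assert (0 <= Cmod w * Cmod w)%R by nra. nra.
  - replace (Ccos w - 1) with (/ 2 * (Cexp (Ci * w) + Cexp (- (Ci * w))) + - (1))
      by (unfold Ccos; field).
    eapply Rle_trans; [apply Cmod_triangle|].
    rewrite Cmod_mult, Cmod_inv, Cmod_R, Rabs_right, Cmod_opp, Cmod_1 by (try lra; apply C2_neq_0).
    pose proof (Cmod_triangle (Cexp (Ci * w)) (Cexp (- (Ci * w)))). rewrite !Cmod_Cexp in H1.
    assert (exp (Re (Ci * w)) <= exp B)%R.
    { apply exp_le_le. pose proof (re_le_Cmod (Ci * w)). rewrite Ei in H2.
      pose proof (Rle_abs (Re (Ci * w))). lra. }
    assert (exp (Re (- (Ci * w))) <= exp B)%R.
    { apply exp_le_le. pose proof (re_le_Cmod (- (Ci * w))). rewrite Cmod_opp, Ei in H3.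
      pose proof (Rle_abs (Re (- (Ci * w)))). lra. }
    assert (1 <= 4 * (Cmod w * Cmod w))%R by nra. nra.
Qed.

(** On [0, pi/2] one has |cos(2 s x) - 1| <= K sin^2 x, and the integral of sin^2 cos^(2m) is the
    difference of two consecutive Wallis integrals, that is [wallis m] divided by 2m + 2. *)
Lemma cos_int_near_wallis (s : C) : exists K, forall m,
  (Cmod (cos_int s (2 * m) - wallis m) <= K * (wallis m / INR (2 * m + 2)))%R.
Proof.
  pose proof PI_RGT_0 as HPI. pose proof PI_4 as HPI4.
  set (B := (Cmod s * PI)%R). set (K0 := (8 + 4 * (exp B + 1))%R).
  assert (HK0 : (0 < K0)%R) by (unfold K0; pose proof (exp_pos B); lra).
  pose proof (Cmod_ge_0 s) as Ps.
  (* K0 bounds cos w - 1 by K0 |w|^2 at w = 2 s x, which explains 4 |s|^2; the 9 comes from x <= 3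
     sin x on [0, pi/2]. *)
  set (K := (K0 * (4 * (Cmod s * Cmod s)) * 9)%R).
  assert (HK : (0 <= K)%R) by (unfold K; repeat apply Rmult_le_pos; lra).
  exists K. intros m.
  assert (Kb : forall x, (0 <= x <= PI / 2)%R -> (Cmod (Ccos (2 * s * (x, 0%R)) - 1) <= K * (sin x * sin x))%R).
  { intros x Hx. change ((x, 0%R) : C) with (RtoC x).
    assert (Ew : Cmod (2 * s * x) = (2 * Cmod s * x)%R).
    { rewrite !Cmod_mult, !Cmod_R, !Rabs_right by lra. ring. }
    eapply Rle_trans; [apply (Ccos_quadratic_bound _ B)|].
    - rewrite Ew. unfold B. nra.
    - fold K0. rewrite Ew.
      assert (x <= 3 * sin x)%R by (pose proof (sin_ge_cubic x ltac:(lra)); nra).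
      assert (x * x <= 9 * (sin x * sin x))%R by nra.
      replace (K0 * (2 * Cmod s * x * (2 * Cmod s * x)))%R with (K0 * (4 * (Cmod s * Cmod s)) * (x * x))%R by ring.
      unfold K. rewrite (Rmult_assoc _ 9). apply Rmult_le_compat_l; auto. repeat apply Rmult_le_pos; lra. }
  assert (Cc := cos_kernel_cont s (2 * m) 0 (PI / 2) ltac:(lra)).
  assert (C0 := cos_kernel_cont 0 (2 * m) 0 (PI / 2) ltac:(lra)).
  assert (C1 := cos_kernel_cont 0 (2 * S m) 0 (PI / 2) ltac:(lra)).
  assert (CN : ccont_on (fun x => - (1) * cos_kernel 0 (2 * m) (x, 0%R)) 0 (PI / 2)).
  { intros t Ht. apply Ccontinuous_mult; [apply Ccontinuous_const|now apply C0]. }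
  assert (E : cos_int s (2 * m) - wallis m =
     CInt (fun x => cos_kernel s (2 * m) (x, 0%R) + - (1) * cos_kernel 0 (2 * m) (x, 0%R)) 0 (PI / 2)).
  { rewrite <- cos_int_wallis, CInt_plus, CInt_scal by auto. unfold cos_int. ring. }
  rewrite E.
  assert (K1 : forall x n, cos_kernel 0 n (x, 0%R) = (cos x ^ n)%R).
  { intros x n. unfold cos_kernel. change ((x, 0%R) : C) with (RtoC x).
    replace (2 * 0 * x) with (RtoC 0) by ring. rewrite Ccos_0, Ccos_RtoC, RtoC_pow. ring. }
  assert (Ig : is_RInt (fun x => (K * (cos x ^ (2 * m) - cos x ^ (2 * S m)))%R) 0 (PI / 2)
     (K * (wallis m - wallis (S m)))%R).
  { apply (is_RInt_scal (V := R_NormedModule)), (is_RInt_minus (V := R_NormedModule)).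
    - apply (is_RInt_ext (fun x => Re (cos_kernel 0 (2 * m) (x, 0%R)))); [intros; now rewrite K1|].
      replace (wallis m) with (Re (cos_int 0 (2 * m))) by now rewrite cos_int_wallis.
      apply is_CInt_re, is_CInt_cont; auto.
    - apply (is_RInt_ext (fun x => Re (cos_kernel 0 (2 * S m) (x, 0%R)))); [intros; now rewrite K1|].
      replace (wallis (S m)) with (Re (cos_int 0 (2 * S m))) by now rewrite cos_int_wallis.
      apply is_CInt_re, is_CInt_cont; auto. }
  replace (wallis m / INR (2 * m + 2))%R with (wallis m - wallis (S m))%R.
  2:{ cbn [wallis]. assert (INR (2 * m + 2) <> 0)%R by (apply not_0_INR; lia).
      replace (2 * m + 2)%nat with (S (2 * m + 1)) in * by lia. rewrite S_INR in *. field. auto. }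
  apply (CInt_bound_fun _ (fun x => (K * (cos x ^ (2 * m) - cos x ^ (2 * S m)))%R) 0 (PI / 2)); auto; [lra| |].
  - intros t Ht. apply (continuous_plus (V := C_R_NormedModule)); [now apply Cc|now apply CN].
  - intros x Hx. rewrite K1. unfold cos_kernel. change ((x, 0%R) : C) with (RtoC x).
    rewrite (Ccos_RtoC x), <- RtoC_pow.
    replace (Ccos (2 * s * x) * (cos x ^ (2 * m))%R + - (1) * (cos x ^ (2 * m))%R)
      with ((Ccos (2 * s * x) - 1) * (cos x ^ (2 * m))%R) by ring.
    assert (Pc : (0 <= cos x ^ (2 * m))%R).
    { apply pow_le, cos_ge_0; lra. }
    rewrite Cmod_mult, Cmod_R, (Rabs_right (cos x ^ _)) by lra.
    replace (cos x ^ (2 * m) - cos x ^ (2 * S m))%R with (sin x * sin x * cos x ^ (2 * m))%R.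
    + rewrite <- Rmult_assoc. apply Rmult_le_compat_r; [auto|exact (Kb x Hx)].
    + replace (2 * S m)%nat with (S (S (2 * m))) by lia. simpl pow.
      pose proof (sin2_cos2 x). unfold Rsqr in H. replace (sin x * sin x)%R with (1 - cos x * cos x)%R by lra. ring.
Qed.

Fixpoint sine_product (s : C) (m : nat) : C :=
  match m with
  | O => 1
  | S k => sine_product s k * (1 - s * s / (INR (S k) * INR (S k)))
  end.

(** By the recurrence, the new factor of the product times the new ratio [cos_int] / [wallis] equals
    the old ratio, so the left side does not depend on m. This is Euler's product in finite form,
    with a correction that tends to 1. *)
Lemma sine_product_ratio (s : C) m : s <> 0 ->
  PI * s * (sine_product s m * (cos_int s (2 * m) / wallis m)) = Csin (PI * s).
Proof.
  intros Hs. pose proof PI_RGT_0.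
  induction m.
  - rewrite <- cos_int_0 by auto. cbn [sine_product wallis Nat.mul]. rewrite RtoC_div by lra.
    change (0 + (0 + 0))%nat with 0%nat. field. apply PI_neq_C0.
  - rewrite <- IHm. do 1 f_equal. cbn [sine_product wallis].
    assert (R1 := cos_int_rec s (2 * m)).
    replace (S (S (2 * m))) with (2 * S m)%nat in * by lia.
    replace (2 * m + 1)%nat with (S (2 * m)) by lia. replace (2 * m + 2)%nat with (2 * S m)%nat by lia.
    rewrite RtoC_mult, RtoC_div by (apply not_0_INR; lia).
    assert (W := wallis_pos m).
    assert (HW : RtoC (wallis m) <> 0) by (intros E; apply (f_equal Re) in E; unfold Re in E; simpl in E; lra).
    assert (P1 : RtoC (INR (S m)) <> 0) by (intros E; apply (f_equal Re) in E; revert E; apply not_0_INR; lia).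
    assert (P2 : RtoC (INR (S (2 * m))) <> 0) by (intros E; apply (f_equal Re) in E; revert E; apply not_0_INR; lia).
    assert (E2 : RtoC (INR (2 * S m)) = 2 * INR (S m)).
    { rewrite mult_INR, RtoC_mult. reflexivity. }
    rewrite E2 in *.
    set (N := RtoC (INR (S m))) in *. set (N2 := RtoC (INR (S (2 * m)))) in *.
    set (W0 := RtoC (wallis m)) in *. set (I2 := cos_int s (2 * S m)) in *.
    transitivity (sine_product s m * ((2 * N * (2 * N) - 4 * s * s) * I2) / (W0 * N2 * 2 * N)).
    + field. repeat split; auto.
    + rewrite R1. field. repeat split; auto.
Qed.

(** * Euler's reflection formula *)

(** The increments are u_n a_n, and u is bounded by |u_0| exp(sum of b), so the telescoping series
    of increments converges absolutely. *)
Lemma infinite_product_cv (u a : nat -> C) (b : nat -> R) : (forall n, u (S n) = u n * (1 + a n)) ->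
  (forall n, (Cmod (a n) <= b n)%R) -> ex_series b -> exists l, is_Clim u l.
Proof.
  intros Hu Hb Hs.
  assert (b0 : forall n, (0 <= b n)%R) by (intros n; eapply Rle_trans; [apply Cmod_ge_0|apply Hb]).
  assert (B0 : forall n, (Cmod (u (S n)) <= Cmod (u 0%nat) * exp (sum_n b n))%R).
  { assert (St : forall n, (Cmod (u (S n)) <= Cmod (u n) * exp (b n))%R).
    { intros n. rewrite Hu, Cmod_mult. apply Rmult_le_compat_l; [apply Cmod_ge_0|].
      eapply Rle_trans; [apply Cmod_triangle|]. rewrite Cmod_1. specialize (Hb n).
      pose proof (exp_ineq1_le (b n)). lra. }
    induction n.
    - rewrite sum_O. apply St.
    - rewrite sum_Sn. unfold plus; simpl. rewrite exp_plus, <- Rmult_assoc.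
      eapply Rle_trans; [apply St|]. apply Rmult_le_compat_r; auto. apply Rlt_le, exp_pos. }
  set (B := (Cmod (u 0%nat) * exp (Series b))%R).
  assert (HB : forall n, (Cmod (u n) <= B)%R).
  { intros [|n].
    - unfold B. rewrite <- (Rmult_1_r (Cmod (u 0%nat))) at 1. apply Rmult_le_compat_l; [apply Cmod_ge_0|].
      rewrite <- exp_0. apply exp_le_le. eapply Rle_trans; [|apply (sum_n_incr_le_Series b 0); auto].
      rewrite sum_O. auto.
    - eapply Rle_trans; [apply B0|]. apply Rmult_le_compat_l; [apply Cmod_ge_0|].
      apply exp_le_le. now apply sum_n_incr_le_Series. }
  assert (HB0 : (0 <= B)%R) by (eapply Rle_trans; [apply Cmod_ge_0|apply (HB 0%nat)]).
  assert (L := CSeries_Clim (fun n => u n * a n) (fun n => B * b n)%R).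
  assert (L1 : is_Clim (Csum (fun n => u n * a n)) (CSeries (fun n => u n * a n))).
  { apply L.
    - intros n. rewrite Cmod_mult. apply Rmult_le_compat; try apply Cmod_ge_0; auto.
    - now apply (ex_series_scal (V := R_NormedModule)). }
  exists (u 0%nat + CSeries (fun n => u n * a n)).
  apply (is_Clim_shift _ _ 1).
  apply (is_Clim_ext (fun n => u 0%nat + Csum (fun n => u n * a n) n)).
  - intros n. rewrite Nat.add_1_r. induction n.
    + rewrite Csum_0, Hu. ring.
    + rewrite Csum_S, (Hu (S n)), <- IHn. ring.
  - apply is_Clim_plus; auto. apply is_Clim_const.
Qed.

Lemma is_lim_seq_inv_INR_S : is_lim_seq (fun n => / INR (S n))%R 0.
Proof.
  apply (is_lim_seq_incr_1 (fun n => / INR n)%R 0).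
  replace (Finite 0) with (Rbar_inv p_infty) by reflexivity.
  apply is_lim_seq_inv; [apply is_lim_seq_INR|easy].
Qed.

(** Comparison with 2/((n+1)(n+2)), whose sum telescopes. *)
Lemma ex_series_inv_sqr : ex_series (fun n => / (INR (S n) * INR (S n)))%R.
Proof.
  assert (T : is_series (fun n => / (INR (S n) * INR (S (S n))))%R 1%R).
  { change (is_lim_seq (sum_n (fun n => / (INR (S n) * INR (S (S n))))%R) 1%R).
    apply is_lim_seq_ext with (u := fun n => (1 - / INR (S (S n)))%R).
    - intros n. induction n.
      + rewrite sum_O. simpl. field.
      + rewrite sum_Sn, <- IHn. unfold plus; simpl plus.
        assert (INR (S (S n)) <> 0)%R by (apply not_0_INR; lia).
        assert (INR (S (S (S n))) <> 0)%R by (apply not_0_INR; lia).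
        change (1 - / INR (S (S (S n))) = 1 - / INR (S (S n)) + / (INR (S (S n)) * INR (S (S (S n)))))%R.
        rewrite (S_INR (S (S n))) in *. field. auto.
    - replace (Finite 1) with (Finite (1 - 0)) by (f_equal; ring).
      apply is_lim_seq_minus'; [apply is_lim_seq_const|].
      exact (proj1 (is_lim_seq_incr_1 _ _) is_lim_seq_inv_INR_S). }
  apply (ex_series_le (V := R_CompleteNormedModule) _ (fun n => 2 * / (INR (S n) * INR (S (S n))))%R).
  - intros n. change (Rabs (/ (INR (S n) * INR (S n))) <= 2 * / (INR (S n) * INR (S (S n))))%R.
    pose proof (INR_S_pos n). pose proof (pos_INR n). rewrite (S_INR (S n)).
    assert (1 <= INR (S n))%R by (rewrite S_INR; lra).
    rewrite Rabs_right by (apply Rle_ge, Rlt_le, Rinv_0_lt_compat; nra).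
    apply (Rmult_le_reg_r (INR (S n) * INR (S n) * (INR (S n) + 1))); [apply Rmult_lt_0_compat; nra|].
    replace (/ (INR (S n) * INR (S n)) * (INR (S n) * INR (S n) * (INR (S n) + 1)))%R with (INR (S n) + 1)%R
      by (field; lra).
    replace (2 * / (INR (S n) * (INR (S n) + 1)) * (INR (S n) * INR (S n) * (INR (S n) + 1)))%R with (2 * INR (S n))%R
      by (field; lra). lra.
  - apply (ex_series_scal (V := R_NormedModule)). exists 1%R. exact T.
Qed.

Definition gauss_seq (s : C) (n : nat) : C := INR (fact n) * Cpower (INR n) s / Crising s n.

Definition nonpole (s : C) : Prop := forall n : nat, s + INR n <> 0.

Lemma Crising_neq_0 s n : nonpole s -> Crising s n <> 0.
Proof.
  intros H. induction n; cbn [Crising].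
  - specialize (H 0%nat). simpl INR in H. now rewrite Cplus_0_r in H.
  - apply Cmult_neq_0; auto.
Qed.

(** The quotient of the terms of index q + 1 and q is (q+1) ((q+1)/q)^s / (s+q+1), written as 1 plus
    a summable error. Starting from q >= 1 avoids the power of 0. *)
Lemma gauss_seq_step s m : nonpole s ->
  gauss_seq s (S (S m)) = gauss_seq s (S m) *
   (1 + ((INR (S (S m)) * Cexp (s * (ln (INR (S (S m)) / INR (S m)))) - INR (S (S m)) - s) / (s + INR (S (S m))))).
Proof.
  intros H. unfold gauss_seq.
  pose proof (INR_S_pos m) as P1. pose proof (INR_S_pos (S m)) as P2.
  rewrite (Cpower_pos _ _ P1), (Cpower_pos _ _ P2). rewrite ln_div by auto.
  rewrite RtoC_minus.
  replace (s * ln (INR (S (S m)))) with (s * ln (INR (S m)) + s * (ln (INR (S (S m))) - ln (INR (S m)))) by ring.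
  rewrite Cexp_plus. change (Crising s (S (S m))) with (Crising s (S m) * (s + INR (S (S m)))).
  change (fact (S (S m))) with (S (S m) * fact (S m))%nat. rewrite mult_INR, RtoC_mult.
  field. split; [apply H|now apply Crising_neq_0].
Qed.

(** The logarithm la of (q+1)/q lies between 1/(q+1) and 1/q, so the quadratic error of exp(s la),
    times q + 1, and (q+1) la - 1 are both O(1/q). The denominator is at least (q+1)/2 as soon as q
    >= 2|s| + 1. *)
Lemma gauss_factor_bound s m : (2 * Cmod s + 1 <= INR (S m))%R ->
  (Cmod ((INR (S (S m)) * Cexp (s * (ln (INR (S (S m)) / INR (S m)))) - INR (S (S m)) - s) / (s + INR (S (S m))))
   <= (32 * (Cmod s * Cmod s) + 2 * Cmod s) * / (INR (S m) * INR (S m)))%R.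
Proof.
  intros Hm. pose proof (Cmod_ge_0 s) as Ps.
  pose proof (INR_S_pos m) as P1. set (q := INR (S m)) in *.
  assert (E : INR (S (S m)) = (q + 1)%R) by (unfold q; apply S_INR). rewrite E.
  set (la := ln ((q + 1) / q)).
  assert (La1 : (la <= / q)%R).
  { unfold la. replace ((q + 1) / q)%R with (1 + / q)%R by (field; lra).
    pose proof (exp_ineq1_le (ln (1 + / q))). rewrite exp_ln in H; [lra|].
    pose proof (Rinv_0_lt_compat q P1). lra. }
  assert (La2 : (/ (q + 1) <= la)%R).
  { unfold la. replace ((q + 1) / q)%R with (/ (q / (q + 1)))%R by (field; lra).
    rewrite ln_Rinv by (apply Rdiv_lt_0_compat; lra).
    pose proof (exp_ineq1_le (ln (q / (q + 1)))). rewrite exp_ln in H by (apply Rdiv_lt_0_compat; lra).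
    replace (q / (q + 1))%R with (1 - / (q + 1))%R in * by (field; lra). lra. }
  assert (Iq : (0 < / (q + 1))%R) by (apply Rinv_0_lt_compat; lra).
  assert (Iq' : (0 < / q)%R) by (apply Rinv_0_lt_compat; lra).
  assert (Hsl : (Cmod (s * la) <= 1 / 2)%R).
  { rewrite Cmod_mult, Cmod_R, Rabs_right by lra.
    apply Rle_trans with (Cmod s * / q)%R; [apply Rmult_le_compat_l; lra|].
    apply (Rmult_le_reg_r q); auto. rewrite Rmult_assoc, Rinv_l by lra. lra. }
  assert (Q := Cexp_quadratic_bound _ Hsl).
  assert (Dn : ((q + 1) / 2 <= Cmod (s + (q + 1)%R))%R).
  { pose proof (Cmod_triangle_rev (q + 1)%R (- s)). rewrite Cmod_opp, Cmod_R, Rabs_right in H by lra.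
    replace ((q + 1)%R - - s) with (s + (q + 1)%R) in H by ring. lra. }
  assert (Nz : s + (q + 1)%R <> 0) by (apply Cmod_gt_0; lra).
  rewrite Cmod_div by auto.
  replace ((q + 1)%R * Cexp (s * la) - (q + 1)%R - s) with
    ((q + 1)%R * (Cexp (s * la) - 1 - s * la) + s * ((q + 1) * la - 1)%R).
  2:{ rewrite RtoC_minus, RtoC_mult. ring. }
  set (num := (q + 1)%R * (Cexp (s * la) - 1 - s * la) + s * ((q + 1) * la - 1)%R).
  assert (Nb : (Cmod num <= (q + 1) * (16 * (Cmod s * Cmod s) + Cmod s) * / (q * q))%R).
  { unfold num. eapply Rle_trans; [apply Cmod_triangle|]. rewrite !Cmod_mult, !Cmod_R.
    rewrite (Rabs_right (q + 1)) by lra.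
    rewrite Cmod_mult, Cmod_R, (Rabs_right la) in Q by lra.
    assert (0 <= (q + 1) * la - 1 <= / q)%R.
    { split.
      - apply (Rmult_le_compat_l (q + 1)) in La2; [|lra]. rewrite Rinv_r in La2 by lra. lra.
      - apply (Rmult_le_compat_l (q + 1)) in La1; [|lra].
        replace ((q + 1) * / q)%R with (1 + / q)%R in La1 by (field; lra). lra. }
    rewrite (Rabs_right ((q + 1) * la - 1)) by lra.
    assert (l2 : (la * la <= / q * / q)%R) by (apply Rmult_le_compat; lra).
    assert (X1 : (Cmod (Cexp (s * la) - 1 - s * la) <= 8 * (Cmod s * Cmod s) * (/ q * / q))%R).
    { eapply Rle_trans; [exact Q|].
      replace (8 * (Cmod s * la * (Cmod s * la)))%R with (8 * (Cmod s * Cmod s) * (la * la))%R by ring.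
      apply Rmult_le_compat_l; [nra|auto]. }
    assert (X2 : (Cmod s * ((q + 1) * la - 1) <= Cmod s * ((q + 1) * (/ q * / q)))%R).
    { apply Rmult_le_compat_l; auto. replace ((q + 1) * (/ q * / q))%R with (/ q + / q * / q)%R by (field; lra).
      assert (0 < / q * / q)%R by (apply Rmult_lt_0_compat; auto). lra. }
    rewrite Rinv_mult. assert (0 <= Cmod s * Cmod s)%R by nra.
    assert (0 < (q + 1) * (/ q * / q))%R by (apply Rmult_lt_0_compat; [lra|apply Rmult_lt_0_compat; auto]).
    apply Rle_trans with ((q + 1) * (8 * (Cmod s * Cmod s) * (/ q * / q)) + Cmod s * ((q + 1) * (/ q * / q)))%R.
    - apply Rplus_le_compat; auto. apply Rmult_le_compat_l; [lra|auto].
    - assert (0 <= (Cmod s * Cmod s) * ((q + 1) * (/ q * / q)))%R by (apply Rmult_le_pos; lra). nra. }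
  apply Rle_trans with ((q + 1) * (16 * (Cmod s * Cmod s) + Cmod s) * / (q * q) * / ((q + 1) / 2))%R.
  - unfold Rdiv at 1. apply Rmult_le_compat; auto; [apply Cmod_ge_0|apply Rlt_le, Rinv_0_lt_compat; lra|].
    apply Rinv_le_contravar; lra.
  - right. field. lra.
Qed.

(** [CGamma] is a total limit, meaningful once the sequence is known to converge; from an index
    beyond 2|s| + 1 onwards the sequence is a convergent infinite product. *)
Lemma gauss_seq_cv s : nonpole s -> is_Clim (gauss_seq s) (CGamma s).
Proof.
  intros H.
  assert (Ex : exists l, is_Clim (gauss_seq s) l).
  { destruct (nfloor_ex (2 * Cmod s + 1)) as [N0 HN0]; [pose proof (Cmod_ge_0 s); lra|].
    set (K := (32 * (Cmod s * Cmod s) + 2 * Cmod s)%R).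
    destruct (infinite_product_cv (fun n => gauss_seq s (S (n + N0)))
      (fun n => (INR (S (S (n + N0))) * Cexp (s * (ln (INR (S (S (n + N0))) / INR (S (n + N0))))) - INR (S (S (n + N0))) - s)
          / (s + INR (S (S (n + N0)))))
      (fun n => K * / (INR (S (n + N0)) * INR (S (n + N0))))%R) as [l Hl].
    - intros n. now apply gauss_seq_step.
    - intros n. apply gauss_factor_bound. rewrite S_INR, plus_INR. pose proof (pos_INR n). lra.
    - apply (ex_series_scal (V := R_NormedModule)).
      apply (ex_series_ext (fun n => / (INR (S (N0 + n)) * INR (S (N0 + n))))%R).
      { intros n. now rewrite (Nat.add_comm N0). }
      apply (ex_series_incr_n (fun n => / (INR (S n) * INR (S n)))%R N0). apply ex_series_inv_sqr.
    - exists l. apply (is_Clim_shift _ _ (S N0)).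
      apply (is_Clim_ext (fun n => gauss_seq s (S (n + N0)))); auto.
      intros n. f_equal. lia. }
  destruct Ex as [l Hl]. replace (CGamma s) with l; auto.
  change (CGamma s) with (CLim_seq (gauss_seq s)). unfold CLim_seq.
  rewrite (is_lim_seq_unique _ _ (is_Clim_re _ _ Hl)), (is_lim_seq_unique _ _ (is_Clim_im _ _ Hl)).
  now destruct l.
Qed.

(** The factors pair off as (k + s)(k - s) = k^2 (1 - s^2/k^2); the first factor s and the last
    factor n + 1 - s stay alone. *)
Lemma Crising_reflection s n :
  Crising s n * Crising (1 - s) n = s * (INR (S n) - s) * (INR (fact n) * INR (fact n)) * sine_product s n.
Proof.
  induction n.
  - cbn [Crising sine_product fact]. simpl INR. ring.
  - cbn [Crising sine_product]. change (fact (S n)) with (S n * fact n)%nat.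
    rewrite mult_INR, RtoC_mult.
    transitivity (Crising s n * Crising (1 - s) n * ((s + INR (S n)) * (1 - s + INR (S n)))); [ring|].
    rewrite IHn. rewrite (S_INR (S n)), RtoC_plus.
    assert (RtoC (INR (S n)) <> 0) by (apply RtoC_neq_0, not_0_INR; lia).
    field. auto.
Qed.

Lemma is_Clim_RtoC (u : nat -> R) (l : R) : is_lim_seq u l -> is_Clim (fun n => RtoC (u n)) l.
Proof. intros H. apply is_Clim_pair; simpl; auto. apply is_lim_seq_const. Qed.

Theorem Gamma_reflection (s : C) : ~ is_integer s ->
  CGamma s * CGamma (1 - s) * Csin (PI * s) = PI.
Proof.
  intros Hs. pose proof PI_RGT_0 as HPI.
  assert (N1 : nonpole s).
  { intros n E. apply Hs. exists (- Z.of_nat n)%Z. rewrite opp_IZR, <- INR_IZR_INZ, RtoC_opp.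
    replace s with (s + INR n - INR n) by ring. rewrite E. ring. }
  assert (N2 : nonpole (1 - s)).
  { intros n E. apply Hs. exists (1 + Z.of_nat n)%Z. rewrite plus_IZR, <- INR_IZR_INZ, RtoC_plus.
    replace s with (1 + INR n - (1 - s + INR n)) by ring. rewrite E. ring. }
  assert (s0 : s <> 0).
  { intros ->. apply Hs. exists 0%Z. auto. }
  set (g := CGamma s * CGamma (1 - s)).
  assert (Lg : is_Clim (fun n => gauss_seq s n * gauss_seq (1 - s) n) g)
    by (apply is_Clim_mult; now apply gauss_seq_cv).
  destruct (cos_int_near_wallis s) as [K HK].
  set (r := fun m => cos_int s (2 * m) / wallis m).
  assert (Wn : forall m, RtoC (wallis m) <> 0).
  { intros m. apply RtoC_neq_0. pose proof (wallis_pos m). lra. }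
  assert (Lr : is_Clim r 1).
  { intros e He. destruct (INR_large (Rmax 0 (K / e))) as [N HN]. exists N. intros m Hm. specialize (HN m Hm).
    pose proof (Rmax_l 0 (K / e)). pose proof (Rmax_r 0 (K / e)).
    assert (W := wallis_pos m). specialize (HK m).
    unfold r. replace (cos_int s (2 * m) / wallis m - 1) with ((cos_int s (2 * m) - wallis m) / wallis m) by (field; auto).
    rewrite Cmod_div, Cmod_R, Rabs_right by (auto; lra).
    assert (P : (INR m + 1 <= INR (2 * m + 2))%R) by (rewrite <- S_INR; apply le_INR; lia).
    assert (P0 : (0 <= INR m)%R) by apply pos_INR.
    apply Rle_lt_trans with (K / INR (2 * m + 2))%R.
    - apply (Rmult_le_reg_r (wallis m)); auto. unfold Rdiv at 1. rewrite Rmult_assoc, Rinv_l, Rmult_1_r by lra.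
      eapply Rle_trans; [exact HK|]. right; field. lra.
    - apply (Rmult_lt_reg_r (INR (2 * m + 2))); [lra|]. unfold Rdiv. rewrite Rmult_assoc, Rinv_l, Rmult_1_r by lra.
      assert (K <= e * INR m)%R.
      { apply (Rmult_le_reg_r (/ e)); [now apply Rinv_0_lt_compat|].
        replace (e * INR m * / e)%R with (INR m) by (field; lra). unfold Rdiv in H0. lra. }
      nra. }
  (* An exact identity before any limit; the unpaired last factor, divided by n + 1, is 1 + (1 -
     s)/(n + 1) and tends to 1. *)
  assert (Key : forall n, gauss_seq s (S n) * gauss_seq (1 - s) (S n) * (1 + (1 - s) * RtoC (/ INR (S n))) * Csin (PI * s)
     = PI * r (S n)).
  { intros n. rewrite <- (sine_product_ratio s (S n)) by auto. fold (r (S n)).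
    pose proof (INR_S_pos n) as P.
    assert (En : RtoC (INR (S n)) <> 0) by (apply RtoC_neq_0; lra).
    assert (Ec : Cpower (INR (S n)) s * Cpower (INR (S n)) (1 - s) = INR (S n)).
    { rewrite !Cpower_pos by auto. rewrite <- Cexp_plus.
      replace (s * ln (INR (S n)) + (1 - s) * ln (INR (S n))) with (RtoC (ln (INR (S n)))) by ring.
      now rewrite Cexp_real, exp_ln. }
    assert (Er := Crising_reflection s (S n)).
    pose proof (Crising_neq_0 s (S n) N1) as Z1. pose proof (Crising_neq_0 (1 - s) (S n) N2) as Z2.
    unfold gauss_seq. rewrite RtoC_inv by lra.
    transitivity ((INR (fact (S n)) * INR (fact (S n))) * (Cpower (INR (S n)) s * Cpower (INR (S n)) (1 - s))
       * ((INR (S n) + 1 - s) / INR (S n)) * (PI * s * sine_product s (S n) * r (S n))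
       / (Crising s (S n) * Crising (1 - s) (S n))).
    - field. auto.
    - rewrite Ec. rewrite (S_INR (S n)), RtoC_plus in Er.
      transitivity (PI * r (S n) * (s * (INR (S n) + 1 - s) * (INR (fact (S n)) * INR (fact (S n))) * sine_product s (S n))
        / (Crising s (S n) * Crising (1 - s) (S n))).
      + field. auto.
      + rewrite <- Er. field. auto. }
  apply (is_Clim_unique (fun n => gauss_seq s (S n) * gauss_seq (1 - s) (S n) * (1 + (1 - s) * RtoC (/ INR (S n))) * Csin (PI * s))).
  - replace (g * Csin (PI * s)) with (g * (1 + (1 - s) * RtoC 0) * Csin (PI * s)) by ring.
    apply is_Clim_mult; [|apply is_Clim_const]. apply is_Clim_mult.
    + apply (is_Clim_ext (fun n => gauss_seq s (n + 1) * gauss_seq (1 - s) (n + 1))).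
      { intros n. now rewrite Nat.add_1_r. }
      apply (is_Clim_shift_inv (fun n => gauss_seq s n * gauss_seq (1 - s) n)), Lg.
    + apply is_Clim_plus; [apply is_Clim_const|]. apply is_Clim_scal, is_Clim_RtoC, is_lim_seq_inv_INR_S.
  - apply (is_Clim_ext (fun n => PI * r (S n))); [intros n; now rewrite Key|].
    assert (X : is_Clim (fun n => PI * r (S n)) (PI * 1)); [|now rewrite Cmult_1_r in X].
    apply (is_Clim_scal PI (fun n => r (S n)) 1).
    apply (is_Clim_ext (fun n => r (n + 1)%nat)); [intros n; now rewrite Nat.add_1_r|].
    now apply (is_Clim_shift_inv r).
Qed.

(** * Taylor numbers *)

Lemma is_pseries_Clim (c : nat -> C) (z l : C) :
  is_pseries (K := C_AbsRing) (V := C_NormedModule) c z l <-> is_Clim (Csum (fun k => c k * z ^ k)) l.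
Proof.
  assert (Pn : forall k, pow_n (K := C_Ring) z k = z ^ k).
  { induction k; [reflexivity|]. rewrite Cpow_S, <- IHk. reflexivity. }
  assert (E : forall k, scal (K := C_Ring) (V := C_ModuleSpace) (pow_n (K := C_Ring) z k) (c k) = c k * z ^ k).
  { intros k. rewrite Pn. apply Cmult_comm. }
  split; intros H.
  - apply is_series_Clim in H. apply (is_Clim_ext _ _ _ (fun n => Csum_ext _ _ n E)), H.
  - apply Clim_is_series. apply (is_Clim_ext _ _ _ (fun n => Csum_ext _ _ n (fun k => eq_sym (E k)))), H.
Qed.

Definition taylor_on (h : C -> C) (a : nat -> C) (r : R) : Prop :=
  forall z, (Cmod z < r)%R -> is_Clim (Csum (fun k => a k / INR (fact k) * z ^ k)) (h z).

Lemma is_taylor_iff h a : is_taylor h a <-> exists r, (0 < r)%R /\ taylor_on h a r.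
Proof.
  split.
  - intros [r Hr]. exists r. split; [apply cond_pos|]. intros z Hz. apply is_pseries_Clim, Hr.
    split.
    + change (Rabs (Re z - 0) < r)%R. rewrite Rminus_0_r. eapply Rle_lt_trans; [apply re_le_Cmod|auto].
    + change (Rabs (Im z - 0) < r)%R. rewrite Rminus_0_r. eapply Rle_lt_trans; [apply im_le_Cmod|auto].
  - intros [r [Hr H]]. assert (Hr2 : (0 < r / 2)%R) by lra. exists (mkposreal _ Hr2).
    intros z [B1 B2]. apply is_pseries_Clim, H.
    change (Rabs (Re z - 0) < r / 2)%R in B1. change (Rabs (Im z - 0) < r / 2)%R in B2.
    rewrite Rminus_0_r in B1, B2. eapply Rle_lt_trans; [apply Cmod_le_Rabs|lra].
Qed.

Lemma CV_radius_pos_of_series (a : nat -> R) (x l : R) : (0 < x)%R -> is_series (fun k => (a k * x ^ k)%R) l ->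
  Rbar_lt 0 (CV_radius a).
Proof.
  intros Hx H.
  assert (B : exists M, forall n, (Rabs (a n * x ^ n) <= M)%R).
  { assert (T : ex_lim_seq (fun n => a n * x ^ n)%R) by (exists 0%R; apply ex_series_lim_0; eexists; exact H).
    assert (T0 : is_lim_seq (fun n => a n * x ^ n)%R 0) by (apply ex_series_lim_0; eexists; exact H).
    destruct (filterlim_bounded (K := R_AbsRing) (V := R_NormedModule) (fun n => a n * x ^ n)%R) as [M HM].
    - exists 0%R. exact T0.
    - exists M. exact HM. }
  pose proof (proj1 (CV_radius_bounded a) x B) as L.
  destruct (CV_radius a); simpl in *; auto; lra.
Qed.

(** Along the real axis the real and imaginary parts are real power series, whose coefficients are
    determined by their sums; p stands for either part. *)
Lemma taylor_unique h a b : is_taylor h a -> is_taylor h b -> forall n, a n = b n.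
Proof.
  intros Ha Hb. apply is_taylor_iff in Ha, Hb.
  destruct Ha as [r [Hr Ha]]. destruct Hb as [q [Hq Hb]].
  set (x0 := (Rmin r q / 2)%R).
  assert (Hm : (0 < Rmin r q)%R) by (now apply Rmin_pos).
  pose proof (Rmin_l r q). pose proof (Rmin_r r q).
  assert (Part : forall (p : C -> R), (forall u v, p (u + v) = (p u + p v)%R) -> (forall (x : R) u, p (u * x) = (p u * x)%R) ->
    (forall u l, is_Clim u l -> is_lim_seq (fun n => p (u n)) (p l)) -> forall n, p (a n) = p (b n)).
  { intros p Pp Ps Pl n.
    assert (Ser : forall c, forall x, is_Clim (Csum (fun k => c k / INR (fact k) * RtoC x ^ k)) (h x) ->
       is_series (fun k => (p (c k) / INR (fact k) * x ^ k)%R) (p (h x))).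
    { intros c x Hc. apply Pl in Hc. change (is_lim_seq (sum_n (fun k => (p (c k) / INR (fact k) * x ^ k)%R)) (p (h x))).
      apply (is_lim_seq_ext (fun n => p (Csum (fun k => c k / INR (fact k) * RtoC x ^ k) n))); auto.
      intros m.
      assert (Tm : forall k, p (c k / INR (fact k) * RtoC x ^ k) = (p (c k) / INR (fact k) * x ^ k)%R).
      { intros k. unfold Cdiv. rewrite <- RtoC_pow, <- RtoC_inv, !Ps by apply INR_fact_neq_0. reflexivity. }
      induction m.
      - rewrite Csum_0, sum_O. apply Tm.
      - rewrite Csum_S, sum_Sn, Pp, IHm, Tm. reflexivity. }
    assert (Sa : forall x, (Rabs x < r)%R -> is_series (fun k => (p (a k) / INR (fact k) * x ^ k)%R) (p (h x))).
    { intros x Hx. apply Ser, Ha. now rewrite Cmod_R. }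
    assert (Sb : forall x, (Rabs x < q)%R -> is_series (fun k => (p (b k) / INR (fact k) * x ^ k)%R) (p (h x))).
    { intros x Hx. apply Ser, Hb. now rewrite Cmod_R. }
    assert (Hx0 : (Rabs x0 < Rmin r q)%R) by (rewrite Rabs_right; unfold x0; lra).
    assert (E : (p (a n) / INR (fact n) = p (b n) / INR (fact n))%R).
    { apply (PSeries_ext_recip (fun k => p (a k) / INR (fact k))%R (fun k => p (b k) / INR (fact k))%R n).
      - apply (CV_radius_pos_of_series _ x0 (p (h x0))); [unfold x0; lra|]. apply Sa. lra.
      - apply (CV_radius_pos_of_series _ x0 (p (h x0))); [unfold x0; lra|]. apply Sb. lra.
      - exists (mkposreal _ Hm). intros x Hx. change (Rabs (x - 0) < Rmin r q)%R in Hx. rewrite Rminus_0_r in Hx.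
        unfold PSeries. rewrite (is_series_unique _ _ (Sa x ltac:(lra))), (is_series_unique _ _ (Sb x ltac:(lra))).
        reflexivity. }
    pose proof (INR_fact_neq_0 n). apply (Rmult_eq_reg_r (/ INR (fact n))); auto. now apply Rinv_neq_0_compat. }
  intros n. apply injective_projections.
  - apply (Part Re).
    + apply re_plus.
    + intros; apply re_scal_r.
    + apply is_Clim_re.
  - apply (Part Im).
    + apply im_plus.
    + intros; apply im_scal_r.
    + apply is_Clim_im.
Qed.

(** [taylor] is a choice: any explicit expansion makes the choice legitimate and, by uniqueness,
    determines it. *)
Lemma taylor_spec h a : is_taylor h a -> is_taylor h (taylor h) /\ forall n, taylor h n = a n.
Proof.
  intros H. assert (T : is_taylor h (taylor h)) by exact (epsilon_spec _ (is_taylor h) (ex_intro _ a H)).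
  split; auto. now apply (taylor_unique h).
Qed.

(* Expand 1 / (w - z) in Cauchy's formula as a geometric series in z / w. *)
Lemma power_series_expansion (g : C -> C) (r : R) : (0 < r)%R -> on_square (cdiff g) 0 r ->
  exists c : nat -> C, forall z, (Cmod z < r)%R -> is_Clim (Csum (fun k => c k * z ^ k)) (g z).
Proof.
  intros Hr Hg. pose proof PI_RGT_0 as HPI.
  unfold on_square in Hg. replace (Re 0) with 0%R in Hg by reflexivity. replace (Im 0) with 0%R in Hg by reflexivity.
  rewrite !Rminus_0_l, !Rplus_0_l in Hg.
  assert (SqE : forall P : C -> Prop, (forall z, (r <= Cmod z)%R -> cdiff g z -> P z) ->
    (forall x, (- r <= x <= r)%R -> P (x, (- r)%R) /\ P (x, r)) /\
    (forall y, (- r <= y <= r)%R -> P ((- r)%R, y) /\ P (r, y))).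
  { intros P HP.
    assert (Q := square_edges P 0 r Hr).
    replace (Re 0) with 0%R in Q by reflexivity. replace (Im 0) with 0%R in Q by reflexivity.
    rewrite !Rminus_0_l, !Rplus_0_l in Q. apply Q. intros x y X Y L.
    replace (Re 0) with 0%R in * by reflexivity. replace (Im 0) with 0%R in * by reflexivity.
    apply HP; [|apply Hg; lra]. now replace ((x, y) - 0) with ((x, y) : C) in L by (C_parts; ring). }
  set (k := fun n (w : C) => g w * / w ^ S n).
  exists (fun n => bdry (k n) (- r) r (- r) r / (2 * PI * Ci)).
  intros z Hz.
  assert (Pz := Cmod_ge_0 z).
  assert (Nz : forall w, (r <= Cmod w)%R -> w <> 0 /\ w <> z).
  { intros w Hw; split; intros ->; [rewrite Cmod_0 in Hw|]; lra. }
  assert (Dk : forall n w, (r <= Cmod w)%R -> cdiff g w -> cdiff (k n) w).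
  { intros n w Hw Dw. apply (cdiff_mult g); auto. apply (cdiff_inv (fun w => w ^ S n)).
    - apply Cpow_nz. now apply Nz.
    - apply (cdiff_pow (fun w => w)), cdiff_id. }
  assert (D0 : forall w, (r <= Cmod w)%R -> cdiff g w -> cdiff (fun w => g w / (w - z)) w).
  { intros w Hw Dw. apply (cdiff_mult g); auto. apply cdiff_shift_inv. now apply Nz. }
  set (rem := fun n (w : C) => g w / (w - z) * / w ^ S n).
  assert (Dr : forall n w, (r <= Cmod w)%R -> cdiff g w -> cdiff (rem n) w).
  { intros n w Hw Dw. apply (cdiff_mult (fun w => g w / (w - z))); auto. apply (cdiff_inv (fun w => w ^ S n)).
    - apply Cpow_nz. now apply Nz.
    - apply (cdiff_pow (fun w => w)), cdiff_id. }
  assert (Ed : forall f : C -> C, (forall w, (r <= Cmod w)%R -> cdiff g w -> cdiff f w) ->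
     ccont_edges f (- r) r (- r) r).
  { intros f Hf. apply (SqE (ccont f)). intros; apply cdiff_ccont; auto. }
  assert (Cf : bdry (fun w => g w / (w - z)) (- r) r (- r) r = 2 * PI * Ci * g z).
  { pose proof (re_le_Cmod z) as B1. pose proof (im_le_Cmod z) as B2. apply Rabs_le_between in B1, B2.
    replace z with ((Re z, Im z) : C) by (destruct z; reflexivity).
    apply cauchy_formula; auto; lra. }
  (* Each step uses 1/(w - z) = 1/w + z/(w (w - z)), which splits one more coefficient off the
     remainder. *)
  assert (Rec : forall n, 2 * PI * Ci * g z = Csum (fun j => bdry (k j) (- r) r (- r) r * z ^ j) n
     + z ^ S n * bdry (rem n) (- r) r (- r) r).
  { assert (Step : forall (G : C -> C) n, (forall w, (r <= Cmod w)%R -> cdiff g w -> cdiff G w) ->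
      (forall w, (r <= Cmod w)%R -> G w = k n w + z * rem n w) ->
      bdry G (- r) r (- r) r = bdry (k n) (- r) r (- r) r + z * bdry (rem n) (- r) r (- r) r).
    { intros G n HG EG. rewrite <- bdry_scal by (try lra; apply Ed, Dr).
      rewrite <- bdry_plus; try lra; [|apply Ed, Dk|].
      - apply bdry_ext_edges; try lra; apply (SqE (fun w => G w = k n w + z * rem n w)); auto.
      - apply Ed. intros; apply (cdiff_mult (fun _ => z)); [apply cdiff_const|now apply Dr]. }
    induction n.
    - rewrite Csum_0, <- Cf. rewrite (Step (fun w => g w / (w - z)) 0%nat); auto; [simpl; ring|].
      intros w Hw. destruct (Nz w Hw). unfold k, rem. simpl. field. split; auto. now apply Cminus_eq_contra.
    - rewrite IHn, Csum_S. rewrite (Step (rem n) (S n)); auto; [rewrite !Cpow_S; ring|].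
      intros w Hw. destruct (Nz w Hw). unfold k, rem. rewrite !Cpow_S. field.
      repeat split; auto; [now apply Cpow_nz|now apply Cminus_eq_contra]. }
  assert (E0 : ccont_edges (fun w => g w / (w - z)) (- r) r (- r) r) by (apply Ed; auto).
  assert (Bm : exists M, (forall x, (- r <= x <= r)%R -> (Cmod (g (x, (- r)%R) / ((x, (- r)%R) - z))%C <= M)%R /\
       (Cmod (g (x, r) / ((x, r) - z))%C <= M)%R) /\
     (forall y, (- r <= y <= r)%R -> (Cmod (g ((- r)%R, y) / (((- r)%R, y) - z))%C <= M)%R /\
       (Cmod (g (r, y) / ((r, y) - z))%C <= M)%R)).
  { assert (Q := square_edges_bounded (fun w => g w / (w - z)) 0 r Hr).
    replace (Re 0) with 0%R in Q by reflexivity. replace (Im 0) with 0%R in Q by reflexivity.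
    rewrite !Rminus_0_l, !Rplus_0_l in Q. exact (Q E0). }
  destruct Bm as [M [M1 M2]].
  assert (M0 : (0 <= M)%R).
  { eapply Rle_trans; [apply Cmod_ge_0|apply (M1 0%R); lra]. }
  assert (rn : forall n, (0 < r ^ n)%R) by (intros; now apply pow_lt).
  assert (Br : forall n, (Cmod (bdry (rem n) (- r) r (- r) r) <= M * / r ^ S n * (2 * (r - - r) + 2 * (r - - r)))%R).
  { intros n.
    assert (One : forall w, (r <= Cmod w)%R -> (Cmod (g w / (w - z)) <= M)%R -> (Cmod (rem n w) <= M * / r ^ S n)%R).
    { intros w Hw HM. destruct (Nz w Hw). unfold rem. rewrite Cmod_mult, Cmod_inv, Cmod_pow by now apply Cpow_nz.
      apply Rmult_le_compat; try apply Cmod_ge_0; auto.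
      - apply Rlt_le, Rinv_0_lt_compat, pow_lt; lra.
      - apply Rinv_le_contravar; auto. apply pow_incr; lra. }
    destruct (SqE (fun w => (r <= Cmod w)%R) ltac:(auto)) as [e1 e2].
    apply bdry_bound; try lra.
    - apply Ed, Dr.
    - intros x X; split; apply One; first [now apply e1|now apply M1].
    - intros y Y; split; apply One; first [now apply e2|now apply M2]. }
  set (q := (Cmod z / r)%R).
  assert (Hq : (0 <= q < 1)%R).
  { unfold q. split; [apply Rdiv_le_0_compat; lra|].
    apply (Rmult_lt_reg_r r); auto. unfold Rdiv. rewrite Rmult_assoc, Rinv_l; lra. }
  assert (Err : forall n, (Cmod (Csum (fun j => bdry (k j) (- r) r (- r) r / (2 * PI * Ci) * z ^ j)%C n - g z)
      <= M * (8 * r) / (2 * PI) * q ^ S n)%R).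
  { intros n. pose proof two_PI_Ci_neq_0 as N2.
    replace (Csum (fun j => bdry (k j) (- r) r (- r) r / (2 * PI * Ci) * z ^ j) n - g z) with
      (- (z ^ S n * bdry (rem n) (- r) r (- r) r / (2 * PI * Ci))).
    - rewrite Cmod_opp, Cmod_div, Cmod_mult, Cmod_pow, Cmod_two_PI_Ci by auto.
      replace (M * (8 * r) / (2 * PI) * q ^ S n)%R with
        (Cmod z ^ S n * (M * / r ^ S n * (2 * (r - - r) + 2 * (r - - r))) / (2 * PI))%R.
      + unfold Rdiv. apply Rmult_le_compat_r; [apply Rlt_le, Rinv_0_lt_compat; lra|].
        apply Rmult_le_compat_l; [apply pow_le; lra|apply Br].
      + unfold q, Rdiv. rewrite Rpow_mult_distr, pow_inv. ring.
    - apply (Cmult_reg_l (2 * PI * Ci)); auto.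
      replace (2 * PI * Ci * (Csum (fun j => bdry (k j) (- r) r (- r) r / (2 * PI * Ci) * z ^ j) n - g z)) with
        (Csum (fun j => bdry (k j) (- r) r (- r) r * z ^ j) n - 2 * PI * Ci * g z).
      + rewrite (Rec n). field. auto using PI_neq_C0, Ci_nz.
      + transitivity (2 * PI * Ci * Csum (fun j => bdry (k j) (- r) r (- r) r / (2 * PI * Ci) * z ^ j) n - 2 * PI * Ci * g z);
          [|ring].
        rewrite <- Csum_scal. f_equal. apply Csum_ext. intros j. field. auto using PI_neq_C0, Ci_nz. }
  assert (Lq : is_lim_seq (fun n => M * (8 * r) / (2 * PI) * q ^ S n)%R (M * (8 * r) / (2 * PI) * 0)%R).
  { apply (is_lim_seq_scal_l _ _ 0). apply (is_lim_seq_incr_1 (fun n => q ^ n)%R). apply is_lim_seq_geom. rewrite Rabs_right; lra. }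
  rewrite Rmult_0_r in Lq. apply is_lim_seq_spec in Lq.
  intros e He. destruct (Lq (mkposreal e He)) as [N HN]. exists N. intros n Hn. specialize (HN n Hn).
  simpl pos in HN. rewrite Rminus_0_r in HN. eapply Rle_lt_trans; [apply Err|].
  eapply Rle_lt_trans; [apply Rle_abs|exact HN].
Qed.

Lemma is_lim_seq_bounded (u : nat -> R) (l : R) : is_lim_seq u l -> exists M, forall n, (Rabs (u n) <= M)%R.
Proof.
  intros H. destruct (filterlim_bounded (K := R_AbsRing) (V := R_NormedModule) u) as [M HM].
  - exists l. exact H.
  - exists M. exact HM.
Qed.

Lemma is_Clim_bounded (u : nat -> C) (l : C) : is_Clim u l -> exists M, forall n, (Cmod (u n) <= M)%R.
Proof.
  intros H. destruct (is_lim_seq_bounded _ _ (is_Clim_re _ _ H)) as [M1 H1].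
  destruct (is_lim_seq_bounded _ _ (is_Clim_im _ _ H)) as [M2 H2].
  exists (M1 + M2)%R. intros n. eapply Rle_trans; [apply Cmod_le_Rabs|]. specialize (H1 n). specialize (H2 n). lra.
Qed.

Lemma Csum_terms_bounded (a : nat -> C) (l : C) : is_Clim (Csum a) l -> exists M, forall n, (Cmod (a n) <= M)%R.
Proof.
  intros H. destruct (is_Clim_bounded _ _ H) as [M HM]. exists (M + M)%R. intros [|n].
  - specialize (HM 0%nat). rewrite Csum_0 in HM. pose proof (Cmod_ge_0 (a 0%nat)). lra.
  - replace (a (S n)) with (Csum a (S n) + - Csum a n) by (rewrite Csum_S; ring).
    eapply Rle_trans; [apply Cmod_triangle|]. rewrite Cmod_opp. pose proof (HM n). pose proof (HM (S n)). lra.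
Qed.

(** The power series coefficients are O(x^(-n)), as follows from convergence at x. On |z| <= 3x/4
    the series then has a geometric majorant of ratio 3/4. *)
Definition geom_bounded (a : nat -> C) (x M : R) : Prop :=
  (0 < x)%R /\ forall n, (Cmod (a n / INR (fact n)) * x ^ n <= M)%R.

Lemma egf_term_bound a x M z n : geom_bounded a x M -> (Cmod z <= 3 / 4 * x)%R ->
  (Cmod (a n / INR (fact n) * z ^ n) <= M * (3 / 4) ^ n)%R.
Proof.
  intros [Hx H] Hz. rewrite Cmod_mult, Cmod_pow. specialize (H n).
  assert (P : (Cmod z ^ n <= (3 / 4 * x) ^ n)%R) by (apply pow_incr; split; [apply Cmod_ge_0|auto]).
  rewrite Rpow_mult_distr in P.
  assert (0 < (3 / 4) ^ n)%R by (apply pow_lt; lra).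
  pose proof (Cmod_ge_0 (a n / INR (fact n))).
  apply Rle_trans with (Cmod (a n / INR (fact n)) * ((3 / 4) ^ n * x ^ n))%R; [apply Rmult_le_compat_l; auto|].
  replace (Cmod (a n / INR (fact n)) * ((3 / 4) ^ n * x ^ n))%R with
    (Cmod (a n / INR (fact n)) * x ^ n * (3 / 4) ^ n)%R by ring.
  apply Rmult_le_compat_r; lra.
Qed.

Lemma ex_series_geom_34 M : ex_series (fun n => M * (3 / 4) ^ n)%R.
Proof.
  apply (ex_series_scal (V := R_NormedModule)). apply ex_series_geom. rewrite Rabs_right; lra.
Qed.

Lemma egf_Clim a x M z : geom_bounded a x M -> (Cmod z <= 3 / 4 * x)%R ->
  is_Clim (Csum (fun n => a n / INR (fact n) * z ^ n)) (egf a z).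
Proof.
  intros H Hz. apply (CSeries_Clim _ (fun n => M * (3 / 4) ^ n)%R); [|apply ex_series_geom_34].
  intros n. now apply (egf_term_bound a x).
Qed.

(** Squares of half-side x/8 about points of |z| <= x/2 stay in |z| <= 3x/4, where the geometric
    majorant holds. *)
Lemma egf_cdiff a x M z : geom_bounded a x M -> (Cmod z <= x / 2)%R -> cdiff (egf a) z.
Proof.
  intros H Hz. assert (Hx : (0 < x)%R) by apply H.
  apply (cdiff_CSeries (fun n z => a n / INR (fact n) * z ^ n) (fun n => M * (3 / 4) ^ n)%R z (x / 8)); [lra| | |apply ex_series_geom_34].
  - intros n u v _ _. apply (cdiff_mult (fun _ => a n / INR (fact n))); [apply cdiff_const|].
    apply (cdiff_pow (fun w => w)), cdiff_id.
  - intros n u v U V. apply (egf_term_bound a x); auto.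
    eapply Rle_trans; [apply (square_Cmod z (x / 8)); auto; lra|lra].
Qed.

Lemma Cexp_neq_1_small (t : C) : t <> 0 -> (Cmod t < 1)%R -> Cexp t - 1 <> 0.
Proof.
  intros Ht Hs E. assert (E1 : Cexp t = 1) by (replace (Cexp t) with (Cexp t - 1 + 1) by ring; rewrite E; ring).
  destruct (Cexp_eq_1 t E1) as [k Hk]. apply Ht. rewrite Hk in *. pose proof PI2_1.
  assert (H2 := im_le_Cmod (0%R, (2 * PI * IZR k)%R)). unfold Im in H2; cbn [snd] in H2.
  destruct (Z.eq_dec k 0) as [->|N].
  - C_parts; ring.
  - exfalso. rewrite !Rabs_mult, (Rabs_right 2), (Rabs_right PI) in H2 by lra.
    assert (1 <= Rabs (IZR k))%R by (rewrite <- abs_IZR; apply IZR_le; lia). nra.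
Qed.

(** Expanding (exp z - 1) f(z), whose constant coefficient is 0, and shifting the coefficients by
    one divides by z without ever evaluating a quotient at 0. *)
Lemma modulator_germ_taylor (a : nat -> C) (x M : R) : geom_bounded a x M ->
  exists b, is_taylor (modulator_germ (egf a)) b.
Proof.
  intros H. assert (Hx : (0 < x)%R) by apply H.
  set (fc := egf a). set (g := fun z => (Cexp z - 1) * fc z).
  assert (Dg : forall z, (Cmod z <= x / 2)%R -> cdiff g z).
  { intros z Hz. apply (cdiff_mult (fun z => Cexp z - 1)).
    - apply cdiff_minus; [eexists; apply is_cderiv_exp|apply cdiff_const].
    - now apply (egf_cdiff a x M). }
  destruct (power_series_expansion g (x / 4)) as [c Hc]; [lra| |].
  { intros u v U V. apply Dg. eapply Rle_trans; [apply (square_Cmod 0 (x / 4)); auto; lra|]. rewrite Cmod_0. lra. }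
  set (b := fun k => c (S k) * INR (fact k)).
  assert (Eb : forall k, b k / INR (fact k) = c (S k)).
  { intros k. unfold b. field. apply RtoC_neq_0, INR_fact_neq_0. }
  assert (c0 : c 0%nat = 0).
  { assert (L := Hc 0 ltac:(rewrite Cmod_0; lra)).
    assert (G0 : g 0 = 0) by (unfold g; rewrite Cexp_0; ring). rewrite G0 in L.
    apply (is_Clim_unique (Csum (fun k => c k * 0 ^ k))); auto.
    apply (is_Clim_ext (fun _ => c 0%nat)); [|apply is_Clim_const].
    intros n. induction n; [rewrite Csum_0; simpl; ring|]. rewrite Csum_S, <- IHn, Cpow_S. ring. }
  assert (Tail : forall z n, Csum (fun k => c k * z ^ k) (S n) = z * Csum (fun k => b k / INR (fact k) * z ^ k) n).
  { intros z n. induction n.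
    - rewrite Csum_S, !Csum_0, c0, Eb. simpl. ring.
    - rewrite Csum_S, IHn, Csum_S, Eb, !Cpow_S. ring. }
  assert (Gb : exists M', geom_bounded b (x / 8) M').
  { assert (L := Hc (x / 8)%R ltac:(rewrite Cmod_R, Rabs_right; lra)).
    destruct (Csum_terms_bounded _ _ L) as [M1 HM1].
    exists (M1 / (x / 8))%R. split; [lra|]. intros n. rewrite Eb. specialize (HM1 (S n)).
    rewrite Cmod_mult, Cmod_pow, Cmod_R, Rabs_right in HM1 by lra. simpl in HM1.
    apply (Rmult_le_reg_r (x / 8)); [lra|].
    replace (M1 / (x / 8) * (x / 8))%R with M1 by (field; lra). lra. }
  destruct Gb as [M' Gb].
  assert (Val : forall z : C, z <> 0 -> (Cmod z <= 3 / 4 * (x / 8))%R -> egf b z = g z / z).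
  { intros z Hz Hz2. assert (L := egf_Clim b (x / 8) M' z Gb Hz2).
    assert (L2 := is_Clim_shift_inv _ _ 1 (Hc z ltac:(lra))).
    apply (Cmult_reg_l z); auto. replace (z * (g z / z)) with (g z) by (field; auto).
    apply (is_Clim_unique (fun n => z * Csum (fun k => b k / INR (fact k) * z ^ k) n)).
    - now apply is_Clim_scal.
    - apply (is_Clim_ext (fun n => Csum (fun k => c k * z ^ k) (n + 1)%nat)); auto.
      intros n. rewrite Nat.add_1_r. apply Tail. }
  (* Off 0 the shifted series equals g(z)/z. As z tends to 0 through positive reals it tends to
     g'(0), which is f(0) because exp z - 1 has derivative 1 at its zero. *)
  assert (V0 : egf b 0 = fc 0).
  { apply Ceq_minus, Cmod_eq_0, Rle_antisym; [|apply Cmod_ge_0].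
    apply le_epsilon. intros e He. rewrite Rplus_0_l.
    assert (Cb : ccont (egf b) 0) by (apply cdiff_ccont, (egf_cdiff b (x / 8) M'); auto; rewrite Cmod_0; lra).
    assert (Dg0 : is_cderiv g 0 (fc 0)).
    { destruct (egf_cdiff a x M 0 H) as [D HD]; [rewrite Cmod_0; lra|]. fold fc in HD.
      replace (fc 0) with ((Cexp 0 + 0) * fc 0 + (Cexp 0 - 1) * D) by (rewrite Cexp_0; ring).
      apply (is_cderiv_mult (fun z => Cexp z - 1)); auto.
      apply (is_cderiv_plus Cexp (fun _ => - (1))); [apply is_cderiv_exp|apply is_cderiv_const]. }
    destruct (Cb (e / 2)%R ltac:(lra)) as [d1 [Hd1 H1]].
    destruct (Dg0 (e / 2)%R ltac:(lra)) as [d2 [Hd2 H2]].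
    set (h := (Rmin (x / 16) (Rmin d1 d2) / 2)%R).
    assert (Hm : (0 < Rmin (x / 16) (Rmin d1 d2))%R) by (repeat apply Rmin_pos; lra).
    pose proof (Rmin_l (x / 16) (Rmin d1 d2)). pose proof (Rmin_r (x / 16) (Rmin d1 d2)).
    pose proof (Rmin_l d1 d2). pose proof (Rmin_r d1 d2).
    assert (Hh : Cmod (RtoC h) = h) by (rewrite Cmod_R, Rabs_right; unfold h; lra).
    assert (hp : (0 < h)%R) by (unfold h; lra).
    assert (h0 : RtoC h <> 0) by (apply RtoC_neq_0; lra).
    specialize (H1 h ltac:(rewrite Hh; unfold h; lra)). specialize (H2 h ltac:(rewrite Hh; unfold h; lra)).
    rewrite Cplus_0_l in H1, H2. rewrite Val in H1 by (auto; rewrite Hh; unfold h; lra).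
    assert (G0 : g 0 = 0) by (unfold g; rewrite Cexp_0; ring). rewrite G0 in H2.
    assert (X : (Cmod (g h / h - fc 0) <= e / 2)%R).
    { replace (g h / h - fc 0) with ((g h - 0 - fc 0 * h) / h) by (field; auto).
      rewrite Cmod_div by auto. rewrite Hh in *. apply (Rmult_le_reg_r h); auto.
      unfold Rdiv at 1. rewrite Rmult_assoc, Rinv_l; lra. }
    replace (egf b 0 - fc 0) with ((g h / h - fc 0) + - (g h / h - egf b 0)) by ring.
    eapply Rle_trans; [apply Cmod_triangle|]. rewrite Cmod_opp. lra. }
  exists b. apply is_taylor_iff. exists (3 / 4 * (x / 8))%R. split; [lra|].
  intros z Hz. assert (L := egf_Clim b (x / 8) M' z Gb ltac:(lra)).
  assert (Em : egf b z = modulator_germ fc z); [|now rewrite <- Em].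
  unfold modulator_germ. fold fc. destruct (Ceq_dec z 0) as [->|N]; auto.
  rewrite Val by (auto; lra). unfold g. field. auto.
Qed.

Lemma complex_ext_geom_bounded (f : R -> R) : real_analytic_at_0 f ->
  exists x M, geom_bounded (fun n => RtoC (Derive_n f n 0)) x M.
Proof.
  intros [d Hd]. assert (Hx : (0 < d / 2)%R) by (pose proof (cond_pos d); lra).
  specialize (Hd (d / 2)%R).
  assert (B : ball (M := R_UniformSpace) 0%R d (d / 2)%R).
  { change (Rabs (d / 2 - 0) < d)%R. rewrite Rminus_0_r, Rabs_right; pose proof (cond_pos d); lra. }
  specialize (Hd B).
  apply (is_pseries_R (fun n => (Derive_n f n 0 / INR (fact n))%R)) in Hd.
  destruct (is_lim_seq_bounded (fun n => (Derive_n f n 0 / INR (fact n) * (d / 2) ^ n)%R) 0) as [M HM].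
  { apply ex_series_lim_0. eexists; exact Hd. }
  exists (d / 2)%R, M. split; auto. intros n. specialize (HM n).
  rewrite <- RtoC_div, Cmod_R by apply INR_fact_neq_0.
  rewrite Rabs_mult, (Rabs_right ((d / 2) ^ n)) in HM; auto. apply Rle_ge, pow_le. lra.
Qed.

(** The factor exp t - 1 of the modulator cancels the denominator of f_(alpha), which leaves the
    modulator of f at alpha t; uniqueness of Taylor numbers then gives the powers of alpha. *)
Lemma P_dilate (h : C -> C) (alpha : C) (b : nat -> C) : alpha <> 0 -> is_taylor (modulator_germ h) b ->
  forall n, P_ (dilate alpha h) n = alpha ^ n * P_ h n.
Proof.
  intros Ha Hb n. unfold P_.
  destruct (taylor_spec _ _ Hb) as [T E]. rewrite E.
  refine (proj2 (taylor_spec _ (fun n => alpha ^ n * b n) _) n).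
  apply is_taylor_iff. apply is_taylor_iff in Hb. destruct Hb as [r [Hr Hb]].
  assert (Pa := proj1 (Cmod_gt_0 alpha) Ha).
  (* |t| < 1 excludes the zeros of exp t - 1 other than 0, and |t| < r/|alpha| keeps alpha t in the
     disc of the expansion. *)
  exists (Rmin 1 (r / Cmod alpha))%R. split.
  { apply Rmin_pos; [lra|now apply Rdiv_lt_0_compat]. }
  intros t Ht. assert (L1 := Rlt_le_trans _ _ _ Ht (Rmin_l _ _)). assert (L2 := Rlt_le_trans _ _ _ Ht (Rmin_r _ _)).
  assert (L3 : (Cmod (alpha * t) < r)%R).
  { rewrite Cmod_mult. apply (Rmult_lt_compat_l (Cmod alpha)) in L2; auto.
    replace (Cmod alpha * (r / Cmod alpha))%R with r in L2 by (field; lra). auto. }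
  assert (L := Hb _ L3).
  replace (modulator_germ (dilate alpha h) t) with (modulator_germ h (alpha * t)).
  - apply (is_Clim_ext (Csum (fun k => b k / INR (fact k) * (alpha * t) ^ k))); auto.
    intros m. apply Csum_ext. intros k. rewrite Cpow_mult_l. field. apply RtoC_neq_0, INR_fact_neq_0.
  - unfold modulator_germ, dilate. destruct (Ceq_dec t 0) as [->|N].
    + destruct (Ceq_dec (alpha * 0) 0) as [_|F]; [|exfalso; apply F; ring].
      destruct (Ceq_dec 0 0) as [_|F]; [|exfalso; auto]. reflexivity.
    + destruct (Ceq_dec (alpha * t) 0) as [F|_]; [exfalso; revert F; now apply Cmult_neq_0|].
      pose proof (Cexp_neq_1_small t N L1). field. auto.
Qed.

(** Both sides are the Taylor numbers of the modulator at -z. A positive [rho] bounds P_n x^n for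
    some x > 0, and division by n! preserves the bound, so the series of the modulator does
    represent it near 0. *)
Lemma P_parity (h : C -> C) (e : C) : Rbar_lt 0 (rho h) ->
  (forall z, modulator h (- z) = e * modulator h z) -> forall n, (- (1)) ^ n * P_ h n = e * P_ h n.
Proof.
  intros Hrho He.
  assert (X : exists x : R, (0 < x)%R /\ Rbar_lt x (rho h)).
  { destruct (rho h) as [r| |]; simpl in *; try easy.
    - exists (r / 2)%R. lra.
    - exists 1%R. split; [lra|auto]. }
  destruct X as [x [Hx Hxr]].
  assert (Gb : exists M, geom_bounded (P_ h) x M).
  { assert (Sx : ex_series (fun n => Rabs (Cmod (P_ h n) * x ^ n))%R).
    { apply CV_disk_inside. rewrite Rabs_right by lra. auto. }
    destruct (is_lim_seq_bounded _ 0 (ex_series_lim_0 _ Sx)) as [M HM]. exists M. split; auto. intros n.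
    specialize (HM n). rewrite Rabs_Rabsolu in HM. pose proof (Rle_abs (Cmod (P_ h n) * x ^ n)).
    rewrite Cmod_div, Cmod_R, Rabs_right by (try apply RtoC_neq_0, INR_fact_neq_0; apply Rle_ge, pos_INR).
    assert (1 <= INR (fact n))%R by (apply (le_INR 1), lt_O_fact).
    assert (/ INR (fact n) <= 1)%R by (rewrite <- Rinv_1; apply Rinv_le_contravar; lra).
    assert (0 <= Cmod (P_ h n) * x ^ n)%R by (apply Rmult_le_pos; [apply Cmod_ge_0|apply pow_le; lra]).
    assert (0 < / INR (fact n))%R by (apply Rinv_0_lt_compat; lra).
    unfold Rdiv. replace (Cmod (P_ h n) * / INR (fact n) * x ^ n)%R with (Cmod (P_ h n) * x ^ n * / INR (fact n))%R by ring.
    nra. }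
  destruct Gb as [M Gb].
  apply (taylor_unique (fun z => modulator h (- z))).
  - apply is_taylor_iff. exists (3 / 4 * x)%R. split; [lra|]. intros z Hz.
    apply (is_Clim_ext (Csum (fun k => P_ h k / INR (fact k) * (- z) ^ k))).
    + intros n. apply Csum_ext. intros k. replace (- z) with (- (1) * z) by ring. rewrite Cpow_mult_l. field.
      apply RtoC_neq_0, INR_fact_neq_0.
    + apply (egf_Clim _ x M); auto. rewrite Cmod_opp. lra.
  - apply is_taylor_iff. exists (3 / 4 * x)%R. split; [lra|]. intros z Hz. rewrite He.
    apply (is_Clim_ext (fun n => e * Csum (fun k => P_ h k / INR (fact k) * z ^ k) n)).
    + intros n. rewrite <- Csum_scal. apply Csum_ext. intros k. field. apply RtoC_neq_0, INR_fact_neq_0.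
    + apply is_Clim_scal, (egf_Clim _ x M); auto. lra.
Qed.

(** The radius is the supremum of the r for which a_n r^n is bounded, and r -> k r maps the set
    belonging to a_n k^n onto the set belonging to a_n. *)
Lemma CV_radius_dilate (a : nat -> R) (k : R) : (0 < k)%R ->
  (forall r : R, CV_radius a = Finite r -> CV_radius (fun n => a n * k ^ n)%R = Finite (r / k)) /\
  (CV_radius a = p_infty -> CV_radius (fun n => a n * k ^ n)%R = p_infty).
Proof.
  intros Hk.
  set (a' := fun n => (a n * k ^ n)%R).
  assert (U := CV_radius_bounded a). assert (U' := CV_radius_bounded a').
  assert (E : forall r, (exists M, forall n, (Rabs (a' n * r ^ n) <= M)%R) <->
     (exists M, forall n, (Rabs (a n * (k * r) ^ n) <= M)%R)).
  { intros r; split; intros [M HM]; exists M; intros n; specialize (HM n); unfold a' in *;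
    rewrite Rpow_mult_distr in *; [rewrite <- Rmult_assoc|rewrite Rmult_assoc]; auto. }
  split.
  - intros r Hr. rewrite Hr in U. apply (is_lub_Rbar_unique) in U' as V. rewrite <- V.
    apply is_lub_Rbar_unique. split.
    + intros y Hy. apply E in Hy. apply (proj1 U) in Hy. simpl in *.
      apply (Rmult_le_reg_l k); auto. replace (k * (r / k))%R with r by (field; lra). auto.
    + intros b Hb. destruct b as [b| |]; simpl; auto.
      * assert (Rbar_le r (k * b)%R).
        { apply (proj2 U). intros y Hy. specialize (Hb (y / k)%R). simpl in *.
          assert (y / k <= b)%R.
          { apply Hb, E. replace (k * (y / k))%R with y by (field; lra). auto. }
          apply (Rmult_le_reg_r (/ k)); [now apply Rinv_0_lt_compat|].
          replace (k * b * / k)%R with b by (field; lra). auto. }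
        simpl in H. apply (Rmult_le_reg_l k); auto. replace (k * (r / k))%R with r by (field; lra). auto.
      (* r = 0 always belongs to the set, so minus infinity is not an upper bound. *)
      * apply (Hb 0%R). exists (Rabs (a' 0%nat)). intros n. destruct n; simpl.
        -- rewrite Rmult_1_r. lra.
        -- rewrite Rmult_0_l, Rmult_0_r, Rabs_R0. apply Rabs_pos.
  - intros Hr. rewrite Hr in U. apply (is_lub_Rbar_unique) in U' as V. rewrite <- V.
    apply is_lub_Rbar_unique. split; [intros y Hy; exact I|].
    intros b Hb. destruct b as [b| |]; simpl; auto.
    + apply (proj2 U (Finite (k * b))). intros y Hy. specialize (Hb (y / k)%R). simpl in *.
      assert (y / k <= b)%R.
      { apply Hb, E. replace (k * (y / k))%R with y by (field; lra). auto. }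
      apply (Rmult_le_reg_r (/ k)); [now apply Rinv_0_lt_compat|].
      replace (k * b * / k)%R with b by (field; lra). auto.
    + apply (Hb 0%R). exists (Rabs (a' 0%nat)). intros n. destruct n; simpl.
      * rewrite Rmult_1_r. lra.
      * rewrite Rmult_0_l, Rmult_0_r, Rabs_R0. apply Rabs_pos.
Qed.

(** * The functional equation *)

Lemma n_spec (h : C -> C) : (0 <= r_ h)%R ->
  (r_ h < INR (n_ h))%R /\ forall m, (m < n_ h)%nat -> (INR m <= r_ h)%R.
Proof.
  intros Hr. unfold n_. destruct (base_Int_part (r_ h)) as [I1 I2].
  assert (I0 : (0 <= Int_part (r_ h))%Z).
  { assert (-1 < Int_part (r_ h))%Z; [apply lt_IZR; lra|lia]. }
  assert (E : INR (Z.to_nat (Int_part (r_ h))) = IZR (Int_part (r_ h))) by (rewrite INR_IZR_INZ, Z2Nat.id; auto).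
  split; [rewrite S_INR, E; lra|].
  intros m Hm. assert (L : (m <= Z.to_nat (Int_part (r_ h)))%nat) by lia.
  apply le_INR in L. lra.
Qed.

Lemma r_nonneg (h : C -> C) : Rbar_lt 0 (rho h) -> (0 <= r_ h)%R.
Proof.
  unfold r_. destruct (rho h) as [r| |]; simpl; intros H; try easy; try lra.
  apply Rlt_le, Rinv_0_lt_compat; auto.
Qed.

Lemma summable_at_of_r (h : C -> C) (c : R) : Rbar_lt 0 (rho h) -> (r_ h < c)%R -> (0 < c)%R -> summable_at (P_ h) c.
Proof.
  intros Hr H Hc. apply summable_at_CV_radius; auto. fold (rho h).
  unfold r_ in H. destruct (rho h) as [r| |]; simpl in *; try easy.
  rewrite <- (Rinv_inv r). apply Rinv_lt_contravar; auto.
  apply Rmult_lt_0_compat; auto. now apply Rinv_0_lt_compat.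
Qed.

(** Bracketed as in the statement, so that [dilate two_pi_i fc] is [fa] by conversion. *)
Definition two_pi_i : C := 2 * Ci * PI.

Lemma two_pi_i_neq_0 : two_pi_i <> 0.
Proof. unfold two_pi_i. repeat apply Cmult_neq_0; auto using PI_neq_C0, Ci_nz, C2_neq_0. Qed.

Lemma Cmod_two_pi_i : Cmod two_pi_i = (2 * PI)%R.
Proof. rewrite <- Cmod_two_PI_Ci. unfold two_pi_i. f_equal. ring. Qed.

Lemma r_dilate (h : C -> C) : Rbar_lt 0 (rho h) ->
  (forall n, P_ (dilate two_pi_i h) n = two_pi_i ^ n * P_ h n) ->
  Rbar_lt 0 (rho (dilate two_pi_i h)) /\ r_ (dilate two_pi_i h) = (2 * PI * r_ h)%R.
Proof.
  intros H HP. pose proof PI_RGT_0 as HPI.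
  destruct (CV_radius_dilate (fun n => Cmod (P_ h n)) (2 * PI) ltac:(lra)) as [D1 D2].
  assert (E : rho (dilate two_pi_i h) = CV_radius (fun n => Cmod (P_ h n) * (2 * PI) ^ n)%R).
  { unfold rho. apply CV_radius_ext. intros n. rewrite HP, Cmod_mult, Cmod_pow, Cmod_two_pi_i. ring. }
  unfold r_. rewrite E. fold (rho h) in D1, D2.
  destruct (rho h) as [r| |]; try easy.
  - rewrite (D1 r eq_refl). simpl in *. split; [apply Rdiv_lt_0_compat; lra|].
    simpl. field. lra.
  - rewrite (D2 eq_refl). simpl. split; auto. ring.
Qed.

(** The principal logarithms of 2 pi i and, below, of -2 pi i: the part of each pole's coordinate
    that does not depend on n. *)
Definition log_up : C := (ln (2 * PI), (PI / 2)%R).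
Definition log_down : C := (ln (2 * PI), (- (PI / 2))%R).

Lemma Cexp_log_up : Cexp log_up = two_pi_i.
Proof.
  pose proof PI_RGT_0. unfold log_up, two_pi_i, Cexp. unfold Re, Im; cbn [fst snd].
  rewrite exp_ln, cos_PI2, sin_PI2 by lra. C_parts; ring.
Qed.

Lemma Cexp_log_down : Cexp log_down = - two_pi_i.
Proof.
  pose proof PI_RGT_0. unfold log_down, two_pi_i, Cexp. unfold Re, Im; cbn [fst snd].
  rewrite exp_ln, cos_neg, sin_neg, cos_PI2, sin_PI2 by lra. C_parts; ring.
Qed.

Lemma Cexp_INR_mult (k : nat) (x : C) : Cexp (INR k * x) = Cexp x ^ k.
Proof.
  induction k.
  - simpl INR. rewrite Cmult_0_l. apply Cexp_0.
  - rewrite S_INR, RtoC_plus, Cpow_S, <- IHk, <- Cexp_plus. f_equal. ring.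
Qed.

(** With z = beta n each z^(a-k) splits as beta^a beta^(-k) n^(a-k), and beta^(-k) cancels the
    beta^k in q. The sign e is there for the lower poles, where beta = -2 pi i while the
    coefficients carry powers of 2 pi i. *)
Lemma gen_power_pole (h : C -> C) (q : nat -> C) (x beta e a : C) (n : nat) (c : R) : summable_at (P_ h) c ->
  (1 <= n)%nat -> (c <= INR n)%R -> Cexp x = beta ->
  (forall k, q k = e * (beta ^ k * P_ h k)) ->
  gen_power q a (x + ln (INR n)) = e * Cexp (a * x) * gpower h (INR n) a.
Proof.
  intros Hp Hn Hc Hx Hq.
  assert (Pn : (0 < INR n)%R) by (apply lt_0_INR; lia).
  assert (Eg : gpower h (INR n) a = gen_power (P_ h) a (ln (INR n))).
  { rewrite (RtoC_Cexp_ln (INR n)) at 1 by auto. apply gpower_exp. unfold Im; simpl. pose proof PI_RGT_0. lra. }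
  rewrite Eg. unfold gen_power.
  destruct (gen_power_summable (P_ h) c a (ln (INR n)) Hp) as [B1 B2].
  { unfold Re; simpl. apply ln_le; auto. apply Hp. }
  rewrite <- (CSeries_scal _ _ _ B1 B2). apply CSeries_ext. intros k.
  unfold gen_power_term. rewrite Hq.
  replace ((a - INR k) * (x + ln (INR n))) with (a * x + (- (INR k * x) + (a - INR k) * ln (INR n))) by ring.
  rewrite !Cexp_plus, Cexp_opp, Cexp_INR_mult, Hx.
  assert (beta ^ k <> 0) by (apply Cpow_nz; rewrite <- Hx; apply Cexp_neq_0).
  field. auto.
Qed.

Lemma pole_up_split n : (1 <= n)%nat -> pole_up n = log_up + ln (INR n).
Proof.
  intros Hn. assert (0 < INR n)%R by (apply lt_0_INR; lia). pose proof PI_RGT_0.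
  unfold pole_up, log_up. rewrite ln_mult by lra. C_parts; ring.
Qed.

Lemma pole_down_split n : (1 <= n)%nat -> pole_down n = log_down + ln (INR n).
Proof.
  intros Hn. assert (0 < INR n)%R by (apply lt_0_INR; lia). pose proof PI_RGT_0.
  unfold pole_down, log_down. rewrite ln_mult by lra. C_parts; ring.
Qed.

(* The identity theorem is applied on squares avoiding 0 that meet the half-plane Re z < 0. *)
Lemma left_half_plane_identity (E : C -> C) : (forall z : C, z <> 0 -> cdiff E z) ->
  (forall z, (Re z < 0)%R -> E z = 0) -> forall z : C, z <> 0 -> E z = 0.
Proof.
  intros HE H0.
  assert (Im_nz : forall z, Im z <> 0%R -> E z = 0).
  { intros [x y] Hy. unfold Im in Hy; cbn [snd] in Hy.
    assert (Sg : exists sg, (sg = 1 \/ sg = -1)%R /\ (0 < sg * y)%R).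
    { destruct (Rtotal_order y 0) as [L|[L|L]]; [exists (-1)%R|lra|exists 1%R]; lra. }
    destruct Sg as [sg [Hsg Hsy]]. set (v := (sg * y)%R) in *.
    assert (Ev : (v * v = y * y)%R) by (unfold v; destruct Hsg as [-> | ->]; ring).
    (* The square has centre -1 + i sg T and half-side T - v/2, with v = |y|. It stays at height at
       least v/2 and so avoids 0, the unit disc about its centre lies in Re z < 0, and T is large
       enough for (x, y) to be at distance less than T - v/2 from the centre. *)
    set (T := ((y * y + (x + 1) * (x + 1)) / v + 1 + v)%R).
    assert (HT : (T * v = y * y + (x + 1) * (x + 1) + v + v * v)%R) by (unfold T; field; lra).
    assert (Tv : (v + 1 <= T)%R).
    { unfold T. assert (0 <= (y * y + (x + 1) * (x + 1)) / v)%R; [|lra].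
      pose proof (Rle_0_sqr y). pose proof (Rle_0_sqr (x + 1)). unfold Rsqr in *.
      apply Rdiv_le_0_compat; lra. }
    clearbody T.
    apply (identity_square E ((-1)%R, (sg * T)%R) (T - v / 2) 1 (x, y)); try lra.
    - intros u w U W. apply HE. intros F. injection F; intros F1 F2. unfold Im in W; cbn [snd] in W. subst w.
      destruct Hsg as [-> | ->]; lra.
    - intros z Hz. apply H0. pose proof (re_le_Cmod (z - ((-1)%R, (sg * T)%R))). apply Rabs_le_between in H.
      unfold Re in *; simpl in *. lra.
    - rewrite pair_eq_minus. unfold Cmod; cbn [fst snd]. rewrite <- (sqrt_Rsqr (T - v / 2)) by lra.
      apply sqrt_lt_1_alt. unfold Rsqr.
      assert (Esq : ((y - sg * T) ^ 2 = y * y - 2 * (T * v) + T * T)%R).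
      { unfold v. destruct Hsg as [-> | ->]; ring. }
      split; [apply Rplus_le_le_0_compat; apply pow2_ge_0|]. rewrite Esq.
      replace ((x - -1) ^ 2)%R with ((x + 1) * (x + 1))%R by ring.
      replace ((T - v / 2) * (T - v / 2))%R with (T * T - T * v + v * v / 4)%R by field.
      assert (0 < v * v)%R by (apply Rmult_lt_0_compat; auto). lra. }
  (* A non-zero real point is a limit of non-real ones, and E is continuous there. *)
  intros z Hz. destruct (Req_dec (Im z) 0) as [Hi|Hi]; [|now apply Im_nz].
  apply Cmod_eq_0, Rle_antisym; [|apply Cmod_ge_0].
  apply le_epsilon. intros e He. rewrite Rplus_0_l.
  destruct (cdiff_ccont E z (HE z Hz) e He) as [d [Hd H1]].
  specialize (H1 (Ci * (d / 2)%R)).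
  rewrite Cmod_mult, Cmod_Ci, Cmod_R, Rabs_right, Rmult_1_l in H1 by lra. specialize (H1 ltac:(lra)).
  rewrite Im_nz in H1.
  - replace (0 - E z) with (- E z) in H1 by ring. rewrite Cmod_opp in H1. lra.
  - destruct z as [u w]. unfold Im in *; simpl in *. lra.
Qed.

(** 2 pi i ((2 pi i)^(s-1) + e (-2 pi i)^(s-1)) with principal powers and parity sign e: what the
    pair of poles of index n contributes, apart from n^(s-1, f). *)
Definition trig_factor (e s : C) : C :=
  2 * PI * Ci * (Cexp ((s - 1) * log_up) + e * Cexp ((s - 1) * log_down)).

Lemma cdiff_trig_factor e s : cdiff (trig_factor e) s.
Proof.
  assert (D : forall w, cdiff (fun s => Cexp ((s - 1) * w)) s).
  { intros w. apply cdiff_exp. apply (cdiff_mult (fun s => s - 1)); [|apply cdiff_const].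
    apply cdiff_minus; [apply cdiff_id|apply cdiff_const]. }
  apply (cdiff_mult (fun _ => 2 * PI * Ci)); [apply cdiff_const|].
  apply cdiff_plus; [apply D|]. apply (cdiff_mult (fun _ => e)); [apply cdiff_const|apply D].
Qed.

Lemma holomorphic_at_cdiff (L : C -> C) (s : C) : holomorphic_at L s -> cdiff L s.
Proof. intros H. apply ex_derive_cdiff. exact (locally_singleton _ _ H). Qed.

Lemma cdiff_reflect (L : C -> C) s : cdiff L (1 - s) -> cdiff (fun z => L (1 - z)) s.
Proof.
  intros H. apply (cdiff_comp L (fun z => 1 - z)); auto.
  apply cdiff_minus; [apply cdiff_const|apply cdiff_id].
Qed.

Lemma locally_C_eps (s : C) (P : C -> Prop) (d : R) : (0 < d)%R ->
  (forall z, (Cmod (z - s) < d)%R -> P z) -> locally (T := C_UniformSpace) s P.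
Proof.
  intros Hd H. assert (Hd2 : (0 < d / 2)%R) by lra. exists (mkposreal _ Hd2). intros z [B1 B2]. apply H.
  change (Rabs (Re z - Re s) < d / 2)%R in B1. change (Rabs (Im z - Im s) < d / 2)%R in B2.
  eapply Rle_lt_trans; [apply Cmod_le_Rabs|].
  replace (Re (z - s)) with (Re z - Re s)%R by (unfold Re; simpl; ring).
  replace (Im (z - s)) with (Im z - Im s)%R by (unfold Im; simpl; ring). lra.
Qed.

Lemma holomorphic_at_reflect (L : C -> C) s : holomorphic_at L (1 - s) -> holomorphic_at (fun z => L (1 - z)) s.
Proof.
  intros [d Hd]. apply (locally_C_eps s _ d (cond_pos d)). intros z Hz.
  apply ex_derive_cdiff, cdiff_reflect, ex_derive_cdiff, Hd.
  assert (E : Cmod ((1 - z) - (1 - s)) = Cmod (z - s)) by (rewrite <- Cmod_opp; f_equal; ring).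
  split.
  - change (Rabs (Re (1 - z) - Re (1 - s)) < d)%R.
    replace (Re (1 - z) - Re (1 - s))%R with (Re (1 - z - (1 - s))) by (unfold Re; simpl; ring).
    eapply Rle_lt_trans; [apply re_le_Cmod|]. now rewrite E.
  - change (Rabs (Im (1 - z) - Im (1 - s)) < d)%R.
    replace (Im (1 - z) - Im (1 - s))%R with (Im (1 - z - (1 - s))) by (unfold Im; simpl; ring).
    eapply Rle_lt_trans; [apply im_le_Cmod|]. now rewrite E.
Qed.

Lemma isolated_integer (s z : C) : is_integer s -> z <> s -> (Cmod (z - s) < 1)%R -> ~ is_integer z.
Proof.
  intros [n ->] N Hz [m ->]. rewrite <- RtoC_minus, Cmod_R, <- minus_IZR, <- abs_IZR in Hz.
  apply lt_IZR in Hz. apply N. f_equal. f_equal. lia.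
Qed.

(** With q = exp(i pi s/2), the cosine, the two powers of 2 pi i and -2 pi i, and sin(pi s) are all
    rational in q and (2 pi)^s. The product collapses to g (q^2 - q^(-2)) / (2 i pi), which the
    reflection formula evaluates as 1. *)
Lemma functional_factor (s g : C) (e : C) (kappa : nat) :
  (kappa = 0%nat /\ e = 1) \/ (kappa = 1%nat /\ e = - (1)) ->
  g * Csin (PI * s) = PI ->
  2 * Ci ^ kappa * Ccos (PI / 2 * (s - INR kappa)) / Cpower (2 * PI) s * (g / (2 * Ci * PI) * trig_factor e s) = 1.
Proof.
  intros Hk Hg. pose proof PI_RGT_0 as HPI.
  set (q := Cexp (Ci * (PI / 2 * s))).
  assert (Hq : q <> 0) by apply Cexp_neq_0.
  assert (EP : Cpower (2 * PI) s = Cexp (s * ln (2 * PI))).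
  { rewrite <- RtoC_mult. apply Cpower_pos. lra. }
  set (P := Cexp (s * ln (2 * PI))) in *.
  assert (HP : P <> 0) by apply Cexp_neq_0.
  assert (R2 : RtoC (PI / 2) = PI / 2) by (rewrite RtoC_div by lra; auto).
  assert (Ei : Cexp (Ci * (PI / 2)) = Ci).
  { unfold Cexp. replace (Re (Ci * (PI / 2))) with 0%R by (rewrite <- R2; unfold Re; simpl; ring).
    replace (Im (Ci * (PI / 2))) with (PI / 2)%R by (rewrite <- R2; unfold Im; simpl; ring).
    rewrite exp_0, cos_PI2, sin_PI2. C_parts; ring. }
  assert (Lu : log_up = ln (2 * PI) + Ci * (PI / 2)).
  { rewrite <- R2. unfold log_up. C_parts; ring. }
  assert (Ld : log_down = ln (2 * PI) - Ci * (PI / 2)).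
  { rewrite <- R2. unfold log_down. C_parts; ring. }
  assert (E2P : Cexp (ln (2 * PI)) = 2 * PI).
  { rewrite Cexp_real, exp_ln by lra. apply RtoC_mult. }
  assert (Eup : Cexp ((s - 1) * log_up) = P * q / (2 * PI * Ci)).
  { rewrite Lu. replace ((s - 1) * (ln (2 * PI) + Ci * (PI / 2))) with
      ((s * ln (2 * PI) + Ci * (PI / 2 * s)) + - (ln (2 * PI) + Ci * (PI / 2))) by ring.
    rewrite Cexp_plus, Cexp_opp, !Cexp_plus, E2P, Ei. reflexivity. }
  assert (Edn : Cexp ((s - 1) * log_down) = P / q * Ci / (2 * PI)).
  { rewrite Ld. replace ((s - 1) * (ln (2 * PI) - Ci * (PI / 2))) with
      ((s * ln (2 * PI) + - (Ci * (PI / 2 * s))) + (- ln (2 * PI) + Ci * (PI / 2))) by ring.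
    rewrite !Cexp_plus, !Cexp_opp, E2P, Ei. fold q P. field. auto using PI_neq_C0. }
  assert (Es : Csin (PI * s) = (q * q - / (q * q)) / (2 * Ci)).
  { unfold Csin. rewrite Cexp_opp. replace (Ci * (PI * s)) with (Ci * (PI / 2 * s) + Ci * (PI / 2 * s)) by field.
    rewrite Cexp_plus. reflexivity. }
  pose proof PI_neq_C0 as NP. pose proof Ci_nz as NC. pose proof C2_neq_0 as N2.
  unfold trig_factor. rewrite Eup, Edn, EP. rewrite Es in Hg.
  assert (Hg2 : g * (q * q - / (q * q)) = 2 * Ci * PI) by (rewrite <- Hg; field; auto).
  destruct Hk as [[-> ->]|[-> ->]].
  - simpl INR. unfold Ccos. replace (Ci * (PI / 2 * (s - 0))) with (Ci * (PI / 2 * s)) by ring.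
    rewrite Cexp_opp. fold q.
    (* [field] treats i as a variable, so the expression is arranged for i^2 = -1 to be substituted
       by [Ci_sqr]. *)
    transitivity (g * (q * q + Ci * Ci - (1 + Ci * Ci) + 1 + Ci * Ci * / (q * q)) / (2 * Ci * PI) * 1).
    + simpl Cpow. transitivity (g * ((q + / q) * (q + Ci * Ci / q)) / (2 * Ci * PI)); [field; auto|].
      rewrite Ci_sqr. field. auto.
    + rewrite Ci_sqr. transitivity (g * (q * q - / (q * q)) / (2 * Ci * PI)); [field; auto|].
      rewrite Hg2. field. auto.
  - simpl INR. unfold Ccos. replace (Ci * (PI / 2 * (s - 1))) with (Ci * (PI / 2 * s) + - (Ci * (PI / 2))) by ring.
    rewrite Cexp_opp, Cexp_plus, Cexp_opp, Ei. fold q.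
    transitivity (g * ((q + Ci * Ci / q) * (q - Ci * Ci / q)) / (2 * Ci * PI)); [simpl Cpow; field; auto|].
    rewrite Ci_sqr. transitivity (g * (q * q - / (q * q)) / (2 * Ci * PI)); [field; auto|].
    rewrite Hg2. field. auto.
Qed.

Theorem theorem1p1 :
  forall (f : R -> R) (L : C -> C) (kappa : nat) (c d : R),
    let fc := complex_ext f in
    let fa := dilate (2 * Ci * PI) fc in
    let rhs := fun s : C =>
      2 * Ci ^ kappa * CGamma s * Ccos (PI / 2 * (s - INR kappa))
      / Cpower (2 * PI) s * FC c d fa s in
    standing f ->
    (kappa = 0%nat /\ (forall z : C, modulator fc (- z) = modulator fc z)) \/
    (kappa = 1%nat /\ (forall z : C, modulator fc (- z) = - modulator fc z)) ->
    is_LC fc L ->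
    hankel_ok fa c d ->
    forall s : C, s <> 0 ->
      (~ is_integer s -> L (1 - s) = rhs s) /\
      (is_integer s -> continued_value rhs s (L (1 - s))).
Proof.
  intros f L kappa c d fc fa rhs [Hf Hrho] Hpar HL Hok.
  pose proof PI_RGT_0 as HPI.
  change (Rbar_lt 0 (rho fc)) in Hrho.
  destruct (complex_ext_geom_bounded f Hf) as [x [M Gb]].
  destruct (modulator_germ_taylor _ x M Gb) as [b Hb].
  change (is_taylor (modulator_germ fc) b) in Hb.
  assert (HP : forall n, P_ fa n = two_pi_i ^ n * P_ fc n) by exact (P_dilate fc _ b two_pi_i_neq_0 Hb).
  destruct (r_dilate fc Hrho HP) as [Hrho' Er]. change (dilate two_pi_i fc) with fa in *.
  assert (Hr0 := r_nonneg fc Hrho). destruct (n_spec fc Hr0) as [Hn1 Hn2].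
  destruct Hok as [Hc [Hd Hk]].
  assert (Hn0 : (1 <= n_ fc)%nat) by (unfold n_; lia).
  (* The midpoint of [r_ fa] = 2 pi r_f and c is an admissible smaller radius. An index m < n_f
     satisfies m <= r_f, so its pole lies inside |z| = c, and [hankel_ok] puts c below the modulus
     of the pole of index n_f. *)
  assert (CD : contour_data (P_ fa) ((r_ fa + c) / 2) c d (n_ fc)).
  { assert (0 <= 2 * PI * r_ fc)%R by (apply Rmult_le_pos; lra).
    constructor; auto; try lra.
    - apply summable_at_of_r; auto; lra.
    - intros m Hm Hmn. specialize (Hn2 m Hmn). rewrite Er in Hc. nra.
    - specialize (Hk (Z.of_nat (n_ fc))). rewrite <- INR_IZR_INZ, Rabs_right in Hk by (apply Rle_ge, pos_INR).
      apply Hk. rewrite Er. apply Rmult_lt_compat_l; lra. }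
  assert (Hsum : summable_at (P_ fc) (INR (n_ fc))).
  { apply summable_at_of_r; auto. lra. }
  (* e = (-1)^kappa treats both parities at once. *)
  assert (He : exists e : C, ((kappa = 0%nat /\ e = 1) \/ (kappa = 1%nat /\ e = - (1))) /\ e * e = 1 /\
    forall n, (- (1)) ^ n * P_ fc n = e * P_ fc n).
  { destruct Hpar as [[Hk0 H]|[Hk1 H]].
    - exists 1. split; [auto|]. split; [ring|]. apply P_parity; auto. intros z. rewrite H. ring.
    - exists (- (1)). split; [auto|]. split; [ring|]. apply P_parity; auto. intros z. rewrite H. ring. }
  destruct He as [e [Hke [Hee Hpe]]].
  destruct HL as [HL1 [HL2 _]].
  (* Both sides are holomorphic away from s = 0, the point where 1 - s meets the possible pole of
     L. *)
  assert (Main : forall s : C, s <> 0 -> hankel_log (P_ fa) c d (s - 1) = trig_factor e s * L (1 - s)).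
  { intros s Hs. apply Ceq_minus.
    apply (left_half_plane_identity (fun s => hankel_log (P_ fa) c d (s - 1) - trig_factor e s * L (1 - s))); auto.
    - intros z Hz. apply cdiff_minus.
      + apply (cdiff_comp (hankel_log (P_ fa) c d) (fun z => z - 1)).
        * apply cdiff_minus; [apply cdiff_id|apply cdiff_const].
        * exact (cdiff_hankel_log _ _ _ _ _ _ CD).
      + apply (cdiff_mult (trig_factor e)); [apply cdiff_trig_factor|].
        apply cdiff_reflect, holomorphic_at_cdiff, HL2. intros E. apply Hz.
        replace z with (1 - (1 - z)) by ring. rewrite E. ring.
    - intros z Hz. apply (proj1 (Ceq_minus (hankel_log (P_ fa) c d (z - 1)) _)).
      assert (Ha : (Re (z - 1)%C < -1)%R) by (unfold Re in *; simpl; lra).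
      refine (is_Clim_unique _ _ _ (hankel_residues _ _ _ _ _ _ CD Ha) _).
      assert (Ser : is_Clim (Csum (fun j => gpower fc (INR (n_ fc + j)) (z - 1))) (L (1 - z))).
      { assert (S := HL1 (1 - z)%C ltac:(unfold Re in *; simpl; lra)). apply is_series_Clim in S.
        replace (- (1 - z)) with (z - 1) in S by ring. exact S. }
      apply (is_Clim_ext (fun n => trig_factor e z * Csum (fun j => gpower fc (INR (n_ fc + j)) (z - 1)) n));
        [|now apply is_Clim_scal].
      intros n. rewrite <- Csum_scal, <- Csum_scal. apply Csum_ext. intros j.
      assert (J1 : (1 <= n_ fc + j)%nat) by lia.
      assert (J2 : (INR (n_ fc) <= INR (n_ fc + j))%R) by (apply le_INR; lia).
      rewrite pole_up_split, pole_down_split by auto.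
      rewrite (gen_power_pole fc (P_ fa) log_up two_pi_i 1 (z - 1) (n_ fc + j) _ Hsum J1 J2 Cexp_log_up).
      2:{ intros k. rewrite HP. ring. }
      rewrite (gen_power_pole fc (P_ fa) log_down (- two_pi_i) e (z - 1) (n_ fc + j) _ Hsum J1 J2 Cexp_log_down).
      (* The coefficient (2 pi i)^k P_k equals e (-2 pi i)^k P_k, because (-1)^k P_k = e P_k and e^2
         = 1. *)
      2:{ intros k. rewrite HP. replace (- two_pi_i) with (- (1) * two_pi_i) by ring. rewrite Cpow_mult_l.
          transitivity (two_pi_i ^ k * (e * ((- (1)) ^ k * P_ fc k))); [|ring].
          rewrite Hpe. transitivity (e * e * (two_pi_i ^ k * P_ fc k)); [rewrite Hee; ring|ring]. }
      unfold trig_factor. ring. }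
  assert (Gen : forall s : C, s <> 0 -> ~ is_integer s -> L (1 - s) = rhs s).
  { intros s Hs Hi. unfold rhs, FC.
    rewrite (hankel_int_log fa _ c d _ (s - 1) CD), (Main s Hs).
    assert (F := functional_factor s (CGamma s * CGamma (1 - s)) e kappa Hke (Gamma_reflection s Hi)).
    rewrite <- (Cmult_1_l (L (1 - s))) at 1.
    etransitivity; [exact (f_equal (fun u => u * L (1 - s)) (eq_sym F))|]. unfold Cdiv. ring. }
  intros s Hs. split; [now apply Gen|].
  (* L(1 - z) itself is the continuation: it is holomorphic at s since s is not 0, and every other
     point near s is neither 0 nor an integer. *)
  intros Hi. exists (fun z => L (1 - z)). split; [|split; auto].
  - apply holomorphic_at_reflect, HL2. intros E. apply Hs.
    replace s with (1 - (1 - s)) by ring. rewrite E. ring.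
  - assert (Ps := proj1 (Cmod_gt_0 s) Hs).
    apply (locally_C_eps s _ (Rmin 1 (Cmod s))); [apply Rmin_pos; lra|].
    intros z Hz Hne. apply Gen.
    + intros ->. assert (L2 := Rlt_le_trans _ _ _ Hz (Rmin_r _ _)).
      replace (0 - s) with (- s) in L2 by ring. rewrite Cmod_opp in L2. lra.
    + apply (isolated_integer s); auto. eapply Rlt_le_trans; [exact Hz|apply Rmin_l].
Qed.
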